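(* Let $K\subset\mathbb D$ be a Lebesgue measurable quasi-interpolating set and let $\zeta=\{z_j\}\subset K$ be an $\epsilon$-chain of $K$ with respect to $\rho$, where $\epsilon\in(0,1)$, such that $\delta(\zeta)\ge\delta>0$. Put $\epsilon_*:=\max\{\frac12,\epsilon\}$. Then for every complex Banach space $X$ there is a bounded linear operator $L_K^X:L^\infty(K,X)\to C_\rho(\mathbb D,X)$ of norm $$\|L_K^X\|\le \frac{c\,\epsilon}{1-\epsilon}\cdot\max\left\{1,\frac{\log\frac1\delta}{(1-\epsilon_* )^2}\right\}$$ for a numerical constant $c<25\cdot 10^6$, such that for every $f\in L^\infty(K,X)$ the function $L_K^Xf$ is a weak solution of $$\frac{\partial F}{\partial\bar z}=\frac{f(z)}{1-|z|^2},\qquad |z|<1,$$ and the family $\{L_K^X\}_X$ has the following properties: (i) if $T:X\to Y$ is a bounded linear operator between complex Banach spaces, then $T L_K^X=L_K^Y T$, where $(Tf)(z):=T(f(z))$; (ii) if $f\in L^\infty(K,X)$ has compact essential range, then the range of $L_K^Xf$ is relatively compact in $X$; (iii) if $f\in L^\infty(K,X)$ is continuously differentiable on an open set $U\subset\mathbb D$, then $L_K^Xf$ is continuously differentiable on $U$.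
   Context: $\mathbb D=\{z\in\mathbb C:|z|<1\}$. The pseudohyperbolic metric on $\mathbb D$ is $\rho(z,w)=\left|\frac{z-w}{1-\bar wz}\right|$. For a complex Banach space $X$ and a Lebesgue measurable $K\subset\mathbb D$, $L^\infty(K,X)$ is the Banach space of a.e.-equivalence classes of Bochner measurable essentially bounded functions $f:\mathbb D\to X$ with $f=0$ a.e. on $\mathbb D\setminus K$, with norm $\|f\|_\infty=\operatorname{ess\,sup}_{z\in K}\|f(z)\|_X$. For $U\subset\mathbb D$, $C_\rho(U,X)$ is the Banach space of bounded continuous functions $U\to X$ that are uniformly continuous with respect to $\rho$, with the supremum norm. A function $F\in L^\infty(\mathbb D,X)$ is a weak solution of $\frac{\partial F}{\partial\bar z}=\frac{f(z)}{1-|z|^2}$ if for every $C^\infty$ function $\varphi$ with compact support in $\mathbb D$: $\iint_{\mathbb D}F\,\frac{\partial\varphi}{\partial\bar z}\,dz\wedge d\bar z=-\iint_{\mathbb D}\frac{f(z)}{1-|z|^2}\varphi(z)\,dz\wedge d\bar z$. A sequence $\zeta=\{z_n\}\subset\mathbb D$ is interpolating for $H^\infty$ (bounded holomorphic functions on $\mathbb D$) if for every bounded sequence $\{a_n\}\subset\mathbb C$ there is $g\in H^\infty$ with $g(z_n)=a_n$ for all $n$. Its characteristic is $\delta(\zeta):=\inf_k\prod_{j\ne k}\rho(z_j,z_k)$ (equal to $1$ if $\zeta$ is a single point); $\zeta$ is interpolating iff $\delta(\zeta)>0$ (Carleson). A subset $S$ of a metric space $(\mathcal M,d)$ is $\epsilon$-separated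 if $d(x,y)\ge\epsilon$ for all distinct $x,y\in S$; an $\epsilon$-chain of $\mathcal M$ is a maximal $\epsilon$-separated subset of $\mathcal M$. A set $K\subset\mathbb D$ is quasi-interpolating if some $\epsilon$-chain of $K$ ($\epsilon\in(0,1)$) with respect to $\rho$ is an interpolating sequence for $H^\infty$. *)

(* Defs.v *)
From HB Require Import structures.
From mathcomp Require Import all_boot all_order all_algebra complex.
From mathcomp Require Import all_classical all_reals all_analysis.
Set Implicit Arguments. Unset Strict Implicit. Unset Printing Implicit Defensive.
Import Order.TTheory GRing.Theory Num.Theory.
Import numFieldNormedType.Exports.
Local Open Scope classical_set_scope.
Local Open Scope ring_scope.
Local Open Scope complex_scope.

Section Defs.
Variable R : realType.
Local Notation C := R[i].

Definition disc : set C := [set z | `|z| < 1].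

Definition rho (z w : C) : R := complex.Re `|(z - w) / (1 - w^* * z)|.

Definition separated (eps : R) (S : set C) : Prop :=
  forall x y, S x -> S y -> x <> y -> eps <= rho x y.

Definition chain (eps : R) (M S : set C) : Prop :=
  [/\ S `<=` M, separated eps S &
      forall S', S `<=` S' -> S' `<=` M -> separated eps S' -> S' = S].

Definition cdiff_at (g : C -> C) (z : C) : Prop :=
  exists g' : C, forall e : R, 0 < e -> exists d : R, 0 < d /\
    forall w, 0 < `|w - z| < d%:C -> `|(g w - g z) / (w - z) - g'| < e%:C.

Definition H_infty (g : C -> C) : Prop :=
  (forall z, disc z -> cdiff_at g z) /\
  exists M : R, forall z, disc z -> `|g z| <= M%:C.

(* interpolating sequence for H^infty (a sequence of distinct points is
   encoded by its set of points Z; a bounded sequence of data is a bounded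
   function a on Z) *)
Definition interpolating (Z : set C) : Prop :=
  Z `<=` disc /\
  forall a : C -> C, (exists M : R, forall z, Z z -> `|a z| <= M%:C) ->
    exists g, H_infty g /\ forall z, Z z -> g z = a z.

(* delta(Z) >= d : for every k in Z, the infinite product prod_{j in Z, j<>k}
   rho(z_j,z_k) (of numbers in [0,1], i.e. the infimum of its finite partial
   products) is >= d *)
Definition characteristic_ge (Z : set C) (d : R) : Prop :=
  forall k, Z k -> forall s : seq C, uniq s ->
    (forall j, j \in s -> Z j /\ j <> k) ->
    d <= \prod_(j <- s) rho j k.

Definition quasi_interpolating (K : set C) : Prop :=
  exists eps : R, 0 < eps < 1 /\ exists Z, chain eps K Z /\ interpolating Z.

Definition lambda2 := ((@lebesgue_measure R) \x (@lebesgue_measure R))%E.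

Definition toR2 (z : C) : R * R := (complex.Re z, complex.Im z).

Definition null (N : set C) : Prop :=
  exists B : set (R * R), [/\ measurable B, lambda2 B = 0%E &
    forall z, N z -> B (toR2 z)].

Definition ae (P : C -> Prop) : Prop :=
  exists N, null N /\ forall z, ~ N z -> P z.

Definition leb_measurable (K : set C) : Prop :=
  exists B : set (R * R), measurable B /\
    null [set z | ~ (K z <-> B (toR2 z))].

Section Vector.
Variable X : normedModType C^o.

Definition simple_fun (s : seq (set C * X)) (z : C) : X :=
  \sum_(p <- s) (if `[< p.1 z >] then p.2 else 0).

Definition strongly_measurable (f : C -> X) : Prop :=
  exists s : nat -> seq (set C * X),
    (forall n p, p \in s n -> leb_measurable p.1) /\
    ae (fun z => simple_fun (s n) z @[n --> \oo] --> f z).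

Definition Linfty (K : set C) (f : C -> X) : Prop :=
  [/\ strongly_measurable f,
      exists M : R, ae (fun z => `|f z| <= M%:C) &
      ae (fun z => ~ K z -> f z = 0)].

Definition simple_integral (s : seq (set (R * R) * X)) : X :=
  \sum_(p <- s) ((fine (lambda2 p.1))%:C : C^o) *: p.2.

Definition is_bochner_integral (g : C -> X) (v : X) : Prop :=
  exists s : nat -> seq (set (R * R) * X),
  [/\ forall n p, p \in s n -> measurable p.1 /\ (lambda2 p.1 < +oo)%E,
      exists h : nat -> R * R -> R,
        [/\ forall n, measurable_fun setT (h n),
            forall n x, 0 <= h n x,
            forall n, ae (fun z =>
              `|g z - simple_fun [seq (fun w => p.1 (toR2 w), p.2) | p <- s n] z|
                <= (h n (toR2 z))%:C) &
            (\int[lambda2]_x (h n x)%:E)%E @[n --> \oo] --> 0%E] &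
      simple_integral (s n) @[n --> \oo] --> v].

Definition has_partial (dir : C) (g : C -> X) (z : C) (v : X) : Prop :=
  forall e : R, 0 < e -> exists d : R, 0 < d /\
    forall h : R, 0 < `|h| < d ->
      `|(((h%:C)^-1 : C^o) *: (g (z + h%:C * dir) - g z)) - v| < e%:C.

Definition continuous_at (g : C -> X) (z : C) : Prop :=
  forall e : R, 0 < e -> exists d : R, 0 < d /\
    forall w, `|w - z| < d%:C -> `|g w - g z| < e%:C.

Definition open_set (U : set C) : Prop :=
  forall z, U z -> exists d : R, 0 < d /\ forall w, `|w - z| < d%:C -> U w.

Definition C1_on (U : set C) (g : C -> X) : Prop :=
  exists gx gy : C -> X, forall z, U z ->
    [/\ has_partial 1 g z (gx z), has_partial 'i g z (gy z),
        continuous_at gx z & continuous_at gy z].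

Definition C_rho (F : C -> X) : Prop :=
  [/\ exists M : R, forall z, disc z -> `|F z| <= M%:C,
      forall z, disc z -> continuous_at F z &
      forall e : R, 0 < e -> exists d : R, 0 < d /\
        forall z w, disc z -> disc w -> rho z w < d -> `|F z - F w| < e%:C].

Definition ess_range (f : C -> X) : set X :=
  [set x | forall e : R, 0 < e -> ~ null [set z | disc z /\ `|f z - x| < e%:C]].
End Vector.

Definition smooth (phi : C -> C^o) : Prop :=
  exists D : seq bool -> C -> C^o,
    D [::] = phi /\
    forall (s : seq bool) z,
      continuous_at (D s) z /\
      has_partial 1 (D s) z (D (false :: s) z) /\
      has_partial 'i (D s) z (D (true :: s) z).

Definition test_function (phi : C -> C^o) : Prop :=
  smooth phi /\
  exists r : R, 0 <= r < 1 /\ forall z, r%:C < `|z| -> phi z = 0.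

(* F is a weak solution of dF/dzbar = f(z)/(1-|z|^2) on the disc:
   for every test function phi,
   int F dphi/dzbar dz/\dzbar = - int f/(1-|z|^2) phi dz/\dzbar,
   where dz/\dzbar = -2i dx dy and dphi/dzbar = (phi_x + i phi_y)/2 *)
Definition weak_solution (X : normedModType C^o) (F f : C -> X) : Prop :=
  forall phi phix phiy : C -> C^o, test_function phi ->
    (forall z, has_partial 1 phi z (phix z) /\ has_partial 'i phi z (phiy z)) ->
    exists v w : X,
    [/\ is_bochner_integral
          (fun z => ((phix z + 'i * phiy z) / 2 : C^o) *: F z) v,
        is_bochner_integral
          (fun z => (phi z / (1 - `|z| ^+ 2) : C^o) *: f z) w &
        ((- 2 * 'i : C^o) *: v) = - ((- 2 * 'i : C^o) *: w)].

End Defs.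
Arguments disc {R}.

(* Main.v *)
Require Import Defs.
From HB Require Import structures.
From mathcomp Require Import all_boot all_order all_algebra complex.
From mathcomp Require Import all_classical all_reals all_analysis.
From mathcomp Require Import measurable_realfun.
From mathcomp Require Import ring lra.
Set Implicit Arguments.
Unset Strict Implicit.
Unset Printing Implicit Defensive.
Import Order.TTheory GRing.Theory Num.Theory.
Import numFieldNormedType.Exports.
Local Open Scope classical_set_scope.
Local Open Scope ring_scope.
Local Open Scope complex_scope.

(* The solution is the integral operator
     L f (z) = 1/kappa * int c(z,w) f(w) / ((1 - |w|^2) (z - w)) dw,   kappa = pi,
   where c(., w) is holomorphic on the disc and c(w, w) = 1 for w near the net, so that the kernel
   solves the d-bar equation, and where int |c(z,w)| / ((1 - |w|^2) |z - w|) dw is bounded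
   uniformly in z, so that L is bounded.  As the kernel is scalar, naturality in X is immediate;
   the weak equation follows from the Cauchy-Pompeiu formula and Fubini.
   The functions c are built, as P. Jones did for interpolating sequences, from products over a
   net of K; what they need is a bound on sum_k (1 - rho(z_k, z_j)^2), which the logarithm of
   the product of the rho(z_k, z_j) controls.  If eps < 1/2 the net is the chain itself, with
   discs of radius eps, which gives the factor eps in the norm.  Otherwise it is a maximal
   1/2-separated subset of K; its points are grouped by nearby points of the chain, and within a
   group they are counted by packing squares after a Moebius map. *)

(** The kernel [c] is only measurable in its second variable, so regularity of the solution F cannot
    be read off it. It comes from a localization: for a cutoff chi, partial fractions show that
    kappa chi(z) F(z) is the Cauchy transform at z of (d-bar chi) F + chi f / (1 - |w|^2), in which
    [c] no longer occurs. With chi at scale d = (1 - |z|) / 4 this density is O(1/d) on a square of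
    side O(d), where the L1 modulus of 1 / (z - w) is at most d times a function of |z - z'| / d.
    The powers of d cancel, which is uniform continuity for rho. The C^1 property follows by
    splitting the same formula into a part with smooth kernel and a convolution. Origin of the norm:
    a net point carries 1 / |z - w| over a square of half-side 2 r b, whence the bound 4608 r N0,
    where N0 bounds the sums of 1 - rho^2. Small eps has r = eps and N0 = 1 + 2 log(1/delta). The
    estimates around a net point ask for r <= 1/2, so for larger eps the net is refined; then N0 <=
    3660 m / (1 - eps), m being the maximum in the norm bound, and eps >= 1/2 restores the factor
    eps. *)

(** * Real modulus, the weight 1 - |z|^2 and the pseudohyperbolic distance *)

Section ComplexModulus.
Variable R : realType.
Local Notation C := R[i].
Implicit Types (z w a c : C) (x y : R).

(** The norm of [R[i]] takes values in [R[i]]; all estimates are made with its real part, which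
    lives where the order is total. *)
Definition nm z : R := complex.Re `|z|.

Lemma nmE z : `|z| = (nm z)%:C.
Proof. by rewrite /nm normc_def. Qed.

Lemma nm_sqr z : nm z ^+ 2 = complex.Re z ^+ 2 + complex.Im z ^+ 2.
Proof. by apply: complexI; rewrite rmorphXn /= -nmE -add_Re2_Im2. Qed.

Lemma nm_ge0 z : 0 <= nm z.
Proof. by rewrite -ler0c -nmE. Qed.

Lemma nm0 : nm 0 = 0. Proof. by rewrite /nm normr0. Qed.
Lemma nm1 : nm 1 = 1. Proof. by rewrite /nm normr1. Qed.
Lemma nmN z : nm (- z) = nm z. Proof. by rewrite /nm normrN. Qed.
Lemma nmB z w : nm (z - w) = nm (w - z). Proof. by rewrite /nm distrC. Qed.
Lemma nm_conj z : nm (z^*) = nm z. Proof. by rewrite /nm normcJ. Qed.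
Lemma nmM z w : nm (z * w) = nm z * nm w.
Proof. by apply: complexI; rewrite -nmE normrM !nmE rmorphM. Qed.
Lemma nmX z n : nm (z ^+ n) = nm z ^+ n.
Proof. by apply: complexI; rewrite -nmE normrX !nmE rmorphXn. Qed.
Lemma nmV z : nm z^-1 = (nm z)^-1.
Proof. by apply: complexI; rewrite -nmE normfV nmE fmorphV. Qed.
Lemma nm_prod (I : Type) (s : seq I) (P : pred I) (F : I -> C) :
  nm (\prod_(i <- s | P i) F i) = \prod_(i <- s | P i) nm (F i).
Proof. by rewrite (big_morph nm nmM nm1). Qed.
Lemma nmD z w : nm (z + w) <= nm z + nm w.
Proof. by rewrite -lecR rmorphD -!nmE ler_normD. Qed.
Lemma nm_real x : nm x%:C = `|x|.
Proof. by apply: complexI; rewrite -nmE normc_def /= expr0n addr0 sqrtr_sqr. Qed.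
Lemma nm_eq0 z : (nm z == 0) = (z == 0).
Proof. by rewrite -[RHS]normr_eq0 nmE (inj_eq (@complexI R)). Qed.
Lemma nm_gt0 z : (0 < nm z) = (z != 0).
Proof. by rewrite lt0r nm_eq0 nm_ge0 andbT. Qed.
Lemma nmBD z w : nm z - nm w <= nm (z - w).
Proof. by rewrite lerBlDr -{1}(subrK w z) nmD. Qed.
Lemma Re_le_nm z : `|complex.Re z| <= nm z.
Proof. by rewrite -lecR -nmE normc_ge_Re. Qed.
Lemma Im_le_nm z : `|complex.Im z| <= nm z.
Proof.
rewrite -(@ler_pXn2r _ 2) ?nnegrE ?nm_ge0 // nm_sqr real_normK ?num_real //.
by rewrite lerDr sqr_ge0.
Qed.
Lemma nm_le_ReIm z : nm z <= `|complex.Re z| + `|complex.Im z|.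
Proof.
rewrite -(@ler_pXn2r _ 2) ?nnegrE ?nm_ge0 ?addr_ge0 // nm_sqr sqrrD.
by rewrite !real_normK ?num_real // -addrA lerD2l lerDr mulrn_wge0 // mulr_ge0.
Qed.
Lemma nm_i : nm 'i = 1.
Proof.
by apply/eqP; rewrite -(@eqrXn2 _ 2) ?nm_ge0 // nm_sqr /= expr0n add0r expr1n.
Qed.
Lemma nm2E z : (nm z ^+ 2)%:C = z * z^*.
Proof. by rewrite rmorphXn /= -nmE sqr_normc. Qed.

Lemma discE z : disc z <-> nm z < 1.
Proof. by rewrite /disc /= nmE -ltcR. Qed.

Lemma disc_le z : disc z -> nm z <= 1.
Proof. by move/discE/ltW. Qed.

(** The weight in the equation, within a factor 2 of the distance [1 - nm z] to the circle. *)
Definition b z : R := 1 - nm z ^+ 2.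
Lemma b_gt0 z : disc z -> 0 < b z.
Proof. by move/discE => h; rewrite /b subr_gt0 expr_lt1 ?nm_ge0. Qed.
Lemma b_ge0 z : nm z <= 1 -> 0 <= b z.
Proof. by move=> h; rewrite /b subr_ge0 expr_le1 ?nm_ge0. Qed.
Lemma b_le1 z : b z <= 1.
Proof. by rewrite /b gerBl sqr_ge0. Qed.
Lemma b_le_dist z : nm z <= 1 -> b z <= 2 * (1 - nm z).
Proof. by move=> h; have := nm_ge0 z; rewrite /b => ?; nra. Qed.
Lemma b_ge_dist z : nm z <= 1 -> 1 - nm z <= b z.
Proof. by move=> h; have := nm_ge0 z; rewrite /b => ?; nra. Qed.

Lemma nm_sub1_ge a z : 1 - nm a * nm z <= nm (1 - a^* * z).
Proof. by rewrite -(nm_conj a) -nmM -{1}nm1 nmBD. Qed.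

Lemma sub1_neq0 a z : nm a <= 1 -> disc z -> 1 - a^* * z != 0.
Proof.
move=> ha /discE hz; rewrite -nm_gt0; apply: lt_le_trans (nm_sub1_ge a z).
by have := nm_ge0 a; have := nm_ge0 z; move=> *; nra.
Qed.

(** The identity behind 1 - rho^2 = [gk]; it also yields the comparison of [b] at nearby points and
    the Euclidean separation of a net. *)
Lemma nm2_sub1 a z : nm (1 - a^* * z) ^+ 2 = nm (z - a) ^+ 2 + b a * b z.
Proof.
rewrite /b !nm_sqr; case: a => a1 a2; case: z => z1 z2 /=.
by ring.
Qed.

Lemma rhoE z w : rho z w = nm (z - w) / nm (1 - w^* * z).
Proof. by rewrite /rho -/(nm _) nmM nmV. Qed.
Lemma nm_sub1C a z : nm (1 - a^* * z) = nm (1 - z^* * a).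
Proof. by rewrite -(nm_conj (1 - a^* * z)) rmorphB rmorph1 rmorphM /= conjcK mulrC. Qed.
Lemma rhoC z w : rho z w = rho w z.
Proof. by rewrite !rhoE nmB nm_sub1C. Qed.
Lemma rho_ge0 z w : 0 <= rho z w.
Proof. by rewrite rhoE divr_ge0 ?nm_ge0. Qed.

(* [gk z w = 1 - rho z w ^ 2] on the disc *)
Definition gk z w : R := b z * b w / nm (1 - z^* * w) ^+ 2.
Lemma gkC z w : gk z w = gk w z.
Proof. by rewrite /gk nm_sub1C (mulrC (b z)). Qed.
Lemma rho2E z w : nm z <= 1 -> disc w -> rho z w ^+ 2 = 1 - gk z w.
Proof.
move=> hz hw; rewrite rhoC rhoE /gk.
have h := sub1_neq0 hz hw; have h2 : nm (1 - z^* * w) != 0 by rewrite nm_eq0.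
by rewrite expr_div_n; field: (nm2_sub1 z w).
Qed.
Lemma gk_ge0 z w : nm z <= 1 -> nm w <= 1 -> 0 <= gk z w.
Proof. by move=> *; rewrite divr_ge0 ?mulr_ge0 ?b_ge0 // ?exprn_ge0 ?nm_ge0. Qed.
Lemma rho_lt1 z w : disc z -> disc w -> rho z w < 1.
Proof.
move=> hz hw; rewrite -(@expr_lt1 _ 2) ?rho_ge0 // rho2E //; last first.
  by rewrite ltW //; apply/discE.
have h : 0 < nm (1 - z^* * w) by rewrite nm_gt0 sub1_neq0 ?disc_le.
by rewrite ltrBlDr ltrDl divr_gt0 ?mulr_gt0 ?b_gt0.
Qed.
End ComplexModulus.

(** * Real norm of a vector *)

Section VectorModulus.
Variables (R : realType) (X : normedModType R[i]^o).
Implicit Types (x y : X).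
Definition nX x : R := complex.Re (`|x| : R[i]).

Lemma nXE x : `|x| = (nX x)%:C.
Proof. by rewrite /nX RRe_real // ger0_real. Qed.
Lemma nX_ge0 x : 0 <= nX x.
Proof. by rewrite -ler0c -nXE. Qed.
Lemma nX0 : nX 0 = 0. Proof. by rewrite /nX normr0. Qed.
Lemma nXN x : nX (- x) = nX x. Proof. by rewrite /nX normrN. Qed.
Lemma nXB x y : nX (x - y) = nX (y - x). Proof. by rewrite /nX distrC. Qed.
Lemma nXD x y : nX (x + y) <= nX x + nX y.
Proof. by rewrite -lecR rmorphD /= -!nXE; exact: ler_normD. Qed.
Lemma nXZ (c : R[i]^o) x : nX (c *: x) = nm c * nX x.
Proof. by apply: complexI; rewrite -nXE normrZ nXE (nmE c) rmorphM. Qed.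
Lemma nX_eq0 x : (nX x == 0) = (x == 0).
Proof. by rewrite -[RHS]normr_eq0 nXE -(inj_eq (@complexI R)). Qed.
Lemma nX_gt0 x : (0 < nX x) = (x != 0).
Proof. by rewrite lt0r nX_eq0 nX_ge0 andbT. Qed.
Lemma nX_tri z x y : nX (x - y) <= nX (x - z) + nX (z - y).
Proof. by rewrite (le_trans _ (nXD _ _)) // addrA subrK. Qed.
Lemma nXBD x y : nX x - nX y <= nX (x - y).
Proof. by rewrite lerBlDr -{1}(subrK y x) nXD. Qed.
End VectorModulus.

Lemma nX_scalar (R : realType) (z : R[i]^o) : nX z = nm z.
Proof. by []. Qed.

(** * Simple functions on a measure space and their integrals *)

Section BochnerIntegral.
Context d (T : measurableType d) (R : realType) (mu : {measure set T -> \bar R}).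

Definition aeT (P : T -> Prop) :=
  exists B, [/\ measurable B, mu B = 0%E & forall x, ~ B x -> P x].

Lemma aeT_all (P : T -> Prop) : (forall x, P x) -> aeT P.
Proof. by move=> h; exists set0; split. Qed.
Lemma aeT_and (P Q : T -> Prop) : aeT P -> aeT Q -> aeT (fun x => P x /\ Q x).
Proof.
move=> [A [mA A0 hA]] [B [mB B0 hB]]; exists (A `|` B); split.
- exact: measurableU.
- by rewrite measureU0.
- by move=> x /not_orP[nA nB]; split; [exact: hA | exact: hB].
Qed.
Lemma aeT_imp (P Q : T -> Prop) : (forall x, P x -> Q x) -> aeT P -> aeT Q.
Proof. by move=> h [A [mA A0 hA]]; exists A; split => // x /hA/h. Qed.
Lemma aeT_bigcap (P : nat -> T -> Prop) : (forall n, aeT (P n)) ->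
  aeT (fun x => forall n, P n x).
Proof.
move=> /choice[A hA]; exists (\bigcup_n A n); split.
- by apply: bigcup_measurable => n _; have [] := hA n.
- apply: measure_negligible; first by apply: bigcup_measurable => n _; have [] := hA n.
  by apply: negligible_bigcup => n; have [? ? _] := hA n; exact: measure0_negligible || (apply/negligibleP).
- move=> x nx n; have [_ _ h] := hA n; apply: h => hx; apply: nx.
  by exists n.
Qed.
Lemma aeT_ae (P : T -> Prop) : aeT P -> {ae mu, forall x, P x}.
Proof.
move=> [A [mA A0 hA]]; exists A; split => // x /= nP.
by apply: contrapT => /hA.
Qed.

Section Simple.
Variable X : normedModType R[i]^o.
Implicit Types (s : seq (set T * X)) (g : T -> X).

(** The sets of [s] may overlap, so concatenation of lists is addition of functions. *)
Definition sf s x : X := \sum_(p <- s) (if `[< p.1 x >] then p.2 else 0).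
Definition sint s : X := \sum_(p <- s) ((fine (mu p.1))%:C : R[i]^o) *: p.2.
Definition fsimple s :=
  forall p, p \in s -> measurable p.1 /\ (mu p.1 < +oo)%E.

Lemma measurable_asbool (A : set T) : measurable A ->
  measurable_fun setT (fun x => `[< A x >]).
Proof.
move=> mA; apply: (measurable_fun_bool true); rewrite setTI.
by congr (measurable _): mA; apply/seteqP; split => x /= /asboolP.
Qed.

(** The norm is not additive, so the induction carries an offset [x0] that collects the values
    already decided. *)
Lemma measurable_nX_sf s x0 : fsimple s ->
  measurable_fun setT (fun x => nX (sf s x + x0)).
Proof.
elim: s x0 => [|p s IH] x0 hs.
  by rewrite /sf; under eq_fun do rewrite big_nil; exact: measurable_cst.
have hs' : fsimple s by move=> q qs; apply: hs; rewrite inE qs orbT.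
have [mp _] := hs p (mem_head _ _).
rewrite (_ : (fun _ => _) = fun x => if `[< p.1 x >] then nX (sf s x + (p.2 + x0))
   else nX (sf s x + x0)).
  by apply: measurable_fun_ifT => //; [exact: measurable_asbool | exact: IH | exact: IH].
apply/funext => x; rewrite /sf big_cons.
by case: ifP => _; rewrite ?add0r // (addrC p.2) -addrA.
Qed.

(** Overlapping sets are handled by splitting [D] along the first set of the list; on the inner half
    the offset grows by the vector of that set. *)
Lemma nX_sint_le_aux s (D : set T) x0 : fsimple s -> measurable D ->
  (mu D < +oo)%E ->
  ((nX (\sum_(p <- s) ((fine (mu (p.1 `&` D)))%:C : R[i]^o) *: p.2
     + ((fine (mu D))%:C : R[i]^o) *: x0))%:E
   <= \int[mu]_(x in D) (nX (sf s x + x0))%:E)%E.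
Proof.
elim: s D x0 => [|p s IH] D x0 hs mD D_fin.
  rewrite big_nil add0r /sf.
  under eq_integral do rewrite big_nil add0r.
  rewrite integral_cst // nXZ nm_real ger0_norm ?fine_ge0 // EFinM fineK.
    by rewrite muleC.
  by rewrite ge0_fin_numE.
have hs' : fsimple s by move=> q qs; apply: hs; rewrite inE qs orbT.
have [mp _] := hs p (mem_head _ _).
have mDp : measurable (D `&` p.1) by exact: measurableI.
have mDq : measurable (D `\` p.1) by exact: measurableD.
have D1 : (mu (D `&` p.1) < +oo)%E.
  by apply: le_lt_trans D_fin; rewrite le_measure ?inE //; apply: subIsetl.
have D2 : (mu (D `\` p.1) < +oo)%E.
  by apply: le_lt_trans D_fin; rewrite le_measure ?inE //; apply: subDsetl.
have fin (A : set T) : measurable A -> (mu (A `&` D) < +oo)%E.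
  move=> mA; apply: le_lt_trans D_fin; rewrite le_measure ?inE //.
  exact: measurableI.
have split_mu (A : set T) : measurable A ->
    fine (mu (A `&` D)) =
    fine (mu (A `&` (D `&` p.1))) + fine (mu (A `&` (D `\` p.1))).
  move=> mA; rewrite -fineD.
  - rewrite -measureU; [|exact: measurableI|exact: measurableI|].
    + by rewrite -setIUr setUIDK.
    + by apply/seteqP; split => // x [[_ [_ h]] [_ [_ /(_ h)]]].
  - rewrite ge0_fin_numE //; apply: le_lt_trans D1.
    by rewrite le_measure ?inE //; exact: measurableI.
  - rewrite ge0_fin_numE //; apply: le_lt_trans D2.
    by rewrite le_measure ?inE //; exact: measurableI.
have muD : fine (mu D) = fine (mu (D `&` p.1)) + fine (mu (D `\` p.1)).
  by have := split_mu setT measurableT; rewrite !setTI.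
have -> : (\int[mu]_(x in D) (nX (sf (p :: s) x + x0))%:E =
    \int[mu]_(x in D `&` p.1) (nX (sf (p :: s) x + x0))%:E +
    \int[mu]_(x in D `\` p.1) (nX (sf (p :: s) x + x0))%:E)%E.
  rewrite -ge0_integral_setU ?setUIDK //.
  - by apply/measurable_EFinP; apply: measurable_funTS; exact: measurable_nX_sf.
  - by move=> x _; rewrite lee_fin nX_ge0.
  - by rewrite /disj_set; apply/eqP/seteqP; split => // x [[_ h] [_ /(_ h)]].
have H1 := IH (D `&` p.1) (p.2 + x0) hs' mDp D1.
have H2 := IH (D `\` p.1) x0 hs' mDq D2.
have -> : (\int[mu]_(x in D `&` p.1) (nX (sf (p :: s) x + x0))%:E =
  \int[mu]_(x in D `&` p.1) (nX (sf s x + (p.2 + x0)))%:E)%E.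
  apply: eq_integral => x; rewrite inE => -[_ px].
  by rewrite /sf big_cons asboolT // (addrC p.2) -addrA.
have -> : (\int[mu]_(x in D `\` p.1) (nX (sf (p :: s) x + x0))%:E =
  \int[mu]_(x in D `\` p.1) (nX (sf s x + x0))%:E)%E.
  apply: eq_integral => x; rewrite inE => -[_ px].
  by rewrite /sf big_cons asboolF // add0r.
apply: le_trans (leeD H1 H2); rewrite -EFinD lee_fin.
apply: le_trans (nXD _ _); rewrite le_eqVlt; apply/orP; left; apply/eqP.
congr nX; rewrite big_cons muD.
rewrite (eq_big_seq (fun q => ((fine (mu (q.1 `&` (D `&` p.1))))%:C : R[i]^o) *: q.2
   + ((fine (mu (q.1 `&` (D `\` p.1))))%:C : R[i]^o) *: q.2)); last first.
  by move=> q qs; rewrite (split_mu _ (proj1 (hs' q qs))) rmorphD scalerDl.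
rewrite big_split /= (setIC p.1 D) rmorphD scalerDl scalerDr.
set a := \sum_(_ <- _) _; set b' := \sum_(_ <- _) _.
by rewrite [RHS]addrACA (addrC (_ *: p.2)) -!addrA.
Qed.

Lemma nX_sint_le s (h : T -> R) : fsimple s -> measurable_fun setT h ->
  (forall x, 0 <= h x) -> aeT (fun x => nX (sf s x) <= h x) ->
  ((nX (sint s))%:E <= \int[mu]_x (h x)%:E)%E.
Proof.
move=> hs mh h0 sh.
pose D := \big[setU/set0]_(p <- s) p.1.
have sD p : p \in s -> p.1 `<=` D.
  by move=> ps x px; rewrite /D -bigcup_seq; exists p.
have mD : measurable D.
  by rewrite /D -bigcup_seq; apply: bigcup_measurable_seq || apply: fin_bigcup_measurable => // p /hs[].
have D_fin : (mu D < +oo)%E.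
  rewrite /D; elim: s hs {sh D sD mD} => [|p s IH] hs.
    by rewrite big_nil measure0.
  have hs' : fsimple s by move=> q qs; apply: hs; rewrite inE qs orbT.
  have [mp p_fin] := hs p (mem_head _ _).
  rewrite big_cons; apply: le_lt_trans (measureU2 _ _ _) _ => //.
    by rewrite -bigcup_seq; apply: fin_bigcup_measurable => // q /hs'[].
  by rewrite lte_add_pinfty // IH.
have := nX_sint_le_aux 0 hs mD D_fin; rewrite scaler0 addr0.
rewrite (_ : \sum_(p <- s) _ = sint s); last first.
  by apply: eq_big_seq => p ps; rewrite setIidl //; exact: sD.
move=> /le_trans; apply.
apply: le_trans (_ : \int[mu]_(x in D) (h x)%:E <= _)%E; last first.
  by apply: ge0_subset_integral => //; [exact/measurable_EFinP | move=> x _; rewrite lee_fin].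
apply: ae_ge0_le_integral => //.
- by move=> x _; rewrite lee_fin nX_ge0.
- by apply/measurable_EFinP; apply: measurable_funTS; exact: measurable_nX_sf.
- by move=> x _; rewrite lee_fin.
- by apply/measurable_EFinP; apply: measurable_funTS.
- apply: aeT_ae; apply: aeT_imp sh => x hx _.
  by rewrite addr0 lee_fin.
Qed.
End Simple.
End BochnerIntegral.

(** * Upper integrals and the Bochner integral *)

Section Bochner.
Context d (T : measurableType d) (R : realType) (mu : {measure set T -> \bar R}).
Local Notation aeT := (aeT mu).

(* [uint_le phi e]: the upper integral of [phi] is at most [e]. *)
Definition uint_le (phi : T -> R) (e : R) := exists h : T -> R,
  [/\ measurable_fun setT h, forall x, 0 <= h x, aeT (fun x => phi x <= h x) &
    (\int[mu]_x (h x)%:E <= e%:E)%E].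

Lemma uint_le_ae (phi psi : T -> R) e :
  aeT (fun x => phi x <= psi x) -> uint_le psi e -> uint_le phi e.
Proof.
move=> h1 [h [mh h0 h2 he]]; exists h; split => //.
by apply: aeT_imp (aeT_and h1 h2) => x [a c]; exact: le_trans a c.
Qed.
Lemma uint_le_mono (phi psi : T -> R) e :
  (forall x, phi x <= psi x) -> uint_le psi e -> uint_le phi e.
Proof. by move=> h; apply: uint_le_ae; exact: aeT_all. Qed.
Lemma uint_le_le (phi : T -> R) a c : a <= c -> uint_le phi a -> uint_le phi c.
Proof.
move=> ac [h [mh h0 h2 he]]; exists h; split => //.
by apply: le_trans he _; rewrite lee_fin.
Qed.
Lemma uint_leD (phi psi : T -> R) a c : uint_le phi a -> uint_le psi c ->
  uint_le (fun x => phi x + psi x) (a + c).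
Proof.
move=> [h [mh h0 h2 he]] [k [mk k0 k2 ke]]; exists (fun x => h x + k x); split.
- exact: measurable_funD.
- by move=> x; rewrite addr_ge0.
- by apply: aeT_imp (aeT_and h2 k2) => x [? ?]; rewrite lerD.
- under eq_integral do rewrite EFinD.
  rewrite ge0_integralD //; first by rewrite EFinD leeD.
  + by move=> x _; rewrite lee_fin.
  + exact/measurable_EFinP.
  + by move=> x _; rewrite lee_fin.
  + exact/measurable_EFinP.
Qed.
Lemma uint_leZ (phi : T -> R) a c : 0 <= c -> uint_le phi a ->
  uint_le (fun x => c * phi x) (c * a).
Proof.
move=> c0 [h [mh h0 h2 he]]; exists (fun x => c * h x); split.
- exact: measurable_funM.
- by move=> x; rewrite mulr_ge0.
- by apply: aeT_imp h2 => x ?; rewrite ler_wpM2l.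
- under eq_integral do rewrite EFinM.
  rewrite ge0_integralZl_EFin //; first by rewrite EFinM lee_wpmul2l // lee_fin.
  + by move=> x _; rewrite lee_fin.
  + exact/measurable_EFinP.
Qed.
Lemma uint_le0 : uint_le (fun=> 0) 0.
Proof.
exists (fun=> 0); split => //; first exact: aeT_all.
by rewrite integral0.
Qed.
Lemma uint_le_self (h : T -> R) e : measurable_fun setT h ->
  (forall x, 0 <= h x) -> (\int[mu]_x (h x)%:E <= e%:E)%E -> uint_le h e.
Proof. by move=> *; exists h; split => //; exact: aeT_all. Qed.
Lemma uint_le_int (h : T -> R) e : measurable_fun setT h ->
  (forall x, 0 <= h x) -> uint_le h e -> (\int[mu]_x (h x)%:E <= e%:E)%E.
Proof.
move=> mh h0 [k [mk k0 hk ke]]; apply: le_trans ke.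
apply: ae_ge0_le_integral => //.
- by move=> x _; rewrite lee_fin.
- exact/measurable_EFinP.
- by move=> x _; rewrite lee_fin.
- exact/measurable_EFinP.
- by apply: aeT_ae; apply: aeT_imp hk => x; rewrite lee_fin.
Qed.

Section Vect.
Variable X : normedModType R[i]^o.
Implicit Types (g : T -> X) (v : X) (s : seq (set T * X)).

(** The integral by closure of the simple functions in the upper L1 seminorm. Quantifying over
    errors rather than sequences turns limits, sums and linear images into epsilon arguments;
    [cint_is_bochner] recovers the sequential form. *)
Definition bint g v := forall e : R, 0 < e -> exists s, [/\ fsimple mu s,
  uint_le (fun x => nX (g x - sf s x)) e & nX (sint mu s - v) <= e].

Lemma nX_sint_uint s e : fsimple mu s -> uint_le (fun x => nX (sf s x)) e ->
  nX (sint mu s) <= e.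
Proof.
move=> hs [h [mh h0 h2 he]]; rewrite -lee_fin; apply: le_trans he.
exact: nX_sint_le.
Qed.

Lemma bint_norm g v M : bint g v -> uint_le (fun x => nX (g x)) M -> nX v <= M.
Proof.
move=> hg hM; apply/ler_addgt0Pr => e e0.
have e20 : 0 < e / 2 by rewrite divr_gt0.
have [s [hs hgs hsv]] := hg _ e20.
have : nX (sint mu s) <= M + e / 2.
  apply: nX_sint_uint => //; apply: uint_le_mono (uint_leD hM hgs) => x.
  by rewrite -[X in nX X](subrK (g x)) (le_trans (nXD _ _)) // addrC lerD2l nXB.
have := nXBD v (sint mu s); rewrite nXB; move: hsv; lra.
Qed.

Lemma sf_cat s1 s2 x : sf (s1 ++ s2) x = sf s1 x + sf s2 x.
Proof. by rewrite /sf big_cat. Qed.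
Lemma sint_cat s1 s2 : sint mu (s1 ++ s2) = sint mu s1 + sint mu s2.
Proof. by rewrite /sint big_cat. Qed.
Lemma fsimple_cat s1 s2 : fsimple mu s1 -> fsimple mu s2 -> fsimple mu (s1 ++ s2).
Proof. by move=> h1 h2 p; rewrite mem_cat => /orP[/h1|/h2]. Qed.

Lemma bint_ae g g' v : aeT (fun x => g x = g' x) -> bint g v -> bint g' v.
Proof.
move=> gg' h e /h[s [? hs ?]]; exists s; split => //; apply: uint_le_ae hs.
by apply: aeT_imp gg' => x ->.
Qed.
Lemma bint_ext g g' v : (forall x, g x = g' x) -> bint g v -> bint g' v.
Proof. by move=> h; apply: bint_ae; apply: aeT_all. Qed.

(** Difference quotients, regularized kernels and holomorphic approximants all pass to the limit
    through this lemma. *)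
Lemma bint_closed g v : (forall e : R, 0 < e -> exists g' v', [/\ bint g' v',
  uint_le (fun x => nX (g x - g' x)) e & nX (v' - v) <= e]) -> bint g v.
Proof.
move=> h e e0; have e20 : 0 < e / 2 by rewrite divr_gt0.
have [g' [v' [/(_ _ e20)[s [hs gs sv]] gg' vv']]] := h _ e20.
exists s; split => //.
  rewrite (splitr e); apply: uint_le_mono (uint_leD gg' gs) => x; exact: nX_tri.
by apply: le_trans (nX_tri v' _ _) _; rewrite (splitr e) lerD.
Qed.

Lemma bint_sf s : fsimple mu s -> bint (sf s) (sint mu s).
Proof.
move=> hs e e0; exists s; split => //; last by rewrite subrr nX0 ltW.
by apply: uint_le_le (ltW e0) _; apply: uint_le_mono uint_le0 => x; rewrite subrr nX0.
Qed.
End Vect.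

(** Such a map acts on the simple approximants value by value. This gives naturality of the operator
    and, when [A] multiplies a fixed vector by a scalar, the passage from scalar to vector
    integrals. *)
Lemma bint_map (X Y : normedModType R[i]^o) (A : X -> Y) (k : R) g v :
  (forall x y, A (x + y) = A x + A y) ->
  (forall (c : R[i]^o) x, A (c *: x) = c *: A x) ->
  (forall x, nX (A x) <= k * nX x) ->
  bint g v -> bint (A \o g) (A v).
Proof.
move=> AD AZ Ak hg e e0.
have A0 : A 0 = 0 by rewrite -(scale0r (0 : X)) AZ scale0r.
have AB x y : A (x - y) = A x - A y by rewrite -scaleN1r AD AZ scaleN1r.
pose e' := e / (`|k| + 1).
have k1 : 0 < `|k| + 1 by rewrite ltr_pwDr.
have e'0 : 0 < e' by rewrite divr_gt0.
have ek : `|k| * e' <= e.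
  by rewrite /e' mulrA ler_pdivrMr // mulrC ler_pM2l // lerDl.
have Ak' x : nX (A x) <= `|k| * nX x.
  by apply: le_trans (Ak _) _; rewrite ler_wpM2r ?nX_ge0 // ler_norm.
have [s [hs gs sv]] := hg _ e'0.
exists [seq (p.1, A p.2) | p <- s]; split.
- by move=> q /mapP[p ps ->]; exact: hs.
- apply: uint_le_le ek _; apply: uint_le_mono (uint_leZ (normr_ge0 k) gs) => x.
  apply: le_trans (Ak' _); rewrite AB /sf big_map (big_morph A AD A0) /=.
  rewrite (_ : \sum_(j <- s) (if _ then _ else _) =
    \sum_(i <- s) A (if `[< i.1 x >] then i.2 else 0)) //.
  by apply: eq_bigr => p _; case: ifP.
- apply: le_trans ek; apply: le_trans (_ : `|k| * nX (sint mu s - v) <= _); last first.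
    by rewrite ler_wpM2l.
  apply: le_trans (Ak' _); rewrite AB /sint big_map (big_morph A AD A0) /=.
  by under [X in _ <= nX (X - _)]eq_bigr do rewrite AZ.
Qed.

Section Vect2.
Variable X : normedModType R[i]^o.
Implicit Types (g : T -> X) (v : X) (s : seq (set T * X)).

Lemma bintD g g' v v' : bint g v -> bint g' v' ->
  bint (fun x => g x + g' x) (v + v').
Proof.
move=> hg hg' e e0; have e20 : 0 < e / 2 by rewrite divr_gt0.
have [s [hs gs sv]] := hg _ e20; have [s' [hs' gs' sv']] := hg' _ e20.
exists (s ++ s'); split; first exact: fsimple_cat.
- rewrite (splitr e); apply: uint_le_mono (uint_leD gs gs') => x.
  by rewrite sf_cat opprD addrACA nXD.
- by rewrite sint_cat opprD addrACA (le_trans (nXD _ _)) // (splitr e) lerD.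
Qed.
Lemma bintZ (a : R[i]^o) g v : bint g v -> bint (fun x => a *: g x) (a *: v).
Proof.
apply: (@bint_map X X (fun x => a *: x) (nm a)).
- by move=> x y; rewrite scalerDr.
- by move=> c x; rewrite !scalerA mulrC.
- by move=> x; rewrite nXZ.
Qed.
Lemma bintB g g' v v' : bint g v -> bint g' v' ->
  bint (fun x => g x - g' x) (v - v').
Proof.
move=> h /(@bintZ (-1)); rewrite scaleN1r => /(bintD h).
by apply: bint_ext => x; rewrite scaleN1r.
Qed.
Lemma bint_dist g g' v v' M : bint g v -> bint g' v' ->
  uint_le (fun x => nX (g x - g' x)) M -> nX (v - v') <= M.
Proof. by move=> hg hg'; exact: bint_norm (bintB hg hg'). Qed.
Lemma bint_unique g v v' : bint g v -> bint g v' -> v = v'.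
Proof.
move=> hg hg'; apply/eqP; rewrite -subr_eq0 -nX_eq0 eq_le nX_ge0 andbT.
apply: bint_dist hg hg' _; apply: uint_le_mono uint_le0 => x.
by rewrite subrr nX0.
Qed.
Lemma bint0 : bint (fun=> (0 : X)) 0.
Proof.
have := @bint_sf X [::]; rewrite /sint big_nil => h.
by apply: bint_ext (h _) => // x; rewrite /sf big_nil.
Qed.
End Vect2.

Lemma nX_cvg (X : normedModType R[i]^o) (v_ : nat -> X) v :
  (forall e : R, 0 < e -> exists N, forall n, (N <= n)%N -> nX (v_ n - v) < e) <->
  v_ n @[n --> \oo] --> v.
Proof.
split=> [h|/cvgrPdist_lt h e e0].
  apply/cvgrPdist_lt => e e0.
  have eE : e = (complex.Re e)%:C by rewrite RRe_real // gtr0_real.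
  have e'0 : 0 < complex.Re e by rewrite -ltcR -eE.
  have [N hN] := h _ e'0; exists N => // n /= /hN.
  by rewrite nXB eE nXE ltcR.
have e0' : 0 < e%:C :> R[i] by rewrite ltcR.
have [N _ hN] := h _ e0'; exists N => n /hN /=.
by rewrite nXE ltcR nXB.
Qed.

(** Integrals of approximants with errors 1/(n+1) and 1/(m+1) differ by at most the sum of these, so
    they form a Cauchy sequence in the complete space [X]. *)
Lemma bint_complete (X : completeNormedModType R[i]^o) (g : T -> X) :
  (forall e : R, 0 < e -> exists g' v', bint g' v' /\
     uint_le (fun x => nX (g x - g' x)) e) -> exists v, bint g v.
Proof.
move=> h.
have /choice[G /choice[V hGV]] : forall n : nat, exists g' v', bint g' v' /\
    uint_le (fun x => nX (g x - g' x)) n.+1%:R^-1.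
  by move=> n; apply: h.
have VV n m : nX (V n - V m) <= n.+1%:R^-1 + m.+1%:R^-1.
  have [bn un] := hGV n; have [bm um] := hGV m.
  apply: bint_dist bn bm _; apply: uint_le_mono (uint_leD un um) => x.
  by rewrite (nXB (g x) (G n x)) nX_tri.
have small e : 0 < e -> exists N, forall n, (N <= n)%N -> n.+1%:R^-1 < e :> R.
  move=> e0; have [N _ hN] := near_infty_natSinv_lt (PosNum e0).
  by exists N => n /hN.
have : cvgn V.
  apply/cauchy_cvgP/cauchy_ballP => e e0.
  have eE : e = (complex.Re e)%:C by rewrite RRe_real // gtr0_real.
  have e'0 : 0 < complex.Re e by rewrite -ltcR -eE.
  have e''0 : 0 < complex.Re e / 2 by rewrite divr_gt0.
  have [N hN] := small _ e''0.
  exists (V @` [set n | (N <= n)%N], V @` [set n | (N <= n)%N]).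
    by split; exists N => // n Nn; exists n.
  move=> [_ _] [/= [n Nn <-] [m Nm <-]].
  rewrite -ball_normE /= eE nXE ltcR; apply: le_lt_trans (VV _ _) _.
  by rewrite (splitr (complex.Re e)) ltrD //; apply: hN.
move=> /cvg_ex[v /nX_cvg hv]; exists v; apply: bint_closed => e e0.
have [N1 h1] := hv _ e0; have [N2 h2] := small _ e0.
pose n := maxn N1 N2; have [bn un] := hGV n.
exists (G n), (V n); split => //.
  by apply: uint_le_le un; rewrite ltW // h2 // leq_maxr.
by rewrite ltW // h1 // leq_maxl.
Qed.
End Bochner.

(** * Strong measurability through balls and separability *)

Section StronglyMeasurable.
Context d (T : measurableType d) (R : realType).

(** Pettis' form of strong measurability. Its two clauses concern every point, not almost every one,
    which makes pointwise limits and continuous operations direct. *)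
Definition SM (X : normedModType R[i]^o) (g : T -> X) :=
  (forall y (e : R), measurable [set x | nX (g x - y) < e]) /\
  exists c : nat -> X, forall x (e : R), 0 < e -> exists n, nX (g x - c n) < e.

Definition cont2 (X Y Z : normedModType R[i]^o) (F : X -> Y -> Z) :=
  forall a b (e : R), 0 < e -> exists2 del : R, 0 < del & forall a' b',
    nX (a' - a) < del -> nX (b' - b) < del -> nX (F a' b' - F a b) < e.

Lemma small_inv (e : R) : 0 < e -> exists N, forall n, (N <= n)%N -> n.+1%:R^-1 < e.
Proof.
move=> e0; have [N _ hN] := near_infty_natSinv_lt (PosNum e0).
by exists N => n /hN.
Qed.

Lemma measurable_ltr_set (f h : T -> R) : measurable_fun setT f ->
  measurable_fun setT h -> measurable [set x | f x < h x].
Proof.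
move=> mf mh; have := measurable_fun_ltr mf mh measurableT (Y := [set true]).
by rewrite setTI; apply.
Qed.

(** An open condition on a pair is a countable union of conditions on products of small balls around
    the two dense sequences. *)
Lemma SM_open2 (X Y : normedModType R[i]^o) (g : T -> X) (h : T -> Y)
  (O : X -> Y -> Prop) : SM g -> SM h ->
  (forall a b, O a b -> exists2 e : R, 0 < e & forall a' b',
     nX (a' - a) < e -> nX (b' - b) < e -> O a' b') ->
  measurable [set x | O (g x) (h x)].
Proof.
move=> [mg [c hc]] [mh [k hk]] openO.
pose good (i : nat * nat * nat) := forall a b, nX (a - c i.1.1) < i.2.+1%:R^-1 ->
  nX (b - k i.1.2) < i.2.+1%:R^-1 -> O a b.
rewrite (_ : [set x | _] = \bigcup_(i in good)
  ([set x | nX (g x - c i.1.1) < i.2.+1%:R^-1] `&`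
   [set x | nX (h x - k i.1.2) < i.2.+1%:R^-1])); last first.
  apply/seteqP; split => x /=.
    move=> /openO[e e0 hO]; have e20 : 0 < e / 2 by rewrite divr_gt0.
    have [N hN] := small_inv e20; have {}hN := hN _ (leqnn N).
    have N0 : (0 : R) < N.+1%:R^-1 by rewrite invr_gt0.
    have [n hn] := hc x _ N0; have [m hm] := hk x _ N0.
    exists ((n, m), N) => //= a b /= ha hb; apply: hO.
      apply: le_lt_trans (nX_tri (c n) _ _) _; rewrite (nXB (c n)) (splitr e).
      by rewrite ltrD // (lt_trans _ hN).
    apply: le_lt_trans (nX_tri (k m) _ _) _; rewrite (nXB (k m)) (splitr e).
    by rewrite ltrD // (lt_trans _ hN).
  by move=> [i hi [/= h1 h2]]; exact: hi.
rewrite bigcup_mkcond; apply: countable_bigcupT_measurable => // i.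
by case: ifP => // _; apply: measurableI; [exact: mg | exact: mh].
Qed.

Lemma SM_cont2 (X Y Z : normedModType R[i]^o) (F : X -> Y -> Z) g h :
  SM g -> SM h -> cont2 F -> SM (fun x => F (g x) (h x)).
Proof.
move=> hg hh cF; split=> [y e|].
  apply: (@SM_open2 _ _ _ _ (fun a b => nX (F a b - y) < e)) => // a b hab.
  have e0 : 0 < e - nX (F a b - y) by rewrite subr_gt0.
  have [del del0 hd] := cF a b _ e0; exists del => // a' b' ha hb.
  have := hd _ _ ha hb; rewrite ltrBrDr; apply: le_lt_trans; exact: nX_tri.
have [_ [c hc]] := hg; have [_ [k hk]] := hh.
exists (fun i => if unpickle i is Some nm then F (c nm.1) (k nm.2) else 0) => x e e0.
have [del del0 hd] := cF (g x) (h x) _ e0.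
have [n hn] := hc x _ del0; have [m hm] := hk x _ del0.
by exists (pickle (n, m)); rewrite pickleK /= nXB hd // nXB.
Qed.

Lemma SM_measurable_nX (X : normedModType R[i]^o) (g : T -> X) y : SM g ->
  measurable_fun setT (fun x => nX (g x - y)).
Proof.
move=> [mg _].
move=> mT; apply: (measurability _ (RGenInftyO.measurableE R)) => //= _ [_ [a ->] <-].
by rewrite setTI (_ : _ @^-1` _ = [set x | nX (g x - y) < a]).
Qed.
Lemma SM_measurable_norm (X : normedModType R[i]^o) (g : T -> X) : SM g ->
  measurable_fun setT (fun x => nX (g x)).
Proof.
move=> /(SM_measurable_nX 0); congr measurable_fun; apply/funext => x.
by rewrite subr0.
Qed.

Lemma SM_cst (X : normedModType R[i]^o) (y : X) : SM (fun=> y).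
Proof.
split=> [y' e|].
  have [h|h] := pselect (nX (y - y') < e).
    by rewrite (_ : mkset _ = setT) //; apply/seteqP; split.
  by rewrite (_ : mkset _ = set0) //; apply/seteqP; split.
by exists (fun=> y) => x e e0; exists 0%N; rewrite subrr nX0.
Qed.

Lemma SM_D (X : normedModType R[i]^o) (g h : T -> X) :
  SM g -> SM h -> SM (fun x => g x + h x).
Proof.
move=> hg hh; apply: (SM_cont2 (F := fun a b => a + b)) => // a b e e0.
exists (e / 2); first by rewrite divr_gt0.
move=> a' b' ha hb; rewrite opprD addrACA (le_lt_trans (nXD _ _)) //.
by rewrite (splitr e) ltrD.
Qed.

Lemma SM_Z (X : normedModType R[i]^o) (g : T -> R[i]^o) (h : T -> X) :
  SM g -> SM h -> SM (fun x => g x *: h x).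
Proof.
move=> hg hh; apply: (SM_cont2 (F := fun (a : R[i]^o) (b : X) => a *: b)) => // a b e e0.
pose K := nm a + nX b + 1.
have K0 : 0 < K by rewrite ltr_pwDr // addr_ge0 // ?nm_ge0 // nX_ge0.
exists (Num.min 1 (e / K / 2)); first by rewrite lt_min ltr01 !divr_gt0.
move=> a' b'; rewrite !lt_min => /andP[ha1 ha] /andP[_ hb].
have -> : a' *: b' - a *: b = (a' *: (b' - b)) + ((a' - a) *: b : X).
  by rewrite scalerBr scalerBl addrA subrK.
apply: le_lt_trans (nXD _ _) _; rewrite !nXZ.
have ha' : nm a' <= nm a + 1.
  by rewrite -lerBlDl (le_trans (nmBD _ _)) // ltW.
have h0 : 0 < e / K / 2 by rewrite !divr_gt0.
have hE : e / K / 2 * K = e / 2 by field; rewrite gt_eqF.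
have := nX_ge0 b; have := nm_ge0 a; have := nX_ge0 (b' - b); have := nm_ge0 (a' - a).
rewrite !nX_scalar in ha ha1 *.
have h1 : nm a' * nX (b' - b) <= (nm a + 1) * (e / K / 2).
  by rewrite ler_pM ?nm_ge0 ?nX_ge0 // ltW.
have h2 : nm (a' - a) * nX b <= e / K / 2 * nX b.
  by rewrite ler_wpM2r ?nX_ge0 // ltW.
have h3 : (nm a + 1) * (e / K / 2) + e / K / 2 * nX b = e / 2.
  by rewrite -hE /K; ring.
by move=> *; lra.
Qed.

Lemma SM_if (X : normedModType R[i]^o) (A : set T) (g h : T -> X) :
  measurable A -> SM g -> SM h -> SM (fun x => if `[< A x >] then g x else h x).
Proof.
move=> mA [mg [c hc]] [mh [k hk]]; split=> [y e|].
  rewrite (_ : [set _ | _] = (A `&` [set x | nX (g x - y) < e]) `|`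
     (~` A `&` [set x | nX (h x - y) < e])).
    by apply: measurableU; apply: measurableI => //; exact: measurableC.
  apply/seteqP; split => x /=; case: asboolP => [a|a]; first by left.
  - by right.
  - by move=> [[]|[]].
  - by move=> [[]|[]].
exists (fun n => if odd n then c n./2 else k n./2) => x e e0; case: asboolP => _.
  by have [n hn] := hc x _ e0; exists n.*2.+1; rewrite /= odd_double /= uphalf_double.
by have [n hn] := hk x _ e0; exists n.*2; rewrite odd_double half_double.
Qed.

Lemma SM_lim (X : normedModType R[i]^o) (g_ : nat -> T -> X) (g : T -> X) :
  (forall n, SM (g_ n)) ->
  (forall x (e : R), 0 < e -> exists N, forall n, (N <= n)%N -> nX (g_ n x - g x) < e) ->
  SM g.
Proof.
move=> hg hl; split=> [y e|].
  (* A strict inequality survives the limit only with a margin, here 1/(k+1). *)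
  rewrite (_ : [set _ | _] = \bigcup_k \bigcup_N \bigcap_(n in [set n | (N <= n)%N])
     [set x | nX (g_ n x - y) < e - k.+1%:R^-1]).
    apply: bigcup_measurable => k _; apply: bigcup_measurable => N _.
    by apply: bigcap_measurableType => n _; have [m _] := hg n; exact: m.
  apply/seteqP; split => x /=.
    move=> hx; have h0 : 0 < (e - nX (g x - y)) / 2 by rewrite divr_gt0 // subr_gt0.
    have [k hk] := small_inv h0; have {}hk := hk _ (leqnn k).
    have [N hN] := hl x _ h0; exists k => //; exists N => // n /= /hN hn.
    have := nX_tri (g x) (g_ n x) y; move: (k.+1%:R^-1) hk hn => t.
    by move: (nX _) (nX _) (nX _) => ? ? ?; lra.
  move=> [k _ [N _ hN]]; have k0 : (0 : R) < k.+1%:R^-1 by rewrite invr_gt0.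
  have [M hM] := hl x _ k0; pose n := maxn N M.
  have h1 : nX (g_ n x - y) < e - k.+1%:R^-1 := hN n (leq_maxl _ _).
  have h2 := hM n (leq_maxr _ _); have := nX_tri (g_ n x) (g x) y.
  rewrite (nXB (g x) (g_ n x)); move: (k.+1%:R^-1) h1 h2 {k0 hN hM} => t.
  by move: (nX _) (nX _) (nX _) => ? ? ?; lra.
have /choice[c hc] : forall n, exists c : nat -> X, forall x (e : R), 0 < e ->
    exists m, nX (g_ n x - c m) < e by move=> n; have [] := hg n.
exists (fun i => if unpickle i is Some p then c p.1 p.2 else 0) => x e e0.
have e20 : 0 < e / 2 by rewrite divr_gt0.
have [N hN] := hl x _ e20; have {}hN := hN _ (leqnn N).
have [m hm] := hc N x _ e20; exists (pickle (N, m)); rewrite pickleK /=.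
apply: le_lt_trans (nX_tri (g_ N x) _ _) _.
by rewrite (nXB (g x)) (splitr e) ltrD.
Qed.

Lemma SM_cont1 (X Y : normedModType R[i]^o) (F : X -> Y) (g : T -> X) : SM g ->
  (forall a (e : R), 0 < e -> exists2 del : R, 0 < del & forall a',
     nX (a' - a) < del -> nX (F a' - F a) < e) -> SM (fun x => F (g x)).
Proof.
move=> hg cF; have c2 : cont2 (fun a (_ : X) => F a).
  move=> a b e e0.
  by have [del d0 hd] := cF a e e0; exists del => // a' b' h _; exact: hd.
exact: (SM_cont2 hg hg c2).
Qed.

Lemma SM_B (X : normedModType R[i]^o) (g h : T -> X) :
  SM g -> SM h -> SM (fun x => g x - h x).
Proof.
move=> hg hh; have := SM_D hg (SM_Z (SM_cst (-1 : R[i]^o)) hh).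
by congr SM; apply/funext => x; rewrite scaleN1r.
Qed.

Lemma SM_real (f : T -> R) : measurable_fun setT f -> SM (fun x => (f x)%:C : R[i]^o).
Proof.
move=> mf; split=> [y e|].
  have [e0|e0] := ltP 0 e; last first.
    rewrite (_ : [set _ | _] = set0) //; apply/seteqP; split => // x /=.
    by move=> /(le_lt_trans (nX_ge0 _)); rewrite ltNge e0.
  have -> : [set x | nX (((f x)%:C : R[i]^o) - y) < e] =
     setT `&` [set x | (f x - complex.Re y) ^+ 2 + complex.Im y ^+ 2 < e ^+ 2].
    have E x : (nX (((f x)%:C : R[i]^o) - y) < e) =
        ((f x - complex.Re y) ^+ 2 + complex.Im y ^+ 2 < e ^+ 2).
      rewrite nX_scalar -[LHS](@ltr_pXn2r _ 2) ?nnegrE ?nm_ge0 ?(ltW e0) //.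
      by rewrite nm_sqr; case: y => a b /=; rewrite add0r sqrrN.
    by apply/seteqP; split => x; rewrite /= E // => -[].
  rewrite setTI; apply: measurable_ltr_set => //.
  apply: measurable_funD => //; apply: measurable_funX.
  exact: measurable_funB.
exists (fun i => if unpickle i is Some q then (ratr q)%:C else 0) => x e e0.
have [q] := rat_in_itvoo (ltr_pwDr e0 (lexx (f x))).
rewrite in_itv /= => /andP[h1 h2]; exists (pickle q); rewrite pickleK.
rewrite nX_scalar -rmorphB nm_real ltr_norml; lra.
Qed.

Lemma SM_asbool (A : set T) (X : normedModType R[i]^o) (y : X) : measurable A ->
  SM (fun x => if `[< A x >] then y else 0).
Proof. by move=> mA; apply: SM_if => //; exact: SM_cst. Qed.

Lemma SM_sum (I : eqType) (r : seq I) (X : normedModType R[i]^o) (g : I -> T -> X) :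
  (forall i, i \in r -> SM (g i)) -> SM (fun x => \sum_(i <- r) g i x).
Proof.
elim: r => [|i r IH] h.
  by rewrite (_ : (fun=> _) = fun=> 0) ?boolp.funeqE => [|x]; [exact: SM_cst | rewrite big_nil].
rewrite (_ : (fun _ => _) = fun x => g i x + \sum_(i <- r) g i x).
  apply: SM_D; first by apply: h; rewrite mem_head.
  by apply: IH => j jr; apply: h; rewrite inE jr orbT.
by apply/funext => x; rewrite big_cons.
Qed.
Lemma SM_sf (X : normedModType R[i]^o) (s : seq (set T * X)) :
  (forall p, p \in s -> measurable p.1) -> SM (sf s).
Proof. by move=> hs; apply: SM_sum => p /hs; exact: SM_asbool. Qed.
End StronglyMeasurable.

Lemma SM_comp d1 d2 (T1 : measurableType d1) (T2 : measurableType d2) (R : realType)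
  (X : normedModType R[i]^o) (g : T2 -> X) (phi : T1 -> T2) :
  SM g -> measurable_fun setT phi -> SM (fun x => g (phi x)).
Proof.
move=> [mg [c hc]] mphi; split=> [y e|]; last by exists c => x; exact: hc.
by have := mphi measurableT _ (mg y e); rewrite setTI.
Qed.

(** * Existence of the integral of a strongly measurable function *)

Section BochnerExistence.
Context d (T : measurableType d) (R : realType) (mu : {measure set T -> \bar R}).

Section Approx.
Variables (X : normedModType R[i]^o) (g : T -> X) (c : nat -> X).
Let A (s : seq (set T * X)) (n : nat) := [set x | nX (g x - c n) < nX (g x - sf s x)].
(** Greedy approximation starting from 0: at stage [m] the value becomes [c m] exactly where that is
    strictly closer to [g]. The error is therefore nonincreasing and never exceeds the norm of
    [g]. *)
Fixpoint nearest n : seq (set T * X) := if n is m.+1 then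
  (A (nearest m) m, c m) :: [seq (p.1 `\` A (nearest m) m, p.2) | p <- nearest m]
  else [::].
Lemma sf_nearestS n x : sf (nearest n.+1) x =
  if `[< A (nearest n) n x >] then c n else sf (nearest n) x.
Proof.
rewrite /sf /= big_cons big_map /=; case: asboolP => h.
  by rewrite big1 ?addr0 // => p _; rewrite asboolF // => -[_ /(_ h)].
rewrite add0r; apply: eq_bigr => p _; congr (if _ then _ else _).
by apply/asboolP/asboolP => [[]|] //; split.
Qed.
Lemma nearest_le n x : nX (g x - sf (nearest n.+1) x) <= nX (g x - sf (nearest n) x).
Proof. by rewrite sf_nearestS; case: asboolP => // /ltW. Qed.
Lemma nearest_leq n m x : (n <= m)%N ->
  nX (g x - sf (nearest m) x) <= nX (g x - sf (nearest n) x).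
Proof.
move=> /subnK <-; elim: (m - n)%N => // k IH.
by apply: le_trans IH; exact: nearest_le.
Qed.
Lemma nearest_le_norm n x : nX (g x - sf (nearest n) x) <= nX (g x).
Proof.
by apply: le_trans (nearest_leq x (leq0n n)) _; rewrite /sf big_nil subr0.
Qed.
Lemma nearest_lt n m x : (n < m)%N -> nX (g x - sf (nearest m) x) <= nX (g x - c n).
Proof.
move=> /(nearest_leq x) /le_trans; apply; rewrite sf_nearestS.
by case: asboolP => //; rewrite /A /= => /negP; rewrite -leNgt.
Qed.

Hypothesis SMg : SM g.
Lemma nearest_measurable n p : p \in nearest n -> measurable p.1.
Proof.
elim: n p => // n IH p; rewrite inE.
have mA : measurable (A (nearest n) n).
  have h1 := SM_measurable_nX (c n) SMg.
  have h2 := SM_measurable_norm (SM_B SMg (SM_sf IH)).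
  exact: measurable_ltr_set.
by move=> /orP[/eqP->//|/mapP[q /IH mq ->]]; exact: measurableD.
Qed.
(** Where [c n] is chosen it beats an error of at most |g|, so |c n| < 2 |g| there and Chebyshev's
    inequality bounds the measure; when [c n] is 0 it is never strictly better. *)
Lemma nearest_fsimple n M : uint_le mu (fun x => nX (g x)) M -> fsimple mu (nearest n).
Proof.
move=> gM; have gM' := uint_le_int (SM_measurable_norm SMg) (fun x => nX_ge0 _) gM.
suff h p : p \in nearest n -> (mu p.1 < +oo)%E.
  by move=> p pn; split; [exact: nearest_measurable pn | exact: h].
elim: n p => // n IH p; rewrite inE => pn.
have mp : measurable p.1 by apply: (@nearest_measurable n.+1); rewrite inE.
case/orP: pn => [/eqP pE|/mapP[q qn pE]]; last first.
  apply: le_lt_trans (IH _ qn); rewrite le_measure ?inE //.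
    exact: nearest_measurable qn.
  by rewrite pE; exact: subDsetl.
have pA x : p.1 x -> nX (c n) / 2 < nX (g x).
  rewrite pE /A /= => h; have := nearest_le_norm n x.
  have := nX_tri (g x) (c n) 0; rewrite !subr0 (nXB (c n)); lra.
have [c0|c0] := eqVneq (c n) 0.
  rewrite (_ : p.1 = set0) ?measure0 //; apply/seteqP; split => // x.
  rewrite pE /A /= c0 subr0; have := nearest_le_norm n x; lra.
have c20 : 0 < nX (c n) / 2 by rewrite divr_gt0 // nX_gt0.
have : ((nX (c n) / 2)%:E * mu p.1 <= M%:E)%E.
  rewrite -integral_cst //; apply: le_trans gM'.
  apply: le_trans (_ : \int[mu]_(x in p.1) (nX (g x))%:E <= _)%E.
    apply: ge0_le_integral => //.
    - by move=> x _ /=; rewrite lee_fin ltW.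
    - by apply/measurable_EFinP/measurable_funTS; exact: SM_measurable_norm.
    - by move=> x /pA; rewrite lee_fin => /ltW.
  apply: ge0_subset_integral => //.
  - by apply/measurable_EFinP; exact: SM_measurable_norm.
  - by move=> x _; rewrite lee_fin nX_ge0.
rewrite muleC -lee_pdivlMr // -EFinM => /le_lt_trans; apply.
by rewrite ltry.
Qed.
End Approx.

(** Dominated convergence for the errors of [nearest], with the norm of [g] as dominating
    function. *)
Lemma simple_approx (X : normedModType R[i]^o) (g : T -> X) M (e : R) :
  SM g -> uint_le mu (fun x => nX (g x)) M -> 0 < e ->
  exists s, fsimple mu s /\ uint_le mu (fun x => nX (g x - sf s x)) e.
Proof.
move=> SMg gM e0; have gM' := uint_le_int (SM_measurable_norm SMg) (fun x => nX_ge0 _) gM.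
have [_ [c hc]] := SMg.
have fs n : fsimple mu (nearest g c n) := nearest_fsimple SMg gM.
pose f n x := nX (g x - sf (nearest g c n) x).
have mf n : measurable_fun setT (f n).
  apply: SM_measurable_norm; apply: SM_B => //; apply: SM_sf => p.
  by move=> /(fs n)[].
have [] := @dominated_convergence _ T R mu setT measurableT (fun n x => (f n x)%:E)
  (fun=> 0%E) (fun x => (nX (g x))%:E).
- by move=> n; exact/measurable_EFinP.
- exact: measurable_cst.
- apply: aeW => x _; apply: cvg_EFin; first by apply: nearW.
  apply/cvgrPdist_lt => eps eps0.
  have [n hn] := hc x _ eps0; exists n.+1 => // m /= nm.
  rewrite sub0r normrN ger0_norm ?nX_ge0 //; apply: le_lt_trans hn.
  exact: nearest_lt.
- apply/integrableP; split; first by apply/measurable_EFinP; exact: SM_measurable_norm.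
  under eq_integral do rewrite gee0_abs ?lee_fin ?nX_ge0 //.
  by apply: le_lt_trans gM' _; rewrite ltry.
- apply: aeW => x n _; rewrite gee0_abs ?lee_fin ?nX_ge0 //.
  exact: nearest_le_norm.
move=> _ _; rewrite integral0 => /fine_cvgP[hfin].
move=> /cvgrPdist_lt/(_ _ e0)[N2 _ hN2]; have [N1 _ hN1] := hfin.
pose n := maxn N1 N2; exists (nearest g c n); split; first exact: fs.
apply: uint_le_self; [exact: mf | by move=> x; exact: nX_ge0 |].
have := hN2 n (leq_maxr _ _); have := hN1 n (leq_maxl _ _) => /= hf.
rewrite sub0r normrN => /(le_lt_trans (ler_norm _))/ltW.
by rewrite -lee_fin fineK.
Qed.

Lemma bint_exists (X : completeNormedModType R[i]^o) (g : T -> X) M :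
  SM g -> uint_le mu (fun x => nX (g x)) M -> exists v, bint mu g v.
Proof.
move=> SMg gM; apply: bint_complete => e e0.
have [s [fs gs]] := simple_approx SMg gM e0.
by exists (sf s), (sint mu s); split => //; exact: bint_sf.
Qed.
End BochnerExistence.

(** * Integrals of a nonnegative function times a fixed vector *)

Section ScalarIntegrals.
Import HBNNSimple.
Context d (T : measurableType d) (R : realType) (mu : {measure set T -> \bar R}).

Lemma ae_aeT (P : T -> Prop) : {ae mu, forall x, P x} -> aeT mu P.
Proof.
move=> [A [mA A0 hA]]; exists A; split => // x nA.
by apply: contrapT => nP; apply: nA; exact: hA.
Qed.

Lemma aeT_fin_num (F : T -> \bar R) M : measurable_fun setT F ->
  (forall x, 0%R <= F x)%E -> (\int[mu]_x F x <= M%:E)%E ->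
  aeT mu (fun x => F x \is a fin_num).
Proof.
move=> mF F0 FM; apply: ae_aeT.
have iF : mu.-integrable setT F.
  apply/integrableP; split => //.
  under eq_integral do rewrite gee0_abs //.
  by apply: le_lt_trans FM _; rewrite ltry.
have := integrable_ae measurableT iF.
by apply: filterS => x; apply.
Qed.

Lemma fine_integral (F : T -> \bar R) M : measurable_fun setT F ->
  (forall x, 0%R <= F x)%E -> (\int[mu]_x F x <= M%:E)%E ->
  (\int[mu]_x (fine (F x))%:E)%E = (\int[mu]_x F x)%E.
Proof.
move=> mF F0 FM; apply: ae_eq_integral => //.
- by apply/measurable_EFinP; exact: measurableT_comp.
- apply: aeT_ae; apply: aeT_imp (aeT_fin_num mF F0 FM) => x /fineK h _.
  by rewrite h.
Qed.

(** The bridge from extended real integrals to [bint]: a nonnegative simple function below [c], with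
    integral within [e'] of that of [c], provides the approximating list. *)
Lemma bint_real (X : normedModType R[i]^o) (c : T -> R) (y : X) M :
  measurable_fun setT c -> (forall x, 0 <= c x) -> (\int[mu]_x (c x)%:E <= M%:E)%E ->
  bint mu (fun x => ((c x)%:C : R[i]^o) *: y)
    (((fine (\int[mu]_x (c x)%:E))%:C : R[i]^o) *: y).
Proof.
move=> mc c0 cM e e0.
have c0' x : (0%R <= (c x)%:E)%E by rewrite lee_fin.
have cfin : (\int[mu]_x (c x)%:E)%E \is a fin_num.
  rewrite ge0_fin_numE; last by apply: integral_ge0 => x _.
  by apply: le_lt_trans cM _; rewrite ltry.
have y1 : 0 < nX y + 1 by rewrite ltr_pwDr ?nX_ge0.
pose e' := e / (nX y + 1); have e'0 : 0 < e' by rewrite divr_gt0.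
have ee : e' * nX y <= e.
  by rewrite /e' mulrAC ler_pdivrMr // ler_pM2l // lerDl.
have [_ [h hc <-]] : exists2 u, [set sintegral mu h | h in
    [set h : {nnsfun T >-> R} | forall x, ((h x)%:E <= (c x)%:E)%E]] u &
    (\int[mu]_x (c x)%:E - e'%:E < u)%E.
  have := cfin; rewrite (ge0_integralTE mu c0') => /(ub_ereal_sup_adherent e'0)[u hu uu].
  by exists u.
rewrite -integralT_nnsfun => hh.
have hc' x : h x <= c x by rewrite -lee_fin.
have h0 x : 0 <= h x by [].
have mh : measurable_fun setT (EFin \o h) by apply/measurable_EFinP.
have hint : (\int[mu]_x (h x)%:E <= \int[mu]_x (c x)%:E)%E.
  apply: ge0_le_integral => //; last exact/measurable_EFinP.
  by move=> x _; rewrite lee_fin.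
have hfin : (\int[mu]_x (h x)%:E)%E \is a fin_num.
  rewrite ge0_fin_numE; last by apply: integral_ge0 => x _; rewrite lee_fin.
  by apply: le_lt_trans hint _; rewrite -ge0_fin_numE // integral_ge0.
have mpre r : measurable (h @^-1` [set r]) by exact: measurable_sfunP.
have prefin r : 0 < r -> (mu (h @^-1` [set r]) < +oo)%E.
  move=> r0; have : (r%:E * mu (h @^-1` [set r]) <= M%:E)%E.
    rewrite -integral_cst //; apply: le_trans cM.
    apply: le_trans (_ : \int[mu]_(x in h @^-1` [set r]) (c x)%:E <= _)%E.
      apply: ge0_le_integral => //.
      - by move=> x _ /=; rewrite lee_fin ltW.
      - by apply/measurable_EFinP/measurable_funTS.
      - by move=> x /= <-; rewrite lee_fin.
    by apply: ge0_subset_integral => //; exact/measurable_EFinP.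
  rewrite muleC -lee_pdivlMr // -EFinM => /le_lt_trans; apply.
  by rewrite ltry.
have /finite_seqP[S0 S0E] : finite_set (range h) by exact: fimfunP.
(* The value 0 is dropped because its level set may have infinite measure. *)
pose S := [seq r <- undup S0 | r != 0].
have memS r : (r \in S) = (r != 0) && (r \in range h).
  rewrite mem_filter mem_undup; congr (_ && _); apply/idP/idP; rewrite inE S0E //.
have uS : uniq S by rewrite filter_uniq // undup_uniq.
have Spos r : r \in S -> 0 < r.
  by rewrite memS => /andP[r0]; rewrite inE => -[x _ rE]; rewrite lt0r r0 -rE h0.
have sint_h : fine (\int[mu]_x (h x)%:E) = \sum_(r <- S) r * fine (mu (h @^-1` [set r])).
  rewrite integralT_nnsfun sintegralE S0E.
  rewrite (_ : [set` S0] = [set` undup S0]); last first.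
    by apply/seteqP; split => r /=; rewrite mem_undup.
  rewrite -fsbig_seq ?undup_uniq //= /S big_filter.
  rewrite (bigID (fun r => r != 0)) /= [X in (_ + X)%E]big1 => [|r /negPn/eqP ->]; last by rewrite mul0e.
  rewrite adde0 -(@big_filter _ _ _ _ _ (fun r => r != 0)) -/S.
  rewrite (eq_big_seq (fun r => (r * fine (mu (h @^-1` [set r])))%:E)).
    by rewrite sumEFin /= /S big_filter.
  by move=> r /Spos/prefin rf; rewrite EFinM fineK // ge0_fin_numE.
exists [seq (h @^-1` [set r], (r%:C : R[i]^o) *: y) | r <- S]; split.
- by move=> p /mapP[r /Spos/prefin rf ->]; split; [exact: mpre | exact: rf].
- apply: uint_le_le ee _; rewrite mulrC.
  have sfE x : sf [seq (h @^-1` [set r], (r%:C : R[i]^o) *: y) | r <- S] x =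
      ((h x)%:C : R[i]^o) *: y.
    rewrite /sf big_map /=; have [hx0|hx0] := eqVneq (h x) 0.
      rewrite hx0 scale0r big_seq big1 // => r /Spos r0.
      by rewrite asboolF //= => hr; move: r0; rewrite -hr ltxx.
    rewrite (bigD1_seq (h x)) //=; last by rewrite memS hx0 inE; exists x.
    rewrite asboolT // big1 ?addr0 // => r rh; rewrite asboolF //= => hr.
    by rewrite hr eqxx in rh.
  apply: uint_le_mono (uint_leZ (a := e') (nX_ge0 y) _); last first.
    apply: (@uint_le_self _ _ _ _ (fun x => c x - h x)).
    + by apply: measurable_funB => //; apply/measurable_EFinP.
    + by move=> x; rewrite subr_ge0.
    + have : (\int[mu]_x (c x)%:E = \int[mu]_x (h x)%:E + \int[mu]_x (c x - h x)%:E)%E.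
        rewrite -ge0_integralD //.
        * by apply: eq_integral => x _; rewrite -EFinD addrC subrK.
        * by move=> x _; rewrite lee_fin.
        * by move=> x _; rewrite lee_fin subr_ge0.
        * apply/measurable_EFinP; apply: measurable_funB => //.
      move=> ceq; have Dfin : (\int[mu]_x (c x - h x)%:E)%E \is a fin_num.
        by move: cfin; rewrite ceq fin_numD hfin.
      rewrite -(fineK Dfin) lee_fin; move: hh.
      by rewrite ceq -(fineK hfin) -(fineK Dfin) -!EFinD lte_fin; lra.
  move=> x; rewrite sfE -scalerBl -rmorphB nXZ nm_real mulrC.
  by rewrite ger0_norm // subr_ge0.
- rewrite /sint big_map /=.
  under eq_bigr do rewrite scalerA -rmorphM mulrC.
  rewrite -scaler_suml -rmorph_sum -sint_h -scalerBl -rmorphB nXZ nm_real.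
  apply: le_trans ee; rewrite ler_wpM2r ?nX_ge0 // distrC ger0_norm; last first.
    by rewrite subr_ge0 fine_le.
  rewrite lerBlDr -lee_fin EFinD !fineK // ltW // addeC.
  by rewrite -lteBlDr.
Qed.
End ScalarIntegrals.

(** * Fubini's theorem for the Bochner integral *)

Section Fubini.
Context d1 d2 d3 (T1 : measurableType d1) (T2 : measurableType d2)
  (P : measurableType d3) (R : realType) (m1 : {measure set T1 -> \bar R})
  (m2 : {measure set T2 -> \bar R}) (m : {measure set P -> \bar R})
  (pr : T1 -> T2 -> P).
Hypothesis mpr : forall x, measurable_fun setT (pr x).
Hypothesis fib : forall f : P -> \bar R, measurable_fun setT f ->
  (forall p, 0%R <= f p)%E ->
  measurable_fun setT (fun x => \int[m2]_y f (pr x y))%E /\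
  (\int[m]_p f p = \int[m1]_x \int[m2]_y f (pr x y))%E.

Lemma uint_le_fiber (h : P -> R) M (I : T1 -> R) : measurable_fun setT h ->
  (forall p, 0 <= h p) -> (\int[m]_p (h p)%:E <= M%:E)%E ->
  aeT m1 (fun x => ((I x)%:E <= \int[m2]_y (h (pr x y))%:E)%E) -> uint_le m1 I M.
Proof.
move=> mh h0 hM hI.
have [mf fE] := @fib (EFin \o h) (proj2 (measurable_EFinP _ _) mh) (fun p => h0 p).
have F0 x : (0%R <= \int[m2]_y (EFin \o h) (pr x y))%E.
  by apply: integral_ge0 => y _; rewrite /= lee_fin.
rewrite fE in hM.
exists (fun x => fine (\int[m2]_y (EFin \o h) (pr x y))%E); split.
- exact: measurableT_comp.
- by move=> x; rewrite fine_ge0.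
- apply: aeT_imp (aeT_and hI (aeT_fin_num mf F0 hM)) => x [h1 h2].
  by rewrite -lee_fin fineK.
- by rewrite (fine_integral mf F0 hM).
Qed.

(** With [pr] abstract, one argument serves both orders of integration. The sections of a simple
    approximant integrate to measures times vectors; at almost every [x] the value [I x] differs
    from this by at most the fibre integral of the error, which Tonelli makes small in the mean. *)
Lemma bint_fiber (X : normedModType R[i]^o) (h : P -> X) M v (I : T1 -> X) :
  SM h -> uint_le m (fun p => nX (h p)) M -> bint m h v ->
  aeT m1 (fun x => bint m2 (fun y => h (pr x y)) (I x)) -> bint m1 I v.
Proof.
move=> hSM hM hv hI; apply: bint_closed => e e0.
have [s [fs hs]] := simple_approx hSM hM e0.
pose sec (A : set P) x := [set y | A (pr x y)].
have msec A x : measurable A -> measurable (sec A x).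
  by move=> mA; have := mpr x measurableT mA; rewrite setTI.
have indE A x : measurable A ->
    (\int[m2]_y (\1_A (pr x y))%:E = m2 (sec A x))%E.
  move=> mA; rewrite -[in RHS](setIT (sec A x)) -(integral_indic m2 measurableT (msec A x mA)).
  by apply: eq_integral => y _; rewrite /indic; congr (_%:R%:E); apply/idP/idP => /[!inE].
have indP A : measurable A -> measurable_fun setT (fun x => m2 (sec A x)) /\
    (m A = \int[m1]_x m2 (sec A x))%E.
  move=> mA.
  have [||h1 h2] := @fib (fun p => (\1_A p)%:E).
  - by apply/measurable_EFinP; exact: measurable_indic.
  - by move=> p; rewrite lee_fin.
  split; first by congr (measurable_fun _ _): h1; apply/funext => x; rewrite indE.
  rewrite -[in LHS](setIT A) -(integral_indic m measurableT mA) h2.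
  by apply: eq_integral => x _; rewrite indE.
exists (fun x => \sum_(p <- s) ((fine (m2 (sec p.1 x)))%:C : R[i]^o) *: p.2), (sint m s).
have fin_sec p : p \in s -> aeT m1 (fun x => m2 (sec p.1 x) \is a fin_num).
  move=> /fs[mp pf]; have [mi miE] := indP _ mp.
  apply: (@aeT_fin_num _ _ _ _ _ (fine (m p.1))) => //.
  by rewrite fineK ?miE // -miE ge0_fin_numE.
split.
- have hp p : p \in s -> bint m1 (fun x => ((fine (m2 (sec p.1 x)))%:C : R[i]^o) *: p.2)
      (((fine (m p.1))%:C : R[i]^o) *: p.2).
    move=> ps; have [mp pf] := fs p ps; have [mi miE] := indP _ mp.
    have le : (\int[m1]_x m2 (sec p.1 x) <= (fine (m p.1))%:E)%E.
      by rewrite fineK ?miE // -miE ge0_fin_numE.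
    rewrite miE -(fine_integral mi _ le) //.
    apply: (@bint_real _ _ _ _ _ _ _ (fine (m p.1))).
    + exact: measurableT_comp.
    + by move=> x; rewrite fine_ge0.
    + by rewrite (fine_integral mi _ le).
  rewrite /sint; elim: s {fs hs fin_sec} hp => [|p s IH] hp.
    by rewrite big_nil; apply: bint_ext (bint0 _ _) => x; rewrite big_nil.
  rewrite big_cons; apply: bint_ext (bintD (hp _ (mem_head _ _)) (IH _)).
    by move=> x; rewrite big_cons.
  by move=> q qs; apply: hp; rewrite inE qs orbT.
- have mD : measurable_fun setT (fun p => nX (h p - sf s p)).
    by apply: SM_measurable_norm; apply: SM_B => //; apply: SM_sf => p /fs[].
  apply: (uint_le_fiber mD) => //; first by move=> p; exact: nX_ge0.
    by apply: uint_le_int hs => // p; exact: nX_ge0.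
  have allfin : aeT m1 (fun x => forall p, p \in s -> m2 (sec p.1 x) \is a fin_num).
    elim: s fin_sec {fs hs mD} => [|p s IH] hp; first exact: aeT_all.
    have hq q : q \in s -> aeT m1 (fun x => m2 (sec q.1 x) \is a fin_num).
      by move=> qs; apply: hp; rewrite inE qs orbT.
    apply: aeT_imp (aeT_and (hp _ (mem_head _ _)) (IH hq)) => x [h1 h2] q.
    by rewrite inE => /orP[/eqP->|/h2].
  apply: aeT_imp (aeT_and hI allfin) => x [hx fx].
  (* An infinite fibre integral bounds everything; otherwise it can be read as a real number. *)
  have [->|] := eqVneq (\int[m2]_y (nX (h (pr x y) - sf s (pr x y)))%:E)%E +oo%E.
    by rewrite leey.
  move=> Dfin; have D0 : (0%R <= \int[m2]_y (nX (h (pr x y) - sf s (pr x y)))%:E)%E.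
    by apply: integral_ge0 => y _; rewrite lee_fin nX_ge0.
  have DE : (\int[m2]_y (nX (h (pr x y) - sf s (pr x y)))%:E)%E \is a fin_num.
    by rewrite ge0_fin_numE // ltey.
  rewrite -(fineK DE) lee_fin.
  pose sx := [seq (sec p.1 x, p.2) | p <- s].
  have fsx : fsimple m2 sx.
    move=> q /mapP[p ps ->] /=; split; first by apply: msec; have [] := fs p ps.
    by rewrite -ge0_fin_numE // fx.
  have -> : \sum_(p <- s) ((fine (m2 (sec p.1 x)))%:C : R[i]^o) *: p.2 = sint m2 sx.
    by rewrite /sint big_map.
  apply: bint_dist hx (bint_sf fsx) _.
  have sfx y : sf sx y = sf s (pr x y) by rewrite /sf big_map.
  exists (fun y => nX (h (pr x y) - sf s (pr x y))); split.
  + exact: (measurableT_comp mD).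
  + by move=> y; exact: nX_ge0.
  + by apply: aeT_all => y; rewrite sfx.
  + by rewrite fineK.
- apply: bint_dist (bint_sf fs) hv _; apply: uint_le_mono hs => p.
  by rewrite nXB.
Qed.
End Fubini.

Lemma bint_fubini d1 d2 (T1 : measurableType d1) (T2 : measurableType d2)
  (R : realType) (m1 : {sigma_finite_measure set T1 -> \bar R})
  (m2 : {sigma_finite_measure set T2 -> \bar R})
  (X : completeNormedModType R[i]^o) (h : T1 * T2 -> X) M
  (I : T1 -> X) (J : T2 -> X) : SM h ->
  (\int[m1]_x \int[m2]_y (nX (h (x, y)))%:E <= M%:E)%E ->
  aeT m1 (fun x => bint m2 (fun y => h (x, y)) (I x)) ->
  aeT m2 (fun y => bint m1 (fun x => h (x, y)) (J y)) ->
  exists v, bint m1 I v /\ bint m2 J v.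
Proof.
move=> hSM hM hI hJ.
pose m := (m1 \x m2)%E.
have mh := SM_measurable_norm hSM.
have hM' : uint_le m (fun p => nX (h p)) M.
  apply: uint_le_self => //; first by move=> p; exact: nX_ge0.
  rewrite fubini_tonelli1 //; first exact/measurable_EFinP.
  by move=> p; rewrite lee_fin nX_ge0.
have [v hv] := bint_exists hSM hM'; exists v; split.
- apply: (@bint_fiber _ _ _ T1 T2 _ R m1 m2 m pair) hSM hM' hv hI.
  + by move=> x; exact: pair1_measurable.
  + move=> f mf f0; split; first exact: measurable_fun_fubini_tonelli_F.
    by rewrite fubini_tonelli1.
- apply: (@bint_fiber _ _ _ T2 T1 _ R m2 m1 m (fun y x => (x, y))) hSM hM' hv hJ.
  + by move=> y; exact: pair2_measurable.
  + move=> f mf f0; split; first exact: measurable_fun_fubini_tonelli_G.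
    by rewrite fubini_tonelli2.
Qed.

(** * Change of variables and scaling of Lebesgue measure *)

Section ChangeOfVariables.
Context d (T : measurableType d) (R : realType) (mu : {measure set T -> \bar R}).
Variables (phi : T -> T) (k : R).
Hypotheses (mphi : measurable_fun setT phi) (k0 : 0 <= k).
Hypothesis mu_phi : forall A, measurable A -> (mu (phi @^-1` A) = k%:E * mu A)%E.

Lemma integral_phi (h : T -> \bar R) : measurable_fun setT h ->
  (forall x, 0%R <= h x)%E -> (\int[mu]_x h (phi x) = k%:E * \int[mu]_x h x)%E.
Proof.
move=> mh h0.
have h1 := ge0_integral_pushforward mphi mu measurableT mh (fun x _ => h0 x).
rewrite preimage_setT in h1; rewrite -[LHS]h1.
apply: etrans (eq_measure_integral (mscale (NngNum k0) mu) _) _.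
  by move=> A mA _; rewrite [LHS]mu_phi.
by rewrite ge0_integral_mscale // => x _; exact: h0.
Qed.

Lemma uint_le_phi (h : T -> R) e : uint_le mu h e -> uint_le mu (fun x => h (phi x)) (k * e).
Proof.
move=> [g [mg g0 [B [mB B0 hB]] ge]]; exists (fun x => g (phi x)); split => //.
- exact: measurableT_comp.
- exists (phi @^-1` B); split.
  + by rewrite -[X in measurable X]setTI; exact: mphi.
  + by rewrite mu_phi // B0 mule0.
  + by move=> x; apply: hB.
- have -> : (\int[mu]_x (g (phi x))%:E = k%:E * \int[mu]_x (g x)%:E)%E.
    apply: (integral_phi (h := EFin \o g)) => //; exact/measurable_EFinP.
  by rewrite EFinM lee_wpmul2l // lee_fin.
Qed.

Lemma bint_phi (X : normedModType R[i]^o) (g : T -> X) v : bint mu g v ->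
  bint mu (fun x => g (phi x)) ((k%:C : R[i]^o) *: v).
Proof.
move=> hg e e0; pose e' := e / (k + 1).
have k1 : 0 < k + 1 by rewrite ltr_pwDr.
have e'0 : 0 < e' by rewrite divr_gt0.
have ee : k * e' <= e by rewrite /e' mulrA ler_pdivrMr // mulrC ler_pM2l // lerDl.
have [s [fs gs sv]] := hg _ e'0.
exists [seq (phi @^-1` p.1, p.2) | p <- s]; split.
- move=> q /mapP[p /fs[mp pf] ->] /=; split.
    by rewrite -[X in measurable X]setTI; exact: mphi.
  by rewrite mu_phi // lte_mul_pinfty // lee_fin.
- apply: uint_le_le ee _; apply: uint_le_mono (uint_le_phi gs) => x.
  by rewrite /sf big_map.
- rewrite /sint big_map (eq_big_seq (fun p => (k%:C : R[i]^o) *: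
      (((fine (mu p.1))%:C : R[i]^o) *: p.2))).
    rewrite -scaler_sumr -scalerBr nXZ nm_real ger0_norm //.
    by apply: le_trans ee; rewrite ler_wpM2l.
  move=> p /fs[mp pf] /=; rewrite mu_phi // scalerA -rmorphM fineM //.
  by rewrite ge0_fin_numE.
Qed.
End ChangeOfVariables.

Lemma mule_rescale (R : realType) (a c : R) (x y : \bar R) : a != 0 -> c != 0 ->
  (((a * c)^-1)%:E * ((a%:E * x) * (c%:E * y)) = x * y)%E.
Proof.
move=> a0 c0; have h : (((a * c)^-1)%:E * (a%:E * c%:E) = 1)%E.
  by rewrite -!EFinM mulVf // mulf_neq0.
transitivity ((((a * c)^-1)%:E * (a%:E * c%:E)) * (x * y))%E.
  by rewrite -[RHS]muleA; congr (_ * _)%E; exact: muleACA.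
by rewrite h mul1e.
Qed.

Section ProductScaling.
Context d1 d2 (T1 : measurableType d1) (T2 : measurableType d2) (R : realType).
Variables (m1 : {sigma_finite_measure set T1 -> \bar R})
  (m2 : {sigma_finite_measure set T2 -> \bar R}).
Lemma sigma_finite_product : sigma_finite setT (m1 \x m2)%E.
Proof.
have [F [UF mF]] := sigma_finiteT m1; have [G [UG mG]] := sigma_finiteT m2.
exists (fun n => if unpickle n is Some (i, j) then F i `*` G j else set0).
  apply/seteqP; split => // -[x y] _.
  have [i _ Fx] : (\bigcup_i F i) x by rewrite -UF.
  have [j _ Gy] : (\bigcup_i G i) y by rewrite -UG.
  by exists (pickle (i, j)) => //; rewrite pickleK.
move=> n; case: unpickle => [[i j]|]; last by rewrite measure0.
have [mFi Fi] := mF i; have [mGj Gj] := mG j; split; first exact: measurableX.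
by rewrite product_measure1E // lte_mul_pinfty // ge0_fin_numE.
Qed.
(* The canonical sigma-finite structure of a product in the library requires
   subprobabilities. *)
Definition prodsf : {sigma_finite_measure set (T1 * T2)%type -> \bar R} :=
  HB.pack (m1 \x m2)%E (Measure_isSigmaFinite.Build _ _ _ (m1 \x m2)%E sigma_finite_product).

Variables (f1 : T1 -> T1) (f2 : T2 -> T2) (k1 k2 : R).
Hypotheses (mf1 : measurable_fun setT f1) (mf2 : measurable_fun setT f2).
Hypotheses (k10 : 0 < k1) (k20 : 0 < k2).
Hypothesis m1f : forall A, measurable A -> (m1 (f1 @^-1` A) = k1%:E * m1 A)%E.
Hypothesis m2f : forall A, measurable A -> (m2 (f2 @^-1` A) = k2%:E * m2 A)%E.
Let f12 (p : T1 * T2) := (f1 p.1, f2 p.2).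

Lemma measurable_prod_map : measurable_fun setT f12.
Proof.
apply: measurable_fun_pair.
  exact: (measurableT_comp mf1 measurable_fst).
exact: (measurableT_comp mf2 measurable_snd).
Qed.

(** The rescaled pushforward agrees with the product measure on rectangles, which determine it. *)
Lemma prodsf_scale A : measurable A ->
  (prodsf (f12 @^-1` A) = (k1 * k2)%:E * prodsf A)%E.
Proof.
move=> mA.
have k120 : 0 <= (k1 * k2)^-1 by rewrite invr_ge0 mulr_ge0 // ltW.
have mf12 := measurable_prod_map.
pose m0 : {measure set (T1 * T2)%type -> \bar R} :=
  mscale (NngNum k120) (pushforward prodsf f12).
pose m' := m0 mf12.
have m'E B C : measurable B -> measurable C -> m' (B `*` C) = (m1 B * m2 C)%E.
  move=> mB mC.
  have -> : m' (B `*` C) =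
    (((k1 * k2)^-1)%:E * (m1 \x m2) ((f1 @^-1` B) `*` (f2 @^-1` C)))%E by [].
  rewrite product_measure1E //; last 2 first.
  - by rewrite -[X in measurable X]setTI; exact: mf1.
  - by rewrite -[X in measurable X]setTI; exact: mf2.
  transitivity (((k1 * k2)^-1)%:E * ((k1%:E * m1 B) * (k2%:E * m2 C)))%E.
    by rewrite -(m1f mB) -(m2f mC).
  by apply: mule_rescale; rewrite gt_eqF.
have h : (m1 \x m2)%E A = (((k1 * k2)^-1)%:E * prodsf (f12 @^-1` A))%E :=
  product_measure_unique m'E mA.
rewrite [in RHS]/prodsf /= h muleA -EFinM mulfV ?mul1e //.
by rewrite gt_eqF // mulr_gt0.
Qed.
End ProductScaling.

Section Lebesgue2.
Variable R : realType.
Definition lam1 : {sigma_finite_measure set (measurableTypeR R) -> \bar R} := @lebesgue_measure R.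
Definition lam2 := prodsf lam1 lam1.
(** The same uniqueness argument in dimension one, tested on half-open intervals. *)
Lemma lam1_affine (c t : R) (A : set (measurableTypeR R)) : 0 < c -> measurable A ->
  (lam1 ((fun x : measurableTypeR R => (c * (x : R) + t)%R : measurableTypeR R) @^-1` A) = c^-1%:E * lam1 A)%E.
Proof.
move=> c0 mA; have c0' : 0 <= c by rewrite ltW.
have mf : measurable_fun setT (fun x : measurableTypeR R => (c * (x : R) + t)%R : measurableTypeR R).
  by apply: measurable_funD => //; apply: measurable_funM.
pose m0 : {measure set (measurableTypeR R) -> \bar R} :=
  mscale (NngNum c0') (pushforward lam1 (fun x : measurableTypeR R => (c * (x : R) + t)%R : measurableTypeR R)).
pose m' := m0 mf.
have m'E X : ocitv X -> lebesgue_measure X = m' X.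
  move=> [[a e] _ <-].
  rewrite /=; have -> : m' `]a, e]%classic =
      (c%:E * lebesgue_measure `]((a - t) / c)%R, ((e - t) / c)%R]%classic)%E.
    congr (_ * lebesgue_measure _)%E.
    apply/seteqP; split => x /=; rewrite !in_itv /= ltr_pdivrMr // ler_pdivlMr //;
      by rewrite ltrBlDr lerBrDr mulrC.
  rewrite /lam1 !lebesgue_measure_itv /= !lte_fin ltr_pM2r ?invr_gt0 // ltrD2r.
  case: ifP => _; last by rewrite mule0.
  rewrite -!EFinD -EFinM; congr (_%:E).
  by field; rewrite gt_eqF.
have h : lam1 A = (c%:E * lam1 ((fun x : measurableTypeR R =>
  (c * (x : R) + t)%R : measurableTypeR R) @^-1` A))%E := lebesgue_measure_unique m'E mA.
rewrite h muleA -EFinM mulVf ?mul1e //.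
by rewrite gt_eqF.
Qed.

Lemma lam2_affine (c t1 t2 : R) A : 0 < c -> measurable A ->
  (lam2 ((fun p : measurableTypeR R * measurableTypeR R => ((c * (p.1 : R) + t1)%R : measurableTypeR R, (c * (p.2 : R) + t2)%R : measurableTypeR R)) @^-1` A) = (c^-1 * c^-1)%:E * lam2 A)%E.
Proof.
move=> c0 mA; apply: (prodsf_scale (f1 := fun x : measurableTypeR R => (c * (x : R) + t1)%R : measurableTypeR R)
  (f2 := fun x : measurableTypeR R => (c * (x : R) + t2)%R : measurableTypeR R)) => //.
- by apply: measurable_funD => //; apply: measurable_funM.
- by apply: measurable_funD => //; apply: measurable_funM.
- by rewrite invr_gt0.
- by rewrite invr_gt0.
- by move=> B mB; exact: lam1_affine.
- by move=> B mB; exact: lam1_affine.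
Qed.
End Lebesgue2.

(** Countable additivity in the form used for dyadic layers and for cells: at each point some finite
    partial sum dominates, with a length depending on the point, while the integrals are summed over
    all layers. *)
Lemma uint_le_series d (T : measurableType d) (R : realType)
  (mu : {measure set T -> \bar R}) (phi : T -> R) (psi : nat -> T -> R)
  (c : nat -> R) M :
  (forall k, measurable_fun setT (psi k)) -> (forall k x, 0 <= psi k x) ->
  (forall k, (\int[mu]_x (psi k x)%:E <= (c k)%:E)%E) ->
  (forall n, \sum_(k < n) c k <= M) ->
  aeT mu (fun x => exists n, phi x <= \sum_(k < n) psi k x) ->
  uint_le mu phi M.
Proof.
move=> mpsi psi0 cpsi cM hphi.
pose F x := (\sum_(0 <= k <oo) (psi k x)%:E)%E.
have F0 x : (0%R <= F x)%E by apply: nneseries_ge0 => n _ _; rewrite lee_fin.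
have mF : measurable_fun setT F.
  apply: ge0_emeasurable_sum => [k x _ _|k _]; first by rewrite lee_fin.
  exact/measurable_EFinP.
have FM : (\int[mu]_x F x <= M%:E)%E.
  rewrite integral_nneseries //; last 2 first.
  - by move=> n; exact/measurable_EFinP.
  - by move=> n x _; rewrite lee_fin.
  apply: lime_le; first by apply: is_cvg_nneseries => n _ _; apply: integral_ge0 => x _; rewrite lee_fin.
  apply: nearW => n; apply: (@le_trans _ _ (\sum_(k < n) c k)%:E); last by rewrite lee_fin.
  by rewrite -sumEFin big_mkord; apply: lee_sum => k _.
exists (fun x => fine (F x)); split.
- exact: measurableT_comp.
- by move=> x; rewrite fine_ge0.
- apply: aeT_imp (aeT_and hphi (aeT_fin_num mF F0 FM)) => x [[n hn] Ff].
  rewrite -lee_fin fineK //; apply: (@le_trans _ _ (\sum_(k < n) psi k x)%:E).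
    by rewrite lee_fin.
  rewrite -sumEFin -(big_mkord xpredT (fun k => (psi k x)%:E)).
  by apply: nneseries_lim_ge => k _ _; rewrite lee_fin.
- by rewrite (fine_integral mF F0 FM).
Qed.

(** * Squares and the Cauchy kernel in the plane *)

Section Plane.
Variable R : realType.
Local Notation C := R[i].
Local Notation T2 := (measurableTypeR R * measurableTypeR R)%type.
Definition cx (p : T2) : C := (p.1 : R) +i* (p.2 : R).
Implicit Types (z w : C) (phi psi : C -> R).

Definition cule phi M := uint_le (lam2 R) (fun p => phi (cx p)) M.
Definition cae (P : C -> Prop) := aeT (lam2 R) (fun p => P (cx p)).
(** Squares stand in for discs because the product measure gives their area exactly; [snorm_le_nm]
    turns a bound on the modulus into membership. *)
Definition box (c : C) (r : R) z : bool :=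
  (`|complex.Re (z - c)| <= r) && (`|complex.Im (z - c)| <= r).

Lemma cule_mono phi psi M : (forall z, phi z <= psi z) -> cule psi M -> cule phi M.
Proof. by move=> h; apply: uint_le_mono. Qed.
Lemma cule_le phi a c : a <= c -> cule phi a -> cule phi c.
Proof. exact: uint_le_le. Qed.
Lemma culeD phi psi a c : cule phi a -> cule psi c -> cule (fun z => phi z + psi z) (a + c).
Proof. exact: uint_leD. Qed.
Lemma culeZ phi a c : 0 <= c -> cule phi a -> cule (fun z => c * phi z) (c * a).
Proof. exact: uint_leZ. Qed.

Lemma measurable_Re_cx : measurable_fun setT (fun p : T2 => complex.Re (cx p)).
Proof. exact: measurable_fst. Qed.
Lemma measurable_Im_cx : measurable_fun setT (fun p : T2 => complex.Im (cx p)).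
Proof. exact: measurable_snd. Qed.

Lemma boxE c r : [set p : T2 | box c r (cx p)] =
  `[complex.Re c - r, complex.Re c + r]%classic `*` `[complex.Im c - r, complex.Im c + r]%classic.
Proof.
by apply/seteqP; split => -[x y]; case: c => a e; rewrite /box /= !in_itv /= !ler_distl => /andP.
Qed.
Lemma measurable_box c r : measurable [set p : T2 | box c r (cx p)].
Proof. by rewrite boxE; apply: measurableX; exact: measurable_itv. Qed.
Lemma lam2_box c r : 0 <= r -> (lam2 R [set p : T2 | box c r (cx p)] = (4 * r ^+ 2)%:E)%E.
Proof.
move=> r0; rewrite boxE.
have h x : lebesgue_measure `[x - r, x + r]%classic = (2 * r)%:E :> \bar R.
  rewrite lebesgue_measure_itv /= lte_fin ltrBlDr -addrA ltrDl.
  case: ltP => hr; first by rewrite -EFinD; congr (_%:E); ring.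
  by congr (_%:E); lra.
transitivity (lebesgue_measure `[(complex.Re c - r)%R, (complex.Re c + r)%R]%classic *
    lebesgue_measure `[(complex.Im c - r)%R, (complex.Im c + r)%R]%classic)%E.
  by apply: product_measure1E; exact: measurable_itv.
by rewrite !h -EFinM; congr (_%:E); ring.
Qed.
Lemma indic_box c r p : \1_[set p : T2 | box c r (cx p)] p = (box c r (cx p))%:R :> R.
Proof.
rewrite indicE; have [h|h] := boolP (box c r (cx p)); first by rewrite mem_set.
by rewrite memNset //=; exact/negP.
Qed.
Lemma int_box c r : 0 <= r ->
  (\int[lam2 R]_p ((box c r (cx p))%:R : R)%:E = (4 * r ^+ 2)%:E)%E.
Proof.
move=> r0; rewrite -(lam2_box c r0) -[in RHS](setIT (mkset _)).
rewrite -(integral_indic _ measurableT (measurable_box c r)).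
by apply: eq_integral => p _; rewrite indic_box.
Qed.
Lemma measurable_fun_box c r : measurable_fun setT (fun p : T2 => (box c r (cx p))%:R : R).
Proof.
rewrite (_ : (fun _ => _) = \1_[set p : T2 | box c r (cx p)]).
  by apply: measurable_indic; exact: measurable_box.
by apply/funext => p; rewrite indic_box.
Qed.
Lemma cule_box c r : 0 <= r -> cule (fun z => (box c r z)%:R) (4 * r ^+ 2).
Proof.
move=> r0; apply: uint_le_self; [exact: measurable_fun_box|by move=> p; rewrite ler0n|].
by rewrite (int_box c r0).
Qed.

Definition snorm z := Num.max `|complex.Re z| `|complex.Im z|.
Lemma box_snorm c r z : box c r z = (snorm (z - c) <= r).
Proof. by rewrite /snorm ge_max. Qed.
Lemma snorm_le_nm z : snorm z <= nm z.
Proof. by rewrite ge_max Re_le_nm Im_le_nm. Qed.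
Lemma snorm_ge0 z : 0 <= snorm z.
Proof. by rewrite le_max normr_ge0. Qed.
Lemma snorm_gt0 z : z != 0 -> 0 < snorm z.
Proof.
rewrite lt_max !normr_gt0; case: z => x y /=; rewrite -negb_and.
by apply: contra => /andP[/eqP-> /eqP->].
Qed.

Lemma cae_neq z : cae (fun w => w != z).
Proof.
exists [set p : T2 | cx p = z]; split.
- rewrite (_ : mkset _ = [set (complex.Re z : measurableTypeR R)] `*` [set (complex.Im z : measurableTypeR R)]).
    by apply: measurableX; exact: measurable_set1.
  by apply/seteqP; split => -[x y] /=; case: z => a e; [case=> -> ->|move=> /= [-> ->]].
- apply/eqP; rewrite eq_le measure_ge0 andbT.
  have h r : 0 <= r -> (lam2 R [set p : T2 | cx p = z] <= (4 * r ^+ 2)%:E)%E.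
    move=> r0; rewrite -(lam2_box z r0) le_measure ?inE //; last first.
    + move=> p /= ->; rewrite box_snorm subrr /snorm /= normr0 ge_max r0.
    by [].
    + exact: measurable_box.
    + rewrite (_ : mkset _ = [set (complex.Re z : measurableTypeR R)] `*` [set (complex.Im z : measurableTypeR R)]).
      by apply: measurableX; exact: measurable_set1.
      by apply/seteqP; split => -[x y] /=; case: z => a e; [case=> -> ->|move=> /= [-> ->]].
  by have := h 0 (lexx 0); rewrite expr0n mulr0.
- by move=> p /= /eqP.
Qed.

Lemma sum_geom2 (n : nat) : \sum_(k < n) (2^-1 : R) ^+ k <= 2.
Proof.
suff -> : \sum_(k < n) (2^-1 : R) ^+ k = 2 - 2 * 2^-1 ^+ n.
  by rewrite gerBl mulr_ge0 // exprn_ge0 // invr_ge0.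
elim: n => [|n IH]; first by rewrite big_ord0 expr0; lra.
by rewrite big_ord_recr /= IH exprS; field.
Qed.

Lemma half_pow_lt (e : R) : 0 < e -> exists n, (2^-1 : R) ^+ n < e.
Proof.
move=> e0; have [N hN] := small_inv e0; exists N.+1.
apply: le_lt_trans (hN _ (leqnn N)); rewrite exprVn lef_pV2 ?posrE ?exprn_gt0 //.
by rewrite -natrX ler_nat ltnW // ltn_expl.
Qed.

(* Dyadic annuli around [a] bound the integral over the box centred at [a];
   by rearrangement an equal box placed elsewhere gives less. *)
Lemma cule_kernel a c r : 0 < r -> cule (fun w => (box c r w)%:R / nm (w - a)) (12 * r).
Proof.
move=> r0.
pose A (k : nat) (w : C) : R := (box a (r * 2^-1 ^+ k) w)%:R - (box a (r * 2^-1 ^+ k.+1) w)%:R.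
have h2 k : 0 < (2^-1 : R) ^+ k by rewrite exprn_gt0.
have rk k : 0 <= r * 2^-1 ^+ k by rewrite mulr_ge0 ?ltW.
have Asub k w : box a (r * 2^-1 ^+ k.+1) w -> box a (r * 2^-1 ^+ k) w.
  rewrite !box_snorm => /le_trans; apply; rewrite ler_pM2l // exprS.
  by rewrite ler_piMl ?ltW //; lra.
have A0 k w : 0 <= A k w.
  rewrite /A; case: (boolP (box a (r * 2^-1 ^+ k.+1) w)) => [/Asub->|_]; first by rewrite subrr.
  by rewrite subr0.
pose psi k w := 2 ^+ k.+1 / r * A k w.
have mA k : measurable_fun setT (fun p => A k (cx p)).
  by apply: measurable_funB; exact: measurable_fun_box.
have main : cule (fun w => \sum_(k < 0) psi k w) 0.
  by apply: uint_le_mono (uint_le0 _) => p; rewrite big_ord0.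
have intA k : (\int[lam2 R]_p (A k (cx p))%:E = (3 * r ^+ 2 * 4^-1 ^+ k)%:E)%E.
  have e : (\int[lam2 R]_p ((box a (r * 2^-1 ^+ k) (cx p))%:R : R)%:E =
     \int[lam2 R]_p (A k (cx p))%:E +
     \int[lam2 R]_p ((box a (r * 2^-1 ^+ k.+1) (cx p))%:R : R)%:E)%E.
    rewrite -ge0_integralD //.
    - by apply: eq_integral => p _; rewrite -EFinD /A subrK.
    - by move=> p _; rewrite lee_fin A0.
    - exact/measurable_EFinP.
    - by apply/measurable_EFinP; exact: measurable_fun_box.
  move: e; rewrite (int_box a (rk k)) (int_box a (rk k.+1)).
  have Ifin : (\int[lam2 R]_p (A k (cx p))%:E)%E \is a fin_num.
    rewrite ge0_fin_numE; last by apply: integral_ge0 => p _; rewrite lee_fin A0.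
    apply: le_lt_trans (_ : _ <= \int[lam2 R]_p ((box a (r * 2^-1 ^+ k) (cx p))%:R : R)%:E)%E _.
      apply: ge0_le_integral => //.
      - by move=> p _; rewrite lee_fin A0.
      - exact/measurable_EFinP.
      - by apply/measurable_EFinP; exact: measurable_fun_box.
      - by move=> p _; rewrite lee_fin /A gerBl ler0n.
    by rewrite (int_box a (rk k)) ltry.
  rewrite -(fineK Ifin) -EFinD => -[h].
  congr (_%:E); apply/eqP; rewrite -(inj_eq (addIr (4 * (r * 2^-1 ^+ k.+1) ^+ 2))) -h.
  have -> : (4^-1 : R) = 2^-1 ^+ 2 by field.
  by apply/eqP; rewrite (exprAC 2^-1 2 k) (exprS 2^-1 k); move: (2^-1 ^+ k) => t; field.
(* The rearrangement: once the indicator of the box at [a] over [r] is added, the sum is dominated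
   by the annuli, 12 r in all, plus the indicator of the box at [c] over [r]. Both indicator terms
   integrate to 4 r, so they cancel in the end. *)
have ser : cule (fun w => (box c r w)%:R / nm (w - a) + (box a r w)%:R / r)
    (12 * r + 4 * r).
  apply: (@uint_le_series _ _ _ _ _ (fun k p => if k is k'.+1 then psi k' (cx p)
     else (box c r (cx p))%:R / r)
    (fun k => if k is k'.+1 then 6 * r * 2^-1 ^+ k' else 4 * r)).
  - case=> [|k]; first by apply: measurable_funM => //; exact: measurable_fun_box.
    by apply: measurable_funM => //; exact: mA.
  - case=> [|k] p; first by rewrite divr_ge0 ?ler0n // ltW.
    by rewrite mulr_ge0 // divr_ge0 // ?exprn_ge0 // ltW.
  - case=> [|k].
      under eq_integral do rewrite mulrC EFinM.
      rewrite ge0_integralZl_EFin //; last 2 first.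
      + by apply/measurable_EFinP; exact: measurable_fun_box.
      + by rewrite invr_ge0 ltW.
      rewrite (int_box c (ltW r0)) -EFinM lee_fin le_eqVlt; apply/orP; left; apply/eqP.
      by field; rewrite gt_eqF.
    under eq_integral do rewrite EFinM.
    rewrite ge0_integralZl_EFin //; last 3 first.
    + by move=> p _; rewrite lee_fin A0.
    + by apply/measurable_EFinP; exact: mA.
    + by rewrite divr_ge0 // ?exprn_ge0 // ltW.
    rewrite intA -EFinM lee_fin le_eqVlt; apply/orP; left; apply/eqP.
    have -> : (4^-1 : R) = 2^-1 ^+ 2 by field.
    rewrite (exprAC 2^-1 2 k) (exprS 2 k) -{1}(invrK (2 ^+ k)) -exprVn.
    by have := h2 k; move: (2^-1 ^+ k) => t t0; field; rewrite !gt_eqF.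
  - case=> [|n]; first by rewrite big_ord0 addr_ge0 // mulr_ge0 // ltW.
    rewrite big_ord_recl /= addrC lerD2r.
    apply: le_trans (_ : 6 * r * 2 <= _); last by rewrite mulrAC; lra.
    by rewrite -mulr_sumr ler_pM2l ?mulr_gt0 // sum_geom2.
  - apply: aeT_imp (cae_neq a) => p pa; set w := cx p in pa *.
    have wa : w - a != 0 by rewrite subr_eq0.
    have [ar|ar] := boolP (box a r w); last first.
      exists 1%N; rewrite big_ord_recl big_ord0 /= mul0r !addr0.
      rewrite -/w; case: (box c r w); last by rewrite !mul0r.
      rewrite !mul1r lef_pV2 ?posrE ?nm_gt0 //.
      rewrite box_snorm -ltNge in ar; exact: le_trans (ltW ar) (snorm_le_nm _).
    have [n hn] : exists n, ~~ box a (r * 2^-1 ^+ n) w.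
      have [n hn] := half_pow_lt (divr_gt0 (snorm_gt0 wa) r0).
      by exists n; rewrite box_snorm -ltNge mulrC -ltr_pdivlMr.
    have [m [hm1 hm2]] : exists m, box a (r * 2^-1 ^+ m) w /\ ~~ box a (r * 2^-1 ^+ m.+1) w.
      elim: n hn => [|n IH] hn; first by rewrite expr0 mulr1 ar in hn.
      by have [h|/IH//] := boolP (box a (r * 2^-1 ^+ n) w); exists n.
    exists m.+2; rewrite big_ord_recl /= -/w addrC.
    have Am : A m w = 1 by rewrite /A hm1 (negbTE hm2) subr0.
    have le1 : 2 ^+ m.+1 / r <= \sum_(i < m.+1) psi i w.
      rewrite big_ord_recr /= /psi Am mulr1 lerDr sumr_ge0 // => i _.
      by rewrite mulr_ge0 // divr_ge0 // ?exprn_ge0 // ltW.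
    have le2 : (nm (w - a))^-1 <= 2 ^+ m.+1 / r.
      rewrite box_snorm -ltNge in hm2.
      rewrite -[X in _ <= X]invrK lef_pV2 ?posrE ?nm_gt0 ?invr_gt0 ?divr_gt0 ?exprn_gt0 //.
      rewrite invfM invrK mulrC -exprVn; exact: le_trans (ltW hm2) (snorm_le_nm _).
    have le3 : r^-1 <= 2 ^+ m.+1 / r.
      by rewrite ler_peMl ?invr_ge0 ?(ltW r0) ?exprn_ege1 ?ler1n.
    rewrite (eq_bigr (fun i : 'I_m.+1 => psi i w)) // ?ar mul1r.
    by case: (box c r w); rewrite ?mul0r ?mul1r; lra.
have [h [mh h0 hh hI]] := ser.
(* Taking the added term away from the majorant [h] leaves a majorant of integral at most 12 r. *)
pose g p := Num.max 0 (h p - (box a r (cx p))%:R / r).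
have mb := measurable_fun_box a r.
have mg : measurable_fun setT g.
  apply: measurable_maxr => //; apply: measurable_funB => //.
  exact: measurable_funM.
have g0 p : 0 <= g p by rewrite le_max lexx.
have hle : aeT (lam2 R) (fun p => (box a r (cx p))%:R / r <= h p).
  apply: aeT_imp hh => p; apply: le_trans; rewrite lerDr divr_ge0 ?nm_ge0 //.
exists g; split => //.
- apply: aeT_imp hh => p; rewrite /g le_max lerBrDr => ->; exact: orbT.
- have : (\int[lam2 R]_p (g p)%:E + (4 * r)%:E <= (12 * r + 4 * r)%:E)%E.
    apply: le_trans hI.
    rewrite (_ : (4 * r)%:E = \int[lam2 R]_p ((box a r (cx p))%:R / r)%:E)%E; last first.
      under eq_integral do rewrite mulrC EFinM.
      rewrite ge0_integralZl_EFin //; last 2 first.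
      + exact/measurable_EFinP.
      + by rewrite invr_ge0 ltW.
      rewrite (int_box a (ltW r0)) -EFinM; congr (_%:E).
      by field; rewrite gt_eqF.
    have br0 p : 0 <= (box a r (cx p))%:R / r by rewrite divr_ge0 ?ler0n // ltW.
    have mbr : measurable_fun setT (fun p => (box a r (cx p))%:R / r) by exact: measurable_funM.
    rewrite -ge0_integralD //; last 4 first.
    + by move=> p _; rewrite lee_fin.
    + exact/measurable_EFinP.
    + by move=> p _; rewrite lee_fin.
    + exact/measurable_EFinP.
    apply: ae_ge0_le_integral => //.
    + by move=> p _; rewrite -EFinD lee_fin addr_ge0.
    + by apply/measurable_EFinP; exact: measurable_funD.
    + by move=> p _; rewrite lee_fin.
    + exact/measurable_EFinP.
    + apply: aeT_ae; apply: aeT_imp hle => p hp _.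
      by rewrite -EFinD lee_fin -lerBrDr /g ge_max lexx andbT subr_ge0.
  have [->|] := eqVneq (\int[lam2 R]_p (g p)%:E)%E +oo%E; first by [].
  move=> gf; have gfin : (\int[lam2 R]_p (g p)%:E)%E \is a fin_num.
    by rewrite ge0_fin_numE ?ltey // integral_ge0 // => p _; rewrite lee_fin.
  by rewrite -(fineK gfin) -EFinD !lee_fin lerD2r.
Qed.
End Plane.

(** * Measurability, affine maps and Fubini in the plane *)

Section PlaneIntegral.
Variable R : realType.
Local Notation C := R[i].
Local Notation T2 := (measurableTypeR R * measurableTypeR R)%type.
Local Notation cx := (@cx R).
Implicit Types (z w : C).

Definition cint (X : normedModType R[i]^o) (g : C -> X) v := bint (lam2 R) (fun p => g (cx p)) v.
Definition cSM (X : normedModType R[i]^o) (g : C -> X) := SM (fun p : T2 => g (cx p)).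

Lemma toR2_cx p : toR2 (cx p) = p. Proof. by case: p. Qed.
Lemma cx_toR2 z : cx (toR2 z) = z. Proof. by case: z. Qed.
Lemma cae_all (P : C -> Prop) : (forall z, P z) -> cae P.
Proof. by move=> h; apply: aeT_all => p. Qed.
Lemma cae_imp (P Q : C -> Prop) : (forall z, P z -> Q z) -> cae P -> cae Q.
Proof. by move=> h; apply: aeT_imp => p; exact: h. Qed.
Lemma cae_and (P Q : C -> Prop) : cae P -> cae Q -> cae (fun z => P z /\ Q z).
Proof. exact: aeT_and. Qed.

Lemma ae_cae (P : C -> Prop) : ae P <-> cae P.
Proof.
split=> [[N [[B [mB B0 NB]] NP]]|[B [mB B0 BP]]].
  by exists B; split => // p nB; apply: NP => /NB; rewrite toR2_cx.
exists (fun z => B (toR2 z)); split; first by exists B; split.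
by move=> z /BP; rewrite cx_toR2.
Qed.

Lemma cSM_id : cSM (fun z => z : R[i]^o).
Proof.
rewrite /cSM (_ : (fun p => _) = fun p : T2 => ((complex.Re (cx p))%:C : R[i]^o) +
   ('i : R[i]^o) *: ((complex.Im (cx p))%:C : R[i]^o)); last first.
  by apply/funext => p; rewrite [LHS]complexE.
apply: SM_D; first by apply: SM_real; exact: measurable_Re_cx.
by apply: SM_Z; [exact: SM_cst | apply: SM_real; exact: measurable_Im_cx].
Qed.

Definition ccont (X : normedModType R[i]^o) (g : C -> X) := forall a (e : R), 0 < e ->
  exists2 del : R, 0 < del & forall a', nm (a' - a) < del -> nX (g a' - g a) < e.

Lemma cSM_cont (X : normedModType R[i]^o) (g : C -> X) : ccont g -> cSM g.
Proof. by move=> h; apply: (SM_cont1 (F := (g : R[i]^o -> X)) cSM_id). Qed.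

Lemma cint_exists (X : completeNormedModType R[i]^o) (g : C -> X) M :
  cSM g -> cule (fun z => nX (g z)) M -> exists v, cint g v.
Proof. exact: bint_exists. Qed.

Let affine (c t1 t2 : R) (p : T2) : T2 :=
  ((c * (p.1 : R) + t1)%R : measurableTypeR R, (c * (p.2 : R) + t2)%R : measurableTypeR R).
Let measurable_affine c t1 t2 : measurable_fun setT (affine c t1 t2).
Proof.
apply: measurable_fun_pair => /=.
  apply: measurable_funD => //; apply: measurable_funM => //; exact: measurable_fst.
apply: measurable_funD => //; apply: measurable_funM => //; exact: measurable_snd.
Qed.
Let cx_affine c t p : cx (affine c (complex.Re t) (complex.Im t) p) = c%:C * cx p + t.
Proof. by case: p t => x y [a e]; rewrite /affine /cx /=; simpc. Qed.

Lemma cint_affine (X : normedModType R[i]^o) (g : C -> X) v (c : R) t : 0 < c ->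
  cint g v -> cint (fun z => g (c%:C * z + t)) (((c^-1 * c^-1)%:C : R[i]^o) *: v).
Proof.
move=> c0 hg.
have k0 : 0 <= c^-1 * c^-1 by rewrite mulr_ge0 // invr_ge0 ltW.
have h := bint_phi (measurable_affine c (complex.Re t) (complex.Im t)) k0 _ hg.
apply: bint_ext (h _) => [p|A mA]; first by rewrite cx_affine.
exact: lam2_affine.
Qed.
Lemma cint_shift (X : normedModType R[i]^o) (g : C -> X) v t :
  cint g v -> cint (fun z => g (z + t)) v.
Proof.
move=> /(cint_affine t ltr01); rewrite invr1 mulr1 scale1r.
by apply: bint_ext => p; rewrite mul1r.
Qed.
Definition cSM2 (X : normedModType R[i]^o) (h : C -> C -> X) :=
  SM (fun q : T2 * T2 => h (cx q.1) (cx q.2)).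

Lemma cint_fubini (X : completeNormedModType R[i]^o) (h : C -> C -> X) (B : C -> R) M
  (I J : C -> X) : cSM2 h -> (forall z, cule (fun w => nX (h z w)) (B z)) ->
  cule B M -> cae (fun z => cint (fun w => h z w) (I z)) ->
  cae (fun w => cint (fun z => h z w) (J w)) -> exists v, cint I v /\ cint J v.
Proof.
move=> hSM hB BM hI hJ.
apply: (@bint_fubini _ _ _ _ R (lam2 R) (lam2 R) X
   (fun q => h (cx q.1) (cx q.2)) M) => //.
have mh := SM_measurable_norm hSM.
have [B' [mB' B'0 BB' B'M]] := BM; apply: le_trans B'M.
apply: ae_ge0_le_integral => //.
- by move=> x _; apply: integral_ge0 => y _; rewrite lee_fin nX_ge0.
- have := @measurable_fun_fubini_tonelli_F _ _ _ _ R (lam2 R)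
    (fun q => (nX (h (cx q.1) (cx q.2)))%:E); apply; first exact/measurable_EFinP.
  by move=> q; rewrite lee_fin nX_ge0.
- by move=> x _; rewrite lee_fin.
- exact/measurable_EFinP.
- apply: aeT_ae; apply: aeT_imp BB' => x hx _.
  apply: (@le_trans _ _ (B (cx x))%:E); last by rewrite lee_fin.
  apply: uint_le_int (hB (cx x)); last by move=> y; exact: nX_ge0.
  exact: (measurableT_comp mh (pair1_measurable x)).
Qed.

Lemma cSM2_fst (X : normedModType R[i]^o) (g : C -> X) : cSM g -> cSM2 (fun z _ => g z).
Proof. by move=> hg; apply: (SM_comp (phi := fst) hg); exact: measurable_fst. Qed.
Lemma cSM2_snd (X : normedModType R[i]^o) (g : C -> X) : cSM g -> cSM2 (fun _ w => g w).
Proof. by move=> hg; apply: (SM_comp (phi := snd) hg); exact: measurable_snd. Qed.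

Lemma cint_is_bochner (X : normedModType R[i]^o) (g : C -> X) v :
  cint g v -> is_bochner_integral g v.
Proof.
move=> hg.
have /choice[s hs] : forall n : nat, exists s, [/\ fsimple (lam2 R) s,
  uint_le (lam2 R) (fun p => nX (g (cx p) - sf s p)) n.+1%:R^-1 &
  nX (sint (lam2 R) s - v) <= n.+1%:R^-1] by move=> n; apply: hg.
have /choice[h hh] : forall n : nat, exists h : T2 -> R, [/\ measurable_fun setT h,
    forall x, 0 <= h x, aeT (lam2 R) (fun p => nX (g (cx p) - sf (s n) p) <= h p) &
    (\int[lam2 R]_x (h x)%:E <= (n.+1%:R^-1)%:E)%E].
  by move=> n; have [_ ? _] := hs n.
exists s; split.
- by move=> n p ps; have [fs _ _] := hs n; exact: fs.
- exists h; split.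
  + by move=> n; have [] := hh n.
  + by move=> n; have [] := hh n.
  + move=> n; apply/ae_cae; have [_ _ hae _] := hh n.
    apply: aeT_imp hae => p hp; rewrite toR2_cx nXE lecR.
    by rewrite /simple_fun big_map /= toR2_cx.
  + apply: (@squeeze_cvge _ _ _ _ (fun=> 0%E) _ (fun n => (n.+1%:R^-1)%:E)).
    * apply: nearW => n; have [_ h0 _ hI] := hh n.
      by rewrite hI andbT; apply: integral_ge0 => x _; rewrite lee_fin.
    * exact: cvg_cst.
    * by apply: cvg_EFin; [exact: nearW | exact: cvg_harmonic].
- apply/nX_cvg => e e0; have [N hN] := small_inv e0; exists N => n /hN.
  by apply: le_lt_trans; have [_ _] := hs n.
Qed.

(** Off a single null set [N] all the Lebesgue measurable sets involved agree with Borel sets and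
    the simple functions converge; the value 0 on [N] makes the convergence hold everywhere. *)
Lemma strongly_measurable_cSM (X : normedModType R[i]^o) (f : C -> X) :
  strongly_measurable f -> exists f' : C -> X, cSM f' /\ cae (fun z => f z = f' z).
Proof.
move=> [s [ms /ae_cae cs]].
have /choice[Bs hBs] : forall A : set C, exists B : set T2, measurable B /\
    (leb_measurable A -> cae (fun z => A z <-> B (toR2 z))).
  move=> A; have [[B [mB [B' [mB' B'0 hB]]]]|nA] := pselect (leb_measurable A).
    exists B; split => // _; exists B'; split => // p nB'.
    apply: contrapT => h; apply: nB'; move: (hB (cx p) h); rewrite toR2_cx => H; exact: H.
  by exists set0; split.
pose s' n : seq (set T2 * X) := [seq (Bs p.1, p.2) | p <- s n].
have ss' : cae (fun z => forall n, simple_fun (s n) z = sf (s' n) (toR2 z)).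
  apply: (@aeT_bigcap _ _ _ _ (fun n p => simple_fun (s n) (cx p) = sf (s' n) (toR2 (cx p)))) => n.
  change (cae (fun z => simple_fun (s n) z = sf (s' n) (toR2 z))); rewrite /sf /simple_fun.
  suff H : cae (fun z => forall p, p \in s n -> (p.1 z <-> Bs p.1 (toR2 z))).
    apply: cae_imp H => z h; rewrite /s' big_map; apply: eq_big_seq => p /h pB /=.
    by congr (if _ then _ else _); apply/asboolP/asboolP => /pB.
  have := ms n; elim: (s n) => [|p r IH] hr; first exact: cae_all.
  have hr' q : q \in r -> leb_measurable q.1 by move=> qr; apply: hr; rewrite inE qr orbT.
  have [_ hp] := hBs p.1.
  apply: cae_imp (cae_and (hp (hr p (mem_head _ _))) (IH hr')) => z [h1 h2] q.
  by rewrite inE => /orP[/eqP->|/h2].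
have [N [mN N0 hN]] := cae_and cs ss'.
exists (fun z => if `[< ~ N (toR2 z) >] then f z else 0); split; last first.
  by exists N; split => // p nN; rewrite asboolT // toR2_cx.
pose g n (p : T2) : X := if `[< (~` N) p >] then sf (s' n) p else 0.
apply: (@SM_lim _ _ _ _ g) => [n|p e e0].
  apply: SM_if; [exact: measurableC | | exact: SM_cst].
  by apply: SM_sf => q /mapP[q' _ ->] /=; have [] := hBs q'.1.
rewrite /g toR2_cx; have [Np|nNp] := pselect (N p).
  by exists 0%N => n _; rewrite !asboolF //= ?subrr ?nX0 //; apply.
have [cp ep] := hN _ nNp; have /nX_cvg/(_ _ e0)[M hM] := cp.
exists M => n /hM; rewrite !asboolT // ep toR2_cx.
by [].
Qed.
End PlaneIntegral.

(** * Limits, continuity and directional derivatives *)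

Section Calculus.
Variable R : realType.
Local Notation continuous_at := Defs.continuous_at.
Local Notation C := R[i].
Implicit Types (z w : C).

Lemma complex_gt0E (e : C) : 0 < e -> e = (complex.Re e)%:C /\ 0 < complex.Re e.
Proof.
move=> e0; have eE : e = (complex.Re e)%:C by rewrite RRe_real // gtr0_real.
by split => //; rewrite -ltcR -eE.
Qed.

Lemma filter_nX_cvg (I : Type) (F : set_system I) {FF : Filter F}
  (X : normedModType R[i]^o) (f : I -> X) (l : X) :
  (forall e : R, 0 < e -> \forall i \near F, nX (f i - l) < e) <-> f @ F --> l.
Proof.
split=> [h|/cvgrPdist_lt h e e0].
  apply/cvgrPdist_lt => e /complex_gt0E[-> e0].
  by apply: filterS (h _ e0) => i; rewrite nXB nXE ltcR.
have e0' : 0 < e%:C :> R[i] by rewrite ltcR.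
by apply: filterS (h _ e0') => i; rewrite nXE ltcR nXB.
Qed.

Lemma filter_cvgV (I : Type) (F : set_system I) {FF : Filter F} (f : I -> R[i]^o)
  (l : R[i]^o) : l != 0 -> f @ F --> l -> ((f i)^-1 : R[i]^o) @[i --> F] --> (l^-1 : R[i]^o).
Proof.
move=> l0 /filter_nX_cvg hf; apply/filter_nX_cvg => e e0.
have n0 : 0 < nm l by rewrite nm_gt0.
have d0 : 0 < Num.min (nm l / 2) (e * (nm l * nm l) / 2).
  by rewrite lt_min !divr_gt0 // !mulr_gt0.
apply: filterS (hf _ d0) => i; rewrite !nX_scalar lt_min => /andP[h1 h2].
have h3 : nm l / 2 < nm (f i) by have := nmBD l (l - f i); rewrite subKr (nmB l); lra.
have fi0 : f i != 0 by rewrite -nm_gt0 (lt_trans _ h3) // divr_gt0.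
have -> : (f i)^-1 - l^-1 = (l - f i) / (f i * l) by field; rewrite l0.
rewrite nmM nmV nmM nmB ltr_pdivrMr ?mulr_gt0 ?nm_gt0 //; apply: lt_trans h2 _.
rewrite -mulrA ltr_pM2l // mulrAC; rewrite ltr_pM2r //.
Qed.

(** Punctured neighbourhoods of 0. Reading [has_partial] as a limit along this filter lets sums,
    products and inverses be differentiated by limit rules. *)
Definition near0 : set_system R :=
  [set P | exists2 d : R, 0 < d & forall h, 0 < `|h| < d -> P h].
Instance near0_filter : Filter near0.
Proof.
split; first by exists 1.
- move=> P Q [d d0 hP] [d' d'0 hQ]; exists (Num.min d d'); first by rewrite lt_min d0.
  by move=> h; rewrite lt_min => /and3P[h0 h1 h2]; split; [apply: hP|apply: hQ]; rewrite h0.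
- by move=> P Q PQ [d d0 hP]; exists d => // h /hP/PQ.
Qed.
Definition cnear z : set_system C :=
  [set P | exists2 d : R, 0 < d & forall w, nm (w - z) < d -> P w].
Instance cnear_filter z : Filter (cnear z).
Proof.
split; first by exists 1.
- move=> P Q [d d0 hP] [d' d'0 hQ]; exists (Num.min d d'); first by rewrite lt_min d0.
  by move=> h; rewrite lt_min => /andP[h1 h2]; split; [apply: hP|apply: hQ].
- by move=> P Q PQ [d d0 hP]; exists d => // h /hP/PQ.
Qed.
Lemma near0P (P : R -> Prop) : (\forall h \near near0, P h) <->
  exists2 d : R, 0 < d & forall h, 0 < `|h| < d -> P h.
Proof. by []. Qed.

Lemma has_partialP (X : normedModType R[i]^o) dir (g : C -> X) z v :
  has_partial dir g z v <->
  ((h%:C)^-1 : R[i]^o) *: (g (z + h%:C * dir) - g z) @[h --> near0] --> v.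
Proof.
split=> [h|/filter_nX_cvg h e e0].
  apply/filter_nX_cvg => e /h[d [d0 hd]]; apply/near0P; exists d => // t /hd.
  by rewrite nXE ltcR.
by have /near0P[d d0 hd] := h e e0; exists d; split => // t /hd; rewrite nXE ltcR.
Qed.

Lemma continuous_atE (X : normedModType R[i]^o) (g : C -> X) z :
  continuous_at g z <-> forall e : R, 0 < e -> exists2 d : R, 0 < d &
    forall w, nm (w - z) < d -> nX (g w - g z) < e.
Proof.
split=> h e /h.
  move=> [d [d0 hd]]; exists d => // w hw.
  by have := hd w; rewrite nmE nXE !ltcR; apply.
move=> [d d0 hd]; exists d; split => // w.
by rewrite nmE nXE !ltcR; exact: hd.
Qed.

Lemma ccontE (X : normedModType R[i]^o) (g : C -> X) :
  ccont g <-> forall z, continuous_at g z.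
Proof.
by split=> h z; [apply/continuous_atE => e; exact: h | have /continuous_atE := h z].
Qed.

Lemma continuous_atP (X : normedModType R[i]^o) (g : C -> X) z :
  continuous_at g z <-> g x @[x --> cnear z] --> g z.
Proof. by rewrite continuous_atE -filter_nX_cvg. Qed.

Lemma continuous_atD (X : normedModType R[i]^o) (f g : C -> X) z :
  continuous_at f z -> continuous_at g z -> continuous_at (fun w => f w + g w) z.
Proof. by move=> /continuous_atP hf /continuous_atP hg; apply/continuous_atP; exact: cvgD. Qed.
Lemma continuous_atZ (X : normedModType R[i]^o) (f : C -> R[i]^o) (g : C -> X) z :
  continuous_at f z -> continuous_at g z -> continuous_at (fun w => f w *: g w) z.
Proof. by move=> /continuous_atP hf /continuous_atP hg; apply/continuous_atP; exact: cvgZ. Qed.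
Lemma continuous_atV (f : C -> R[i]^o) z :
  continuous_at f z -> f z != 0 -> continuous_at (fun w => (f w)^-1 : R[i]^o) z.
Proof. by move=> /continuous_atP hf h0; apply/continuous_atP; exact: filter_cvgV. Qed.
Lemma continuous_at_cst (X : normedModType R[i]^o) (v : X) z : continuous_at (fun=> v) z.
Proof. by apply/continuous_atP; exact: cvg_cst. Qed.
Lemma continuous_at_id z : continuous_at (fun w => w : R[i]^o) z.
Proof. by apply/continuous_atE => e e0; exists e. Qed.
Lemma continuous_at_ext (X : normedModType R[i]^o) (f g : C -> X) z (d : R) : 0 < d ->
  (forall w, nm (w - z) < d -> f w = g w) -> continuous_at f z -> continuous_at g z.
Proof.
move=> d0 fg /continuous_atE hf; apply/continuous_atE => e /hf[d' d'0 hd].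
exists (Num.min d d'); first by rewrite lt_min d0.
move=> w; rewrite lt_min => /andP[h1 h2].
by rewrite -!fg ?subrr ?nm0 //; exact: hd.
Qed.

Lemma partial_continuous (X : normedModType R[i]^o) dir (g : C -> X) z v :
  has_partial dir g z v -> g (z + h%:C * dir) @[h --> near0] --> g z.
Proof.
move=> /has_partialP hg.
have h0 : ((h%:C : R[i]^o) @[h --> near0] --> (0 : R[i]^o)).
  apply/filter_nX_cvg => e e0; apply/near0P; exists e => // h /andP[_ he].
  by rewrite subr0 nX_scalar nm_real.
have c : (g z + (h%:C : R[i]^o) *: (((h%:C)^-1 : R[i]^o) *: (g (z + h%:C * dir) - g z)))
    @[h --> near0] --> g z + (0 : R[i]^o) *: v.
  by apply: cvgD; [exact: cvg_cst | exact: cvgZ].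
rewrite -[X in _ --> X]addr0 -(scale0r v); apply: cvg_trans c; apply: near_eq_cvg.
apply/near0P; exists 1 => // h /andP[h1 _] /=.
have hC : (h%:C : R[i]) != 0 by rewrite -nm_eq0 nm_real normr_eq0 -normr_gt0.
by rewrite scalerA mulfV // scale1r addrC subrK.
Qed.

Lemma partial_ext (X : normedModType R[i]^o) dir (f g : C -> X) z v (d : R) : 0 < d ->
  (forall w, nm (w - z) < d -> f w = g w) -> has_partial dir f z v -> has_partial dir g z v.
Proof.
move=> d0 fg hf e /hf[d' [d'0 hd]].
pose d1 := Num.min d' (d / (nm dir + 1)).
have n1 : 0 < nm dir + 1 by rewrite ltr_pwDr ?nm_ge0.
exists d1; split; first by rewrite lt_min d'0 divr_gt0.
move=> h /andP[h0]; rewrite lt_min => /andP[h1 h2].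
rewrite -!fg ?subrr ?nm0 //; first by apply: hd; rewrite h0.
rewrite addrC addKr nmM nm_real.
rewrite ltr_pdivlMr // in h2; apply: le_lt_trans h2.
by rewrite ler_wpM2l // lerDl.
Qed.

Lemma partialD (X : normedModType R[i]^o) dir (f g : C -> X) z v v' :
  has_partial dir f z v -> has_partial dir g z v' ->
  has_partial dir (fun w => f w + g w) z (v + v').
Proof.
move=> /has_partialP hf /has_partialP hg; apply/has_partialP.
have c : (((h%:C)^-1 : R[i]^o) *: (f (z + h%:C * dir) - f z) +
    ((h%:C)^-1 : R[i]^o) *: (g (z + h%:C * dir) - g z)) @[h --> near0] --> v + v' by exact: cvgD.
apply: cvg_trans c; apply: near_eq_cvg; apply/near0P; exists 1 => // h _ /=.
by rewrite -scalerDr opprD addrACA.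
Qed.

Lemma partialZ (X : normedModType R[i]^o) dir (f : C -> R[i]^o) (g : C -> X) z a v :
  has_partial dir f z a -> has_partial dir g z v ->
  has_partial dir (fun w => f w *: g w) z (a *: g z + f z *: v).
Proof.
move=> hf hg; have hc := partial_continuous hg.
move/has_partialP : hf => hf; move/has_partialP : hg => hg; apply/has_partialP.
have c : (((((h%:C)^-1 : R[i]^o) *: (f (z + h%:C * dir) - f z)) *: g (z + h%:C * dir)) +
    f z *: (((h%:C)^-1 : R[i]^o) *: (g (z + h%:C * dir) - g z)))
    @[h --> near0] --> a *: g z + f z *: v.
  by apply: cvgD; [exact: (cvgZ hf hc) | apply: (cvgZ _ hg); exact: cvg_cst].
apply: cvg_trans c; apply: near_eq_cvg; apply/near0P; exists 1 => // h _ /=.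
have E (k l : R[i]^o) (x : X) : (k *: l) *: x = k *: (l *: x) by rewrite scalerA.
rewrite E (scalerA (f z)) (mulrC (f z)) -scalerA -scalerDr; congr (_ *: _).
by rewrite scalerBl scalerBr addrA subrK.
Qed.

Lemma partialV dir (f : C -> R[i]^o) z a : f z != 0 ->
  has_partial dir f z a -> has_partial dir (fun w => (f w)^-1 : R[i]^o) z (- a / f z ^+ 2).
Proof.
move=> f0 hf; have hc := partial_continuous hf.
move/has_partialP : hf => hf; apply/has_partialP.
have f00 : \forall h \near near0, f (z + h%:C * dir) != 0.
  have fz0 : 0 < nX (f z) by rewrite nX_gt0.
  move/filter_nX_cvg : hc => /(_ _ fz0); apply: filterS => h.
  by apply: contraTneq => ->; rewrite sub0r nXN ltxx.
have h1 : ((f (z + h%:C * dir))^-1 : R[i]^o) @[h --> near0] --> ((f z)^-1 : R[i]^o).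
  exact: (filter_cvgV f0 hc).
have h2 : ((- (f z)^-1 : R[i]^o) @[_ --> near0] --> (- (f z)^-1 : R[i]^o)) by exact: cvg_cst.
have c : ((((h%:C)^-1 : R[i]^o) *: (f (z + h%:C * dir) - f z)) *: (((f (z + h%:C * dir))^-1 : R[i]^o)
      *: (- (f z)^-1 : R[i]^o)))
    @[h --> near0] --> a *: (((f z)^-1 : R[i]^o) *: (- (f z)^-1 : R[i]^o)).
  by apply: (cvgZ hf); exact: (cvgZ h1 h2).
rewrite (_ : - a / f z ^+ 2 = a *: (((f z)^-1 : R[i]^o) *: (- (f z)^-1 : R[i]^o))); last first.
  by rewrite /GRing.scale /=; field.
apply: cvg_trans c; apply: near_eq_cvg; apply: filterS f00 => h fh /=.
rewrite /GRing.scale /= -!mulrA; congr (_ * _); field.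
by rewrite fh f0.
Qed.
End Calculus.

(** * Mean value inequality and uniformity for compact supports *)

Section MeanValue.
Variables (R : realType) (X : normedModType R[i]^o).
Local Notation C := R[i].
Local Notation continuous_at := Defs.continuous_at.

(** The supremum of the times satisfying the inequality with slack [e] satisfies it too, and
    differentiability there pushes it further unless it is [L]. *)
Lemma mean_value (phi dphi : R -> X) (M L : R) : 0 <= L ->
  (forall t, 0 <= t <= L -> forall e : R, 0 < e -> exists2 d : R, 0 < d & forall h,
     0 < `|h| < d -> nX (((h%:C)^-1 : R[i]^o) *: (phi (t + h) - phi t) - dphi t) < e) ->
  (forall t, 0 <= t <= L -> nX (dphi t) <= M) -> nX (phi L - phi 0) <= M * L.
Proof.
move=> L0 hd hM.
suff H e : 0 < e -> nX (phi L - phi 0) <= (M + e) * L.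
  apply/ler_addgt0Pr => e e0; have L1 : 0 < L + 1 by rewrite ltr_pwDr.
  apply: le_trans (H (e / (L + 1)) _) _; first by rewrite divr_gt0.
  rewrite mulrDl lerD2l mulrAC ler_pdivrMr // ler_pM2l //; lra.
move=> e0.
have step t : 0 <= t <= L -> exists2 d : R, 0 < d & forall h, `|h| < d ->
    nX (phi (t + h) - phi t) <= (M + e) * `|h|.
  move=> ht; have [d d0 H] := hd t ht e e0; exists d => // h hh.
  have [->|h0] := eqVneq h 0; first by rewrite addr0 subrr nX0 normr0 mulr0.
  have hn : 0 < `|h| by rewrite normr_gt0.
  have := H h; rewrite hn hh => /(_ isT) h1.
  have hC : (h%:C : R[i]) != 0 by rewrite -nm_eq0 nm_real normr_eq0.
  have -> : phi (t + h) - phi t =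
      (h%:C : R[i]^o) *: (((h%:C)^-1 : R[i]^o) *: (phi (t + h) - phi t)).
    by rewrite scalerA mulfV // scale1r.
  rewrite nXZ nm_real mulrC ler_pM2r //.
  have := nXBD (((h%:C)^-1 : R[i]^o) *: (phi (t + h) - phi t)) (dphi t).
  have := hM t ht; lra.
pose S := [set t | 0 <= t <= L /\ nX (phi t - phi 0) <= (M + e) * t].
have S0 : S 0 by split; rewrite ?lexx // subrr nX0 mulr0.
have Sb : has_ubound S by exists L => t [/andP[]].
have Ssup : has_sup S by split => //; exists 0.
pose s := sup S.
have s0 : 0 <= s by exact: ub_le_sup.
have sL : s <= L by apply: ge_sup => //; [exists 0 | move=> t [/andP[]]].
have Ss : S s.
  split; first by rewrite s0.
  have [|d d0 hs] := step s; first by rewrite s0.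
  have [t [ht1 ht2] ht] := sup_adherent d0 Ssup.
  have ts : t <= s by apply: ub_le_sup.
  have := hs (t - s); rewrite ler0_norm ?subr_le0 // (addrC s (t - s)) subrK opprB.
  move=> /(_ _) h1; have {h1} h2 : nX (phi t - phi s) <= (M + e) * (s - t).
    by apply: h1; rewrite ltrBlDl -ltrBlDr.
  have := nX_tri (phi t) (phi s) (phi 0); rewrite (nXB (phi s) (phi t)).
  by move: (nX _) (nX _) (nX _) ht2 h2 => ? ? ? *; lra.
have [sE|sE] := eqVneq s L; first by have [_] := Ss; rewrite sE.
have sL' : s < L by rewrite lt_neqAle sE.
have [|d d0 hs] := step s; first by rewrite s0.
pose h := Num.min (d / 2) (L - s).
have h0 : 0 < h by rewrite lt_min divr_gt0 // subr_gt0.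
have hd' : h < d by rewrite gt_min ltr_pdivrMr // ltr_pMr // ltr1n.
have hL : s + h <= L by rewrite -lerBrDl ge_min lexx orbT.
have := hs h; rewrite (ger0_norm (ltW h0)) => /(_ hd') h1.
have [_ h2] := Ss.
have : S (s + h).
  split; first by rewrite addr_ge0 // ltW.
  have := nX_tri (phi s) (phi (s + h)) (phi 0).
  by move: (nX _) (nX _) (nX _) h1 h2 => ? ? ? *; lra.
by move=> /(ub_le_sup Sb); rewrite -/s => h3; lra.
Qed.

(** Compactness of a square: parameters that work near each point have a common range. Uniform
    continuity and boundedness come from suitable [P]; for boundedness it is [nX (g z) <= t^-1]. *)
Lemma near_covering_box (rho0 : R) (P : R -> C -> Prop) :
  (forall z, exists2 d : R, 0 < d & exists2 e : R, 0 < e & forall w t, nm (w - z) < d ->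
     0 < t < e -> P t w) ->
  exists2 e : R, 0 < e & forall t z, 0 < t < e -> nm z <= rho0 -> P t z.
Proof.
move=> hP.
pose K : set (R * R) := `[- rho0, rho0]%classic `*` `[- rho0, rho0]%classic.
have cK : compact K by apply: compact_setX; exact: segment_compact.
pose F : set_system R := [set Q | exists2 e : R, 0 < e & forall t, 0 < t < e -> Q t].
have FF : Filter F.
  split; first by exists 1.
  - move=> A B [d d0 hA] [d' d'0 hB]; exists (Num.min d d'); first by rewrite lt_min d0.
    by move=> h; rewrite lt_min => /and3P[h0 h1 h2]; split; [apply: hA|apply: hB]; rewrite h0.
  - by move=> A B AB [d d0 hA]; exists d => // h /hA/AB.
have := (proj1 (compact_near_coveringP K) cK) R F (fun t p => P t (p.1 +i* p.2)) FF.
case.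
  move=> [x y] _; have [d d0 [e e0 H]] := hP (x +i* y).
  have d20 : 0 < d / 2 by rewrite divr_gt0.
  exists ([set q : R * R | `|q.1 - x| < d / 2 /\ `|q.2 - y| < d / 2], [set t | 0 < t < e]) => /=.
    split; last by exists e.
    exists (ball x (d / 2), ball y (d / 2)) => /=; first by split; exact: nbhsx_ballx.
    by move=> [a c] /= [h1 h2]; rewrite -!(distrC x) -!(distrC y).
  move=> [[a c] t] /= [[h1 h2] ht]; apply: H => //.
  apply: le_lt_trans (nm_le_ReIm _) _ => /=.
  by rewrite (splitr d) ltrD.
move=> e e0 H; exists e => // t [x y] ht hz; apply: (H t ht (x, y)).
have := Re_le_nm (x +i* y); have := Im_le_nm (x +i* y) => /= h1 h2.
by split; rewrite /= in_itv /= -ler_norml; [exact: le_trans h2 hz | exact: le_trans h1 hz].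
Qed.

Lemma compact_support_unif (g : C -> X) rho0 : ccont g -> (forall z, rho0 < nm z -> g z = 0) ->
  forall e : R, 0 < e -> exists2 d : R, 0 < d & forall z w, nm (w - z) < d -> nX (g w - g z) < e.
Proof.
move=> cg gs e e0.
have [|d d0 H] := @near_covering_box (rho0 + 1)
   (fun t z => forall w, nm (w - z) < t -> nX (g w - g z) < e).
  move=> z; have e20 : 0 < e / 2 by rewrite divr_gt0.
  have [d d0 hd] := cg z _ e20; have d20 : 0 < d / 2 by rewrite divr_gt0.
  exists (d / 2) => //; exists (d / 2) => // w t wz /andP[t0 td] w' w'w.
  apply: le_lt_trans (nX_tri (g z) _ _) _; rewrite (splitr e) (nXB (g z)) ltrD ?hd //.
    rewrite -(subrK w w') -addrA; apply: le_lt_trans (nmD _ _) _.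
    by rewrite (splitr d) ltrD // (lt_trans w'w).
  by apply: lt_trans wz _; rewrite ltr_pdivrMr // ltr_pMr // ltr1n.
exists (Num.min 1 (d / 2)); first by rewrite lt_min ltr01 divr_gt0.
move=> z w; rewrite lt_min => /andP[h1 h2].
have [hz|hz] := leP (nm z) (rho0 + 1).
  by apply: (H (d / 2)) => //; rewrite divr_gt0 //= ltr_pdivrMr // ltr_pMr // ltr1n.
rewrite !gs ?subrr ?nX0 //; first by lra.
by have := nmBD z w; rewrite nmB; lra.
Qed.

Lemma compact_support_bounded (g : C -> X) rho0 : ccont g ->
  (forall z, rho0 < nm z -> g z = 0) -> exists2 M : R, 0 <= M & forall z, nX (g z) <= M.
Proof.
move=> cg gs.
have [|d d0 H] := @near_covering_box rho0 (fun t z => nX (g z) <= t^-1).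
  move=> z; have [d d0 hd] := cg z _ ltr01; exists d => //.
  have n1 : 0 < nX (g z) + 1 by rewrite ltr_pwDr ?nX_ge0.
  exists (nX (g z) + 1)^-1; first by rewrite invr_gt0.
  move=> w t /hd wz /andP[t0 tz]; apply: (@le_trans _ _ (nX (g z) + 1)).
    by have := nXBD (g w) (g z); lra.
  by rewrite -[X in X <= _]invrK lef_pV2 ?posrE ?invr_gt0 // ltW.
exists (d / 2)^-1; first by rewrite invr_ge0 ltW // divr_gt0.
move=> z; have [hz|hz] := leP (nm z) rho0.
  by apply: H => //; rewrite divr_gt0 //= ltr_pdivrMr // ltr_pMr // ltr1n.
by rewrite gs // nX0 invr_ge0 ltW // divr_gt0.
Qed.

(* continuously differentiable in the direction [dir], supported in a disc *)
Definition C1c dir (u ud : C -> X) (rho0 : R) := [/\ ccont u,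
  forall z, has_partial dir u z (ud z), ccont ud &
  forall z, rho0 < nm z -> u z = 0 /\ ud z = 0].

(** The sign [s] lets a negative increment h be treated as motion over [0, |h|]. *)
Lemma partial_path dir (u : C -> X) (v : X) z (s t : R) : `|s| = 1 ->
  has_partial dir u (z + (s * t)%:C * dir) v ->
  forall e : R, 0 < e -> exists2 d : R, 0 < d & forall h, 0 < `|h| < d ->
   nX (((h%:C)^-1 : R[i]^o) *: (u (z + (s * (t + h))%:C * dir) - u (z + (s * t)%:C * dir))
        - (s%:C : R[i]^o) *: v) < e.
Proof.
move=> s1 hu e /hu[d [d0 hd]]; exists d => // h hh.
have := hd (s * h); rewrite normrM s1 mul1r => /(_ hh); rewrite nXE ltcR.
have ss0 : s * s = 1 by rewrite -expr2 -real_normK ?num_real // s1 expr1n.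
have ss : s%:C * s%:C = 1 :> R[i] by rewrite -rmorphM ss0.
have -> : z + (s * t)%:C * dir + (s * h)%:C * dir = z + (s * (t + h))%:C * dir.
  by rewrite -addrA -mulrDl mulrDr rmorphD.
apply: le_lt_trans; set B := u _ - u _.
have -> : ((h%:C)^-1 : R[i]^o) *: B - (s%:C : R[i]^o) *: v =
    (s%:C : R[i]^o) *: (((((s * h)%:C)^-1 : R[i]^o) *: B) - v).
  rewrite [RHS]scalerBr [in RHS]scalerA; congr (_ *: _ - _).
  by rewrite rmorphM invfM mulrA mulfV ?mul1r // -nm_eq0 nm_real s1 oner_neq0.
by rewrite nXZ nm_real s1 mul1r.
Qed.

(** Mean value inequality for [u] minus its first order part at [z]: the derivative along the path
    is an increment of [ud], small by uniform continuity. *)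
Lemma quotient_unif dir (u ud : C -> X) rho0 : nm dir = 1 -> C1c dir u ud rho0 ->
  forall e : R, 0 < e -> exists2 d : R, 0 < d & forall h, 0 < `|h| < d -> forall z,
    nX (((h%:C)^-1 : R[i]^o) *: (u (z + h%:C * dir) - u z) - ud z) <= e.
Proof.
move=> dir1 [cu hu cud us] e e0.
have [d d0 H] := compact_support_unif cud (fun z hz => proj2 (us z hz)) e0.
exists d => // h /andP[h0 hd] z.
have hC : (h%:C : R[i]) != 0 by rewrite -nm_eq0 nm_real normr_eq0 -normr_gt0.
pose s := Num.sg h; have s1 : `|s| = 1 by rewrite normr_sg -normr_gt0 h0.
have hs : h = s * `|h| by rewrite -numEsg.
pose phi t := u (z + (s * t)%:C * dir) - ((s * t)%:C : R[i]^o) *: ud z.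
pose dphi t := (s%:C : R[i]^o) *: (ud (z + (s * t)%:C * dir) - ud z).
have H1 : nX (phi `|h| - phi 0) <= e * `|h|.
  apply: (@mean_value phi dphi) => //.
    move=> t _ e' e'0.
    have [d' d'0 H'] := @partial_path dir u (ud (z + (s * t)%:C * dir)) z s t s1 (hu _) e' e'0.
    exists d' => // k hk; have := H' k hk.
    have kC : (k%:C : R[i]) != 0.
      by case/andP: hk => k0 _; rewrite -nm_eq0 nm_real normr_eq0 -normr_gt0.
    have -> : phi (t + k) - phi t = (u (z + (s * (t + k))%:C * dir) - u (z + (s * t)%:C * dir))
        - ((s * k)%:C : R[i]^o) *: ud z.
      rewrite /phi mulrDr rmorphD scalerDl; move: (u _) (u _) => a c.
      by rewrite opprB (addrC (_ *: _) (_ *: _)) opprD !addrA subrK addrAC.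
    rewrite /dphi; set A := u _ - u _.
    have kk : k%:C^-1 * (s * k)%:C = s%:C :> R[i] by rewrite rmorphM mulrCA mulVf // mulr1.
    have -> : ((k%:C)^-1 : R[i]^o) *: (A - ((s * k)%:C : R[i]^o) *: ud z) =
       ((k%:C)^-1 : R[i]^o) *: A - (s%:C : R[i]^o) *: ud z by rewrite scalerBr scalerA kk.
    by rewrite [(s%:C : R[i]^o) *: (_ - _)]scalerBr opprB addrA subrK.
  move=> t /andP[t0 th]; rewrite /dphi nXZ nm_real s1 mul1r ltW // H //.
  by rewrite addrC addKr nmM dir1 mulr1 nm_real normrM s1 mul1r ger0_norm // (le_lt_trans th).
rewrite /phi mulr0 mul0r addr0 scale0r subr0 -hs in H1.
have -> : ((h%:C)^-1 : R[i]^o) *: (u (z + h%:C * dir) - u z) - ud z =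
  ((h%:C)^-1 : R[i]^o) *: (u (z + h%:C * dir) - (h%:C : R[i]^o) *: ud z - u z).
  by rewrite [in RHS]addrAC [RHS]scalerBr scalerA mulVf // scale1r.
by rewrite nXZ nmV nm_real mulrC ler_pdivrMr.
Qed.
End MeanValue.

(** * Completeness of the scalars *)

Section CompleteComplex.
Variable R : realType.

Lemma complex_cauchy_cvg (F : set_system (R[i]^o : uniformType)) : ProperFilter F ->
  cauchy F -> cvg F.
Proof.
move=> FF /cauchy_ballP cF.
have aux (f : R[i] -> R) : (forall z w, `|f z - f w| <= nm (z - w)) ->
    exists l, forall e : R, 0 < e -> \forall z \near F, `|f z - l| < e.
  move=> hf.
  have : cauchy (f @ F).
    apply/cauchy_ballP => e e0.
    have e0' : 0 < e%:C :> R[i] by rewrite ltcR.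
    have [[A B] /= [FA FB] AB] := cF _ e0'.
    exists (f @` A, f @` B) => /=.
      by split; [apply: filterS FA => z Az; exists z | apply: filterS FB => z Bz; exists z].
    move=> [_ _] [/= [z Az <-] [w Bw <-]]; rewrite /ball /=.
    apply: le_lt_trans (hf _ _) _.
    by have := AB (z, w) (conj Az Bw); rewrite -ball_normE /= nmE ltcR.
  move=> /cauchy_cvg/cvg_ex[l /cvgrPdist_lt hl]; exists l => e /hl.
  by apply: filterS => z; rewrite distrC.
have [a ha] := aux (@complex.Re R) ltac:(by move=> z w; rewrite -raddfB Re_le_nm).
have [c hc] := aux (@complex.Im R) ltac:(by move=> z w; rewrite -raddfB Im_le_nm).
apply/cvg_ex; exists (a +i* c); apply/(@filter_nX_cvg R _ F _ R[i]^o (fun z => z)) => e e0.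
have e20 : 0 < e / 2 by rewrite divr_gt0.
apply: filterS2 (ha _ e20) (hc _ e20) => z h1 h2; rewrite nX_scalar.
apply: le_lt_trans (nm_le_ReIm _) _; rewrite (splitr e); move: h1 h2; case: z => x y /= h1 h2.
exact: ltrD.
Qed.

(* Not a canonical instance: the library's instance on [GRing.regular] for [realType] is in the way. *)
Definition scalar_space : completeNormedModType R[i]^o :=
  HB.pack R[i]^o (Uniform_isComplete.Build R[i]^o complex_cauchy_cvg).

Lemma cint_exists_scalar (g : R[i] -> R[i]^o) M :
  cSM g -> cule (fun z => nX (g z)) M -> exists v : R[i]^o, cint g v.
Proof. exact: (@cint_exists R scalar_space). Qed.

End CompleteComplex.

(** * Integrals of derivatives and derivatives of convolutions *)

Section Convolution.
Variables (R : realType).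
Local Notation C := R[i].
Local Notation continuous_at := Defs.continuous_at.

Lemma box0_nm (rho0 : R) z : nm z <= rho0 -> box 0 rho0 z.
Proof. by move=> h; rewrite box_snorm subr0 (le_trans (snorm_le_nm _)). Qed.

Lemma cule_support (phi : C -> R) M rho0 : 0 <= M -> 0 <= rho0 ->
  (forall z, phi z <= M) -> (forall z, rho0 < nm z -> phi z <= 0) ->
  cule phi (M * (4 * rho0 ^+ 2)).
Proof.
move=> M0 r0 hM hs; apply: cule_mono (culeZ M0 (cule_box 0 r0)) => z.
have [h|/hs h] := leP (nm z) rho0; first by rewrite box0_nm // mulr1.
by apply: le_trans h _; rewrite mulr_ge0.
Qed.

Variable X : completeNormedModType R[i]^o.

(** By translation invariance each difference quotient integrates to 0; the quotients converge
    uniformly and have supports in a common disc. *)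
Lemma cint_partial0 dir (u ud : C -> X) rho0 : nm dir = 1 -> 0 <= rho0 ->
  C1c dir u ud rho0 -> cint ud 0.
Proof.
move=> dir1 r0 hu; have [cu pu cud us] := hu.
have [M M0 hM] := compact_support_bounded cu (fun z hz => proj1 (us z hz)).
have [v hv] : exists v, cint u v.
  apply: (cint_exists (cSM_cont cu) (M := M * (4 * rho0 ^+ 2))).
  by apply: cule_support => // z /us[-> _]; rewrite nX0.
apply: bint_closed => e e0.
have A0 : 0 < 4 * (rho0 + 1) ^+ 2 by rewrite mulr_gt0 // exprn_gt0 // ltr_pwDr.
have e'0 : 0 < e / (4 * (rho0 + 1) ^+ 2) by rewrite divr_gt0.
have [d d0 hd] := quotient_unif dir1 hu e'0.
(* A step of at most 1/2 keeps the shifted support within radius [rho0 + 1]. *)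
pose h := Num.min (d / 2) (1 / 2 : R).
have h0 : 0 < h by rewrite lt_min !divr_gt0.
have hd' : h < d by rewrite gt_min ltr_pdivrMr // ltr_pMr // ltr1n.
have h1 : h <= 1 by rewrite ge_min; apply/orP; right; lra.
exists (fun p => ((h%:C)^-1 : R[i]^o) *: (u (cx p + h%:C * dir) - u (cx p))), 0; split.
- have := bintZ ((h%:C)^-1 : R[i]^o) (bintB (cint_shift (h%:C * dir) hv) hv).
  by rewrite subrr scaler0.
- have H : cule (fun z => nX (ud z - ((h%:C)^-1 : R[i]^o) *: (u (z + h%:C * dir) - u z)))
    (e / (4 * (rho0 + 1) ^+ 2) * (4 * (rho0 + 1) ^+ 2)).
    apply: cule_support; [exact: ltW|lra| |] => z.
      by rewrite nXB hd // (gtr0_norm h0) h0.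
    move=> hz; have [uz udz] := us z ltac:(lra).
    have [uz' _] := us (z + h%:C * dir) ltac:(
      have := nmBD z (- (h%:C * dir)); rewrite opprK nmN nmM dir1 nm_real (gtr0_norm h0); lra).
    by rewrite uz uz' udz subrr scaler0 subrr nX0.
  by rewrite divfK ?gt_eqF // in H.
- by rewrite subrr nX0 ltW.
Qed.

(** The uniformly small error of the difference quotients of [u] is integrated against the locally
    integrable [k]; once [z] is fixed, all supports lie in one box around 0. *)
Lemma convolution_partial dir (k : C -> R[i]^o) (u ud F G : C -> X) rho0 (B : R -> R) :
  nm dir = 1 -> 0 <= rho0 -> (forall r, 0 < r -> cule (fun w => (box 0 r w)%:R * nm (k w)) (B r)) ->
  C1c dir u ud rho0 -> (forall z, cint (fun w => k w *: u (z + w)) (F z)) ->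
  (forall z, cint (fun w => k w *: ud (z + w)) (G z)) ->
  forall z, has_partial dir F z (G z) /\ continuous_at G z.
Proof.
move=> dir1 r0 hk hu hF hG z; have [cu pu cud us] := hu.
pose r := rho0 + nm z + 2; have rp : 0 < r by have := nm_ge0 z; rewrite /r; lra.
have B1 : 0 < `|B r| + 1 by rewrite ltr_pwDr.
have bd (phi : C -> X) (e : R) : 0 <= e -> (forall w, nX (phi w) <= e) ->
    (forall w, rho0 + 1 < nm (z + w) -> phi w = 0) ->
    cule (fun w => nX (k w *: phi w)) (e * (`|B r| + 1)).
  move=> e0 h1 h2; apply: cule_le (_ : e * B r <= _) _.
    by rewrite ler_wpM2l //; have := ler_norm (B r); lra.
  apply: cule_mono (culeZ e0 (hk r rp)) => w; rewrite nXZ.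
  have [h|h] := leP (nm (z + w)) (rho0 + 1); last first.
    by rewrite h2 // nX0 mulr0 mulr_ge0 // mulr_ge0 ?nm_ge0 // ler0n.
  rewrite box0_nm ?mul1r 1?mulrC ?ler_wpM2r ?nm_ge0 //.
  by have := nmBD w (- z); rewrite opprK nmN (addrC w) /r; lra.
split.
  move=> e e0; have e'0 : 0 < e / (`|B r| + 1) / 2 by rewrite !divr_gt0.
  have [d d0 hd] := quotient_unif dir1 hu e'0.
  exists (Num.min d 1); split; first by rewrite lt_min d0 ltr01.
  move=> h /andP[h0]; rewrite lt_min => /andP[hd' h1]; rewrite nXE ltcR.
  apply: (@le_lt_trans _ _ (e / (`|B r| + 1) / 2 * (`|B r| + 1))); last first.
    by rewrite mulrAC divfK ?gt_eqF //; lra.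
  have H1 := bintB (bintZ ((h%:C)^-1 : R[i]^o) (bintB (hF (z + h%:C * dir)) (hF z))) (hG z).
  apply: bint_norm H1 _.
  have H : cule (fun w => nX (k w *: (((h%:C)^-1 : R[i]^o) *: (u (z + w + h%:C * dir) - u (z + w))
       - ud (z + w)))) (e / (`|B r| + 1) / 2 * (`|B r| + 1)).
    apply: bd; [exact: ltW | by move=> w; apply: hd; rewrite h0 |] => w hw.
    have [uz udz] := us (z + w) ltac:(lra).
    have [uz' _] := us (z + w + h%:C * dir) ltac:(
      have := nmBD (z + w) (- (h%:C * dir)); rewrite opprK nmN nmM dir1 nm_real; lra).
    by rewrite uz uz' udz subrr scaler0 subrr.
  apply: uint_le_mono H => p; rewrite le_eqVlt; apply/orP; left; apply/eqP; congr nX.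
  by rewrite -scalerBr [RHS]scalerBr !scalerA [k _ * _]mulrC addrAC.
apply/continuous_atE => e e0; have e'0 : 0 < e / (`|B r| + 1) / 2 by rewrite !divr_gt0.
have [d d0 hd] := compact_support_unif cud (fun z hz => proj2 (us z hz)) e'0.
exists (Num.min d 1); first by rewrite lt_min d0 ltr01.
move=> z'; rewrite lt_min => /andP[h1 h2].
apply: (@le_lt_trans _ _ (e / (`|B r| + 1) / 2 * (`|B r| + 1))); last first.
  by rewrite mulrAC divfK ?gt_eqF //; lra.
apply: bint_norm (bintB (hG z') (hG z)) _.
have H : cule (fun w => nX (k w *: (ud (z' + w) - ud (z + w)))) (e / (`|B r| + 1) / 2 * (`|B r| + 1)).
  apply: bd; [exact: ltW | |] => w.
    by rewrite ltW // hd // opprD addrACA subrr addr0.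
  move=> hw; have [_ ->] := us (z + w) ltac:(lra).
  have [_ ->] := us (z' + w) ltac:(have := nmBD (z + w) (z - z');
     rewrite (nmB z z') (_ : z + w - (z - z') = z' + w) ?opprB; [lra | ring]).
  by rewrite subrr.
by apply: uint_le_mono H => p; rewrite scalerBr.
Qed.
End Convolution.

Lemma cint_partial0_scalar (R : realType) dir (u ud : R[i] -> R[i]^o) rho0 : nm dir = 1 ->
  0 <= rho0 -> C1c dir u ud rho0 -> cint ud 0.
Proof. exact: (@cint_partial0 R (scalar_space R)). Qed.

(** * The regularizing density and its mass *)

Section Pompeiu.
Variable R : realType.
Local Notation C := R[i].
Local Notation continuous_at := Defs.continuous_at.

(* The d-bar derivative of [u^* / (1 + |u|^2)], a regularization of the Cauchy kernel [1 / u].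
   Its integral [kappa] is pi, but only a lower bound is needed. *)
Definition poisson (u : C) : R := (1 + nm u ^+ 2) ^- 2.
Definition kappa : R := fine (\int[lam2 R]_p (poisson (cx p))%:E).

Lemma poisson_gt0 u : 0 < poisson u.
Proof. by rewrite invr_gt0 exprn_gt0 // ltr_pwDl // exprn_ge0 ?nm_ge0. Qed.

Lemma ccont_conj : ccont (fun z => z^* : R[i]^o).
Proof.
by move=> a e e0; exists e => // a' h; rewrite nX_scalar -rmorphB nm_conj.
Qed.

Lemma poissonE u : (poisson u)%:C = ((1 + u * u^* : C) * (1 + u * u^*))^-1.
Proof. by rewrite -nm2E /poisson -exprVn expr2 rmorphM !fmorphV rmorphD rmorph1 invfM. Qed.

Lemma norm2_neq0 u : 1 + u * u^* != 0 :> C.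
Proof.
rewrite -nm2E (_ : _ + _ = (1 + nm u ^+ 2)%:C) ?fmorph_eq0 ?gt_eqF //; last first.
  by rewrite rmorphD rmorph1.
by rewrite ltr_pwDl // exprn_ge0 ?nm_ge0.
Qed.

Lemma ccont_poisson : ccont (fun u => (poisson u)%:C : R[i]^o).
Proof.
apply/ccontE => z.
have h : continuous_at (fun u => 1 + u * u^* : R[i]^o) z.
  apply: continuous_atD; first exact: continuous_at_cst.
  apply: (continuous_atZ (X := R[i]^o)); first exact: continuous_at_id.
  exact: ((ccontE _).1 ccont_conj).
rewrite (_ : (fun _ => _) = (fun u => ((1 + u * u^*) * (1 + u * u^*))^-1 : R[i]^o)); last first.
  by apply/funext => u; rewrite poissonE.
apply: continuous_atV; first exact: (continuous_atZ (X := R[i]^o)).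
by rewrite mulf_neq0 // norm2_neq0.
Qed.

Lemma measurable_poisson : measurable_fun setT (fun p => poisson (cx p)).
Proof.
have := SM_measurable_nX 0 (cSM_cont ccont_poisson); congr measurable_fun.
by apply/funext => p; rewrite subr0 nX_scalar nm_real ger0_norm // ltW // poisson_gt0.
Qed.

Lemma measurable_cbox (q : R) (c : C) r :
  measurable_fun setT (fun p => q%:E * ((box c r (cx p))%:R : R)%:E)%E.
Proof.
apply: emeasurable_funM; first exact: measurable_cst.
by apply/measurable_EFinP; exact: measurable_fun_box.
Qed.

Lemma int_cbox (q : R) (c : C) r : 0 <= q -> 0 <= r ->
  (\int[lam2 R]_p (q%:E * ((box c r (cx p))%:R : R)%:E) = (q * (4 * r ^+ 2))%:E)%E.
Proof.
move=> q0 r0; rewrite EFinM -(int_box c r0); apply: ge0_integralZl_EFin => //.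
by apply/measurable_EFinP; exact: measurable_fun_box.
Qed.

(** The weight [1 + nm u] is the growth of the error in [cauchy_pompeiu]. Where [snorm u] lies
    between 2^(k-1) and 2^k the integrand is at most 16 / 8^k, on a box of area 4 * 4^k, so the
    layers sum to at most 64 * 2. *)
Lemma cule_poisson : cule (fun u => (1 + nm u) * poisson u) 128.
Proof.
apply: (uint_le_series (psi := fun k p => 16 * (2^-1 ^+ k) ^+ 3 * (box 0 (2 ^+ k) (cx p))%:R)
  (c := fun k => 64 * 2^-1 ^+ k)).
- by move=> k; apply: measurable_funM => //; exact: measurable_fun_box.
- by move=> k p; rewrite !mulr_ge0 // !exprn_ge0 // invr_ge0.
- move=> k; under eq_integral do rewrite EFinM.
  rewrite int_cbox ?exprn_ge0 ?mulr_ge0 ?invr_ge0 ?exprn_ge0 // lee_fin.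
  rewrite exprVn [X in X <= _](_ : _ = 64 * (2 ^+ k)^-1) //.
  by field; rewrite expf_neq0.
- by move=> n; rewrite -mulr_sumr; have := sum_geom2 R n; lra.
apply: aeT_all => p; set u := cx p.
have ex : exists k, snorm u <= 2 ^+ k.
  have [k hk] := half_pow_lt (e := (snorm u + 1)^-1) ltac:(by rewrite invr_gt0 ltr_pwDr ?snorm_ge0).
  exists k; move: hk; rewrite exprVn ltf_pV2 ?posrE ?exprn_gt0 //; last first.
    by rewrite ltr_pwDr ?snorm_ge0.
  lra.
case: (ex_minnP ex) => k hk mink; exists k.+1.
rewrite big_ord_recr /= -[X in X <= _]add0r; apply: lerD.
  by apply: sumr_ge0 => i _; rewrite !mulr_ge0 // !exprn_ge0 // invr_ge0.
rewrite box_snorm subr0 hk mulr1 /poisson exprVn.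
have t0 := nm_ge0 u; set t := nm u in t0 *.
have D0 : 0 < 1 + t ^+ 2 by rewrite ltr_pwDl // exprn_ge0.
rewrite ler_pdivrMr ?exprn_gt0 //.
case: k hk mink => [_ _|k hk mink].
  rewrite expr0 invr1 expr1n mulr1; have := sqr_ge0 (t ^+ 2); have := sqr_ge0 (t - 1); nra.
have tk : 2 ^+ k <= t.
  have : ~~ (snorm u <= 2 ^+ k) by apply/negP => /mink; rewrite ltnn.
  by rewrite -ltNge => h; apply: ltW; apply: lt_le_trans h (snorm_le_nm _).
have m1 : 1 <= 2 ^+ k :> R by rewrite exprn_ege1 // ler1n.
rewrite !(exprS 2 k); set m := 2 ^+ k in tk m1 *.
have m0 : m != 0 by rewrite gt_eqF //; lra.
rewrite (_ : 16 * _ * _ = 16 * (1 + t ^+ 2) ^+ 2 / (2 * m) ^+ 3); last by field.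
rewrite ler_pdivlMr ?exprn_gt0 //; last lra.
have h3 : m ^+ 3 <= t ^+ 3 by rewrite lerXn2r ?nnegrE //; lra.
have m3 : 0 <= m ^+ 3 by rewrite exprn_ge0; lra.
have : (1 + t) * (2 * m) ^+ 3 <= (1 + t) * (8 * t ^+ 3).
  rewrite exprMn ler_wpM2l //; lra.
suff : (1 + t) * (8 * t ^+ 3) <= 16 * (1 + t ^+ 2) ^+ 2 by lra.
have : 0 <= (t ^+ 2 - t) ^+ 2 by exact: sqr_ge0.
have := exprn_ge0 4 t0; have := exprn_ge0 2 t0; nra.
Qed.

Lemma poisson_int_le : (\int[lam2 R]_p (poisson (cx p))%:E <= 128%:E)%E.
Proof.
apply: uint_le_int; [exact: measurable_poisson|by move=> p; rewrite ltW ?poisson_gt0|].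
apply: uint_le_mono cule_poisson => p.
by rewrite ler_peMl ?(ltW (poisson_gt0 _)) // lerDl nm_ge0.
Qed.

Lemma kappa_cint (X : normedModType R[i]^o) (y : X) :
  cint (fun u => ((poisson u)%:C : R[i]^o) *: y) ((kappa%:C : R[i]^o) *: y).
Proof.
apply: bint_real (poisson_int_le); first exact: measurable_poisson.
by move=> p; rewrite ltW ?poisson_gt0.
Qed.

(** A step function below [poisson]: 1/9 on the box of half-side 1, where |u|^2 <= 2, raised to 4/9
    on the box of half-side 1/2, where |u|^2 <= 1/2. The areas 4 and 1 give 4/9 + 3/9. *)
Lemma kappa_ge : 7 / 9 <= kappa.
Proof.
have fin : (\int[lam2 R]_p (poisson (cx p))%:E)%E \is a fin_num.
  rewrite ge0_fin_numE; first by apply: le_lt_trans poisson_int_le _; rewrite ltry.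
  by apply: integral_ge0 => p _; rewrite lee_fin ltW ?poisson_gt0.
rewrite -lee_fin fineK //.
have E : (\int[lam2 R]_p ((1 / 9)%:E * ((box 0 1 (cx p))%:R : R)%:E +
    (1 / 3)%:E * ((box 0 (1 / 2) (cx p))%:R : R)%:E) = (7 / 9 : R)%:E)%E.
  rewrite ge0_integralD //; try by
    [exact: measurable_cbox | move=> p _; rewrite mule_ge0 // lee_fin; lra].
  by rewrite !int_cbox ?divr_ge0 // -EFinD; congr (_%:E); field.
apply: le_trans (_ : ((7 / 9 : R)%:E <= _)%E) _; first by rewrite -E.
apply: ge0_le_integral => //.
- by move=> p _; rewrite adde_ge0 // mule_ge0 // lee_fin; lra.
- by apply: emeasurable_funD; exact: measurable_cbox.
- by apply/measurable_EFinP; exact: measurable_poisson.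
move=> p _; rewrite -!EFinM -EFinD lee_fin {fin E}; set u := cx p.
have hb r : box 0 r u -> 0 <= r -> nm u ^+ 2 <= 2 * r ^+ 2.
  rewrite /box subr0 nm_sqr => /andP[h1 h2] r0.
  have : `|complex.Re u| ^+ 2 <= r ^+ 2 by rewrite lerXn2r ?nnegrE.
  have : `|complex.Im u| ^+ 2 <= r ^+ 2 by rewrite lerXn2r ?nnegrE.
  by rewrite !real_normK ?num_real; lra.
have t0 : 0 <= nm u ^+ 2 by rewrite exprn_ge0 ?nm_ge0.
have key q : 0 < q -> 1 + nm u ^+ 2 <= q -> q ^- 2 <= poisson u.
  move=> q0 hq; have D0 : 0 < 1 + nm u ^+ 2 by lra.
  by rewrite /poisson lef_pV2 ?posrE ?exprn_gt0 // lerXn2r ?nnegrE ?(ltW D0) // ltW.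
have p0 := ltW (poisson_gt0 u).
have [h2|h2] := boolP (box 0 (1 / 2) u).
  have h1 : box 0 1 u.
    by move: h2; rewrite !box_snorm => h; apply: le_trans h _; lra.
  have := hb _ h2 ltac:(lra); rewrite h1 => hu.
  have := key (3 / 2) ltac:(lra) ltac:(lra).
  rewrite (_ : (3 / 2) ^- 2 = 4 / 9 :> R); first by rewrite mulr1 /=; lra.
  by field.
have [h1|h1] := boolP (box 0 1 u); last by rewrite !mulr0 addr0.
have := key 3 ltac:(lra) ltac:(have := hb _ h1; lra).
by rewrite mulr1 mulr0 addr0 -exprVn expr2 => h; apply: le_trans h; lra.
Qed.
End Pompeiu.

(** * The regularized Cauchy kernel *)

Section Pompeiu.
Variable R : realType.
Local Notation C := R[i].
Local Notation continuous_at := Defs.continuous_at.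

Lemma partial_id dir (a z : C) : has_partial dir (fun w => w - a : R[i]^o) z dir.
Proof.
move=> e e0; exists 1; split => // h /andP[h0 _]; rewrite nXE ltcR.
have hn : h%:C != 0 :> C by rewrite fmorph_eq0 -normr_gt0.
rewrite (_ : _ - dir = 0) ?nX0 //.
rewrite (_ : z + h%:C * dir - a - (z - a) = h%:C * dir); last by ring.
by rewrite /GRing.scale /= mulKf // subrr.
Qed.

Lemma partial_conj dir (f : C -> R[i]^o) z v : has_partial dir f z v ->
  has_partial dir (fun w => (f w)^* : R[i]^o) z (v^*).
Proof.
move=> hf e e0; have [d [d0 hd]] := hf e e0; exists d; split => // h /hd.
rewrite !nXE !ltcR !nX_scalar; congr (_ < _); rewrite -nm_conj; congr nm.
rewrite /GRing.scale /= rmorphB rmorphM rmorphB fmorphV; congr (_^-1 * _ - _).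
by rewrite /=; congr (_ +i* _); rewrite oppr0.
Qed.

Lemma partial_cst (X : normedModType R[i]^o) dir (a : X) z : has_partial dir (fun=> a) z 0.
Proof.
by move=> e e0; exists 1; split => // h _; rewrite subrr scaler0 subrr normr0 ltcR.
Qed.

Variable eta : R.
Hypothesis eta0 : 0 < eta.
Variable a : C.

Definition regden w : C := (w - a) * (w - a)^* + (eta ^+ 2)%:C.
(** Tends to 1 / (w - a) as [eta] tends to 0 and is C^1 on the whole plane, so the disc usually cut
    out around [a] is replaced by a limit in [eta]. *)
Definition regker w : C := (w - a)^* / regden w.

Lemma regdenE w : regden w = (nm (w - a) ^+ 2 + eta ^+ 2)%:C.
Proof. by rewrite [RHS]rmorphD /= nm2E. Qed.

Lemma regden_gt0 w : 0 < nm (w - a) ^+ 2 + eta ^+ 2.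
Proof. by rewrite ltr_wpDl ?exprn_gt0 // exprn_ge0 ?nm_ge0. Qed.

Lemma regden_neq0 w : regden w != 0.
Proof. by rewrite regdenE fmorph_eq0 gt_eqF // regden_gt0. Qed.

Lemma partial_regden dir w : has_partial dir (regden : C -> R[i]^o) w
  (dir * (w - a)^* + (w - a) * dir^*).
Proof.
have h1 := partial_id dir a w.
by have := partialD (partialZ h1 (partial_conj h1)) (partial_cst dir ((eta ^+ 2)%:C : R[i]^o) w);
   rewrite addr0.
Qed.

Definition dregker dir w : C :=
  dir^* / regden w - (w - a)^* * (dir * (w - a)^* + (w - a) * dir^*) / regden w ^+ 2.

Lemma partial_regker dir w : has_partial dir (regker : C -> R[i]^o) w (dregker dir w).
Proof.
have h := partialZ (partial_conj (partial_id dir a w))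
  (partialV (regden_neq0 w) (partial_regden dir w)).
by move: h; congr has_partial; rewrite /dregker /GRing.scale /= mulNr mulrN mulrA.
Qed.

Lemma ccont_sub : ccont (fun w => w - a : R[i]^o).
Proof. by apply/ccontE => z; apply: continuous_atD; [exact: continuous_at_id|exact: continuous_at_cst]. Qed.

Lemma continuous_at_conj (f : C -> R[i]^o) z : continuous_at f z ->
  continuous_at (fun w => (f w)^* : R[i]^o) z.
Proof.
move=> /continuous_atE hf; apply/continuous_atE => e /hf[d d0 hd]; exists d => // w /hd.
by rewrite !nX_scalar -rmorphB nm_conj.
Qed.

Lemma continuous_at_sub z : continuous_at (fun w => w - a : R[i]^o) z.
Proof. exact: ((ccontE _).1 ccont_sub). Qed.

Lemma continuous_at_regden z : continuous_at (regden : C -> R[i]^o) z.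
Proof.
apply: (continuous_atD (X := R[i]^o)); last exact: continuous_at_cst.
by apply: (continuous_atZ (X := R[i]^o)); [|apply: continuous_at_conj]; exact: continuous_at_sub.
Qed.

Lemma continuous_at_regker z : continuous_at (regker : C -> R[i]^o) z.
Proof.
apply: (continuous_atZ (X := R[i]^o)); first by apply: continuous_at_conj; exact: continuous_at_sub.
by apply: continuous_atV (regden_neq0 z); exact: continuous_at_regden.
Qed.

Lemma continuous_at_dregker dir z : continuous_at (dregker dir : C -> R[i]^o) z.
Proof.
have cV := continuous_atV (continuous_at_regden z) (regden_neq0 z).
have cB := continuous_at_conj (continuous_at_sub z).
have cst (c : R[i]^o) := continuous_at_cst c z.
apply: (continuous_atD (X := R[i]^o)); first exact: (continuous_atZ (X := R[i]^o)).
rewrite (_ : (fun _ => _) = fun w => (- (w - a)^* : R[i]^o) *: (((dir : R[i]^o) *: ((w - a)^* : R[i]^o) +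
   (w - a : R[i]^o) *: (dir^* : R[i]^o)) *: ((regden w)^-1 *: ((regden w)^-1 : R[i]^o)))); last first.
  by apply/funext => w; rewrite /GRing.scale /= expr2 invfM; ring.
apply: (continuous_atZ (X := R[i]^o)).
  rewrite (_ : (fun _ => _) = fun w => (-1 : R[i]^o) *: ((w - a)^* : R[i]^o)).
    exact: (continuous_atZ (X := R[i]^o)).
  by apply/funext => w; rewrite scaleN1r.
apply: (continuous_atZ (X := R[i]^o)); last exact: (continuous_atZ (X := R[i]^o)).
apply: (continuous_atD (X := R[i]^o)); first exact: (continuous_atZ (X := R[i]^o)).
by apply: (continuous_atZ (X := R[i]^o)); [exact: continuous_at_sub|].
Qed.

(** With i^2 = -1 the terms in the square of the conjugate cancel; what remains is 1/D - |w - a|^2 /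
    D^2, where D is [regden]. *)
Lemma dregker_dbar w : (dregker 1 w + 'i%C * dregker 'i%C w) / 2 = (eta ^+ 2)%:C / regden w ^+ 2.
Proof.
have ci : Num.conj ('i%C : C) = - 'i%C.
  by apply/eqP; rewrite eq_complex /= oppr0 !eqxx.
have c1 : Num.conj (1 : C) = 1 by apply/eqP; rewrite eq_complex /= oppr0 !eqxx.
rewrite /dregker ci c1.
have : 'i%C * 'i%C = -1 :> C by apply/eqP; rewrite eq_complex /= !mul0r !mul1r !sub0r oppr0 !addr0 !eqxx.
have n0 := regden_neq0 w; move: ('i%C : C) => I hI.
have -> : (eta ^+ 2)%:C = regden w - (w - a) * (w - a)^* by rewrite /regden addrC addKr.
move: n0; set D := regden w; set z := w - a; set z' := z^* => n0.
rewrite (_ : _ + _ = ((1 - I * I) / D - z' * (z' + z + I * I * z' - I * I * z) / D ^+ 2)); last first.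
  by field.
by rewrite hI; field.
Qed.

Lemma nm_regker_sub w : w != a ->
  nm ((w - a)^-1 - regker w) = eta ^+ 2 / (nm (w - a) * (nm (w - a) ^+ 2 + eta ^+ 2)).
Proof.
rewrite -subr_eq0 => wa; have n0 := regden_neq0 w.
have -> : (w - a)^-1 - regker w = (eta ^+ 2)%:C / ((w - a) * regden w).
  have -> : (eta ^+ 2)%:C = regden w - (w - a) * (w - a)^* by rewrite /regden addrC addKr.
  by rewrite /regker; move: wa n0; set D := regden w; set z := w - a; set z' := z^* => wa n0;
    field; rewrite wa n0.
rewrite [LHS]nmM nmV nmM regdenE !nm_real !ger0_norm //; last exact: sqr_ge0.
exact: ltW (regden_gt0 w).
Qed.
End Pompeiu.

(** * The Cauchy-Pompeiu formula *)

Section CauchyPompeiu.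
Variable R : realType.
Local Notation C := R[i].
Local Notation continuous_at := Defs.continuous_at.

Lemma C1c_regker dir (u ud : C -> R[i]^o) rho0 eta a : 0 < eta -> C1c dir u ud rho0 ->
  C1c dir (fun w => u w * regker eta a w : R[i]^o)
    (fun w => ud w * regker eta a w + u w * dregker eta a dir w : R[i]^o) rho0.
Proof.
move=> eta0 [/ccontE cu pu /ccontE cud us]; split.
- by apply/ccontE => z; apply: (continuous_atZ (X := R[i]^o)) => //; exact: continuous_at_regker.
- by move=> z; exact: partialZ (pu z) (partial_regker eta0 a dir z).
- apply/ccontE => z; apply: (continuous_atD (X := R[i]^o)).
    by apply: (continuous_atZ (X := R[i]^o)) => //; exact: continuous_at_regker.
  by apply: (continuous_atZ (X := R[i]^o)) => //; exact: continuous_at_dregker.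
- by move=> z /us[-> ->]; rewrite !mul0r addr0.
Qed.

Lemma C1c_dbar (psi psix psiy : C -> R[i]^o) rho0 :
  C1c 1 psi psix rho0 -> C1c 'i%C psi psiy rho0 ->
  ccont (fun w => (psix w + 'i%C * psiy w) / 2 : R[i]^o) /\
  forall w, rho0 < nm w -> (psix w + 'i%C * psiy w) / 2 = 0.
Proof.
move=> [_ _ /ccontE cx hx] [_ _ /ccontE cy hy]; split; last first.
  by move=> w hw; have [_ ->] := hx w hw; have [_ ->] := hy w hw; rewrite mulr0 addr0 mul0r.
apply/ccontE => z; apply: (continuous_atZ (X := R[i]^o)); last exact: continuous_at_cst.
apply: (continuous_atD (X := R[i]^o)) => //.
by apply: (continuous_atZ (X := R[i]^o)) => //; exact: continuous_at_cst.
Qed.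

(** The d-bar derivative of the compactly supported product of [psi] and [regker] integrates to 0;
    the term in which the kernel is differentiated becomes an average of [psi] against [poisson]
    after w = eta u + a. *)
Lemma regularized_pompeiu (psi psix psiy : C -> R[i]^o) rho0 eta a : 0 <= rho0 -> 0 < eta ->
  C1c 1 psi psix rho0 -> C1c 'i%C psi psiy rho0 ->
  exists v : R[i]^o, cint (fun w => (psix w + 'i%C * psiy w) / 2 * regker eta a w : R[i]^o) v /\
    cint (fun u => ((poisson u)%:C : R[i]^o) *: psi (eta%:C * u + a)) (- v).
Proof.
move=> r0 eta0 h1 hi; have [cd d0] := C1c_dbar h1 hi.
have cont : ccont (fun w => (psix w + 'i%C * psiy w) / 2 * regker eta a w : R[i]^o).
  move/ccontE: cd => cd; apply/ccontE => z; apply: (continuous_atZ (X := R[i]^o)) => //.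
  exact: continuous_at_regker.
have z0 w : rho0 < nm w -> (psix w + 'i%C * psiy w) / 2 * regker eta a w = 0 :> R[i]^o.
  by move/d0 => ->; rewrite mul0r.
have [M M0 hM] := compact_support_bounded cont z0.
have [v hv] : exists v, cint (fun w => (psix w + 'i%C * psiy w) / 2 * regker eta a w : R[i]^o) v.
  apply: (cint_exists_scalar (cSM_cont cont) (M := M * (4 * rho0 ^+ 2))).
  by apply: cule_support => // w /z0 ->; rewrite nX0.
exists v; split => //.
have i1 : nm 1 = 1 :> R by exact: nm1.
have H1 := cint_partial0_scalar i1 r0 (C1c_regker a eta0 h1).
have Hi := cint_partial0_scalar (nm_i R) r0 (C1c_regker a eta0 hi).
have H := bintB (bintZ (2^-1 : R[i]^o) (bintD H1 (bintZ ('i%C : R[i]^o) Hi))) hv.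
have H2 : cint (fun w => psi w * ((eta ^+ 2)%:C / regden eta a w ^+ 2) : R[i]^o) (- v).
  move: H; rewrite scaler0 addr0 scaler0 sub0r; apply: bint_ext => p.
  rewrite -dregker_dbar // /GRing.scale /=.
  by move: ('i%C : C) (dregker _ _ 1 _) (dregker _ _ 'i%C _) => I k1 k2; field.
have := bintZ ((eta ^+ 2)%:C : R[i]^o) (cint_affine a eta0 H2).
rewrite scalerA -rmorphM (_ : eta ^+ 2 * (eta^-1 * eta^-1) = 1) ?scale1r; last first.
  by field; rewrite gt_eqF.
apply: bint_ext => p; set u := cx p; rewrite regdenE addrK nmM nm_real /poisson.
have q0 : 0 < 1 + nm u ^+ 2 by rewrite ltr_pwDl // exprn_ge0 ?nm_ge0.
rewrite exprMn real_normK ?num_real //.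
rewrite (_ : _ + eta ^+ 2 = eta ^+ 2 * (1 + nm u ^+ 2)); last by ring.
move: q0; set q := 1 + _ => q0; rewrite fmorphV !rmorphXn rmorphM rmorphXn /GRing.scale /=.
have qn : q%:C != 0 :> C by rewrite fmorph_eq0 gt_eqF.
have en : eta%:C != 0 :> C by rewrite fmorph_eq0 gt_eqF.
by field; rewrite qn en.
Qed.

Lemma cauchy_pompeiu (psi psix psiy : C -> R[i]^o) rho0 : 0 <= rho0 ->
  C1c 1 psi psix rho0 -> C1c 'i%C psi psiy rho0 -> forall a,
  cint (fun w => (psix w + 'i%C * psiy w) / 2 / (w - a) : R[i]^o) (- ((kappa R)%:C * psi a)).
Proof.
move=> r0 h1 hi a; have [cd d0] := C1c_dbar h1 hi.
have [cpsi _ _ psi0] := h1.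
have [M2 M20 hM2] := compact_support_bounded cd d0.
have [M M0 hM] := compact_support_bounded cpsi (fun z hz => proj1 (psi0 z hz)).
apply: bint_closed => e e0.
have e10 : 0 < e / 128 by rewrite divr_gt0.
have [del del0 hdel] := cpsi a _ e10.
pose B := (M2 + 1) * (12 + 4 * rho0 ^+ 2).
have B0 : 0 < B by rewrite mulr_gt0 //; have := sqr_ge0 rho0; lra.
pose A := (2 * M + 1) / del.
have A0 : 0 < A by rewrite divr_gt0 //; lra.
(* The regularization parameter is s^2. Where |w - a| <= s the kernel error is at most 1 / |w - a|,
   of integral 12 s; elsewhere it is at most s^4 / s^3 = s. *)
pose s := Num.min 1 (Num.min (e / B) (e / 128 / A)).
have s0 : 0 < s by rewrite !lt_min ltr01 (divr_gt0 e0 B0) (divr_gt0 e10 A0).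
have s1 : s <= 1 by rewrite ge_min lexx.
have sB : s * B <= e by rewrite -ler_pdivlMr // !ge_min lexx orbT.
have sA : s * A <= e / 128 by rewrite -ler_pdivlMr // !ge_min lexx !orbT.
have eta0 : 0 < s ^+ 2 by rewrite exprn_gt0.
have [v [hv hv']] := regularized_pompeiu a r0 eta0 h1 hi.
exists (fun p => (psix (cx p) + 'i%C * psiy (cx p)) / 2 * regker (s ^+ 2) a (cx p) : R[i]^o), v.
split => //.
  have H : cule (fun w => M2 * ((box a s w)%:R / nm (w - a) + s * (box 0 rho0 w)%:R))
      (M2 * (12 * s + s * (4 * rho0 ^+ 2))).
    by apply: culeZ => //; apply: culeD (cule_kernel _ _ s0) (culeZ (ltW s0) (cule_box _ r0)).
  have H' := cule_le (_ : _ <= e) H.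
  apply: uint_le_mono (H' _) => [p|]; last first.
    by apply: le_trans sB; rewrite /B; have := sqr_ge0 rho0; nra.
  set w := cx p; rewrite -mulrBr nX_scalar nmM.
  have [hw|hw] := leP (nm w) rho0; last first.
    rewrite d0 // nm0 mul0r mulr_ge0 // addr_ge0 ?mulr_ge0 ?invr_ge0 ?nm_ge0 ?ler0n //.
    exact: ltW.
  apply: ler_pM; rewrite ?nm_ge0 //; first by rewrite -nX_scalar.
  have [->|wa] := eqVneq w a.
    by rewrite /regker subrr rmorph0 mul0r invr0 subrr nm0 invr0 mulr0 add0r mulr_ge0 ?ler0n // ltW.
  rewrite nm_regker_sub // box0_nm // mulr1; set t := nm (w - a).
  have t0 : 0 < t by rewrite nm_gt0 subr_eq0.
  have D0 : 0 < t ^+ 2 + s ^+ 2 ^+ 2 by rewrite ltr_wpDl ?exprn_gt0 // ltW // exprn_gt0.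
  have [ht|ht] := leP t s.
    rewrite box_snorm (le_trans (snorm_le_nm _) ht) mul1r -[X in X <= _]addr0 lerD ?(ltW s0) //.
    rewrite ler_pdivrMr ?mulr_gt0 // mulKf ?gt_eqF // lerDr.
    by rewrite exprn_ge0 // ltW.
  apply: (@le_trans _ _ s); last by rewrite lerDr mulr_ge0 ?ler0n // invr_ge0 ltW.
  rewrite ler_pdivrMr ?mulr_gt0 //.
  have h2 : s ^+ 2 <= t ^+ 2 by rewrite lerXn2r ?nnegrE ?ltW.
  have h3 : s * s ^+ 2 <= t * t ^+ 2 by exact: ler_pM (ltW s0) (sqr_ge0 s) (ltW ht) h2.
  have h4 : 0 <= s ^+ 2 ^+ 2 by rewrite exprn_ge0 // exprn_ge0 // ltW.
  rewrite mulrDr mulrDr -[X in X <= _]addr0 lerD //; last by rewrite !mulr_ge0 // ltW.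
  by rewrite exprnP in h3 *; nra.
rewrite -nXN opprD opprK.
have K := kappa_cint (psi a : R[i]^o).
suff H : cule (fun u => nX (((poisson u)%:C : R[i]^o) *: psi ((s ^+ 2)%:C * u + a) -
    ((poisson u)%:C : R[i]^o) *: psi a)) e by exact: bint_dist hv' K H.
have H := culeZ (ltW e10) (cule_poisson R); rewrite divfK // in H.
apply: cule_mono H => u; rewrite -scalerBr nXZ nm_real ger0_norm ?(ltW (poisson_gt0 _)) //.
rewrite mulrA [X in _ <= X]mulrC ler_wpM2l ?(ltW (poisson_gt0 _)) //.
have u0 := nm_ge0 u.
(* Near [a] the continuity of [psi] applies; beyond [del] the bound 2 M is at most a multiple of
   |s^2 u| / del, absorbed by the weight in [cule_poisson]. *)
have [hu|hu] := ltP (nm ((s ^+ 2)%:C * u)) del.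
  apply: le_trans (ltW (hdel _ _)) _; first by rewrite addrK.
  by rewrite ler_peMr ?(ltW e10) // lerDl.
have : nX (psi ((s ^+ 2)%:C * u + a) - psi a) <= nX (psi ((s ^+ 2)%:C * u + a)) + nX (psi a).
  by rewrite -(nXN (psi a)) nXD.
move/le_trans; apply.
have hs : nm ((s ^+ 2)%:C * u) <= s * nm u.
  by rewrite nmM nm_real (ger0_norm (ltW eta0)) ler_wpM2r // expr2 ler_piMl // ltW.
have := hM ((s ^+ 2)%:C * u + a); have := hM a => ? ?.
apply: (@le_trans _ _ (s * A * nm u)); last first.
  by rewrite mulrDr mulr1 ler_wpDl ?(ltW e10) // ler_wpM2r.
rewrite mulrAC /A mulrCA; apply: (@le_trans _ _ ((2 * M + 1) * (del / del))).
  by rewrite divff ?gt_eqF //; lra.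
rewrite ler_wpM2l //; first lra.
by rewrite ler_wpM2r ?invr_ge0 ?(ltW del0) //; apply: le_trans hu _.
Qed.
End CauchyPompeiu.

(** * Holomorphic functions on the disc and their locally uniform limits *)

Section Holomorphic.
Variable R : realType.
Local Notation C := R[i].
Local Notation continuous_at := Defs.continuous_at.

(** Complex differentiability as C^1 together with the Cauchy-Riemann equations, the form that the
    d-bar operator can use. *)
Definition holo (g dg : C -> R[i]^o) := forall z, nm z < 1 ->
  [/\ has_partial 1 g z (dg z), has_partial 'i%C g z ('i%C * dg z),
      continuous_at g z & continuous_at dg z].

Lemma holo_cst (a : C) : holo (fun=> a : R[i]^o) (fun=> 0).
Proof.
move=> z _; split; try exact: continuous_at_cst; first exact: partial_cst.
by rewrite mulr0; exact: partial_cst.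
Qed.

Lemma holo_id : holo (fun z => z : R[i]^o) (fun=> 1).
Proof.
have h dir z : has_partial dir (fun z => z : R[i]^o) z dir.
  by apply: (partial_ext (d := 1)) (partial_id dir 0 z) => // w _; rewrite subr0.
move=> z _; split; [exact: h| by rewrite mulr1; exact: h| exact: continuous_at_id|].
exact: continuous_at_cst.
Qed.

Lemma holoD f df g dg : holo f df -> holo g dg ->
  holo (fun z => f z + g z) (fun z => df z + dg z).
Proof.
move=> hf hg z hz; have [f1 f2 f3 f4] := hf z hz; have [g1 g2 g3 g4] := hg z hz.
split; [exact: partialD| | exact: continuous_atD | exact: continuous_atD].
by rewrite mulrDr; exact: partialD.
Qed.

Lemma holoM f df g dg : holo f df -> holo g dg ->
  holo (fun z => f z * g z : R[i]^o) (fun z => df z * g z + f z * dg z : R[i]^o).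
Proof.
move=> hf hg z hz; have [f1 f2 f3 f4] := hf z hz; have [g1 g2 g3 g4] := hg z hz.
split; [exact: partialZ| | exact: (continuous_atZ (X := R[i]^o))|].
  by rewrite mulrDr mulrA mulrCA; exact: partialZ.
by apply: continuous_atD; exact: (continuous_atZ (X := R[i]^o)).
Qed.

Lemma holoV f df : holo f df -> (forall z, nm z < 1 -> f z != 0) ->
  holo (fun z => (f z)^-1 : R[i]^o) (fun z => - df z / f z ^+ 2 : R[i]^o).
Proof.
move=> hf nf z hz; have [f1 f2 f3 f4] := hf z hz; have fz := nf z hz.
split; [exact: partialV| | exact: continuous_atV |].
  by rewrite mulrA mulrN; exact: partialV.
have cV := continuous_atV f3 fz.
rewrite (_ : (fun _ => _) = fun w => ((-1 : R[i]^o) *: df w) *: ((f w)^-1 *: (f w)^-1 : R[i]^o)).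
  apply: (continuous_atZ (X := R[i]^o)); last exact: (continuous_atZ (X := R[i]^o)).
  by apply: (continuous_atZ (X := R[i]^o)) => //; exact: continuous_at_cst.
by apply/funext => w; rewrite /GRing.scale /= mulN1r -expr2 exprVn.
Qed.

(** An infinite product is known through its partial products; uniform closeness on smaller discs is
    what passes to the limit in the Cauchy-Pompeiu formula. *)
Definition holo_lim (f : C -> C) := forall r e : R, r < 1 -> 0 < e ->
  exists g dg, holo g dg /\ forall z, nm z <= r -> nm (f z - g z) <= e.

(** [f] is controlled only inside the disc, but the cutoff lives in radius [r < 1], so the product
    vanishes identically near every point with [1 <= nm z]. *)
Lemma C1c_mul dir (chi chid f fd : C -> R[i]^o) r : r < 1 -> C1c dir chi chid r ->
  (forall z, nm z < 1 -> [/\ has_partial dir f z (fd z), continuous_at f z & continuous_at fd z]) ->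
  C1c dir (fun z => chi z * f z : R[i]^o) (fun z => chid z * f z + chi z * fd z : R[i]^o) r.
Proof.
move=> r1 [/ccontE cc pc /ccontE cd z0] hf.
have far (F : C -> R[i]^o) z : 1 <= nm z -> (forall w, r < nm w -> F w = 0) ->
    continuous_at F z /\ has_partial dir F z 0.
  move=> hz hF; have d0 : 0 < 1 - r by rewrite subr_gt0.
  have h w : nm (w - z) < 1 - r -> 0 = F w :> R[i]^o.
    by move=> hw; rewrite hF //; have := nmBD z w; rewrite (nmB z); lra.
  split; first by apply: (continuous_at_ext d0 h); exact: continuous_at_cst.
  by apply: (partial_ext d0 h); exact: partial_cst.
have zM z : r < nm z -> chi z * f z = 0 :> R[i]^o by move=> /z0[-> _]; rewrite mul0r.
have zD z : r < nm z -> chid z * f z + chi z * fd z = 0 :> R[i]^o.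
  by move=> /z0[-> ->]; rewrite !mul0r addr0.
split.
- apply/ccontE => z; have [/(far _ z)/(_ zM)[]//|h] := leP 1 (nm z).
  by have [_ ? _] := hf z h; exact: (continuous_atZ (X := R[i]^o)).
- move=> z; have [h|h] := leP 1 (nm z).
    have [_] := far _ z h zM; rewrite zD //; exact: lt_le_trans h.
  by have [? _ _] := hf z h; exact: partialZ (pc z) _.
- apply/ccontE => z; have [/(far _ z)/(_ zD)[]//|h] := leP 1 (nm z).
  have [_ ? ?] := hf z h.
  by apply: continuous_atD; exact: (continuous_atZ (X := R[i]^o)).
- by move=> z h; rewrite zM ?zD.
Qed.

(** For holomorphic f the d-bar derivative of chi f is (d-bar chi) f. A limit [f] is replaced by an
    approximant on the support of chi; [B] collects the error in the integral and the one in the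
    value at [a]. *)
Lemma pompeiu_holo (chi chix chiy : C -> R[i]^o) f r a : 0 <= r -> r < 1 ->
  C1c 1 chi chix r -> C1c 'i%C chi chiy r -> holo_lim f ->
  cint (fun w => (chix w + 'i%C * chiy w) / 2 * f w / (w - a) : R[i]^o)
    (- ((kappa R)%:C * (chi a * f a))).
Proof.
move=> r0 r1 h1 hi hf; apply: bint_closed => e e0.
have [cd d0] := C1c_dbar h1 hi.
have [M M0 hM] := compact_support_bounded cd d0.
have [Mc Mc0 hMc] := compact_support_bounded (let: And4 c _ _ _ := h1 in c)
  (fun z hz => proj1 ((let: And4 _ _ _ c := h1 in c) z hz)).
have k0 : 0 <= kappa R by apply: le_trans (kappa_ge R); lra.
pose B := M * (12 * (r + 1)) + kappa R * Mc + 1.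
have B1 : M * (12 * (r + 1)) <= B by rewrite /B; nra.
have B2 : kappa R * Mc <= B by rewrite /B; nra.
have B0 : 0 < B by rewrite /B; nra.
pose e' := e / B; have e'0 : 0 < e' by rewrite divr_gt0.
have [g [dg [hg fg]]] := hf r _ r1 e'0.
have hg1 z : nm z < 1 -> [/\ has_partial 1 g z (dg z), continuous_at g z & continuous_at dg z].
  by move=> /hg[].
have hgi z : nm z < 1 -> [/\ has_partial 'i%C g z ('i%C * dg z), continuous_at g z &
    continuous_at (fun z => 'i%C * dg z : R[i]^o) z].
  move=> /hg[_ ? ? ?]; split => //; apply: (continuous_atZ (X := R[i]^o)) => //.
  exact: continuous_at_cst.
have H := cauchy_pompeiu r0 (C1c_mul r1 h1 hg1) (C1c_mul r1 hi hgi) a.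
do 2 eexists; split; first exact: H.
  have := culeZ (mulr_ge0 M0 (ltW e'0)) (cule_kernel a 0 (ltr_wpDl r0 ltr01 : 0 < r + 1)).
  move/(cule_le (_ : _ <= e)) => H'; apply: uint_le_mono (H' _) => [p|]; last first.
    by rewrite mulrAC /e' mulrA ler_pdivrMr // mulrC ler_wpM2l ?(ltW e0).
  set w := cx p; rewrite nX_scalar.
  have i2 : 'i%C * 'i%C = -1 :> C.
    by apply/eqP; rewrite eq_complex /= !mul0r !mul1r !sub0r oppr0 !addr0 !eqxx.
  rewrite (_ : _ - _ = ((chix w + 'i%C * chiy w) / 2) * (f w - g w) * (w - a)^-1); last first.
    move: i2; move: ('i%C : C) (chix w) (chiy w) (chi w) (f w) (g w) (dg w) (w - a)^-1.
    move=> I cx' cy c fw gw dw q i2.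
    rewrite (_ : cx' * gw + c * dw + I * (cy * gw + c * (I * dw)) =
       (cx' + I * cy) * gw + (1 + I * I) * c * dw); last by ring.
    by rewrite i2 addrN !mul0r addr0; ring.
  rewrite nmM nmV nmM mulrA; apply: ler_wpM2r; first by rewrite invr_ge0 nm_ge0.
  have [hw|hw] := leP (nm w) r; last first.
    by rewrite d0 // nm0 mul0r mulr_ge0 ?ler0n // mulr_ge0 // ltW.
  rewrite box0_nm ?mulr1; last by lra.
  by apply: ler_pM; rewrite ?nm_ge0 ?fg // -nX_scalar.
rewrite nX_scalar opprK addrC -mulrBr -mulrBr nmM nmM nm_real ger0_norm //.
have [ha|ha] := leP (nm a) r; last first.
  have [_ _ _ hz] := h1; have [-> _] := hz a ha.
  by rewrite nm0 mul0r mulr0 ltW.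
apply: (@le_trans _ _ (kappa R * Mc * e')); last first.
  by rewrite /e' mulrA ler_pdivrMr // mulrC ler_wpM2l ?(ltW e0).
rewrite -mulrA ler_wpM2l // ler_pM ?nm_ge0 ?fg //.
by rewrite -nX_scalar.
Qed.
End Holomorphic.

(** * A C^1 cutoff function *)

Section Bump.
Variable R : realType.
Local Notation C := R[i].
Local Notation continuous_at := Defs.continuous_at.

Definition pos2 (t : R) : R := Num.max 0 t ^+ 2.

Lemma pos2_taylor (t k : R) : `|pos2 (t + k) - pos2 t - 2 * Num.max 0 t * k| <= k ^+ 2.
Proof.
rewrite /pos2; case: (leP 0 t) => ht; case: (leP 0 (t + k)) => hk.
- by rewrite (_ : _ - _ = k ^+ 2) ?ger0_norm ?sqr_ge0 //; ring.
- by rewrite ler_norml; apply/andP; split; nra.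
- by rewrite ler_norml; apply/andP; split; nra.
- by rewrite (_ : _ - _ = 0) ?normr0 ?sqr_ge0 //; ring.
Qed.

Lemma has_partial_real dir (s : C -> R) z (s' : R) :
  has_partial dir (fun w => (s w)%:C : R[i]^o) z s'%:C <->
  forall e : R, 0 < e -> exists2 d : R, 0 < d & forall h : R, 0 < `|h| < d ->
    `|h^-1 * (s (z + h%:C * dir) - s z) - s'| < e.
Proof.
have E h : `|(h%:C^-1 : R[i]^o) *: ((s (z + h%:C * dir))%:C - (s z)%:C) - s'%:C| =
    `|h^-1 * (s (z + h%:C * dir) - s z) - s'|%:C.
  rewrite (_ : _ - s'%:C = (h^-1 * (s (z + h%:C * dir) - s z) - s')%:C).
    by rewrite [LHS]nmE nm_real.
  by rewrite /GRing.scale /= rmorphB rmorphM rmorphB fmorphV.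
split=> H e /H.
  by case=> d [d0 hd]; exists d => // h /hd; rewrite E ltcR.
by case=> d d0 hd; exists d; split => // h /hd; rewrite E ltcR.
Qed.

Lemma partial_pos2 dir (s : C -> R) z (s' : R) :
  has_partial dir (fun w => (s w)%:C : R[i]^o) z s'%:C ->
  has_partial dir (fun w => (pos2 (s w))%:C : R[i]^o) z (2 * Num.max 0 (s z) * s')%:C.
Proof.
move=> /has_partial_real hs; apply/has_partial_real => e e0.
pose p := Num.max 0 (s z); have p0 : 0 <= p by rewrite le_max lexx.
have [d1 d10 hd1] := hs 1 ltr01.
have e'0 : 0 < e / (2 * (2 * p + 1)) by rewrite divr_gt0 //; nra.
have [d2 d20 hd2] := hs _ e'0.
pose B := `|s'| + 1; have B0 : 0 < B by rewrite ltr_wpDl.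
have d30 : 0 < e / (2 * B ^+ 2) by rewrite divr_gt0 // mulr_gt0 // exprn_gt0.
exists (Num.min d1 (Num.min d2 (e / (2 * B ^+ 2)))); first by rewrite !lt_min d10 d20 d30.
move=> h /andP[h0]; rewrite !lt_min => /and3P[h1 h2 h3].
have {}h1 := hd1 h ltac:(by rewrite h0); have {}h2 := hd2 h ltac:(by rewrite h0).
set k := s (z + h%:C * dir) - s z in h1 h2.
have := pos2_taylor (s z) k; rewrite -/p; have -> : s z + k = s (z + h%:C * dir) by rewrite /k addrC subrK.
set T := pos2 _ - pos2 _ => hT.
have -> : h^-1 * T - 2 * p * s' = h^-1 * (T - 2 * p * k) + 2 * p * (h^-1 * k - s') by ring.
apply: le_lt_trans (ler_normD _ _) _; rewrite (splitr e); apply: ler_ltD.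
  rewrite normrM normfV; apply: (@le_trans _ _ (`|h|^-1 * k ^+ 2)).
    by rewrite ler_wpM2l // invr_ge0.
  rewrite -[k ^+ 2]real_normK ?num_real // (_ : `|h|^-1 * _ = (`|h|^-1 * `|k|) ^+ 2 * `|h|); last first.
    by field; rewrite gt_eqF.
  have hk : `|h|^-1 * `|k| <= B.
    rewrite -normfV -normrM /B; have := ler_normB (h^-1 * k - s') (- s').
    by rewrite opprK subrK normrN; lra.
  have hk2 : (`|h|^-1 * `|k|) ^+ 2 <= B ^+ 2 by rewrite lerXn2r ?nnegrE ?(ltW B0) // mulr_ge0 ?invr_ge0.
  apply: le_trans (ler_pM (sqr_ge0 _) (normr_ge0 _) hk2 (ltW h3)) _.
  rewrite (_ : B ^+ 2 * _ = e / 2) //; by field; rewrite gt_eqF.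
rewrite normrM (ger0_norm (_ : 0 <= 2 * p)) ?mulr_ge0 //.
apply: (@le_lt_trans _ _ (2 * p * (e / (2 * (2 * p + 1))))).
  by rewrite ler_wpM2l ?mulr_ge0 // ltW.
by rewrite mulrA ltr_pdivrMr; nra.
Qed.

Lemma continuous_at_real (s : C -> R) z : continuous_at (fun w => (s w)%:C : R[i]^o) z <->
  forall e : R, 0 < e -> exists2 d : R, 0 < d & forall w, nm (w - z) < d -> `|s w - s z| < e.
Proof.
by split => [/continuous_atE H|H]; [|apply/continuous_atE] => e /H[d d0 hd]; exists d => // w /hd;
  rewrite nX_scalar -rmorphB nm_real.
Qed.

Lemma continuous_at_max (s : C -> R) z : continuous_at (fun w => (s w)%:C : R[i]^o) z ->
  continuous_at (fun w => (Num.max 0 (s w))%:C : R[i]^o) z.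
Proof.
move=> /continuous_at_real hs; apply/continuous_at_real => e /hs[d d0 hd]; exists d => // w /hd.
by rewrite !ltr_norml; case: (leP 0 (s w)) => ?; case: (leP 0 (s z)) => ? /andP[? ?]; apply/andP; split; lra.
Qed.

Variables (z0 : C) (d : R).
Hypothesis d0 : 0 < d.

Definition bump_arg z : R := nm (z - z0) ^+ 2 / d ^+ 2 - 1.
(** Equal to 1 up to distance [d] and to 0 from distance sqrt 2 d on; the rounder radius 2 d is used
    below. It has one continuous derivative, as Cauchy-Pompeiu asks. *)
Definition bump z : R := pos2 (1 - pos2 (bump_arg z)).
Definition dbump_arg (dir z : C) : R :=
  2 * (complex.Re dir * complex.Re (z - z0) + complex.Im dir * complex.Im (z - z0)) / d ^+ 2.
Definition dbump dir z : R := 2 * Num.max 0 (1 - pos2 (bump_arg z)) *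
  - (2 * Num.max 0 (bump_arg z) * dbump_arg dir z).

Lemma partial_bump_arg dir z : has_partial dir (fun w => (bump_arg w)%:C : R[i]^o) z (dbump_arg dir z)%:C.
Proof.
apply/has_partial_real => e e0; pose A := nm dir ^+ 2 / d ^+ 2.
have A0 : 0 <= A by rewrite divr_ge0 ?sqr_ge0.
exists (e / (A + 1)); first by rewrite divr_gt0 // ltr_wpDl.
move=> h /andP[h0 h1]; have hn : h != 0 by rewrite -normr_gt0.
rewrite (_ : _ - _ = h * A).
  rewrite normrM (ger0_norm A0); have : `|h| * (A + 1) < e by rewrite -ltr_pdivlMr // ltr_wpDl.
  by rewrite mulrDr mulr1; lra.
have dn : d != 0 by rewrite gt_eqF.
rewrite /bump_arg /dbump_arg /A !nm_sqr; move: hn dn; clear; case: z => x y; case: z0 => a c.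
case: dir => u v /=; rewrite !mul0r subr0 addr0 => hn dn.
by field; rewrite hn dn.
Qed.

Lemma continuous_at_coord (p q : R) (w : C) :
  continuous_at (fun w => (p * complex.Re w + q * complex.Im w)%:C : R[i]^o) w.
Proof.
apply/continuous_at_real => e e0; have D0 : 0 < `|p| + `|q| + 1 by rewrite ltr_wpDl // addr_ge0.
exists (e / (`|p| + `|q| + 1)); first by rewrite divr_gt0.
move=> w'; rewrite ltr_pdivlMr // => h.
rewrite (_ : _ - _ = p * complex.Re (w' - w) + q * complex.Im (w' - w)); last first.
  by rewrite !raddfB /=; ring.
apply: le_lt_trans (ler_normD _ _) _; rewrite !normrM; apply: le_lt_trans h.
have h0 := nm_ge0 (w' - w).
have : `|p| * `|complex.Re (w' - w)| <= `|p| * nm (w' - w) by rewrite ler_wpM2l // Re_le_nm.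
have : `|q| * `|complex.Im (w' - w)| <= `|q| * nm (w' - w) by rewrite ler_wpM2l // Im_le_nm.
by nra.
Qed.

Lemma continuous_at_bump_arg z : continuous_at (fun w => (bump_arg w)%:C : R[i]^o) z.
Proof.
have hB := continuous_at_sub z0 z.
rewrite (_ : (fun _ => _) = fun w => ((d ^- 2)%:C : R[i]^o) *: ((w - z0 : R[i]^o) *: ((w - z0)^* : R[i]^o))
   + (-1 : R[i]^o)); last first.
  by apply/funext => w; rewrite /bump_arg /GRing.scale /= -nm2E -rmorphM rmorphB mulrC.
apply: continuous_atD; last exact: continuous_at_cst.
apply: (continuous_atZ (X := R[i]^o)); first exact: continuous_at_cst.
by apply: (continuous_atZ (X := R[i]^o)) => //; exact: continuous_at_conj.
Qed.

Lemma continuous_at_realM (s t : C -> R) z : continuous_at (fun w => (s w)%:C : R[i]^o) z ->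
  continuous_at (fun w => (t w)%:C : R[i]^o) z -> continuous_at (fun w => (s w * t w)%:C : R[i]^o) z.
Proof.
move=> hs ht; rewrite (_ : (fun _ => _) = fun w => ((s w)%:C : R[i]^o) *: ((t w)%:C : R[i]^o)).
  exact: (continuous_atZ (X := R[i]^o)).
by apply/funext => w; rewrite rmorphM.
Qed.

Lemma continuous_at_inner z :
  continuous_at (fun w => (1 - pos2 (bump_arg w))%:C : R[i]^o) z.
Proof.
have h := continuous_at_max (continuous_at_bump_arg z).
rewrite (_ : (fun _ => _) = fun w => (1 : R[i]^o) + ((-1)%:C : R[i]^o) *:
    ((Num.max 0 (bump_arg w) * Num.max 0 (bump_arg w))%:C : R[i]^o)); last first.
  by apply/funext => w; rewrite /GRing.scale /= -rmorphM mulN1r rmorphB /= rmorphN.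
apply: continuous_atD; first exact: continuous_at_cst.
apply: (continuous_atZ (X := R[i]^o)); first exact: continuous_at_cst.
exact: continuous_at_realM.
Qed.

Lemma bump_far dir z : 2 * d < nm (z - z0) -> bump z = 0 /\ dbump dir z = 0.
Proof.
move=> hB.
have h1 : 1 <= bump_arg z.
  rewrite /bump_arg lerBrDr ler_pdivlMr ?exprn_gt0 //.
  have h3 : (2 * d) ^+ 2 <= nm (z - z0) ^+ 2.
    by rewrite lerXn2r ?nnegrE ?nm_ge0 ?mulr_ge0 ?(ltW d0) ?(ltW hB).
  by have := sqr_ge0 d; rewrite exprMn in h3; lra.
have h2 : 1 - pos2 (bump_arg z) <= 0.
  by rewrite /pos2 max_r; [nra | lra].
by rewrite /bump /dbump {1}/pos2 max_l // expr2 !(mulr0, mul0r).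
Qed.

Lemma C1c_bump dir : C1c dir (fun z => (bump z)%:C : R[i]^o) (fun z => (dbump dir z)%:C : R[i]^o)
  (nm z0 + 2 * d).
Proof.
have c2 (cst : R) z : continuous_at (fun _ => cst%:C : R[i]^o) z by exact: continuous_at_cst.
split.
- apply/ccontE => z; rewrite /bump /pos2; apply: continuous_at_realM;
    apply: continuous_at_max; exact: continuous_at_inner.
- move=> z; apply: partial_pos2; rewrite rmorphN.
  have := partialD (partial_cst dir (1 : R[i]^o) z) (partialZ (partial_cst dir (-1 : R[i]^o) z)
    (partial_pos2 (partial_bump_arg dir z))).
  rewrite scale0r !add0r scaleN1r -rmorphN; congr has_partial.
  by apply/funext => w; rewrite scaleN1r rmorphB.
- apply/ccontE => z; apply: continuous_at_realM; first apply: continuous_at_realM => //.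
    exact/continuous_at_max/continuous_at_inner.
  rewrite (_ : (fun _ => _) = fun w => (- 2 * Num.max 0 (bump_arg w) * dbump_arg dir w)%:C : R[i]^o); last first.
    by apply/funext => w; rewrite !mulNr.
  apply: continuous_at_realM; first apply: continuous_at_realM => //.
    exact/continuous_at_max/continuous_at_bump_arg.
  rewrite (_ : (fun _ => _) = fun w => ((2 / d ^+ 2 * complex.Re dir) * complex.Re w +
    (2 / d ^+ 2 * complex.Im dir) * complex.Im w)%:C + ((- (2 / d ^+ 2 * (complex.Re dir * complex.Re z0 +
      complex.Im dir * complex.Im z0)))%:C : R[i]^o)); last first.
    apply/funext => w; rewrite (_ : dbump_arg dir w = (2 / d ^+ 2 * complex.Re dir * complex.Re w +
      2 / d ^+ 2 * complex.Im dir * complex.Im w) + - (2 / d ^+ 2 * (complex.Re dir * complex.Re z0 +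
      complex.Im dir * complex.Im z0))) ?rmorphD //.
    by rewrite /dbump_arg !raddfB /=; ring.
  by apply: (continuous_atD (X := R[i]^o)) => //; exact: continuous_at_coord.
move=> z hz; have h : 2 * d < nm (z - z0) by have := nmBD z z0; lra.
by have [-> ->] := bump_far dir h.
Qed.

Lemma bump_eq1 z : nm (z - z0) <= d -> bump z = 1.
Proof.
move=> h; have h1 : bump_arg z <= 0.
  rewrite subr_le0 ler_pdivrMr ?exprn_gt0 // mul1r lerXn2r ?nnegrE ?nm_ge0 //; exact: ltW.
by rewrite /bump [pos2 (bump_arg z)]/pos2 max_l // expr2 mul0r subr0 /pos2 max_r // expr1n.
Qed.

Lemma bump_ge0 z : 0 <= bump z.
Proof. exact: sqr_ge0. Qed.

Lemma bump_le1 z : bump z <= 1.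
Proof.
rewrite /bump /pos2; set s := Num.max 0 (bump_arg z) ^+ 2; have s0 : 0 <= s by exact: sqr_ge0.
by case: (leP 0 (1 - s)) => h; [rewrite expr_le1 //; lra | rewrite expr0n].
Qed.

Lemma dbump_eq0 dir z : nm (z - z0) <= d -> dbump dir z = 0.
Proof.
move=> h; have h1 : bump_arg z <= 0.
  rewrite subr_le0 ler_pdivrMr ?exprn_gt0 // mul1r lerXn2r ?nnegrE ?nm_ge0 //; exact: ltW.
by rewrite /dbump (max_l h1) !(mulr0, mul0r, oppr0).
Qed.

(** Where the derivative is nonzero both truncations are at most 1 and |z - z0| <= 2 d bounds the
    inner derivative by 4 / d; differentiating the two squares brings the remaining factor 4. *)
Lemma dbump_le dir z : nm dir = 1 -> `|dbump dir z| <= 16 / d.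
Proof.
move=> hdir; rewrite /dbump; set t := bump_arg z.
have [t1|t1] := leP 1 t.
  have h2 : 1 - pos2 t <= 0 by rewrite /pos2 max_r; [nra | lra].
  by rewrite (max_l h2) mulr0 mul0r normr0 divr_ge0 // ltW.
have p0 : 0 <= pos2 t by exact: sqr_ge0.
have A0 : 0 <= Num.max 0 (1 - pos2 t) <= 1 by case: (leP 0 (1 - pos2 t)) => ?; lra.
have B0 : 0 <= Num.max 0 t <= 1 by case: (leP 0 t) => ?; lra.
have hz : nm (z - z0) <= 2 * d.
  have h2 : nm (z - z0) ^+ 2 <= 2 * d ^+ 2 by rewrite -ler_pdivrMr ?exprn_gt0 //; rewrite /t /bump_arg in t1; lra.
  rewrite -(@ler_pXn2r _ 2) ?nnegrE ?nm_ge0 ?mulr_ge0 ?(ltW d0) // exprMn; have := sqr_ge0 d; lra.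
have D0 : `|dbump_arg dir z| <= 4 / d.
  rewrite /dbump_arg normrM normfV (ger0_norm (sqr_ge0 d)) ler_pdivrMr ?exprn_gt0 //.
  rewrite (_ : 4 / d * d ^+ 2 = 2 * (1 * (2 * d))); last by field; rewrite gt_eqF.
  rewrite normrM ger0_norm // ler_wpM2l // mul1r.
  apply: le_trans hz; rewrite -[nm (z - z0)]mul1r -hdir -(nm_conj dir) -nmM.
  apply: le_trans (Re_le_nm _); rewrite le_eqVlt; apply/orP; left; apply/eqP; congr `|_|.
  by case: dir {hdir} => u v; case: (z - z0) => p q /=; ring.
have h4 : 0 <= 4 / d by rewrite divr_ge0 // ltW.
move: (dbump_arg dir z) D0 => D D0; have DD := normr_ge0 D.
rewrite normrM normrN !normrM (ger0_norm (_ : 0 <= 2)) //.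
rewrite (ger0_norm (proj1 (andP A0))) (ger0_norm (proj1 (andP B0))).
case/andP: A0; case/andP: B0; move: (Num.max 0 t) (Num.max 0 (1 - _)) => u v ? ? ? ?.
have uv : v * u <= 1 by nra.
have uv0 : 0 <= v * u by nra.
rewrite (_ : 16 / d = 4 * (4 / d)); last by ring.
have : v * u * `|D| <= 4 / d by nra.
by lra.
Qed.
End Bump.

(** * Measurability of inverses and of slices *)

Section MoreMeasurability.
Variable R : realType.
Local Notation C := R[i].

(** Where |g| > 1/(n+1) the inverse is the conjugate over |g|^2, with denominator bounded below; the
    convention 0^-1 = 0 makes these truncations converge at the zeros of [g] as well. *)
Lemma SM_V d (T : measurableType d) (g : T -> R[i]^o) :
  SM g -> SM (fun x => (g x)^-1 : R[i]^o).
Proof.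
move=> hg; apply: (SM_lim (g_ := fun n x =>
    if `[< n.+1%:R^-1 < nX (g x - 0) >] then (g x)^-1 : R[i]^o else 0)); last first.
  move=> x e e0; have [->|gx] := eqVneq (g x) 0.
    exists 0%N => n _; case: ifPn => [/asboolP|_]; last by rewrite invr0 subr0 nX0.
    by rewrite subr0 nX0 ltNge invr_ge0 ler0n.
  have [N hN] := small_inv (e := nX (g x)) ltac:(by rewrite nX_scalar nm_gt0).
  exists N => n /hN h; case: ifPn => [_|]; first by rewrite subrr nX0.
  by move/asboolP; rewrite subr0.
move=> n; pose F (y : R[i]^o) : R[i]^o :=
  (nm y ^+ 2)%:C^-1 * y^*.
pose m y : R := Num.max (nm y ^+ 2) (n.+1%:R^-1 ^+ 2).
have e0 : 0 < n.+1%:R^-1 :> R by rewrite invr_gt0 ltr0n.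
have m0 y : 0 < m y by rewrite lt_max; apply/orP; right; exact: exprn_gt0.
have mm : measurable_fun setT (fun x => (m (g x))^-1).
  have cm : measurable_fun setT (fun x => m (g x)).
    apply: measurable_maxr; last exact: measurable_cst.
    apply: measurable_funX; exact: (SM_measurable_norm hg).
  rewrite (_ : (fun _ => _) = (fun x => powR (m (g x)) (-1))).
    by apply: (measurableT_comp (measurable_powR (-1))).
  by apply/funext => x; rewrite powR_inv1 // ltW.
rewrite (_ : (fun _ => _) = fun x => if `[< n.+1%:R^-1 < nX (g x - 0) >] then
     ((m (g x))^-1%:C : R[i]^o) *: ((g x)^* : R[i]^o) else 0); last first.
  apply/funext => x; case: ifPn => // /asboolP; rewrite subr0 nX_scalar => h.
  have gx : g x != 0 by rewrite -nm_gt0; exact: lt_trans h.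
  rewrite /m max_l; last by rewrite lerXn2r ?nnegrE ?nm_ge0 ?ltW.
  rewrite (_ : (nm (g x) ^- 2)%:C = (g x * (g x)^*)^-1) /GRing.scale /=; last first.
    by rewrite -nm2E fmorphV.
  by rewrite invfM divfK // conjC_eq0.
apply: SM_if; last exact: SM_cst.
  apply: measurable_ltr_set; first exact: measurable_cst.
  exact: SM_measurable_nX.
apply: SM_Z; first exact: SM_real.
apply: SM_cont1 hg _ => a e he; exists e => // a' h.
by rewrite nX_scalar -rmorphB nm_conj -nX_scalar.
Qed.

Lemma cSM_b : cSM (fun w => (b w)%:C : R[i]^o).
Proof.
apply: SM_real; apply: measurable_funB; first exact: measurable_cst.
apply: measurable_funX; exact: (SM_measurable_norm (@cSM_id R)).
Qed.

Lemma cint_ae (X : normedModType R[i]^o) (g g' : C -> X) v :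
  cae (fun z => g z = g' z) -> cint g v -> cint g' v.
Proof. exact: bint_ae. Qed.

Lemma cSM2_slice (X : normedModType R[i]^o) (h : C -> C -> X) z : cSM2 h -> cSM (h z).
Proof.
move=> hh; have := SM_comp hh (pair1_measurable (toR2 z)).
by rewrite /cSM; under eq_fun do rewrite /= cx_toR2.
Qed.
End MoreMeasurability.

(** * The integral operator: weak equation and modulus of continuity *)

Section Operator.
Variables (R : realType) (V : set R[i]) (c : R[i] -> R[i] -> R[i]) (A : R).
Local Notation C := R[i].
Local Notation continuous_at := Defs.continuous_at.
Hypothesis V_disc : forall w, V w -> nm w < 1.
Hypothesis c_holo : forall w, V w -> holo_lim (c^~ w).
Hypothesis c_diag : forall w, V w -> c w w = 1.
Hypothesis c_off : forall z w, ~ V w -> c z w = 0.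
Hypothesis c_meas : cSM2 (c : C -> C -> R[i]^o).
Hypothesis c_int : forall z, nm z < 1 -> cule (fun w => nm (c z w) / (b w * nm (z - w))) A.

Definition ker z w : C := (kappa R)%:C^-1 * (c z w / ((b w)%:C * (z - w))).

Lemma kappa_gt0 : 0 < kappa R.
Proof. by apply: lt_le_trans (kappa_ge R); lra. Qed.

Lemma kappa_neq0 : (kappa R)%:C != 0 :> C.
Proof. by rewrite fmorph_eq0 gt_eqF // kappa_gt0. Qed.

Lemma cSM2_ker : cSM2 (ker : C -> C -> R[i]^o).
Proof.
have h1 := cSM2_fst (@cSM_id R); have h2 := cSM2_snd (@cSM_id R).
apply: SM_Z; first exact: SM_cst.
have h3 := SM_V (SM_Z (cSM2_snd (@cSM_b R)) (SM_B h1 h2)).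
exact: SM_Z c_meas h3.
Qed.

Section Function.
Variables (X : completeNormedModType R[i]^o) (f : C -> X) (M : R).
Hypothesis f_meas : cSM f.
Hypothesis M0 : 0 <= M.
Hypothesis f_bound : cae (fun w => nX (f w) <= M).
Hypothesis f_supp : cae (fun w => ~ V w -> f w = 0).

Lemma cule_ker z : nm z < 1 -> cule (fun w => nX (ker z w *: f w)) (M * A / kappa R).
Proof.
move=> hz; have k0 := kappa_gt0.
have H := culeZ (divr_ge0 M0 (ltW k0)) (c_int hz).
have -> : M * A / kappa R = M / kappa R * A by rewrite mulrAC.
suff H1 : cae (fun w => nX (ker z w *: f w) <= M / kappa R * (nm (c z w) / (b w * nm (z - w)))).
  exact: uint_le_ae H1 H.
apply: cae_imp f_bound => w h1; rewrite nXZ.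
have [hV|hV] := pselect (V w); last by rewrite /ker c_off // mul0r mulr0 nm0 mul0r mul0r mulr0.
have bw : 0 < b w by exact/b_gt0/discE/V_disc.
rewrite /ker nmM nmV nmM nmV nmM !nm_real (gtr0_norm k0) (gtr0_norm bw).
rewrite [X in _ <= X](_ : _ = (kappa R)^-1 * (nm (c z w) / (b w * nm (z - w))) * M); last by ring.
by rewrite ler_wpM2l // mulr_ge0 ?invr_ge0 ?(ltW k0) // divr_ge0 ?nm_ge0 // mulr_ge0 ?nm_ge0 ?ltW.
Qed.

Lemma ker_exists z : nm z < 1 -> exists v, cint (fun w => ker z w *: f w) v.
Proof.
move=> hz; apply: cint_exists (cule_ker hz).
by apply: SM_Z => //; exact: (cSM2_slice z cSM2_ker).
Qed.

Variable F : C -> X.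
Hypothesis hF : forall z, nm z < 1 -> cint (fun w => ker z w *: f w) (F z).

Lemma F_bound z : nm z < 1 -> nX (F z) <= M * A / kappa R.
Proof. by move=> hz; apply: bint_norm (hF hz) (cule_ker hz). Qed.

(** Integrating [F] against [q] reduces to the scalar integrals [J w] in the first kernel variable,
    where holomorphy of [c] can act. The weak equation and the local representation are both
    instances. *)
Lemma fubini_ker (q : C -> R[i]^o) (Q r : R) (J : C -> C) : r < 1 -> cSM q ->
  (forall s, r < nm s -> q s = 0) -> cule (fun s => nm (q s)) Q ->
  cae (fun w => V w -> cint (fun s => q s * (c s w / (s - w)) : R[i]^o) (J w)) ->
  exists v, cint (fun s => q s *: F s) v /\
    cint (fun w => ((kappa R)%:C^-1 * (J w / (b w)%:C) : R[i]^o) *: f w) v.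
Proof.
move=> r1 mq q0 hQ hJ; have k0 := kappa_gt0.
apply: (@cint_fubini R X (fun s w => (q s * ker s w) *: f w)
  (fun s => M * `|A| / kappa R * nm (q s)) (M * `|A| / kappa R * Q)).
- apply: SM_Z; last exact: (cSM2_snd f_meas).
  by apply: (SM_Z (X := R[i]^o)); [exact: (cSM2_fst mq)|exact: cSM2_ker].
- move=> s; have [hs|hs] := ltP r (nm s).
    rewrite q0 // nm0 mulr0; have H0 : cule (fun _ : C => 0 : R) 0 by exact: uint_le0.
    by apply: cule_mono H0 => w; rewrite mul0r scale0r nX0.
  have hA := cule_ker (le_lt_trans hs r1).
  have := culeZ (nm_ge0 (q s)) hA; rewrite [X in cule _ X]mulrC => H.
  have H' : cule (fun w => nm (q s) * nX (ker s w *: f w)) (M * `|A| / kappa R * nm (q s)).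
    apply: cule_le H; apply: ler_wpM2r; first exact: nm_ge0.
    by rewrite ler_wpM2r ?invr_ge0 ?(ltW k0) // ler_wpM2l // ler_norm.
  by apply: cule_mono H' => w; rewrite -scalerA [X in X <= _]nXZ.
- by apply: culeZ => //; rewrite divr_ge0 ?(ltW k0) // mulr_ge0.
- apply: cae_all => s; have [hs|hs] := ltP r (nm s).
    rewrite q0 // scale0r; apply: bint_ext (bint0 _ _) => p.
    by rewrite mul0r scale0r.
  apply: bint_ext (bintZ (q s) (hF (le_lt_trans hs r1))) => p.
  by rewrite scalerA.
- have H := cae_and f_supp hJ; apply: cae_imp H => w [h {}hJ].
  have [hV|/h ->] := pselect (V w); last first.
    by rewrite scaler0; apply: bint_ext (bint0 _ _) => p; rewrite scaler0.
  have := bint_map (A := fun s : R[i]^o => s *: f w) (k := nX (f w)) _ _ _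
    (bintZ ((kappa R)%:C^-1 / (b w)%:C : R[i]^o) (hJ hV)).
  move=> H; have : cint (fun s => ((kappa R)%:C^-1 / (b w)%:C * (q s * (c s w / (s - w))) : R[i]^o) *: f w)
      (((kappa R)%:C^-1 / (b w)%:C * J w : R[i]^o) *: f w).
    apply: H => [x y|a x|x]; [exact: scalerDl|by rewrite -scalerA|by rewrite nXZ mulrC nX_scalar].
  rewrite (_ : (kappa R)%:C^-1 / (b w)%:C * J w = (kappa R)%:C^-1 * (J w / (b w)%:C)); last by ring.
  by apply: bint_ext => p; congr (_ *: _); rewrite /ker invfM; ring.
Qed.

(** Take q = d-bar phi. Cauchy-Pompeiu for phi c(., w) at the point w, with c(w, w) = 1, gives J w =
    - kappa phi(w). *)
Lemma weak_identity (phi phix phiy : C -> R[i]^o) r : 0 <= r -> r < 1 ->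
  C1c 1 phi phix r -> C1c 'i%C phi phiy r ->
  exists v, cint (fun s => ((phix s + 'i%C * phiy s) / 2 : R[i]^o) *: F s) v /\
    cint (fun w => (phi w / (b w)%:C : R[i]^o) *: f w) (- v).
Proof.
move=> r0 r1 h1 hi; have [cd d0] := C1c_dbar h1 hi.
have [Md Md0 hMd] := compact_support_bounded cd d0.
have bd : cule (fun s => nm ((phix s + 'i%C * phiy s) / 2)) (Md * (4 * r ^+ 2)).
  by apply: cule_support => // z /d0 ->; rewrite nm0.
have hJ w : V w -> cint (fun s => (phix s + 'i%C * phiy s) / 2 * (c s w / (s - w)) : R[i]^o)
    (- ((kappa R)%:C * phi w)).
  move=> hV; have := pompeiu_holo w r0 r1 h1 hi (c_holo hV).
  by rewrite c_diag // mulr1; apply: bint_ext => p; rewrite mulrA.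
have [v [hv hv']] := fubini_ker r1 (cSM_cont cd) d0 bd (cae_all hJ).
exists v; split => //; have := bintZ (-1 : R[i]^o) hv'; rewrite scaleN1r.
apply: bint_ext => p; rewrite scalerA; congr (_ *: _).
by rewrite mulN1r mulNr mulrN opprK -!mulrA mulKf // kappa_neq0.
Qed.

(** Take q(s) = (d-bar chi)(s) / (z - s). In the result chi F is a sum of Cauchy transforms of
    (d-bar chi) F and chi f / b, and [c] has dropped out. *)
Lemma representation (chi chix chiy : C -> R[i]^o) r z : 0 <= r -> r < 1 -> nm z < 1 ->
  C1c 1 chi chix r -> C1c 'i%C chi chiy r ->
  exists v, cint (fun s => ((chix s + 'i%C * chiy s) / 2 / (z - s) : R[i]^o) *: F s) v /\
    cint (fun w => (chi w / (b w)%:C / (z - w) : R[i]^o) *: f w)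
      (((kappa R)%:C * chi z : R[i]^o) *: F z - v).
Proof.
move=> r0 r1 hz h1 hi; have [cd d0] := C1c_dbar h1 hi.
have [Md Md0 hMd] := compact_support_bounded cd d0.
pose dchi s : C := (chix s + 'i%C * chiy s) / 2.
have m1 : cSM (fun s => dchi s / (z - s) : R[i]^o).
  apply: (SM_Z (X := R[i]^o)); first exact: (cSM_cont cd).
  by apply: SM_V; apply: SM_B; [exact: SM_cst|exact: cSM_id].
have bd : cule (fun s => nm (dchi s / (z - s))) (Md * (12 * 1)).
  apply: cule_mono (culeZ Md0 (cule_kernel z 0 ltr01)) => s.
  rewrite nmM nmV (nmB z) mulrA ler_wpM2r ?invr_ge0 ?nm_ge0 //.
  have [h|h] := leP (nm s) 1; first by rewrite box0_nm // mulr1; have := hMd s; rewrite nX_scalar.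
  by rewrite /dchi d0 ?nm0 ?mulr_ge0 ?ler0n //; exact: lt_trans r1 h.
have q0 s : r < nm s -> dchi s / (z - s) = 0 by move=> h; rewrite /dchi d0 // mul0r.
(* Partial fractions: 1 / ((z - s) (s - w)) is 1 / (z - w) times the difference of 1 / (s - w) and 1
   / (s - z). The value at [z] reproduces the kernel of [F]; the one at [w] leaves chi alone. *)
have mc w : V w -> w != z -> cint (fun s => dchi s / (z - s) * (c s w / (s - w)) : R[i]^o)
    (((kappa R)%:C * (chi z * c z w) - (kappa R)%:C * chi w) / (z - w)).
  move=> hV wz; have H1 := pompeiu_holo w r0 r1 h1 hi (c_holo hV).
  have H2 := pompeiu_holo z r0 r1 h1 hi (c_holo hV); rewrite c_diag // mulr1 in H1.
  have := bintZ ((z - w)^-1 : R[i]^o) (bintB H1 H2).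
  rewrite opprK [- _ + _]addrC [_ *: _]mulrC.
  have E : cae (fun s => (z - w)^-1 * (dchi s * c s w / (s - w) - dchi s * c s w / (s - z)) =
      dchi s / (z - s) * (c s w / (s - w)) :> R[i]^o); last exact: cint_ae E.
  have H := cae_and (cae_neq z) (cae_neq w); apply: cae_imp H => s [sz sw].
  have zw : z - w != 0 by rewrite subr_eq0 eq_sym.
  have zs : z - s != 0 by rewrite subr_eq0 eq_sym.
  have s1 : s - w != 0 by rewrite subr_eq0.
  have s2 : s - z != 0 by rewrite subr_eq0.
  by field; rewrite zw zs s1 s2.
have hJ := cae_imp (fun w wz hV => mc w hV wz) (cae_neq z).
have [v [hv hv']] := fubini_ker r1 m1 q0 bd hJ.
exists v; split => //.
have H := bintB (bintZ ((kappa R)%:C * chi z : R[i]^o) (hF hz)) hv'.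
suff E : cae (fun w => ((kappa R)%:C * chi z : R[i]^o) *: (ker z w *: f w) -
    ((kappa R)%:C^-1 * (((kappa R)%:C * (chi z * c z w) - (kappa R)%:C * chi w) / (z - w) / (b w)%:C) :
      R[i]^o) *: f w = (chi w / (b w)%:C / (z - w) : R[i]^o) *: f w) by exact: cint_ae E H.
have E := cae_and (cae_neq z) f_supp; apply: cae_imp E => w [wz fw].
have [hV|/fw ->] := pselect (V w); last by rewrite !scaler0 subr0.
have bw : (b w)%:C != 0 :> C by rewrite fmorph_eq0 gt_eqF //; exact/b_gt0/discE/V_disc.
rewrite scalerA -scalerBl; congr (_ *: _); rewrite /ker.
have zw : z - w != 0 by rewrite subr_eq0 eq_sym.
by have k0 := kappa_neq0; field; rewrite k0 bw zw.
Qed.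
(** The cutoff varies at rate 16 / d and [b] is at least [d] on its support, hence a density of
    order 1 / d on a square of size [d]. *)
Lemma density_bound z0 d s : 0 < d -> nm z0 + 4 * d <= 1 -> nX (f s) <= M ->
  nX (((((dbump z0 d 1 s)%:C + 'i%C * (dbump z0 d 'i%C s)%:C) / 2 : R[i]^o) *: F s) +
    ((bump z0 d s)%:C / (b s)%:C : R[i]^o) *: f s) <=
  (16 * (M * `|A| / kappa R) + M) / d * (box z0 (2 * d) s)%:R.
Proof.
move=> d0 hd hf; have k0 := kappa_gt0.
have MF0 : 0 <= M * `|A| / kappa R by rewrite divr_ge0 ?(ltW k0) // mulr_ge0.
have Q0 : 0 <= 16 * (M * `|A| / kappa R) + M by rewrite addr_ge0 // mulr_ge0.
have [h|h] := leP (nm (s - z0)) (2 * d); last first.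
  have [-> ->] := bump_far d0 1 h; have [_ ->] := bump_far d0 'i%C h.
  rewrite mulr0 addr0 mul0r mul0r !scale0r addr0 nX0 mulr_ge0 ?ler0n // divr_ge0 //.
  exact: ltW.
rewrite box_snorm (le_trans (snorm_le_nm _) h) mulr1 [X in _ <= X]mulrDl.
have hs : nm s <= 1 - 2 * d by have := nmBD s z0; lra.
have s1 : nm s < 1 by lra.
apply: le_trans (nXD _ _) _; apply: lerD; rewrite nXZ.
  have hD : nm (((dbump z0 d 1 s)%:C + 'i%C * (dbump z0 d 'i%C s)%:C) / 2) <= 16 / d.
    rewrite nmM nmV (_ : nm 2 = 2); last by rewrite -[2](rmorph_nat (real_complex R) 2) nm_real ger0_norm.
    rewrite ler_pdivrMr //; apply: le_trans (nmD _ _) _; rewrite nmM nm_i mul1r !nm_real.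
    have := dbump_le z0 d0 s (nm1 R); have := dbump_le z0 d0 s (nm_i R); lra.
  have hFs : nX (F s) <= M * `|A| / kappa R.
    apply: le_trans (F_bound s1) _; rewrite ler_wpM2r ?invr_ge0 ?(ltW k0) // ler_wpM2l //.
    exact: ler_norm.
  apply: le_trans (ler_pM (nm_ge0 _) (nX_ge0 _) hD hFs) _.
  by rewrite mulrAC.
rewrite nmM nmV !nm_real (ger0_norm (bump_ge0 _ _ _)).
have bs : d <= b s by apply: le_trans (b_ge_dist (ltW s1)); lra.
rewrite ger0_norm ?(le_trans (ltW d0)) // mulrC ler_pM ?nX_ge0 //.
  by rewrite divr_ge0 ?bump_ge0 // (le_trans (ltW d0)).
rewrite -[X in _ <= X]mul1r ler_pM ?bump_ge0 ?bump_le1 ?invr_ge0 ?(le_trans (ltW d0)) //.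
by rewrite lef_pV2 ?posrE // (lt_le_trans d0).
Qed.

Lemma local_representation z0 d z : 0 < d -> nm z0 + 4 * d <= 1 -> nm (z - z0) <= d ->
  cint (fun s => ((z - s)^-1 : R[i]^o) *:
    (((((dbump z0 d 1 s)%:C + 'i%C * (dbump z0 d 'i%C s)%:C) / 2 : R[i]^o) *: F s) +
    ((bump z0 d s)%:C / (b s)%:C : R[i]^o) *: f s)) (((kappa R)%:C : R[i]^o) *: F z).
Proof.
move=> d0 hd hz; have hz1 : nm z < 1 by have := nmBD z z0; lra.
have r0 : 0 <= nm z0 + 2 * d by have := nm_ge0 z0; lra.
have r1 : nm z0 + 2 * d < 1 by lra.
have [v [h1 h2]] := representation r0 r1 hz1 (C1c_bump z0 d0 1) (C1c_bump z0 d0 'i%C).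
have := bintD h1 h2; rewrite addrC subrK (bump_eq1 d0 hz) mulr1.
by apply: bint_ext => p; rewrite scalerDr !scalerA; congr (_ *: _ + _ *: _); rewrite mulrC.
Qed.

(** Near [z] the two kernels are integrated separately, over boxes of half-sides tau d and 2 tau d,
    for 36 tau d. Elsewhere their difference is at most sigma d / (tau d * tau d / 2), on a box of
    area 16 d^2. *)
Lemma kernel_modulus (z0 z z' : C) (d tau sigma : R) : 0 < d -> 0 < tau ->
  sigma <= tau / 2 -> nm (z - z') <= sigma * d ->
  cule (fun w => (box z0 (2 * d) w)%:R * nm ((z - w)^-1 - (z' - w)^-1))
    (d * (36 * tau + 32 * sigma / tau ^+ 2)).
Proof.
move=> d0 tau0 st hz; have td : 0 < tau * d by rewrite mulr_gt0.
have s0 : 0 <= sigma by rewrite -(pmulr_lge0 _ d0) (le_trans (nm_ge0 _) hz).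
have q0 : 0 <= 2 * sigma / (tau ^+ 2 * d) by rewrite divr_ge0 ?mulr_ge0 ?sqr_ge0 // ltW.
have H := culeD (culeD (cule_kernel z z td) (cule_kernel z' z' (mulr_gt0 (ltr0n _ 2) td)))
  (culeZ q0 (cule_box z0 (mulr_ge0 (ler0n _ 2) (ltW d0)))).
have {H} := cule_le (_ : _ <= d * (36 * tau + 32 * sigma / tau ^+ 2)) H.
move=> H; apply: cule_mono (H _) => [w|]; last first.
  by rewrite le_eqVlt; apply/orP; left; apply/eqP; field; rewrite !gt_eqF.
rewrite (nmB w z) (nmB w z').
have p1 : 0 <= (box z (tau * d) w)%:R / nm (z - w) by rewrite divr_ge0 ?ler0n ?nm_ge0.
have p2 : 0 <= (box z' (2 * (tau * d)) w)%:R / nm (z' - w) by rewrite divr_ge0 ?ler0n ?nm_ge0.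
have [_|_] := boolP (box z0 (2 * d) w); last by rewrite mul0r mulr0 addr0 addr_ge0.
rewrite mul1r mulr1.
have [h|h] := leP (snorm (w - z)) (tau * d).
  have h' : snorm (w - z') <= 2 * (tau * d).
    apply: le_trans (_ : snorm (w - z) + nm (z - z') <= _); last by nra.
    have tri (g : {additive C -> R}) : `|g (w - z')| <= `|g (w - z)| + `|g (z - z')|.
      by rewrite (_ : w - z' = (w - z) + (z - z')) ?raddfD ?ler_normD //; ring.
    rewrite ge_max; apply/andP; split; apply: le_trans (tri _) _; apply: lerD;
      rewrite ?Re_le_nm ?Im_le_nm // le_max lexx ?orbT //.
  rewrite !box_snorm h h' -[X in X <= _]addr0 lerD // !mul1r -!nmV.
  by have := nmD (z - w)^-1 (- (z' - w)^-1); rewrite nmN.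
have h1 : tau * d < nm (z - w) by rewrite nmB; apply: lt_le_trans h (snorm_le_nm _).
have h2 : tau * d / 2 <= nm (z' - w).
  have := nmBD (z - w) (z - z'); rewrite (_ : z - w - (z - z') = z' - w); last by ring.
  by move: hz h1; nra.
rewrite -[X in X <= _]add0r lerD ?addr_ge0 //.
have n1 : z - w != 0 by rewrite -nm_gt0; lra.
have n2 : z' - w != 0 by rewrite -nm_gt0; lra.
rewrite (_ : _ - _ = (z' - z) / ((z - w) * (z' - w))); last by field; rewrite n1 n2.
rewrite nmM nmV nmM nmB (_ : 2 * sigma / _ = sigma * d / (tau * d * (tau * d / 2))); last first.
  by field; rewrite !gt_eqF.
apply: ler_pM; rewrite ?nm_ge0 ?invr_ge0 ?mulr_ge0 ?nm_ge0 //.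
rewrite lef_pV2 ?posrE ?mulr_gt0 ?nm_gt0 ?invr_gt0 //.
by rewrite ler_pM // ?ltW // divr_gt0.
Qed.

(** The density contributes 1 / d and the kernel modulus d, so [sigma] does not depend on [z]. The
    two terms are made at most e/4 each; after division by kappa >= 7/9 the total stays below
    [e]. *)
Lemma F_modulus (e : R) : 0 < e -> exists2 sigma : R, 0 < sigma & forall z z', nm z < 1 ->
  nm (z - z') <= sigma * ((1 - nm z) / 4) -> nX (F z - F z') < e.
Proof.
move=> e0; have k0 := kappa_gt0.
pose Q := 16 * (M * `|A| / kappa R) + M + 1.
have MF0 : 0 <= M * `|A| / kappa R by rewrite divr_ge0 ?(ltW k0) // mulr_ge0.
have Q0 : 0 < Q by rewrite ltr_wpDl // addr_ge0 // mulr_ge0.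
pose tau := e / (144 * Q); have tau0 : 0 < tau by rewrite divr_gt0 // mulr_gt0.
pose sigma := Num.min 1 (Num.min (tau / 2) (e * tau ^+ 2 / (128 * Q))).
have sig0 : 0 < sigma.
  by rewrite !lt_min ltr01 divr_gt0 // divr_gt0 // mulr_gt0 // exprn_gt0.
have sig1 : sigma <= 1 by rewrite ge_min lexx.
have sig2 : sigma <= tau / 2 by rewrite !ge_min lexx orbT.
have sig3 : sigma <= e * tau ^+ 2 / (128 * Q) by rewrite !ge_min lexx !orbT.
exists sigma => // z z' hz; set d := _ / 4 => hzz.
have d0 : 0 < d by rewrite divr_gt0 // subr_gt0.
have hd : nm z + 4 * d <= 1 by rewrite /d; lra.
have hz' : nm (z' - z) <= d by rewrite nmB (le_trans hzz) // ler_piMl // ltW.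
have H1 := local_representation d0 hd (_ : nm (z - z) <= d).
have {}H1 := H1 ltac:(by rewrite subrr nm0 ltW).
have H2 := local_representation d0 hd hz'.
have KM := kernel_modulus z d0 tau0 sig2 hzz.
have Qd0 : 0 <= Q / d by rewrite divr_ge0 // ltW.
have B := culeZ Qd0 KM.
have E : nX ((((kappa R)%:C : R[i]^o) *: F z) - ((kappa R)%:C : R[i]^o) *: F z') <=
    Q / d * (d * (36 * tau + 32 * sigma / tau ^+ 2)).
  apply: bint_dist H1 H2 _; apply: uint_le_ae B.
  suff E : cae (fun s => nX (((z - s)^-1 : R[i]^o) *:
    (((((dbump z d 1 s)%:C + 'i%C * (dbump z d 'i%C s)%:C) / 2 : R[i]^o) *: F s) +
    ((bump z d s)%:C / (b s)%:C : R[i]^o) *: f s) - ((z' - s)^-1 : R[i]^o) *: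
    (((((dbump z d 1 s)%:C + 'i%C * (dbump z d 'i%C s)%:C) / 2 : R[i]^o) *: F s) +
    ((bump z d s)%:C / (b s)%:C : R[i]^o) *: f s)) <=
    Q / d * ((box z (2 * d) s)%:R * nm ((z - s)^-1 - (z' - s)^-1))) by exact: E.
  apply: cae_imp f_bound => s hs; have := density_bound d0 hd hs.
  rewrite -scalerBl nXZ; set G := _ + _ => hG.
  rewrite [X in X <= _]mulrC mulrA ler_wpM2r ?nm_ge0 //; apply: le_trans hG _.
  by rewrite ler_wpM2r ?ler0n // ler_wpM2r ?invr_ge0 ?(ltW d0) // /Q; lra.
rewrite -scalerBr nXZ nm_real (gtr0_norm k0) mulrA divfK ?gt_eqF // in E.
have E1 : Q * (36 * tau) = e / 4 by rewrite /tau; field; rewrite gt_eqF.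
have E2 : Q * (32 * sigma / tau ^+ 2) <= e / 4.
  rewrite ler_pdivlMr // in sig3; last by rewrite mulr_gt0.
  rewrite mulrA ler_pdivrMr ?exprn_gt0 //; lra.
have kk := kappa_ge R; have n0 := nX_ge0 (F z - F z').
have : 7 / 9 * nX (F z - F z') <= kappa R * nX (F z - F z') by rewrite ler_wpM2r.
rewrite mulrDr in E; lra.
Qed.
End Function.
End Operator.

(** * From the estimates to [C_rho] and weak solutions *)

Section Conclusions.
Variable R : realType.
Local Notation C := R[i].
Local Notation continuous_at := Defs.continuous_at.

Lemma partial_unique (X : normedModType R[i]^o) dir (g : C -> X) z v v' :
  has_partial dir g z v -> has_partial dir g z v' -> v = v'.
Proof.
move=> h h'; apply/eqP; rewrite -subr_eq0 -nX_eq0 eq_le nX_ge0 andbT leNgt; apply/negP => p.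
have p2 : 0 < nX (v - v') / 2 by rewrite divr_gt0.
have [d [d0 hd]] := h _ p2; have [d' [d'0 hd']] := h' _ p2.
pose t := Num.min d d' / 2; have t0 : 0 < t by rewrite divr_gt0 // lt_min d0.
have m0 : 0 < Num.min d d' by rewrite lt_min d0.
have tt : t < Num.min d d' by rewrite /t; lra.
have [t1 t2] : t < d /\ t < d' by move: tt; rewrite lt_min => /andP[].
have := hd t; have := hd' t; rewrite (gtr0_norm t0) t0 t1 t2 !nXE !ltcR => /(_ isT) a1 /(_ isT) a2.
set q := _ *: _ in a1 a2; have := nX_tri q v v'; rewrite -(nXN (v - q)) opprB; lra.
Qed.

Variable X : completeNormedModType R[i]^o.

Lemma C_rho_intro (F : C -> X) M : (forall z, nm z < 1 -> nX (F z) <= M) ->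
  (forall e : R, 0 < e -> exists2 sigma : R, 0 < sigma & forall z z', nm z < 1 ->
     nm (z - z') <= sigma * ((1 - nm z) / 4) -> nX (F z - F z') < e) -> C_rho F.
Proof.
move=> hM hF; split.
- by exists M => z /discE hz; rewrite nXE lecR hM.
- move=> z /discE hz; apply/continuous_atE => e /hF[s s0 hs].
  exists (s * ((1 - nm z) / 4)); first by rewrite mulr_gt0 // divr_gt0 // subr_gt0.
  by move=> w hw; rewrite -nXN opprB hs // nmB ltW.
(* With D = |1 - conj(w) z| one has |z - w| = rho D and D <= b z + |z - w|. For rho <= 1/2 this
   yields |z - w| <= 2 rho b z <= 4 rho (1 - |z|), hence s / 16. *)
move=> e /hF[s s0 hs]; exists (Num.min (1 / 2) (s / 16)); split.
  by rewrite lt_min !divr_gt0.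
move=> z w /discE hz dw; have hw := dw; move/discE: hw => hw.
rewrite lt_min => /andP[r1 r2]; rewrite nXE ltcR; apply: hs => //.
have dz : disc z by exact/discE.
have D0 : 0 < nm (1 - w^* * z) by rewrite nm_gt0 sub1_neq0 ?disc_le.
have E : nm (z - w) = rho z w * nm (1 - w^* * z) by rewrite rhoE divfK ?gt_eqF.
have hD : nm (1 - w^* * z) <= b z + nm (z - w).
  rewrite (_ : 1 - w^* * z = (b z)%:C + (z - w)^* * z); last first.
    by rewrite /b rmorphB /= nm2E rmorph1 rmorphB; ring.
  apply: le_trans (nmD _ _) _; rewrite nm_real ger0_norm ?b_ge0 ?(ltW hz) // lerD2l nmM nm_conj.
  by rewrite ler_piMr ?nm_ge0 // ltW.
have rr := rho_ge0 z w; have bz := b_le_dist (ltW hz); have n0 := nm_ge0 (z - w).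
have : nm (z - w) <= rho z w * (b z + nm (z - w)) by rewrite {1}E ler_wpM2l.
have : rho z w * nm (z - w) <= 1 / 2 * nm (z - w) by rewrite ler_wpM2r // ltW.
have : rho z w * b z <= s / 16 * (2 * (1 - nm z)).
  by rewrite ler_pM // ?b_ge0 ?(ltW hz) // ltW.
by lra.
Qed.

(** Partial derivatives are unique, so those given with the test function are the first entries of
    its family of derivatives; hence they are continuous and vanish off the support. *)
Lemma weak_solution_intro (F f f' : C -> X) : cae (fun w => f w = f' w) ->
  (forall (phi phix phiy : C -> R[i]^o) r, 0 <= r -> r < 1 ->
    C1c 1 phi phix r -> C1c 'i%C phi phiy r ->
    exists v, cint (fun s => ((phix s + 'i%C * phiy s) / 2 : R[i]^o) *: F s) v /\
      cint (fun w => (phi w / (b w)%:C : R[i]^o) *: f' w) (- v)) ->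
  weak_solution F f.
Proof.
move=> ff H phi phix phiy [[D [D0 hD]] [r [/andP[r0 r1] hr]]] hphi.
have zero z : r < nm z -> phi z = 0 by move=> h; rewrite hr // nmE ltcR.
have part dir z v : has_partial dir phi z v -> r < nm z -> v = 0.
  move=> hv hz; apply: partial_unique hv _.
  have d0 : 0 < nm z - r by rewrite subr_gt0.
  apply: (partial_ext d0 (f := fun=> 0)) (partial_cst dir (0 : R[i]^o) z) => w hw.
  by rewrite zero //; have := nmBD z w; rewrite (nmB z); lra.
have cont s : ccont (D s) by apply/ccontE => z; have [] := hD s z.
have hx : phix = D [:: false].
  apply/funext => z; have [h1 _] := hphi z; have [_ [h2 _]] := hD [::] z.
  by rewrite D0 in h2; exact: partial_unique h1 h2.
have hy : phiy = D [:: true].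
  apply/funext => z; have [_ h1] := hphi z; have [_ [_ h2]] := hD [::] z.
  by rewrite D0 in h2; exact: partial_unique h1 h2.
have c1 : C1c 1 phi phix r.
  split; [by rewrite -D0|by move=> z; have [] := hphi z|by rewrite hx|].
  by move=> z hz; rewrite zero //; split => //; have [h _] := hphi z; exact: part h hz.
have ci : C1c 'i%C phi phiy r.
  split; [by rewrite -D0|by move=> z; have [] := hphi z|by rewrite hy|].
  by move=> z hz; rewrite zero //; split => //; have [_ h] := hphi z; exact: part h hz.
have [v [h1 h2]] := H phi phix phiy r r0 r1 c1 ci.
exists v, (- v); split; last by rewrite scalerN opprK.
  by apply: cint_is_bochner; exact: h1.
apply: cint_is_bochner.
suff E : cae (fun w => (phi w / (b w)%:C : R[i]^o) *: f' w = (phi w / (1 - `|w| ^+ 2) : R[i]^o) *: f w).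
  exact: cint_ae E h2.
apply: cae_imp ff => w ->; rewrite nmE -rmorphXn /=.
by congr (_ / _ *: _); rewrite /b rmorphB rmorph1.
Qed.
End Conclusions.

(** * Continuous differentiability of the solution *)

Section LocalSmoothness.
Variables (R : realType) (X : completeNormedModType R[i]^o).
Local Notation C := R[i].
Local Notation continuous_at := Defs.continuous_at.
Implicit Types (g gd u ud F f : C -> X).

Lemma partial_increment dir g gd z (T B : R) :
  (forall t : R, `|t| <= `|T| -> has_partial dir g (z + t%:C * dir) (gd (z + t%:C * dir)) /\
     nX (gd (z + t%:C * dir)) <= B) -> nX (g (z + T%:C * dir) - g z) <= B * `|T|.
Proof.
move=> H; pose s : R := if 0 <= T then 1 else -1.
have s1 : `|s| = 1 by rewrite /s; case: ifP; rewrite ?normrN normr1.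
have sT : s * `|T| = T.
  rewrite /s; case: (leP 0 T) => h; first by rewrite mul1r ger0_norm.
  by rewrite mulN1r ltr0_norm // opprK.
have st t : 0 <= t <= `|T| -> `|s * t| <= `|T|.
  by move=> /andP[t0 tT]; rewrite normrM s1 mul1r ger0_norm.
have := @mean_value R X (fun t => g (z + (s * t)%:C * dir))
  (fun t => (s%:C : R[i]^o) *: gd (z + (s * t)%:C * dir)) B `|T| (normr_ge0 T).
rewrite sT mulr0 mul0r addr0; apply => t /st /H[h1 h2].
  exact: partial_path s1 h1.
by rewrite nXZ nm_real s1 mul1r.
Qed.

(** Partials control increments along the axes only; the path through [m] has one leg in each
    direction and stays where both partials are bounded by [B]. *)
Lemma C1_continuous (g gx gy : C -> X) (U : set C) : open_set U -> (forall z, U z ->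
    [/\ has_partial 1 g z (gx z), has_partial 'i%C g z (gy z),
        continuous_at gx z & continuous_at gy z]) ->
  forall z, U z -> continuous_at g z.
Proof.
move=> oU hg z0 Uz; apply/continuous_atE => e e0.
have [d [d0 hd]] := oU _ Uz; have [_ _ /continuous_atE/(_ 1 ltr01)[d1 d10 hd1]
  /continuous_atE/(_ 1 ltr01)[d2 d20 hd2]] := hg _ Uz.
pose B := nX (gx z0) + nX (gy z0) + 1.
have B0 : 0 < B by rewrite ltr_wpDl // addr_ge0 ?nX_ge0.
pose r := Num.min d (Num.min d1 d2).
have ok w : nm (w - z0) < r -> [/\ has_partial 1 g w (gx w), has_partial 'i%C g w (gy w),
    nX (gx w) <= B & nX (gy w) <= B].
  rewrite !lt_min => /and3P[h h1 h2].
  have Uw : U w by apply: hd; rewrite nmE ltcR.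
  have [p1 p2 _ _] := hg w Uw; split => //.
    have := hd1 w h1; have := nXBD (gx w) (gx z0); have := nX_ge0 (gy z0); rewrite /B; lra.
  have := hd2 w h2; have := nXBD (gy w) (gy z0); have := nX_ge0 (gx z0); rewrite /B; lra.
have r0 : 0 < r by rewrite !lt_min d0 d10 d20.
exists (Num.min (r / 2) (e / (4 * B))); first by rewrite lt_min !divr_gt0 ?mulr_gt0.
move=> w; rewrite lt_min ltr_pdivlMr // => /andP[hw].
rewrite ltr_pdivlMr ?mulr_gt0 // => he; pose x := complex.Re (w - z0); pose y := complex.Im (w - z0).
have hx : `|x| <= nm (w - z0) by exact: Re_le_nm.
have hy : `|y| <= nm (w - z0) by exact: Im_le_nm.
pose m := z0 + x%:C * 1.
have wE : w = m + y%:C * 'i%C.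
  rewrite /m /x /y mulr1 addrAC; move: (w - z0) (subrK z0 w) => q <-.
  have Eq : q = (complex.Re q)%:C + (complex.Im q)%:C * 'i%C.
    case: q => a c; apply/eqP; rewrite eq_complex /=.
    by rewrite !(mulr0, mul0r, mulr1, mul1r, subr0, add0r, addr0) !eqxx.
  by rewrite {1}Eq; ring.
have L1 : nX (g m - g z0) <= B * `|x|.
  apply: (partial_increment (gd := gx)) => t ht; have [] := ok (z0 + t%:C * 1) => //.
  by rewrite addrC addKr mulr1 nm_real; lra.
have L2 : nX (g w - g m) <= B * `|y|.
  rewrite wE; apply: (partial_increment (gd := gy)) => t ht; have [] := ok (m + t%:C * 'i%C) => //.
  rewrite /m (_ : _ - z0 = x%:C + t%:C * 'i%C); last by ring.
  by apply: le_lt_trans (nmD _ _) _; rewrite nmM nm_i mulr1 !nm_real; lra.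
have := nX_tri (g m) (g w) (g z0).
have : B * `|x| <= B * nm (w - z0) by rewrite ler_wpM2l // ltW.
have : B * `|y| <= B * nm (w - z0) by rewrite ler_wpM2l // ltW.
by rewrite mulrCA in he; lra.
Qed.

Lemma C1c_local dir u ud z0 d : 0 < d ->
  (forall z, nm (z - z0) < 4 * d ->
     [/\ has_partial dir u z (ud z), continuous_at u z & continuous_at ud z]) ->
  (forall z, 2 * d < nm (z - z0) -> u z = 0 /\ ud z = 0) -> C1c dir u ud (nm z0 + 2 * d).
Proof.
move=> d0 h hz.
have far (G : C -> X) z : 4 * d <= nm (z - z0) -> (forall w, 2 * d < nm (w - z0) -> G w = 0) ->
    continuous_at G z /\ has_partial dir G z 0.
  move=> hz4 hG.
  have E w : nm (w - z) < 2 * d -> 0 = G w.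
    move=> hw; rewrite hG //; have := nmBD (z - z0) (z - w).
    by rewrite (_ : z - z0 - (z - w) = w - z0) ?(nmB z w); [lra | ring].
  have dd : 0 < 2 * d by rewrite mulr_gt0.
  split; first by apply: (continuous_at_ext dd E); exact: continuous_at_cst.
  by apply: (partial_ext dd E); exact: partial_cst.
split.
- apply/ccontE => z; have [hf|/h[]//] := leP (4 * d) (nm (z - z0)).
  by have [] := far u z hf (fun w hw => proj1 (hz w hw)).
- move=> z; have [hf|/h[]//] := leP (4 * d) (nm (z - z0)).
  have [_] := far u z hf (fun w hw => proj1 (hz w hw)).
  by have [_ ->] := hz z ltac:(lra).
- apply/ccontE => z; have [hf|/h[]//] := leP (4 * d) (nm (z - z0)).
  by have [] := far ud z hf (fun w hw => proj2 (hz w hw)).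
- by move=> z hw; apply: hz; have := nmBD z z0; lra.
Qed.

Lemma cauchy_transform_exists u r : 0 <= r -> ccont u -> (forall z, r < nm z -> u z = 0) ->
  forall z, exists v, cint (fun w => (- w^-1 : R[i]^o) *: u (z + w)) v.
Proof.
move=> r0 cu us z; have [M M0 hM] := compact_support_bounded cu us.
have rz : 0 < r + nm z + 1 by have := nm_ge0 z; lra.
apply: (cint_exists (M := M * (12 * (r + nm z + 1)))).
  apply: SM_Z.
    have := SM_Z (SM_cst _ (-1 : R[i]^o)) (SM_V (@cSM_id R)).
    by under eq_fun do rewrite scaleN1r.
  have cu' : ccont (fun w => u (z + w)).
    move=> a e /cu-/(_ (z + a))[del del0 hd]; exists del => // a' ha; apply: hd.
    by rewrite opprD addrACA subrr add0r.
  exact: (cSM_cont cu').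
apply: cule_mono (culeZ M0 (cule_kernel 0 0 rz)) => w; rewrite nXZ nmN nmV subr0.
have [h|h] := leP (nm (z + w)) r; last first.
  by rewrite us // nX0 mulr0 mulr_ge0 // mulr_ge0 ?ler0n // invr_ge0 nm_ge0.
rewrite box0_nm ?mul1r 1?mulrC ?ler_wpM2r ?invr_ge0 ?nm_ge0 //.
by have := nmBD w (- z); rewrite opprK nmN (addrC w); lra.
Qed.

Lemma kernel_partial_exists (D : C -> X) r : 0 <= r -> ccont D -> (forall z, r < nm z -> D z = 0) ->
  forall z (d : R), 0 < d -> (forall s, nm (z - s) < d -> D s = 0) ->
  exists v, cint (fun s => ((z - s) ^- 2 : R[i]^o) *: D s) v.
Proof.
move=> r0 cD Ds z d d0 hd; have [M M0 hM] := compact_support_bounded cD Ds.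
apply: (cint_exists (M := d ^- 2 * M * (4 * r ^+ 2))).
  apply: SM_Z; last exact: (cSM_cont cD).
  have h := SM_V (SM_B (SM_cst _ (z : R[i]^o)) (@cSM_id R)).
  by have := SM_Z h h; under eq_fun do rewrite /GRing.scale /= -expr2 exprVn.
have dM : 0 <= d ^- 2 * M by rewrite mulr_ge0 // invr_ge0 exprn_ge0 // ltW.
apply: cule_support => // [s|s /Ds->]; last by rewrite scaler0 nX0.
have [/hd->|h] := ltP (nm (z - s)) d; first by rewrite scaler0 nX0.
rewrite nXZ nmV nmX ler_pM ?invr_ge0 ?exprn_ge0 ?nX_ge0 ?nm_ge0 //.
have n0 : 0 < nm (z - s) by apply: lt_le_trans h.
by rewrite lef_pV2 ?posrE ?exprn_gt0 // lerXn2r ?nnegrE ?(ltW d0) ?nm_ge0.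
Qed.

(** The density vanishes up to distance 2 d from the centre while [z] stays within [d], so |z - s|
    >= d and 1 / (z - s) is differentiated under the integral with an error of order |h| / d^3. *)
Lemma kernel_partial (D : C -> X) r z0 (d : R) (F1 G : C -> X) dir : nm dir = 1 ->
  0 <= r -> 0 < d -> ccont D -> (forall z, r < nm z -> D z = 0) ->
  (forall s, nm (s - z0) <= 2 * d -> D s = 0) ->
  (forall z, nm (z - z0) < d -> cint (fun s => ((z - s)^-1 : R[i]^o) *: D s) (F1 z)) ->
  (forall z, nm (z - z0) < d -> cint (fun s => ((z - s) ^- 2 : R[i]^o) *: D s) (G z)) ->
  forall z, nm (z - z0) < d ->
    has_partial dir F1 z ((- dir : R[i]^o) *: G z) /\ continuous_at (fun z => (- dir : R[i]^o) *: G z) z.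
Proof.
move=> dir1 r0 d0 cD Ds D0 hF hG z hz.
have [M M0 hM] := compact_support_bounded cD Ds.
pose Q := d ^- 3 * (M + 1) * (4 * (r + 1) ^+ 2).
have d30 : 0 < d ^- 3 by rewrite invr_gt0 exprn_gt0.
have Q0 : 0 < Q by rewrite !mulr_gt0 ?exprn_gt0 //; lra.
have e10 : 0 < d - nm (z - z0) by rewrite subr_gt0.
have far z' s : nm (z' - z0) < d -> D s != 0 -> d <= nm (z' - s).
  move=> h; apply: contraR; rewrite -ltNge => h'; apply/eqP/D0.
  have := nmD (s - z') (z' - z0); rewrite (nmB s) (_ : s - z' + (z' - z0) = s - z0); [lra | ring].
have bd (k : C -> C) (t : R) : 0 <= t -> (forall s, D s != 0 -> nm (k s) <= t * d ^- 3) ->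
    cule (fun s => nX ((k s : R[i]^o) *: D s)) (t * Q).
  move=> t0 hk; have tM : 0 <= t * d ^- 3 * (M + 1) by rewrite !mulr_ge0 ?(ltW d30) //; lra.
  have -> : t * Q = t * d ^- 3 * (M + 1) * (4 * (r + 1) ^+ 2) by rewrite /Q !mulrA.
  apply: cule_support => // [|s|s hs]; [lra| | by rewrite Ds ?scaler0 ?nX0 //; lra].
  have [->|hs] := eqVneq (D s) 0; first by rewrite scaler0 nX0.
  rewrite nXZ ler_pM ?nm_ge0 ?nX_ge0 ?hk //; have := hM s; lra.
split.
  move=> e e0; exists (Num.min (d - nm (z - z0)) (e / (2 * Q))); split.
    by rewrite lt_min e10 divr_gt0 // mulr_gt0.
  move=> h; rewrite lt_min => /andP[h0 /andP[h1 h2]]; rewrite nXE ltcR.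
  have hn : h%:C != 0 :> C by rewrite fmorph_eq0 -normr_gt0.
  have hz' : nm (z + h%:C * dir - z0) < d.
    by have := nmD (z - z0) (h%:C * dir); rewrite nmM dir1 mulr1 nm_real (_ : z - z0 + _ = z + h%:C * dir - z0); [lra | ring].
  have H := bintB (bintZ (h%:C^-1 : R[i]^o) (bintB (hF _ hz') (hF _ hz))) (bintZ (- dir : R[i]^o) (hG _ hz)).
  apply: (@le_lt_trans _ _ (`|h| * Q)); last first.
    by move: h2; rewrite ltr_pdivlMr ?mulr_gt0 //; nra.
  pose k s : C := h%:C^-1 * ((z + h%:C * dir - s)^-1 - (z - s)^-1) - (- dir) * (z - s) ^- 2.
  have K := bd k `|h| (normr_ge0 h) _.
  apply: bint_norm H _; apply: uint_le_mono (K _) => [p|s hs]; last first.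
    have a1 := far _ s hz hs; have a2 := far _ s hz' hs.
    have n1 : z - s != 0 by rewrite -nm_gt0; lra.
    have n2 : z + h%:C * dir - s != 0 by rewrite -nm_gt0; lra.
    rewrite /k (_ : _ - _ = dir ^+ 2 * h%:C / ((z - s) ^+ 2 * (z + h%:C * dir - s))); last first.
      by field; rewrite n1 n2 hn.
    rewrite nmM nmV nmM nmX nmM nmX dir1 expr1n mul1r nm_real ler_wpM2l //.
    rewrite lef_pV2 ?posrE ?mulr_gt0 ?exprn_gt0 ?nm_gt0 //.
    rewrite exprSr ler_pM ?exprn_ge0 ?(ltW d0) // lerXn2r ?nnegrE ?nm_ge0 //; exact: ltW.
  rewrite /k le_eqVlt; apply/orP; left; apply/eqP; congr nX.
  by rewrite -scalerBl !scalerA -scalerBl.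
apply/continuous_atE => e e0; exists (Num.min (d - nm (z - z0)) (e / (4 * Q))).
  by rewrite lt_min e10 divr_gt0 // mulr_gt0.
move=> z'; rewrite lt_min => /andP[h1 h2].
have hz' : nm (z' - z0) < d.
  by have := nmD (z - z0) (z' - z); rewrite (_ : z - z0 + _ = z' - z0); [lra | ring].
rewrite -scalerBr nXZ nmN dir1 mul1r.
pose k s : C := (z' - s) ^- 2 - (z - s) ^- 2.
apply: (@le_lt_trans _ _ (2 * nm (z' - z) * Q)); last first.
  by move: h2; rewrite ltr_pdivlMr ?mulr_gt0 //; nra.
have K := bd k (2 * nm (z' - z)) _ _.
apply: bint_norm (bintB (hG _ hz') (hG _ hz)) _.
apply: uint_le_mono (K _ _) => [p||s hs]; first by rewrite -scalerBl.
  by rewrite mulr_ge0 ?nm_ge0.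
have a1 := far _ s hz hs; have a2 := far _ s hz' hs.
have n1 : z - s != 0 by rewrite -nm_gt0; lra.
have n2 : z' - s != 0 by rewrite -nm_gt0; lra.
rewrite /k (_ : _ - _ = (z - z') * (((z - s) * (z' - s) ^+ 2)^-1 + ((z - s) ^+ 2 * (z' - s))^-1)); last first.
  by field; rewrite n1 n2.
rewrite nmM (nmB z) (_ : 2 * _ / _ = nm (z' - z) * (2 * d ^- 3)); last by ring.
rewrite ler_wpM2l ?nm_ge0 //.
have d3 x y : d <= x -> d <= y -> (x * (y * y))^-1 <= d ^- 3.
  move=> hx hy; have x0 : 0 < x by lra. have y0 : 0 < y by lra.
  rewrite lef_pV2 ?posrE ?mulr_gt0 ?exprn_gt0 // exprS expr2.
  by rewrite ler_pM ?mulr_ge0 ?(ltW d0) // ler_pM // ltW.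
apply: le_trans (nmD _ _) _; rewrite !nmV !nmM.
have := d3 _ _ a1 a2; have := d3 _ _ a2 a1; rewrite (mulrC (nm (z' - s)) (_ * _)).
by rewrite (_ : 2 / d ^+ 3 = d ^- 3 + d ^- 3) => [? ?|]; [exact: lerD | ring].
Qed.

Lemma partial_b dir z : has_partial dir (fun w => (b w)%:C : R[i]^o) z
  (- (dir * z^* + z * dir^*)) /\ continuous_at (fun w => (b w)%:C : R[i]^o) z /\
  continuous_at (fun w => - (dir * w^* + w * dir^*) : R[i]^o) z.
Proof.
have E : (fun w => (b w)%:C : R[i]^o) = fun w => (1 : R[i]^o) + (-1 : R[i]^o) *:
    ((w : R[i]^o) *: (w^* : R[i]^o)).
  by apply/funext => w; rewrite /b rmorphB rmorph1 /= nm2E scaleN1r.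
have cst (a : R[i]^o) := continuous_at_cst a z.
have idp : has_partial dir (fun w => w : R[i]^o) z dir.
  by apply: (partial_ext (d := 1)) (partial_id dir 0 z) => // w _; rewrite subr0.
have cc : continuous_at (fun w => w^* : R[i]^o) z.
  by apply: continuous_at_conj; exact: continuous_at_id.
have ci := @continuous_at_id R z.
split; first rewrite E.
  have := partialD (partial_cst dir (1 : R[i]^o) z) (partialZ (partial_cst dir (-1 : R[i]^o) z)
    (partialZ idp (partial_conj idp))).
  by rewrite scale0r !add0r scaleN1r.
split; first rewrite E.
  apply: (continuous_atD (X := R[i]^o)) => //.
  apply: (continuous_atZ (X := R[i]^o)) => //; exact: (continuous_atZ (X := R[i]^o)).
rewrite (_ : (fun _ => _) = fun w => (-1 : R[i]^o) *: ((dir : R[i]^o) *: (w^* : R[i]^o) +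
   (w : R[i]^o) *: (dir^* : R[i]^o))); last by apply/funext => w; rewrite scaleN1r.
apply: (continuous_atZ (X := R[i]^o)) => //.
apply: (continuous_atD (X := R[i]^o)); first exact: (continuous_atZ (X := R[i]^o)).
by apply: (continuous_atZ (X := R[i]^o)).
Qed.

Variables (F f : C -> X) (g : C -> X) (U : set C).
Hypothesis F_cont : forall z, nm z < 1 -> continuous_at F z.
Hypothesis rep : forall (chi chix chiy : C -> R[i]^o) r z, 0 <= r -> r < 1 -> nm z < 1 ->
  C1c 1 chi chix r -> C1c 'i%C chi chiy r ->
  exists v, cint (fun s => ((chix s + 'i%C * chiy s) / 2 / (z - s) : R[i]^o) *: F s) v /\
    cint (fun w => (chi w / (b w)%:C / (z - w) : R[i]^o) *: f w)
      (((kappa R)%:C * chi z : R[i]^o) *: F z - v).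
Hypothesis U_open : open_set U.
Hypothesis U_disc : U `<=` disc.
Hypothesis fg : cae (fun z => U z -> f z = g z).

Lemma cauchy_part_C1 z0 d dir gd : nm dir = 1 -> 0 < d -> nm z0 + 4 * d <= 1 ->
  (forall z, nm (z - z0) < 4 * d -> U z) ->
  (forall z, U z -> [/\ has_partial dir g z (gd z), continuous_at g z & continuous_at gd z]) ->
  exists ud, C1c dir (fun w => ((bump z0 d w)%:C / (b w)%:C : R[i]^o) *: g w) ud (nm z0 + 2 * d).
Proof.
move=> dir1 d0 hd hU hg.
pose p w : R[i]^o := (bump z0 d w)%:C / (b w)%:C.
pose pd w : R[i]^o := (dbump z0 d dir w)%:C / (b w)%:C +
   (bump z0 d w)%:C * (- - (dir * w^* + w * dir^*) / (b w)%:C ^+ 2).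
have hp z : nm (z - z0) < 4 * d -> [/\ has_partial dir p z (pd z), continuous_at p z & continuous_at pd z].
  move=> hz; have bz := b_gt0 (U_disc (hU z hz)).
  have bn : (b z)%:C != 0 :> C by rewrite fmorph_eq0 gt_eqF.
  have [/ccontE c1 c2 /ccontE c3 _] := C1c_bump z0 d0 dir.
  have [b1 [b2 b3]] := partial_b dir z.
  have cV := continuous_atV b2 bn.
  have c4 : continuous_at (fun w => - - (dir * w^* + w * dir^*) / (b w)%:C ^+ 2 : R[i]^o) z.
    rewrite (_ : (fun _ => _) = fun w => ((-1 : R[i]^o) *: (- (dir * w^* + w * dir^*) : R[i]^o)) *:
       (((b w)%:C^-1 : R[i]^o) *: ((b w)%:C^-1 : R[i]^o))); last first.
      by apply/funext => w; rewrite scaleN1r /GRing.scale /= -expr2 exprVn.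
    exact: continuous_atZ (continuous_atZ (continuous_at_cst _ z) b3) (continuous_atZ cV cV).
  split; first exact: partialZ (c2 z) (partialV bn b1).
    exact: continuous_atZ (c1 z) cV.
  exact: continuous_atD (continuous_atZ (c3 z) cV) (continuous_atZ (c1 z) c4).
exists (fun w => pd w *: g w + p w *: gd w); apply: C1c_local => // z hz.
  have [p1 p2 p3] := hp z hz; have [g1 g2 g3] := hg z (hU z hz).
  split; [exact: partialZ|exact: continuous_atZ|].
  by apply: continuous_atD; exact: continuous_atZ.
have [h1 h2] := bump_far d0 dir hz.
by rewrite /p /pd h1 h2 !mul0r !addr0 !scale0r addr0.
Qed.

(** The representation splits kappa F. The part with the derivatives of the cutoff has a merely
    continuous density that vanishes near [z0], so its kernel is smooth there; the other part is a
    convolution of the Cauchy kernel with a compactly supported C^1 function. *)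
Lemma local_C1 z0 d dir gd : nm dir = 1 -> 0 < d -> nm z0 + 4 * d <= 1 ->
  (forall z, nm (z - z0) < 4 * d -> U z) ->
  (forall z, U z -> [/\ has_partial dir g z (gd z), continuous_at g z & continuous_at gd z]) ->
  exists G : C -> X, forall z, nm (z - z0) < d / 2 ->
    has_partial dir F z (G z) /\ continuous_at G z.
Proof.
move=> dir1 d0 hd hU hg; have d20 : 0 < d / 2 by rewrite divr_gt0.
have [ud hu] := cauchy_part_C1 dir1 d0 hd hU hg; set u := fun w => _ in hu.
have r0 : 0 <= nm z0 + 2 * d by have := nm_ge0 z0; lra.
have r1 : nm z0 + 2 * d < 1 by lra.
have [cu pu cud us] := hu.
have [F2 hF2] := choice (cauchy_transform_exists r0 cu (fun z hz => proj1 (us z hz))).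
have [G2 hG2] := choice (cauchy_transform_exists r0 cud (fun z hz => proj2 (us z hz))).
have conv z : has_partial dir F2 z (G2 z) /\ continuous_at G2 z.
  apply: (convolution_partial (B := fun r => 12 * r) dir1 r0 _ hu hF2 hG2) => r rp.
  apply: cule_mono (cule_kernel 0 0 rp) => w; by rewrite nmN nmV subr0.
pose D s := (((dbump z0 d 1 s)%:C + 'i%C * (dbump z0 d 'i%C s)%:C) / 2 : R[i]^o) *: F s.
have [cdb db0] := C1c_dbar (C1c_bump z0 d0 1) (C1c_bump z0 d0 'i%C).
have Ds z : nm z0 + 2 * d < nm z -> D z = 0 by move=> hz; rewrite /D db0 // scale0r.
have Dc : ccont D.
  move/ccontE: cdb => cdb; apply/ccontE => z; have [h|h] := ltP (nm z) 1.
    by apply: continuous_atZ => //; exact: F_cont.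
  have e0 : 0 < 1 - (nm z0 + 2 * d) by lra.
  apply: (continuous_at_ext e0 (f := fun=> 0)); last exact: continuous_at_cst.
  by move=> w hw; rewrite Ds //; have := nmBD z w; rewrite (nmB z); lra.
(* The cutoff is constant up to distance [d], twice the radius d / 2 at which [kernel_partial] is
   applied. *)
have D0 s : nm (s - z0) <= 2 * (d / 2) -> D s = 0.
  move=> hs; have {}hs : nm (s - z0) <= d by lra.
  rewrite /D !dbump_eq0 //.
  by rewrite rmorph0 mulr0 addr0 mul0r scale0r.
have small z : nm (z - z0) < d / 2 -> nm z < 1 by have := nmBD z z0; lra.
have hF1 z : exists v, nm (z - z0) < d / 2 -> cint (fun s => ((z - s)^-1 : R[i]^o) *: D s) v /\
    ((kappa R)%:C : R[i]^o) *: F z = v + F2 z.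
  have [hz|hz] := ltP (nm (z - z0)) (d / 2); last by exists 0.
  have [v [h1 h2]] := rep r0 r1 (small z hz) (C1c_bump z0 d0 1) (C1c_bump z0 d0 'i%C).
  exists v => _; split.
    by apply: bint_ext h1 => p; rewrite /D scalerA [_^-1 * _]mulrC.
  have hz' : nm (z - z0) <= d by lra.
  rewrite (bump_eq1 d0 hz') mulr1 in h2.
  suff E : cae (fun w => ((bump z0 d w)%:C / (b w)%:C / (z - w) : R[i]^o) *: f w =
      ((z - w)^-1 : R[i]^o) *: u w).
    have h3 := cint_shift z (cint_ae E h2).
    suff <- : ((kappa R)%:C : R[i]^o) *: F z - v = F2 z by rewrite addrC subrK.
    apply: bint_unique (hF2 z); apply: bint_ext h3 => p.
    by rewrite opprD addrCA subrr addr0 invrN (addrC (cx p)).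
  apply: cae_imp fg => w fgw; rewrite /u scalerA [X in _ = X *: _]mulrC.
  have [h|h] := ltP (nm (w - z0)) (4 * d); first by rewrite (fgw (hU w h)).
  have h' : 2 * d < nm (w - z0) by lra.
  by have [-> _] := bump_far d0 1 h'; rewrite !mul0r !scale0r.
have [F1 hF1'] := choice hF1.
have hG1 z : exists v, nm (z - z0) < d / 2 -> cint (fun s => ((z - s) ^- 2 : R[i]^o) *: D s) v.
  have [hz|hz] := ltP (nm (z - z0)) (d / 2); last by exists 0.
  have [v hv] := kernel_partial_exists r0 Dc Ds d20 (z := z) (fun s hs => D0 s ltac:(
    have := nmD (s - z) (z - z0); rewrite (nmB s) (_ : s - z + (z - z0) = s - z0); [lra | ring])).
  by exists v.
have [G1 hG1'] := choice hG1.
have part1 := kernel_partial dir1 r0 d20 Dc Ds D0 (fun z hz => proj1 (hF1' z hz)) hG1'.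
exists (fun z => ((kappa R)%:C^-1 : R[i]^o) *: ((- dir : R[i]^o) *: G1 z + G2 z)) => z hz.
have [p1 q1] := part1 z hz; have [p2 q2] := conv z.
have e0 : 0 < d / 2 - nm (z - z0) by rewrite subr_gt0.
split; last first.
  by apply: continuous_atZ; [exact: continuous_at_cst | exact: continuous_atD].
have := partialZ (partial_cst dir ((kappa R)%:C^-1 : R[i]^o) z) (partialD p1 p2).
rewrite scale0r add0r; apply: (partial_ext e0) => w hw.
have hw' : nm (w - z0) < d / 2.
  by have := nmD (w - z) (z - z0); rewrite (_ : w - z + (z - z0) = w - z0); [lra | ring].
by have [_ <-] := hF1' w hw'; rewrite scalerA mulVf ?scale1r // kappa_neq0.
Qed.

(** Local derivatives are glued pointwise by choice; uniqueness of partial derivatives makes the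
    result agree near each point with a continuous function. *)
Lemma C1_on_intro : C1_on U g -> C1_on U F.
Proof.
move=> [gx [gy hg]]; have gc := C1_continuous U_open hg.
have loc z0 : U z0 -> exists2 d : R, 0 < d & [/\ nm z0 + 4 * d <= 1 &
    forall z, nm (z - z0) < 4 * d -> U z].
  move=> Uz; have [r [r0 hr]] := U_open Uz; have /discE hz := U_disc Uz.
  exists (Num.min (r / 4) ((1 - nm z0) / 4)); first by rewrite lt_min !divr_gt0 // subr_gt0.
  split; first by have : Num.min (r / 4) ((1 - nm z0) / 4) <= (1 - nm z0) / 4; [rewrite ge_min lexx orbT | lra].
  move=> z h; apply: hr; rewrite nmE ltcR.
  by have : Num.min (r / 4) ((1 - nm z0) / 4) <= r / 4; [rewrite ge_min lexx | lra].
have glue dir gd : nm dir = 1 ->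
    (forall z, U z -> [/\ has_partial dir g z (gd z), continuous_at g z & continuous_at gd z]) ->
    exists H : C -> X, forall z, U z -> has_partial dir F z (H z) /\ continuous_at H z.
  move=> dir1 hgd.
  have ex z : exists v, U z -> has_partial dir F z v.
    have [Uz|] := pselect (U z); last by exists 0.
    have [d d0 [h1 h2]] := loc z Uz; have [G hG] := local_C1 dir1 d0 h1 h2 hgd.
    by exists (G z) => _; have [] := hG z ltac:(by rewrite subrr nm0 divr_gt0).
  have [H hH] := choice ex; exists H => z Uz; split; first exact: hH.
  have [d d0 [h1 h2]] := loc z Uz; have [G hG] := local_C1 dir1 d0 h1 h2 hgd.
  have d20 : 0 < d / 2 by rewrite divr_gt0.
  have [_] := hG z ltac:(by rewrite subrr nm0).
  apply: (continuous_at_ext d20) => w hw; have [pw _] := hG w hw.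
  by apply: partial_unique pw (hH w _); apply: h2; lra.
have [Hx hHx] := glue 1 gx (nm1 R) ltac:(by move=> z Uz; have [? ? ? ?] := hg z Uz; split => //; exact: gc).
have [Hy hHy] := glue 'i%C gy (nm_i R) ltac:(by move=> z Uz; have [? ? ? ?] := hg z Uz; split => //; exact: gc).
by exists Hx, Hy => z Uz; have [? ?] := hHx z Uz; have [? ?] := hHy z Uz; split.
Qed.
End LocalSmoothness.

(** * Total boundedness and finite combinations of vectors *)

Section TotallyBounded.
Variables (R : realType) (X : completeNormedModType R[i]^o).
Local Notation C := R[i].
Implicit Types (S T : set X) (xs : seq X).

Definition totally_bounded S := forall e : R, 0 < e -> exists s : seq X,
  forall x, S x -> exists2 y, y \in s & nX (x - y) < e.

Lemma ball_nX (x y : X) (e : R) : ball x e%:C y <-> nX (x - y) < e.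
Proof. by rewrite -ball_normE /= nXE ltcR. Qed.

Lemma compact_totally_bounded S : compact S -> totally_bounded S.
Proof.
rewrite compact_cover => cS e e0; have e0' : 0 < e%:C :> R[i]^o by rewrite ltcR.
have [|D' _ hD] := cS X S (fun y => ball y e%:C) (fun y _ => ball_open y e%:C).
  by move=> x Sx; exists x => //; exact: ballxx.
exists (finmap.enum_fset D') => x /hD[y yD /ball_nX h]; exists y => //.
by rewrite -nXN opprB.
Qed.

Lemma ultra_seq (F : set_system X) (xs : seq X) (B : X -> set X) : UltraFilter F ->
  F [set x | exists2 y, y \in xs & B y x] -> exists y, F (B y).
Proof.
move=> UF; have PF := (@ultra_proper _ F UF); elim: xs => [|y xs IH] h.
  by exfalso; apply: (@filter_not_empty _ F); apply: filterS h => x [].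
have [hB|hB] := in_ultra_setVsetC (B y) UF; first by exists y.
apply: IH; apply: filterS2 h hB => x [z]; rewrite inE => /orP[/eqP->//|zx] hz _.
by exists z.
Qed.

(** An ultrafilter contains one ball of each finite cover, hence is Cauchy and converges. *)
Lemma totally_bounded_compact S : totally_bounded S -> compact (closure S).
Proof.
move=> tS; rewrite compact_ultra => F UF FS; have PF := (@ultra_proper _ F UF).
have cF : cvg F.
  apply: cauchy_cvg; apply: cauchy_exP => e /complex_gt0E[-> e0].
  have e20 : 0 < complex.Re e / 2 by rewrite divr_gt0.
  have [s hs] := tS _ e20.
  apply: (@ultra_seq F s (fun y => ball y (complex.Re e)%:C) UF).
  apply: filterS FS => x cx.
  have e20' : 0 < (complex.Re e / 2)%:C :> R[i]^o by rewrite ltcR.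
  have [x' [Sx' /ball_nX xx']] := cx _ (nbhsx_ballx x _ e20').
  have [y ys hy] := hs x' Sx'; exists y => //; apply/ball_nX.
  have := nX_tri x' x y; rewrite -[nX (y - x)]nXN opprB.
  by rewrite (splitr (complex.Re e)); lra.
exists (lim F); split => //; apply: closed_closure => B nB.
have FB : F B by exact: cF.
by have [x [h1 h2]] := filter_ex (filterI FS FB); exists x.
Qed.

Lemma totally_boundedD S T : totally_bounded S -> totally_bounded T ->
  totally_bounded [set x + y | x in S & y in T].
Proof.
move=> hS hT e e0; have e20 : 0 < e / 2 by rewrite divr_gt0.
have [s hs] := hS _ e20; have [t ht] := hT _ e20.
exists [seq x + y | x <- s, y <- t] => _ [x Sx [y Ty <-]].
have [x' x's hx] := hs x Sx; have [y' y't hy] := ht y Ty.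
exists (x' + y'); first by apply/allpairsP; exists (x', y').
rewrite opprD addrACA; apply: le_lt_trans (nXD _ _) _; rewrite (splitr e); exact: ltrD.
Qed.

Lemma totally_bounded_line (x : X) (B : R) : 0 <= B ->
  totally_bounded [set (a : R[i]^o) *: x | a in [set a | nm a <= B]].
Proof.
move=> B0 e e0; pose h := e / (2 * (nX x + 1)).
have x0 := nX_ge0 x.
have h0 : 0 < h by rewrite divr_gt0 // mulr_gt0 // ltr_wpDl.
pose g k : R := - B + k%:R * h.
have grid (t : R) : `|t| <= B -> exists2 k, (k < (Num.truncn (2 * B / h)).+1)%N & `|t - g k| < h.
  rewrite ler_norml => /andP[t1 t2]; have th0 : 0 <= (t + B) / h by rewrite divr_ge0 ?(ltW h0) //; lra.
  exists (Num.truncn ((t + B) / h)).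
    by rewrite ltnS; apply: le_truncn; rewrite ler_wpM2r ?invr_ge0 ?(ltW h0) //; lra.
  have /andP[k1 k2] := truncn_itv th0.
  rewrite ler_pdivlMr // in k1; rewrite ltr_pdivrMr // -natr1 in k2.
  rewrite /g; set k := _%:R in k1 k2 *; rewrite ltr_norml; apply/andP; split; lra.
pose n := (Num.truncn (2 * B / h)).+1.
exists [seq ((g j +i* g k : C) : R[i]^o) *: x | j <- iota 0 n, k <- iota 0 n].
move=> _ [a ha <-].
have [j jn hj] := grid _ (le_trans (Re_le_nm a) ha).
have [k kn hk] := grid _ (le_trans (Im_le_nm a) ha).
exists (((g j +i* g k : C) : R[i]^o) *: x).
  by apply/allpairsP; exists (j, k); rewrite !mem_iota.
rewrite -scalerBl nXZ; have ha' : nm (a - (g j +i* g k)) < 2 * h.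
  apply: le_lt_trans (nm_le_ReIm _) _; rewrite !raddfB /= mulr_natl mulr2n; exact: ltrD.
apply: (@le_lt_trans _ _ (2 * h * nX x)); first by rewrite ler_wpM2r // ltW.
have -> : 2 * h * nX x = e * (nX x / (nX x + 1)) by rewrite /h; field; lra.
by rewrite -[X in _ < X]mulr1 ltr_pM2l // ltr_pdivrMr ?mul1r; lra.
Qed.

Fixpoint span_box (B : R) xs : set X := if xs is x :: xs' then
  [set u + v | u in [set (a : R[i]^o) *: x | a in [set a | nm a <= B]] & v in span_box B xs']
  else [set 0].

Lemma span_box_totally_bounded B xs : 0 <= B -> totally_bounded (span_box B xs).
Proof.
move=> B0; elim: xs => [|x xs IH] /=.
  by move=> e e0; exists [:: 0] => x ->; exists 0; rewrite ?inE // subrr nX0.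
by apply: totally_boundedD => //; exact: totally_bounded_line.
Qed.

Lemma near_totally_bounded S : (forall e : R, 0 < e -> exists2 T, totally_bounded T &
  forall x, S x -> exists2 y, T y & nX (x - y) < e) -> totally_bounded S.
Proof.
move=> h e e0; have e20 : 0 < e / 2 by rewrite divr_gt0.
have [T tT hT] := h _ e20; have [s hs] := tT _ e20; exists s => x /hT[y Ty xy].
have [z zs yz] := hs y Ty; exists z => //; apply: le_lt_trans (nX_tri y _ _) _.
by rewrite (splitr e); exact: ltrD.
Qed.

Variables (f : C -> X).
Hypothesis f_meas : cSM f.

Fixpoint pick_near (e : R) xs (w : C) : X := if xs is x :: xs' then
  if `[< nX (f w - x) < e >] then x else pick_near e xs' w else 0.

Lemma pick_near_close e xs w y : y \in xs -> nX (f w - y) < e -> nX (f w - pick_near e xs w) < e.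
Proof.
elim: xs => //= x xs IH; rewrite inE => h hy; case: ifPn => [/asboolP//|/asboolP hx].
by apply: IH => //; case/orP: h => // /eqP yx; rewrite yx in hy.
Qed.

(** The coefficient of each vector is the integral of [k] over the set where it is picked, at most
    the L1 norm of [k]; the box is thus common to all weights with that bound. *)
Lemma cint_pick_near (k : C -> R[i]^o) B e xs : cSM k -> cule (fun w => nm (k w)) B ->
  exists2 v, cint (fun w => k w *: pick_near e xs w) v & span_box B xs v.
Proof.
elim: xs k => [|x xs IH] k mk hk.
  by exists 0 => //; apply: bint_ext (bint0 _ _) => p; rewrite scaler0.
pose E : set (measurableTypeR R * measurableTypeR R) := [set p | nX (f (cx p) - x) < e].
have mE : measurable E by exact: f_meas.1.
pose k1 w : R[i]^o := if `[< nX (f w - x) < e >] then k w else 0.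
pose k2 w : R[i]^o := if `[< nX (f w - x) < e >] then 0 else k w.
have m1 : cSM k1 by apply: (SM_if mE) => //; exact: SM_cst.
have m2 : cSM k2 by apply: (SM_if mE) => //; exact: SM_cst.
have h1 : cule (fun w => nX (k1 w)) B.
  by apply: cule_mono hk => w; rewrite /k1 nX_scalar; case: ifP => // _; rewrite nm0 nm_ge0.
have h2 : cule (fun w => nm (k2 w)) B.
  by apply: cule_mono hk => w; rewrite /k2; case: ifP => // _; rewrite nm0 nm_ge0.
have [a ha] := cint_exists_scalar m1 h1; have [v hv sv] := IH k2 m2 h2.
have ax := bint_map (A := fun s : R[i]^o => s *: x) (k := nX x) (fun _ _ => scalerDl _ _ _)
  (fun c y => esym (scalerA _ _ _)) (fun y => ltac:(by rewrite nXZ mulrC nX_scalar)) ha.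
exists (a *: x + v).
  apply: bint_ext (bintD ax hv) => p; rewrite /= /k1 /k2.
  by case: ifP => _; rewrite scale0r ?addr0 ?add0r.
exists (a *: x); last by exists v.
by exists a => //=; rewrite -nX_scalar; exact: bint_norm ha h1.
Qed.
End TotallyBounded.

(** * Relative compactness of the range *)

Section CompactRange.
Variables (R : realType) (V : set R[i]) (c : R[i] -> R[i] -> R[i]) (A : R).
Local Notation C := R[i].
Hypothesis V_disc : forall w, V w -> nm w < 1.
Hypothesis c_off : forall z w, ~ V w -> c z w = 0.
Hypothesis c_meas : cSM2 (c : C -> C -> R[i]^o).
Hypothesis c_int : forall z, nm z < 1 -> cule (fun w => nm (c z w) / (b w * nm (z - w))) A.
Variables (X : completeNormedModType R[i]^o) (f : C -> X).
Hypothesis f_meas : cSM f.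
Variable F : C -> X.
Hypothesis hF : forall z, nm z < 1 -> cint (fun w => ker c z w *: f w) (F z).

(** Values outside the essential range lie in balls of radius 1/(m+1) around the dense sequence with
    null preimage, and there are countably many of these. *)
Lemma cae_ess_range (g : C -> X) : cae (fun w => f w = g w) ->
  cae (fun w => disc w -> ess_range g (f w)).
Proof.
move=> fg; have [_ [q hq]] := f_meas.
pose N n m : set C := [set z | disc z /\ nX (g z - q n) < m.+1%:R^-1].
have H : cae (fun w => forall n m, null (N n m) -> ~ N n m w).
  apply: aeT_bigcap => n; apply: aeT_bigcap => m.
  suff h : cae (fun w => null (N n m) -> ~ N n m w) by exact: h.
  have [hn|hn] := pselect (null (N n m)); last exact: cae_all.
  by apply/ae_cae; exists (N n m); split => // z hz _.
have H' := cae_and fg H; apply: cae_imp H' => w [fgw hw] dw e e0 hnull.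
have e20 : 0 < e / 2 by rewrite divr_gt0.
have [m hm] := small_inv e20; have {}hm := hm m (leqnn m).
have m0 : 0 < m.+1%:R^-1 :> R by rewrite invr_gt0 ltr0n.
have [n hn] := hq (toR2 w) _ m0; rewrite cx_toR2 in hn.
apply: (hw n m); last by split => //; rewrite -fgw.
case: hnull => B [mB B0 hB]; exists B; split => // z [dz hz]; apply: hB; split => //.
rewrite nXE ltcR; have := nX_tri (q n) (g z) (f w); rewrite -[nX (q n - f w)]nXN opprB.
by move: m.+1%:R^-1 hm hz hn => t; lra.
Qed.

Lemma ker_cule z : nm z < 1 -> cule (fun w => nm (ker c z w)) (A / kappa R).
Proof.
move=> hz; have h1 : cae (fun _ : C => nX (1 : scalar_space R) <= 1).
  by apply: cae_all => _; have := nm1 R; rewrite -nX_scalar => ->.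
have H := cule_ker V_disc c_off c_int ler01 h1 hz.
rewrite mul1r in H; apply: cule_mono H => w.
change (nm (ker c z w) <= nX (ker c z w * 1 : R[i]^o)).
by rewrite mulr1 nX_scalar.
Qed.

(** Moving [f] to a finite net of the essential range changes [F] by at most the error times the L1
    norm of the kernel, and puts it into one totally bounded set for all [z]. *)
Lemma compact_range (g : C -> X) : cae (fun w => f w = g w) -> compact (ess_range g) ->
  compact (closure (F @` disc)).
Proof.
move=> fg /compact_totally_bounded tb; apply: totally_bounded_compact.
have k0 := kappa_gt0 R; pose B := `|A| / kappa R.
have B0 : 0 <= B by rewrite divr_ge0 // ltW.
have hk z : nm z < 1 -> cule (fun w => nm (ker c z w)) B.
  by move=> hz; apply: cule_le (ker_cule hz); rewrite ler_wpM2r ?invr_ge0 ?(ltW k0) ?ler_norm.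
apply: near_totally_bounded => e e0.
have B1 : 0 < B + 1 by rewrite ltr_wpDl.
have e'0 : 0 < e / (B + 1) by rewrite divr_gt0.
have [xs hxs] := tb _ e'0.
exists (span_box B xs); first exact: span_box_totally_bounded.
move=> _ [z /discE hz <-].
have mk : cSM (ker c z : C -> R[i]^o) by exact: (cSM2_slice z (cSM2_ker c_meas)).
have [v hv sv] := cint_pick_near f_meas (e / (B + 1)) xs mk (hk z hz).
exists v => //; apply: (@le_lt_trans _ _ (e / (B + 1) * B)); last first.
  by rewrite mulrAC ltr_pdivrMr // ltr_pM2l //; lra.
apply: bint_dist (hF hz) hv _.
suff E : cae (fun w => nX (ker c z w *: f w - ker c z w *: pick_near f (e / (B + 1)) xs w) <=
    e / (B + 1) * nm (ker c z w)) by exact: uint_le_ae E (culeZ (ltW e'0) (hk z hz)).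
have H := cae_ess_range fg; apply: cae_imp H => w hw; rewrite -scalerBr nXZ mulrC.
have [hV|hV] := pselect (V w); last by rewrite /ker c_off // mul0r mulr0 nm0 !mulr0.
have /hw/hxs[y ys hy] : disc w by exact/discE/V_disc.
by rewrite ler_wpM2r ?nm_ge0 // ltW // (pick_near_close ys hy).
Qed.
End CompactRange.

(** * Estimates on a pseudohyperbolic disc *)

Section PseudohyperbolicDisc.
Variable R : realType.
Local Notation C := R[i].

Lemma Re_realM (x : R) (z : C) : complex.Re (x%:C * z) = x * complex.Re z.
Proof. by case: z => p q /=; rewrite mul0r subr0. Qed.

Lemma Re_div (x y : C) : complex.Re (x / y) = complex.Re (x * y^*) / nm y ^+ 2.
Proof.
have [->|y0] := eqVneq y 0; first by rewrite invr0 rmorph0 !mulr0 mul0r.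
have -> : x / y = ((nm y ^+ 2)^-1)%:C * (x * y^*).
  rewrite (_ : (nm y ^- 2)%:C = (y * y^*)^-1); last by rewrite -nm2E fmorphV.
  by field; rewrite y0 andbT conjC_eq0.
by rewrite Re_realM mulrC.
Qed.

Lemma Re_mobius (q : C) : complex.Re ((1 + q) / (1 - q)) = (1 - nm q ^+ 2) / nm (1 - q) ^+ 2.
Proof.
by rewrite Re_div; congr (_ / _); rewrite nm_sqr; case: q => p r /=; ring.
Qed.

Variables (r : R) (a w : C).
Hypothesis r12 : 0 < r <= 1 / 2.
Hypothesis da : nm a < 1.
Hypothesis dw : nm w < 1.
Hypothesis near : nm (w - a) < r * nm (1 - a^* * w).

Lemma near_pos : 0 < nm (1 - a^* * w).
Proof. by rewrite nm_gt0 sub1_neq0 ?(ltW da) //; exact/discE. Qed.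

Lemma near_dist_le : nm (1 - a^* * w) <= b a / (1 - r).
Proof.
case/andP: r12 => r0 r1; rewrite ler_pdivlMr; last lra.
have : nm (1 - a^* * w) <= b a + nm (w - a).
  rewrite (_ : 1 - a^* * w = (b a)%:C - a^* * (w - a)); last first.
    by rewrite /b rmorphB rmorph1 /= nm2E; ring.
  apply: le_trans (nmD _ _) _; rewrite nm_real ger0_norm ?b_ge0 ?(ltW da) // lerD2l nmN nmM nm_conj.
  by rewrite ler_piMl ?nm_ge0 // ltW.
by move: near; lra.
Qed.

Lemma near_dist_ge : b a / (1 + r) <= nm (1 - a^* * w).
Proof.
case/andP: r12 => r0 r1; rewrite ler_pdivrMr; last lra.
have : b a <= nm (1 - a^* * w) + nm (w - a).
  rewrite -[b a](ger0_norm (b_ge0 (ltW da))) -nm_real.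
  rewrite (_ : (b a)%:C = (1 - a^* * w) + a^* * (w - a)); last first.
    by rewrite /b rmorphB rmorph1 /= nm2E; ring.
  apply: le_trans (nmD _ _) _; rewrite lerD2l nmM nm_conj.
  by rewrite ler_piMl ?nm_ge0 // ltW.
by move: near; lra.
Qed.

(** With t = |1 - conj(a) w|: (1 - r^2) t^2 <= b a * b w and b a <= (1 + r) t. The 3 is (1 + r) / (1
    - r) at r = 1/2. *)
Lemma near_b : b a <= 3 * b w.
Proof.
case/andP: r12 => r0 r1; have p := near_pos; have := nm2_sub1 a w.
have := near_dist_ge; rewrite ler_pdivrMr; last lra.
set t := nm (1 - a^* * w) in p *; move=> h1 h2.
have ba : 0 < b a by exact/b_gt0/discE.
have h3 : nm (w - a) ^+ 2 <= (r * t) ^+ 2.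
  by rewrite lerXn2r ?nnegrE ?nm_ge0 ?mulr_ge0 ?(ltW r0) ?(ltW p) // ltW.
have h4 : (1 - r ^+ 2) * t ^+ 2 <= b a * b w by rewrite exprMn in h3; lra.
have bt : b a ^+ 2 <= (1 + r) ^+ 2 * t ^+ 2.
  by rewrite -exprMn lerXn2r ?nnegrE ?(ltW ba) // ?mulr_ge0 ?(ltW p) //; [lra | rewrite mulrC].
have h5 : (1 + r) ^+ 2 <= 3 * (1 - r ^+ 2) by nra.
have h6 : b a * b a <= b a * (3 * b w).
  rewrite -expr2; apply: le_trans bt _.
  apply: (@le_trans _ _ (3 * (1 - r ^+ 2) * t ^+ 2)); first by rewrite ler_wpM2r ?sqr_ge0.
  lra.
by rewrite ler_pM2l in h6.
Qed.

Lemma near_box : box a (2 * r * b a) w.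
Proof.
case/andP: r12 => r0 r1; rewrite box_snorm; apply: le_trans (snorm_le_nm _) _.
have := near_dist_le; rewrite ler_pdivlMr; last lra.
have p := near_pos; have := near; set t := nm (1 - a^* * w) in p *; move=> h1 h2.
have h3 : t * (1 / 2) <= t * (1 - r) by rewrite ler_pM2l //; lra.
have h4 : r * t <= r * (2 * b a) by rewrite ler_pM2l //; lra.
lra.
Qed.

(** In the identity [E] the subtracted term is at most [r] times the first, since rho a c < 1 and
    rho w a < r. *)
Lemma near_harnack c : nm c < 1 ->
  nm (1 - c^* * a) * nm (1 - a^* * w) * (1 - r) <= nm (1 - c^* * w) * b a.
Proof.
move=> dc; case/andP: r12 => r0 r1.
have E : (1 - c^* * w) * (b a)%:C = (1 - c^* * a) * (1 - a^* * w) - (c^* - a^*) * (w - a).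
  by rewrite /b rmorphB rmorph1 /= nm2E; ring.
have p1 : 0 < nm (1 - c^* * a) by rewrite nm_gt0 sub1_neq0 ?(ltW dc) //; exact/discE.
have h : nm (c^* - a^*) <= nm (1 - c^* * a).
  have := @rho_lt1 R a c (proj2 (discE a) da) (proj2 (discE c) dc).
  by rewrite rhoE ltr_pdivrMr // mul1r -rmorphB nm_conj (nmB c) => /ltW.
have -> : nm (1 - c^* * w) * b a = nm ((1 - c^* * w) * (b a)%:C).
  by rewrite nmM nm_real ger0_norm // b_ge0 // ltW.
rewrite E.
apply: le_trans (nmBD _ _); rewrite !nmM mulrBr mulr1 lerD2l lerN2 -mulrA.
by rewrite ler_pM ?nm_ge0 // mulrC ltW.
Qed.

(** With t = |1 - conj(c) a|, the Moebius expression has real part at most 2 b a / t^2 at [a], by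
    [nm a <= nm c], and varies by no more than that between [a] and [w]. Only its imaginary part at
    [a] can be large, and that is subtracted. *)
Lemma near_mobius c : nm c < 1 -> nm a <= nm c ->
  b c * nm ((1 + c^* * w) / (1 - c^* * w) -
     (complex.Im ((1 + c^* * a) / (1 - c^* * a)))%:C * 'i%C) <= 4 * gk c a.
Proof.
move=> dc ac; case/andP: r12 => r0 r1.
have Dw : disc w by exact/discE. have Da : disc a by exact/discE.
have n1 : 1 - c^* * a != 0 by rewrite sub1_neq0 ?(ltW dc).
have n2 : 1 - c^* * w != 0 by rewrite sub1_neq0 ?(ltW dc).
pose p (x : C) := (1 + c^* * x) / (1 - c^* * x); rewrite -/(p w) -/(p a).
have bc : 0 <= b c by rewrite b_ge0 // ltW.
have ba : 0 < b a by exact: b_gt0.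
pose t := nm (1 - c^* * a); have t0 : 0 < t by rewrite nm_gt0.
have E : p w - (complex.Im (p a))%:C * 'i%C = (complex.Re (p a))%:C + (p w - p a).
  have Ep : (complex.Re (p a))%:C + (complex.Im (p a))%:C * 'i%C = p a.
    case: (p a) => x y; apply/eqP; rewrite eq_complex /=.
    by rewrite !(mulr0, mul0r, mulr1, mul1r, subr0, add0r, addr0) !eqxx.
  by apply/eqP; rewrite -subr_eq0 -{3}Ep; apply/eqP; ring.
have h1 : `|complex.Re (p a)| <= 2 * b a / t ^+ 2.
  rewrite /p Re_mobius -/t nmM nm_conj.
  have ca : (nm c * nm a) ^+ 2 <= 1 by rewrite expr_le1 ?mulr_ge0 ?nm_ge0 // mulr_ile1 ?nm_ge0 // ltW.
  rewrite ger0_norm ?divr_ge0 ?sqr_ge0 //; last by rewrite subr_ge0.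
  rewrite ler_wpM2r ?invr_ge0 ?sqr_ge0 //.
  have : nm a ^+ 2 * nm a ^+ 2 <= nm c ^+ 2 * nm a ^+ 2.
    by rewrite ler_wpM2r ?sqr_ge0 // lerXn2r ?nnegrE ?nm_ge0.
  have : nm a ^+ 2 <= 1 by rewrite expr_le1 ?nm_ge0 // ltW.
  by rewrite exprMn /b; have := sqr_ge0 (nm a); nra.
have h2 : nm (p w - p a) <= 2 * b a / t ^+ 2.
  rewrite (_ : p w - p a = 2 * c^* * (w - a) / ((1 - c^* * w) * (1 - c^* * a))); last first.
    by rewrite /p; field; rewrite n1 n2.
  have q0 : 0 < nm (1 - c^* * w) by rewrite nm_gt0.
  have qt : 0 < nm (1 - c^* * w) * t by exact: mulr_gt0 q0 t0.
  rewrite nmM nmV [nm (_ * (1 - c^* * a))]nmM -/t (ler_pdivrMr _ _ qt) !nmM.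
  rewrite (_ : nm 2 = 2); last by rewrite -[2](rmorph_nat (real_complex R) 2) nm_real ger0_norm.
  rewrite nm_conj (_ : 2 * b a / t ^+ 2 * _ = 2 * (b a * nm (1 - c^* * w) / t)); last first.
    by field; rewrite gt_eqF.
  rewrite -mulrA ler_wpM2l // ler_pdivlMr //.
  have hk := near_harnack dc; rewrite -/t in hk; have pp := near_pos.
  have ra : nm (w - a) * t <= t * nm (1 - a^* * w) * (1 - r).
    rewrite mulrC -mulrA ler_wpM2l ?(ltW t0) //; apply: le_trans (ltW near) _.
    by rewrite mulrC ler_wpM2l ?(ltW pp) //; lra.
  have wt : 0 <= nm (w - a) * t by rewrite mulr_ge0 ?nm_ge0 // ltW.
  rewrite -mulrA (mulrC (b a)); apply: le_trans (ler_piMl wt (ltW dc)) _.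
  exact: le_trans ra hk.
rewrite E; have h3 : nm ((complex.Re (p a))%:C + (p w - p a)) <= 4 * b a / t ^+ 2.
  apply: le_trans (nmD _ _) _; rewrite nm_real.
  by rewrite (_ : 4 * b a / t ^+ 2 = 2 * b a / t ^+ 2 + 2 * b a / t ^+ 2); [exact: lerD | ring].
apply: le_trans (ler_wpM2l bc h3) _; rewrite /gk -/t le_eqVlt; apply/orP; left; apply/eqP; ring.
Qed.
End PseudohyperbolicDisc.

(** * A telescoping inequality and convergence at a common rate *)

Section Telescoping.
Variables (R : realType) (key y : nat -> R).
Hypothesis y0 : forall k, 0 <= y k.

Lemma inv1_le k : (1 + y k)^-1 <= 1.
Proof. by rewrite invf_le1 ?ltr_wpDr // lerDl. Qed.

Lemma inv1_ge0 k : 0 <= (1 + y k)^-1.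
Proof. by rewrite invr_ge0 addr_ge0. Qed.

(* Removing an index with the smallest key multiplies every other term by at most 1. *)
Lemma sorted_telescope s : sorted (fun i j => key i <= key j) s ->
  \sum_(j <- s) y j * \prod_(k <- s | key j <= key k) (1 + y k)^-1 <=
  1 - \prod_(k <- s) (1 + y k)^-1.
Proof.
elim: s => [|x s IH] hs; first by rewrite !big_nil subrr.
have tr : transitive (fun i j => key i <= key j) by move=> a b c; exact: le_trans.
have {IH}hI := IH (path_sorted hs).
have hx : forall k, k \in s -> key x <= key k by apply/allP; exact: order_path_min tr hs.
set P := \prod_(k <- s) _ in hI.
have Ex : \prod_(k <- x :: s | key x <= key k) (1 + y k)^-1 = (1 + y x)^-1 * P.
  rewrite big_cons lexx; congr (_ * _); rewrite big_seq_cond /P [RHS]big_seq; apply: eq_bigl => k.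
  by case: (boolP (k \in s)) => // /hx ->.
rewrite [X in X <= _]big_cons Ex [X in _ <= 1 - X]big_cons -/P.
have P0 : 0 <= P by apply: prodr_ge0 => k _; exact: inv1_ge0.
have h : \sum_(j <- s) y j * \prod_(k <- x :: s | key j <= key k) (1 + y k)^-1 <= 1 - P.
  apply: le_trans hI; apply: ler_sum => j _; rewrite ler_wpM2l // big_cons.
  case: ifP => // _; rewrite ler_piMl ?inv1_le //.
  by apply: prodr_ge0 => k _; exact: inv1_ge0.
have d0 : 1 + y x != 0 by rewrite gt_eqF // ltr_wpDr.
have E : y x * ((1 + y x)^-1 * P) = P - (1 + y x)^-1 * P by field.
by rewrite E; lra.
Qed.

Lemma telescope n :
  \sum_(j < n) y j * \prod_(k < n | key j <= key k) (1 + y k)^-1 <= 1.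
Proof.
pose s := sort (fun i j => key i <= key j) (index_iota 0 n).
have ps : perm_eq (index_iota 0 n) s by rewrite perm_sym perm_sort.
have to : total (fun i j => key i <= key j) by move=> a b; exact: le_total.
have := sorted_telescope (sort_sorted to (index_iota 0 n)); rewrite -/s.
rewrite -(perm_big _ ps) /= big_mkord => h.
apply: (@le_trans _ _ (1 - \prod_(k <- s) (1 + y k)^-1)); last first.
  by rewrite gerBl; apply: prodr_ge0 => k _; exact: inv1_ge0.
apply: le_trans h; apply: ler_sum => j _.
by rewrite -(perm_big _ ps) /= big_mkord.
Qed.

(** One tail serves every sequence with steps at most Q y_n, so the partial products converge
    uniformly wherever [Q] is uniform. *)
Lemma summable_limit (B : R) : (forall n, \sum_(k < n) y k <= B) ->
  exists tail : nat -> R, [/\ forall n, 0 <= tail n,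
    forall e : R, 0 < e -> exists n0, forall n, (n0 <= n)%N -> tail n <= e &
    forall (v : nat -> R[i]) Q, 0 <= Q -> (forall n, nm (v n.+1 - v n) <= Q * y n) ->
      exists l, forall n, nm (l - v n) <= Q * tail n].
Proof.
move=> hB; pose S n := \sum_(k < n) y k.
have Sinc n m : (n <= m)%N -> S n <= S m.
  move=> nm_; rewrite -(subnKC nm_) /S big_split_ord /= lerDl; exact: sumr_ge0.
have cS : cvgn S.
  by apply: nondecreasing_is_cvgn => //; exists B => _ [n _ <-]; exact: hB.
have Sle n : S n <= limn S by apply: nondecreasing_cvgn_le => // i j; exact: Sinc.
exists (fun n => limn S - S n); split.
- by move=> n; rewrite subr_ge0.
- move=> e e0; move/cvgrPdist_le: cS => /(_ _ e0)[n0 _ h]; exists n0 => n /h.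
  by apply: le_trans; exact: ler_norm.
move=> v Q Q0 hv.
have dist n m : (n <= m)%N -> nm (v m - v n) <= Q * (S m - S n).
  move=> /subnKC <-; elim: (m - n)%N => [|d IH]; first by rewrite addn0 !subrr nm0 mulr0.
  rewrite addnS (_ : v (n + d).+1 - v n = (v (n + d).+1 - v (n + d)%N) + (v (n + d)%N - v n)); last by ring.
  have E : S (n + d).+1 = S (n + d)%N + y (n + d)%N by rewrite /S big_ord_recr.
  apply: le_trans (nmD _ _) _; rewrite E.
  rewrite (_ : Q * _ = Q * y (n + d)%N + Q * (S (n + d)%N - S n)); last by ring.
  exact: lerD.
have dist' n m : (n <= m)%N -> nm (v m - v n) <= Q * (limn S - S n).
  by move=> h; apply: le_trans (dist _ _ h) _; rewrite ler_wpM2l // lerD2r.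
have hcauchy : cauchy ((v : nat -> R[i]^o) @ \oo).
  apply: cauchy_exP => e /complex_gt0E[-> e0].
  have Q1 : 0 < Q + 1 by lra.
  have e'0 : 0 < complex.Re e / (Q + 1) / 2 by rewrite !divr_gt0.
  move/cvgrPdist_le: cS => /(_ _ e'0)[n0 _ h].
  exists (v n0); exists n0 => // m /= hm; rewrite -ball_normE /= nmE ltcR nmB.
  apply: le_lt_trans (dist' _ _ hm) _; have := h n0 (leqnn n0) => /= h'.
  have h2 : limn S - S n0 <= complex.Re e / (Q + 1) / 2 by apply: le_trans h'; exact: ler_norm.
  apply: le_lt_trans (ler_wpM2l Q0 h2) _.
  rewrite mulrA ltr_pdivrMr // mulrA ltr_pdivrMr //; nra.
have hl : ((v : nat -> R[i]^o) @ \oo --> lim ((v : nat -> R[i]^o) @ \oo)).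
  exact: (@complex_cauchy_cvg R _ _ hcauchy).
set l := lim _ in hl; exists l => n.
apply/ler_addgt0Pr => e e0.
have /(_ e e0)[m0 hm] := (proj2 (nX_cvg (v : nat -> R[i]^o) l)) hl.
have := hm (maxn m0 n) (leq_maxl _ _); have := dist' n (maxn m0 n) (leq_maxr _ _).
rewrite nX_scalar (_ : l - v n = (v (maxn m0 n) - v n) - (v (maxn m0 n) - l)); last by ring.
move=> h1 h2; apply: le_trans (nmD _ _) _; rewrite nmN; lra.
Qed.
End Telescoping.

(** * Jones' functions for a sequence of points *)

Section JonesFunctions.
Variables (R : realType) (zeta : nat -> R[i]) (N0 r : R).
Local Notation C := R[i].
(* Padding points are placed at 1, where [b] vanishes, so they contribute nothing. *)
Hypothesis zeta_disc : forall k, nm (zeta k) < 1 \/ zeta k = 1.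
Hypothesis N00 : 0 < N0.
Hypothesis zeta_sum : forall j n, nm (zeta j) < 1 -> \sum_(k < n) gk (zeta k) (zeta j) <= N0.
Hypothesis r12 : 0 < r <= 1 / 2.

Let bz k := b (zeta k).
(** Chosen so that the deviations 4 gk / N of the factors near a net point sum to at most 1/2; the
    sum of the moduli of all the functions is then bounded by the same [N]. *)
Let N := 8 * N0.

(* The factors [1 / (1 + u)] replace Jones' exponentials [exp (- u)].  Since [Re u >= 0] they are
   at most 1 in modulus, and removing the imaginary part of [mob k] at [zeta j] keeps the product
   away from 0 near [zeta j]. *)
Definition mob k (z : C) : C := (1 + (zeta k)^* * z) / (1 - (zeta k)^* * z).
Definition uu j k z : C := (bz k / N)%:C * (mob k z - (complex.Im (mob k (zeta j)))%:C * 'i%C).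
(** Only points at least as close to the circle as [zeta j] enter: [near_mobius] asks for this order
    and [telescope] sums along it. *)
Definition fac j k z : C := if nm (zeta j) <= nm (zeta k) then (1 + uu j k z)^-1 else 1.
Definition base j z : C := ((bz j)%:C / (1 - (zeta j)^* * z)) ^+ 2.
Definition ff j n z : C := base j z * \prod_(k < n) fac j k z.
(** Both the modulus of [base] and a lower bound for [N] times the real part of [uu]; this double
    role makes the sum telescope. *)
Definition xx k (z : C) : R := bz k ^+ 2 / nm (1 - (zeta k)^* * z) ^+ 2.
Definition near j w := [/\ nm (zeta j) < 1, nm w < 1 & nm (w - zeta j) < r * nm (1 - (zeta j)^* * w)].

Lemma N_gt0 : 0 < N. Proof. by rewrite mulr_gt0. Qed.

Lemma zeta_le1 k : nm (zeta k) <= 1.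
Proof. by case: (zeta_disc k) => [/ltW//|->]; rewrite nm1. Qed.

Lemma bz_ge0 k : 0 <= bz k. Proof. exact/b_ge0/zeta_le1. Qed.

Lemma bz_pad k : zeta k = 1 -> bz k = 0.
Proof. by rewrite /bz => ->; rewrite /b nm1 expr1n subrr. Qed.

Lemma den_neq0 k z : nm z < 1 -> 1 - (zeta k)^* * z != 0.
Proof. by move=> hz; apply: sub1_neq0; [exact: zeta_le1 | exact/discE]. Qed.

Lemma Re_uu j k z : nm z < 1 -> xx k z / N <= complex.Re (uu j k z).
Proof.
move=> hz; rewrite /uu Re_realM.
have -> y : complex.Re (mob k z - y%:C * 'i%C) = complex.Re (mob k z).
  by case: (mob k z) => p q /=; ring.
rewrite /mob Re_mobius /xx (_ : bz k ^+ 2 / _ / N = bz k / N * (bz k / nm (1 - (zeta k)^* * z) ^+ 2)).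
  2: by ring.
rewrite ler_wpM2l ?divr_ge0 ?bz_ge0 ?(ltW N_gt0) // ler_wpM2r ?invr_ge0 ?sqr_ge0 //.
rewrite /bz /b nmM nm_conj lerD2l lerN2.
by rewrite exprMn ler_piMr ?sqr_ge0 // expr_le1 ?nm_ge0 // ltW.
Qed.

Lemma xx_ge0 k z : 0 <= xx k z. Proof. by rewrite divr_ge0 ?sqr_ge0. Qed.

Lemma nm_1uu j k z : nm z < 1 -> 1 + xx k z / N <= nm (1 + uu j k z).
Proof.
move=> hz; apply: le_trans (Re_le_nm _); apply: le_trans (ler_norm _).
by rewrite raddfD /= lerD2l Re_uu.
Qed.

Lemma xN_ge0 k z : 0 <= xx k z / N.
Proof. by rewrite divr_ge0 ?xx_ge0 // ltW // N_gt0. Qed.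

Lemma uu_neq0 j k z : nm z < 1 -> 1 + uu j k z != 0.
Proof.
by move=> hz; rewrite -nm_gt0; apply: lt_le_trans (nm_1uu j k hz); rewrite ltr_pwDl ?xN_ge0.
Qed.

Lemma fac_le j k z : nm z < 1 -> nm (zeta j) <= nm (zeta k) -> nm (fac j k z) <= (1 + xx k z / N)^-1.
Proof.
move=> hz hk; rewrite /fac hk nmV lef_pV2 ?posrE ?nm_1uu //.
  by rewrite nm_gt0 uu_neq0.
by rewrite ltr_pwDl ?xN_ge0.
Qed.

Lemma fac_le1 j k z : nm z < 1 -> nm (fac j k z) <= 1.
Proof.
move=> hz; have [h|h] := boolP (nm (zeta j) <= nm (zeta k)); last by rewrite /fac (negbTE h) nm1.
by apply: le_trans (fac_le hz h) _; rewrite invf_le1 ?lerDl ?xN_ge0 // ltr_pwDl ?xN_ge0.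
Qed.

Lemma nm_base j z : nm (base j z) = xx j z.
Proof.
by rewrite /base /xx nmX nmM nmV expr_div_n nm_real real_normK ?num_real.
Qed.

Lemma ff_le j n z : nm z < 1 ->
  nm (ff j n z) <= xx j z * \prod_(k < n | nm (zeta j) <= nm (zeta k)) (1 + xx k z / N)^-1.
Proof.
move=> hz; rewrite /ff nmM nm_base ler_wpM2l ?xx_ge0 // nm_prod.
rewrite [X in _ <= X]big_mkcond /=; apply: ler_prod => k _; rewrite nm_ge0 /=.
by case: ifP => h; [exact: fac_le | rewrite /fac h nm1].
Qed.

Lemma ff_sum n z : nm z < 1 -> \sum_(j < n) nm (ff j n z) <= N.
Proof.
move=> hz; have H := telescope (fun k => nm (zeta k)) (fun k => xN_ge0 k z) n.
apply: le_trans (_ : N * \sum_(j < n) (xx j z / N) *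
   \prod_(k < n | nm (zeta j) <= nm (zeta k)) (1 + xx k z / N)^-1 <= _); last first.
  by rewrite -[X in _ <= X]mulr1 ler_wpM2l // ltW // N_gt0.
rewrite mulr_sumr; apply: ler_sum => j _; apply: le_trans (ff_le _ _ hz) _.
by rewrite mulrA mulrCA divff ?mulr1 // gt_eqF // N_gt0.
Qed.

Lemma ff_decr j n m z : nm z < 1 -> (n <= m)%N -> nm (ff j m z) <= nm (ff j n z).
Proof.
move=> hz /subnKC <-; elim: (m - n)%N => [|d IH]; first by rewrite addn0.
apply: le_trans IH; rewrite addnS /ff big_ord_recr /= mulrA nmM.
by rewrite ler_piMr ?nm_ge0 ?fac_le1.
Qed.

Lemma near_uu j k w : near j w -> nm (zeta j) <= nm (zeta k) ->
  nm (uu j k w) <= 4 * gk (zeta k) (zeta j) / N.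
Proof.
move=> [dj dw hw] jk; have [dk|/bz_pad b0] := zeta_disc k; last first.
  rewrite /uu b0 mul0r mul0r nm0 divr_ge0 ?(ltW N_gt0) // mulr_ge0 // gk_ge0 ?zeta_le1 //.
rewrite /uu nmM nm_real ger0_norm ?divr_ge0 ?bz_ge0 ?(ltW N_gt0) // mulrAC.
rewrite ler_wpM2r ?invr_ge0 ?(ltW N_gt0) //.
exact: (near_mobius r12 dj dw hw dk jk).
Qed.

(** The square [base] is at least 1/4 near its own point, and the product is at least 1 minus the
    sum of the deviations, hence at least 1/2. *)
Lemma ff_near j n w : near j w -> 1 / 8 <= nm (ff j n w).
Proof.
move=> hn; have [dj dw hw] := hn; case/andP: (r12) => r0 r1.
have hb : 1 / 4 <= nm (base j w).
  rewrite nm_base /xx; have h := near_dist_le r12 dj hw.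
  have p := near_pos dj dw; have bj : 0 < bz j by exact/b_gt0/discE.
  rewrite ler_pdivlMr in h; last lra.
  rewrite ler_pdivlMr ?exprn_gt0 //; rewrite -/(bz j) in h.
  have h2 : nm (1 - (zeta j)^* * w) <= 2 * bz j.
    have : nm (1 - (zeta j)^* * w) * (1 / 2) <= nm (1 - (zeta j)^* * w) * (1 - r).
      by rewrite ler_pM2l //; lra.
    by lra.
  have : nm (1 - (zeta j)^* * w) ^+ 2 <= (2 * bz j) ^+ 2.
    by rewrite lerXn2r ?nnegrE ?(ltW p) // mulr_ge0 // ltW.
  by rewrite exprMn; lra.
pose a k := 4 * gk (zeta k) (zeta j) / N.
have a0 k : 0 <= a k.
  by rewrite divr_ge0 ?(ltW N_gt0) // mulr_ge0 // gk_ge0 ?zeta_le1.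
have fa k : 1 - a k <= nm (fac j k w).
  rewrite /fac; case: ifP => h; last by rewrite nm1 gerBl.
  have p : 0 < nm (1 + uu j k w) by rewrite nm_gt0 uu_neq0.
  rewrite nmV; have hu := near_uu hn h; rewrite -/(a k) in hu.
  have h1 : nm (1 + uu j k w) <= 1 + a k by apply: le_trans (nmD _ _) _; rewrite nm1 lerD2l.
  apply: (@le_trans _ _ (1 + a k)^-1); last by rewrite lef_pV2 ?posrE // ltr_pwDl.
  by rewrite -[(_)^-1]mul1r ler_pdivlMr ?ltr_pwDl //; have := a0 k; nra.
have P01 m : 0 <= \prod_(k < m) nm (fac j k w) <= 1.
  apply/andP; split; first by apply: prodr_ge0 => k _; exact: nm_ge0.
  by apply: prodr_ile1 => k _; rewrite nm_ge0 fac_le1.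
have P m : 1 - \sum_(k < m) a k <= \prod_(k < m) nm (fac j k w).
  elim: m => [|m IH]; first by rewrite !big_ord0 subr0.
  rewrite !big_ord_recr /=; have /andP[p0 p1] := P01 m; have := fa m; have := a0 m.
  move: (\prod_(k < m) _) (\sum_(k < m) _) IH p0 p1 => p s; nra.
have sa : \sum_(k < n) a k <= 1 / 2.
  rewrite -mulr_suml -mulr_sumr ler_pdivrMr ?N_gt0 //.
  by have := zeta_sum n dj; rewrite /N; lra.
rewrite /ff nmM nm_prod; have := P n; nra.
Qed.

Lemma mob_le k z : nm z < 1 -> nm (mob k z) <= 2 / (1 - nm z).
Proof.
move=> hz; rewrite /mob nmM nmV; have z0 := nm_ge0 z; have k1 := zeta_le1 k.
have h : nm ((zeta k)^* * z) <= nm z by rewrite nmM nm_conj ler_piMl.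
apply: ler_pM; rewrite ?nm_ge0 ?invr_ge0 ?nm_ge0 //.
  by apply: le_trans (nmD _ _) _; rewrite nm1; lra.
rewrite lef_pV2 ?posrE ?subr_gt0 ?nm_gt0 ?den_neq0 //.
by have := nmBD 1 ((zeta k)^* * z); rewrite nm1; lra.
Qed.

Definition rate j (s : R) : R := 4 / N * (2 / (1 - s) + 2 / (1 - nm (zeta j))).

(** A factor differs from 1 by at most |uu|, which is [bz n] times a constant uniform on smaller
    discs; the 4 in [rate] bounds [base]. *)
Lemma ff_step j n z : nm (zeta j) < 1 -> nm z < 1 ->
  nm (ff j n.+1 z - ff j n z) <= rate j (nm z) * bz n.
Proof.
move=> dj hz; have hb : nm (ff j n z) <= 4.
  apply: le_trans (ff_decr j hz (leq0n n)) _; rewrite /ff big_ord0 mulr1 nm_base.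
  have p : 0 < nm (1 - (zeta j)^* * z) by rewrite nm_gt0 den_neq0.
  rewrite /xx ler_pdivrMr ?exprn_gt0 //.
  have h := nm_sub1_ge (zeta j) z; have bj := b_le_dist (ltW dj); rewrite -/(bz j) in bj.
  have h1 : bz j <= 2 * nm (1 - (zeta j)^* * z).
    have : nm (zeta j) * nm z <= nm (zeta j) by rewrite ler_piMr ?nm_ge0 // ltW.
    by lra.
  have : bz j ^+ 2 <= (2 * nm (1 - (zeta j)^* * z)) ^+ 2.
    by rewrite lerXn2r ?nnegrE ?bz_ge0 // mulr_ge0 // ltW.
  by rewrite exprMn; lra.
have q0 : 0 <= 2 / (1 - nm z) + 2 / (1 - nm (zeta j)).
  by rewrite addr_ge0 // divr_ge0 // subr_ge0 ltW.
have hu : nm (uu j n z) <= bz n / N * (2 / (1 - nm z) + 2 / (1 - nm (zeta j))).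
  have b0 := bz_ge0 n; have Np := N_gt0.
  rewrite /uu nmM nm_real ger0_norm ?divr_ge0 ?(ltW Np) //.
  rewrite ler_wpM2l ?divr_ge0 ?(ltW Np) //; apply: le_trans (nmD _ _) _; apply: lerD.
    exact: mob_le.
  rewrite nmN nmM nm_i mulr1 nm_real; apply: le_trans (Im_le_nm _) _; exact: mob_le.
have hf : nm (fac j n z - 1) <= bz n / N * (2 / (1 - nm z) + 2 / (1 - nm (zeta j))).
  rewrite /fac; case: ifP => h; last first.
    by rewrite subrr nm0 mulr_ge0 // divr_ge0 ?bz_ge0 ?(ltW N_gt0).
  have n0 := uu_neq0 j n hz.
  rewrite (_ : _ - 1 = - (uu j n z * (1 + uu j n z)^-1)); last by field.
  rewrite nmN nmM; apply: le_trans hu; rewrite ler_piMr ?nm_ge0 //.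
  by have := fac_le1 j n hz; rewrite /fac h.
rewrite (_ : ff j n.+1 z - ff j n z = ff j n z * (fac j n z - 1)); last first.
  by rewrite /ff big_ord_recr /=; ring.
rewrite nmM; apply: le_trans (ler_pM (nm_ge0 _) (nm_ge0 _) hb hf) _.
by rewrite /rate le_eqVlt; apply/orP; left; apply/eqP; ring.
Qed.

(** The Blaschke condition, read at one point: |1 - conj(zeta k) zeta j| <= 2 gives bz k * bz j <= 4
    gk. *)
Lemma bz_sum j n : nm (zeta j) < 1 -> \sum_(k < n) bz k <= 4 * N0 / bz j.
Proof.
move=> dj; have bj : 0 < bz j by exact/b_gt0/discE.
rewrite ler_pdivlMr // mulr_suml; apply: le_trans (_ : \sum_(k < n) 4 * gk (zeta k) (zeta j) <= _).
  apply: ler_sum => k _; rewrite /gk mulrA.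
  have p : 0 < nm (1 - (zeta k)^* * zeta j) by rewrite nm_gt0 den_neq0.
  rewrite ler_pdivlMr ?exprn_gt0 // -/(bz k) -/(bz j).
  have h2 : nm (1 - (zeta k)^* * zeta j) <= 2.
    apply: le_trans (nmD _ _) _; rewrite nm1 nmN nmM nm_conj.
    have : nm (zeta k) * nm (zeta j) <= 1 by rewrite mulr_ile1 ?nm_ge0 ?zeta_le1.
    lra.
  have h3 : nm (1 - (zeta k)^* * zeta j) ^+ 2 <= 4.
    by rewrite (_ : 4 = 2 ^+ 2) ?lerXn2r ?nnegrE ?nm_ge0 //; ring.
  have bb : 0 <= bz k * bz j by rewrite mulr_ge0 ?bz_ge0 // ltW.
  by rewrite [X in _ <= X]mulrC ler_wpM2l.
by rewrite -mulr_sumr; have := zeta_sum n dj; lra.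
Qed.

Lemma holo_mob k : exists dg, holo (mob k : C -> R[i]^o) dg.
Proof.
have h1 := holoM (holo_cst ((zeta k)^*)) (@holo_id R).
have h2 := holoD (holo_cst 1) (holoM (holo_cst (-1)) h1).
have h3 : forall z : C, nm z < 1 -> 1 + -1 * ((zeta k)^* * z) != 0.
  by move=> z hz; rewrite mulN1r den_neq0.
have := holoM (holoD (holo_cst 1) h1) (holoV h2 h3).
set g := fun z => _; set dg := fun z => _; move=> h; exists dg.
suff -> : (mob k : C -> R[i]^o) = g by [].
by apply/funext => z; rewrite /g /mob mulN1r.
Qed.

Lemma holo_ff j n : exists dg, holo (ff j n : C -> R[i]^o) dg.
Proof.
have hfac k : exists dg, holo (fac j k : C -> R[i]^o) dg.
  have -> : fac j k = if nm (zeta j) <= nm (zeta k) then fun z => (1 + uu j k z)^-1 else fun=> 1.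
    by apply/funext => z; rewrite /fac; case: ifP.
  case: ifP => h; last by exists (fun=> 0); exact: holo_cst.
  have [dg hg] := holo_mob k.
  have H := holoD (holo_cst 1) (holoM (holo_cst ((bz k / N)%:C))
    (holoD hg (holo_cst (- ((complex.Im (mob k (zeta j)))%:C * 'i%C))))).
  have H' := holoV H (fun z hz => uu_neq0 j k hz).
  by eexists; exact: H'.
elim: n => [|n [dg IH]].
  have h1 := holoM (holo_cst ((zeta j)^*)) (@holo_id R).
  have h2 := holoD (holo_cst 1) (holoM (holo_cst (-1)) h1).
  have h3 : forall z : C, nm z < 1 -> 1 + -1 * ((zeta j)^* * z) != 0.
    by move=> z hz; rewrite mulN1r den_neq0.
  have h4 := holoM (holo_cst ((bz j)%:C)) (holoV h2 h3).
  have := holoM h4 h4; set g := fun z => _; set dg := fun z => _; move=> h; exists dg.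
  suff -> : (ff j 0 : C -> R[i]^o) = g by [].
  by apply/funext => z; rewrite /g /ff big_ord0 mulr1 /base mulN1r expr2.
have [df hf] := hfac n; have := holoM IH hf.
set g := fun z => _; set dg' := fun z => _; move=> h; exists dg'.
suff -> : (ff j n.+1 : C -> R[i]^o) = g by [].
by apply/funext => z; rewrite /g /ff big_ord_recr /= mulrA.
Qed.

Lemma cSM_ff j n : cSM (ff j n : C -> R[i]^o).
Proof.
have cst (a : R[i]^o) : cSM (fun=> a) by exact: SM_cst.
have mM (f g : C -> R[i]^o) : cSM f -> cSM g -> cSM (fun z => f z * g z : R[i]^o).
  by move=> hf hg; exact: SM_Z hf hg.
have mD (f g : C -> R[i]^o) : cSM f -> cSM g -> cSM (fun z => f z + g z : R[i]^o) by exact: SM_D.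
have mB (f g : C -> R[i]^o) : cSM f -> cSM g -> cSM (fun z => f z - g z : R[i]^o) by exact: SM_B.
have mV (f : C -> R[i]^o) : cSM f -> cSM (fun z => (f z)^-1 : R[i]^o) by exact: SM_V.
have mz k := mM _ _ (cst ((zeta k)^*)) (@cSM_id R).
have mmob k : cSM (mob k : C -> R[i]^o).
  exact: (mM _ _ (mD _ _ (cst 1) (mz k)) (mV _ (mB _ _ (cst 1) (mz k)))).
elim: n => [|n IH].
  have m1 := mM _ _ (cst ((bz j)%:C)) (mV _ (mB _ _ (cst 1) (mz j))).
  have := mM _ _ m1 m1; rewrite /cSM; congr SM; apply/funext => p.
  by rewrite /ff big_ord0 mulr1 /base expr2.
have mf : cSM (fac j n : C -> R[i]^o).
  have -> : fac j n = if nm (zeta j) <= nm (zeta n) then fun z => (1 + uu j n z)^-1 else fun=> 1.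
    by apply/funext => z; rewrite /fac; case: ifP.
  case: ifP => _ //.
  exact: (mV _ (mD _ _ (cst 1) (mM _ _ (cst _) (mB _ _ (mmob n) (cst _))))).
have := mM _ _ IH mf; rewrite /cSM; congr SM; apply/funext => p.
by rewrite /ff big_ord_recr /= mulrA.
Qed.
End JonesFunctions.

(** * Construction of the kernel from Jones' functions *)

Section KernelConstruction.
Variables (R : realType) (zeta : nat -> R[i]) (N0 r : R).
Local Notation C := R[i].
Local Notation T2 := (measurableTypeR R * measurableTypeR R)%type.
Hypothesis zeta_disc : forall k, nm (zeta k) < 1 \/ zeta k = 1.
Hypothesis N00 : 0 < N0.
Hypothesis zeta_sum : forall j n, nm (zeta j) < 1 -> \sum_(k < n) gk (zeta k) (zeta j) <= N0.
Hypothesis r12 : 0 < r <= 1 / 2.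
Local Notation near := (near zeta r).
Local Notation ff := (ff zeta N0).

Lemma rate_gt0 j s : nm (zeta j) < 1 -> s < 1 -> 0 < rate zeta N0 j s.
Proof.
move=> dj s1; rewrite /rate !mulr_gt0 ?invr_gt0 ?mulr_gt0 //.
by rewrite addr_gt0 // divr_gt0 // subr_gt0.
Qed.

Lemma jones_limit : exists F : nat -> C -> C, [/\
  forall j z, nm z < 1 -> nm (zeta j) < 1 -> forall n, nm (F j z) <= nm (ff j n z),
  forall j w, near j w -> 1 / 8 <= nm (F j w),
  forall j, nm (zeta j) < 1 -> holo_lim (F j),
  forall j z, ~ (nm z < 1 /\ nm (zeta j) < 1) -> F j z = 0 &
  forall j, cSM (F j : C -> R[i]^o)].
Proof.
(* Summability of the [bz k] is read at one point of the disc; when there are only padding points,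
   the zero functions serve. *)
have [[j0 dj0]|none] := pselect (exists j, nm (zeta j) < 1); last first.
  exists (fun _ _ => 0); split => // [j z _ dj|j w [dj]|j dj|j]; try by exfalso; apply: none; exists j.
  exact: SM_cst.
have [tail [t0 tlim tv]] := summable_limit (bz_ge0 zeta_disc) (fun n => bz_sum zeta_disc zeta_sum n dj0).
have ex j z : exists l, (nm z < 1 /\ nm (zeta j) < 1 ->
    forall n, nm (l - ff j n z) <= rate zeta N0 j (nm z) * tail n) /\
    (~ (nm z < 1 /\ nm (zeta j) < 1) -> l = 0).
  have [[hz dj]|h] := pselect (nm z < 1 /\ nm (zeta j) < 1); last by exists 0.
  have [l hl] := tv (fun n => ff j n z) _ (ltW (rate_gt0 dj hz)) (fun n => ff_step zeta_disc N00 n dj hz).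
  by exists l; split => // h; exfalso; exact: h.
have /choice[F hF] : forall p : nat * C, exists l, (nm p.2 < 1 /\ nm (zeta p.1) < 1 ->
    forall n, nm (l - ff p.1 n p.2) <= rate zeta N0 p.1 (nm p.2) * tail n) /\
    (~ (nm p.2 < 1 /\ nm (zeta p.1) < 1) -> l = 0) by move=> [j z]; exact: ex.
have conv j z : nm z < 1 -> nm (zeta j) < 1 -> forall e : R, 0 < e ->
    exists n0, forall n, (n0 <= n)%N -> nm (F (j, z) - ff j n z) <= e.
  move=> hz dj e e0; have q0 := rate_gt0 dj hz.
  have [n0 h] := tlim (e / rate zeta N0 j (nm z)) ltac:(by rewrite divr_gt0).
  exists n0 => n /h hn; apply: le_trans ((hF (j, z)).1 (conj hz dj) n) _.
  by rewrite mulrC -ler_pdivlMr.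
exists (fun j z => F (j, z)); split.
- move=> j z hz dj n; apply/ler_addgt0Pr => e e0.
  have [n0 h] := conv j z hz dj e e0.
  have h1 := h (maxn n0 n) (leq_maxl _ _).
  have h2 := ff_decr zeta_disc N00 j hz (leq_maxr n0 n).
  by have := nmBD (F (j, z)) (ff j (maxn n0 n) z); lra.
- move=> j w hn; have [dj hw _] := hn; apply/ler_addgt0Pr => e e0.
  have [n0 h] := conv j w hw dj e e0; have := ff_near zeta_disc N00 zeta_sum r12 n0 hn.
  by have := h n0 (leqnn _); have := nmBD (ff j n0 w) (F (j, w)); rewrite (nmB (ff _ _ _)); lra.
- move=> j dj s e s1 e0; have q0 := rate_gt0 dj s1.
  have [n0 h] := tlim (e / rate zeta N0 j s) ltac:(by rewrite divr_gt0).
  have [dg hg] := holo_ff zeta_disc N00 j n0; exists (ff j n0), dg; split => // z hz.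
  have hz1 : nm z < 1 by lra.
  apply: le_trans ((hF (j, z)).1 (conj hz1 dj) n0) _.
  apply: (@le_trans _ _ (rate zeta N0 j s * tail n0)); last first.
    by rewrite mulrC -ler_pdivlMr // h.
  rewrite ler_wpM2r ?t0 // /rate ler_wpM2l ?divr_ge0 ?mulr_ge0 ?(ltW N00) // lerD2r.
  by rewrite ler_wpM2l // lef_pV2 ?posrE ?subr_gt0 // lerD2l lerN2.
- by move=> j z; exact: (hF (j, z)).2.
move=> j; have [dj|dj] := pselect (nm (zeta j) < 1); last first.
  have -> : (fun z => F (j, z)) = (fun=> 0) by apply/funext => z; apply: (hF (j, z)).2 => -[].
  exact: SM_cst.
have md : measurable [set p : T2 | nm (cx p) < 1].
  have := SM_measurable_norm (@cSM_id R) => m1.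
  exact: measurable_ltr_set m1 (measurable_cst _).
apply: (SM_lim (g_ := fun n p => if `[< nm (cx p) < 1 >] then ff j n (cx p) : R[i]^o else 0)).
  move=> n; apply: (SM_if md); last exact: SM_cst.
  exact: (cSM_ff zeta N0 j n).
move=> p e e0; have [hz|hz] := pselect (nm (cx p) < 1); last first.
  exists 0%N => n _; rewrite (hF (j, cx p)).2; last by case.
  by rewrite (asboolF hz) subrr nX0.
have e20 : 0 < e / 2 by rewrite divr_gt0.
have [n0 h] := conv j (cx p) hz dj _ e20; exists n0 => n /h hn.
by rewrite (asboolT hz) -nXN opprB nX_scalar; lra.
Qed.

Lemma measurable_near j : measurable [set p : T2 | near j (cx p)].
Proof.
have [dj|dj] := pselect (nm (zeta j) < 1); last first.
  rewrite (_ : mkset _ = set0); first exact: measurable0.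
  by apply/seteqP; split => p // [].
have md : measurable [set p : T2 | nm (cx p) < 1].
  exact: measurable_ltr_set (SM_measurable_norm (@cSM_id R)) (measurable_cst _).
have m1 : measurable_fun setT (fun p : T2 => nm (cx p - zeta j)).
  exact: (SM_measurable_nX (zeta j : R[i]^o) (@cSM_id R)).
have m2 : measurable_fun setT (fun p : T2 => r * nm (1 - (zeta j)^* * cx p)).
  apply: measurable_funM; first exact: measurable_cst.
  exact: (SM_measurable_norm (SM_B (SM_cst _ (1 : R[i]^o)) (SM_Z (SM_cst _ ((zeta j)^* : R[i]^o)) (@cSM_id R)))).
rewrite (_ : mkset _ = [set p : T2 | nm (cx p) < 1] `&`
   [set p : T2 | nm (cx p - zeta j) < r * nm (1 - (zeta j)^* * cx p)]).
  by apply: measurableI md _; exact: measurable_ltr_set m1 m2.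
by apply/seteqP; split => p /= [] //.
Qed.

(** The discs may overlap; taking the first index makes the net point attached to [w] unique and
    measurable in [w]. *)
Definition cell j w := near j w /\ forall i, (i < j)%N -> ~ near i w.

Lemma measurable_cell j : measurable [set p : T2 | cell j (cx p)].
Proof.
rewrite (_ : mkset _ = [set p : T2 | near j (cx p)] `&`
   \bigcap_i [set p : T2 | (i < j)%N -> ~ near i (cx p)]).
  apply: measurableI; first exact: measurable_near.
  apply: bigcapT_measurable => i; have [ij|ij] := boolP (i < j)%N; last first.
    by rewrite (_ : mkset _ = setT) ?measurableT //; apply/seteqP; split.
  rewrite (_ : mkset _ = ~` [set p : T2 | near i (cx p)]).
    by apply: measurableC; exact: measurable_near.
  by apply/seteqP; split => p /= h; [exact: h | move=> _].
apply/seteqP; split => p /= [h1 h2]; split => // i; first by move=> _; exact: h2.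
exact: (h2 i I).
Qed.

Lemma cell_exists w : (exists j, near j w) -> exists j, cell j w.
Proof.
move=> hn; have hb : exists j, `[< near j w >] by case: hn => j hj; exists j; exact/asboolP.
exists (ex_minn hb); case: ex_minnP => j /asboolP hj hmin; split => // i ij hi.
by have := hmin i ltac:(exact/asboolP); rewrite leqNgt ij.
Qed.

Lemma cell_unique w i j : cell i w -> cell j w -> i = j.
Proof.
move=> [hi mi] [hj mj]; case: (ltngtP i j) => // h; first by case: (mj i h).
by case: (mi j h).
Qed.

Lemma kernel_exists : exists c : C -> C -> C, [/\
  forall w, (exists j, near j w) -> holo_lim (c^~ w),
  forall w, (exists j, near j w) -> c w w = 1,
  forall z w, ~ (exists j, near j w) -> c z w = 0,
  cSM2 (c : C -> C -> R[i]^o) &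
  forall z, nm z < 1 -> cule (fun w => nm (c z w) / (b w * nm (z - w))) (4608 * r * N0)].
Proof.
have [F [Fle Fge Fholo F0 FSM]] := jones_limit.
have /choice[J hJ] : forall w, exists j, (exists i, near i w) -> cell j w.
  move=> w; have [h|h] := pselect (exists i, near i w); last by exists 0%N.
  by have [j hj] := cell_exists h; exists j.
pose c z w : C := if `[< exists j, near j w >] then F (J w) z / F (J w) w else 0.
have cE j z w : cell j w -> c z w = F j z / F j w.
  move=> hj; have ex : exists j, near j w by exists j; case: hj.
  by rewrite /c (asboolT ex) (cell_unique (hJ w ex) hj).
have Fn j w : near j w -> F j w != 0.
  by move=> /Fge h; rewrite -nm_gt0; apply: lt_le_trans h; lra.
exists c; split.
- move=> w ex; have hj := hJ w ex; have nj := hj.1; have [dj _ _] := nj.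
  move=> s e s1 e0; have k0 : 0 < nm (F (J w) w) by rewrite nm_gt0 Fn.
  have [g [dg [hg fg]]] := Fholo _ dj s _ s1 (mulr_gt0 e0 k0).
  exists (fun z => g z * (F (J w) w)^-1), (fun z => dg z * (F (J w) w)^-1 + g z * 0); split.
    exact: holoM hg (holo_cst _).
  by move=> z /fg h; rewrite (cE _ z w hj) -mulrBl nmM nmV ler_pdivrMr.
- by move=> w ex; rewrite (cE _ _ _ (hJ w ex)) divff // Fn //; exact: (hJ w ex).1.
- by move=> z w h; rewrite /c (asboolF h).
(* At each pair at most one cell contributes, so the partial sums are eventually constant. *)
- apply: (SM_lim (g_ := fun n (q : T2 * T2) => \sum_(j < n) (if `[< cell j (cx q.2) >] then
      F j (cx q.1) / F j (cx q.2) : R[i]^o else 0))).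
    move=> n; have := @SM_sum _ _ R _ (index_enum 'I_n) R[i]^o
      (fun j q => if `[< cell j (cx q.2) >] then F j (cx q.1) / F j (cx q.2) : R[i]^o else 0); apply.
    move=> j _; apply: (SM_if (A := [set q : T2 * T2 | cell j (cx q.2)])); last exact: SM_cst.
      have ms : measurable_fun setT (snd : T2 * T2 -> T2) by exact: measurable_snd.
      by have := ms measurableT _ (measurable_cell j); rewrite setTI.
    exact: SM_Z (cSM2_fst (FSM j)) (SM_V (cSM2_snd (FSM j))).
  move=> q e e0; set z := cx q.1; set w := cx q.2.
  have [ex|ex] := pselect (exists j, near j w); last first.
    exists 0%N => n _; rewrite big1 ?sub0r ?nXN; last first.
      by move=> j _; rewrite asboolF // => -[h _]; apply: ex; exists j.
    by rewrite /c (asboolF ex) nX0.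
  exists (J w).+1 => n hn; have hj := hJ w ex.
  rewrite (bigD1 (Ordinal hn)) //= (asboolT hj) big1 ?addr0 => [|i hi].
    by rewrite (cE _ z w hj) subrr nX0.
  rewrite asboolF // => hi'; move: hi; rewrite -val_eqE /=.
  by rewrite (cell_unique hi' hj) eqxx.
move=> z hz; have r0 : 0 < r by case/andP: r12.
(* 24 is 8 for 1 / |F_k(w)| times 3 for b (zeta k) / b w. With 12 * 2 r b (zeta k) from
   [cule_kernel] a cell contributes 576 r |F_k(z)|, and the |F_k(z)| sum to at most 8 N0. *)
pose q k : R := if `[< nm (zeta k) < 1 >] then 24 * nm (F k z) / b (zeta k) else 0.
have bk k : nm (zeta k) < 1 -> 0 < b (zeta k) by move=> h; apply/b_gt0/discE.
have q0 k : 0 <= q k.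
  rewrite /q; case: ifP => // /asboolP h.
  by rewrite divr_ge0 ?(ltW (bk k h)) // mulr_ge0 ?nm_ge0.
pose psi k (p : T2) : R := q k * ((box (zeta k) (2 * r * b (zeta k)) (cx p))%:R / nm (cx p - z)).
have mpsi k : measurable_fun setT (psi k).
  apply: measurable_funM; first exact: measurable_cst.
  apply: measurable_funM; first exact: measurable_fun_box.
  have h := SM_measurable_norm (SM_V (SM_B (@cSM_id R) (SM_cst _ (z : R[i]^o)))).
  rewrite (_ : (fun _ => _) = fun p : T2 => nX ((cx p - z)^-1 : R[i]^o)) //.
  by apply/funext => p; rewrite nX_scalar nmV.
have psi0 k p : 0 <= psi k p by rewrite mulr_ge0 // divr_ge0 ?ler0n ?nm_ge0.
apply: (uint_le_series mpsi psi0 (c := fun k => 576 * r * nm (F k z))).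
- move=> k; apply: uint_le_int => //; rewrite /psi /q.
  case: ifP => [/asboolP h|/asboolP h]; last first.
    have H0 : cule (fun _ : C => 0 : R) 0 by exact: uint_le0.
    have h5 : 0 <= 576 * r * nm (F k z) by exact: mulr_ge0 (mulr_ge0 (ler0n _ _) (ltW r0)) (nm_ge0 _).
    by apply: uint_le_mono (cule_le h5 H0) => p; rewrite mul0r.
  have rb : 0 < 2 * r * b (zeta k) by rewrite !mulr_gt0 ?bk.
  have c0 : 0 <= 24 * nm (F k z) / b (zeta k).
    by rewrite divr_ge0 ?(ltW (bk k h)) // mulr_ge0 ?nm_ge0.
  have H := culeZ c0 (cule_kernel z (zeta k) rb).
  have <- : 24 * nm (F k z) / b (zeta k) * (12 * (2 * r * b (zeta k))) = 576 * r * nm (F k z).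
    by field; rewrite gt_eqF // bk.
  exact: H.
- move=> n; rewrite -mulr_sumr.
  have h : \sum_(k < n) nm (F k z) <= 8 * N0.
    apply: le_trans (ff_sum zeta_disc N00 n hz); apply: ler_sum => k _.
    have [h|h] := pselect (nm (zeta k) < 1); first exact: Fle.
    by rewrite F0 ?nm0 ?nm_ge0 //; case.
  have K0 : 0 <= 576 * r by exact: mulr_ge0 (ler0n _ _) (ltW r0).
  apply: le_trans (ler_wpM2l K0 h) _.
  by rewrite (_ : 576 * r * (8 * N0) = 4608 * r * N0); [exact: lexx | ring].
apply: aeT_all => p; set w := cx p.
have [ex|ex] := pselect (exists j, near j w); last first.
  by exists 0%N; rewrite big_ord0 /c (asboolF ex) nm0 mul0r.
have hj := hJ w ex; set j := J w in hj; have nj := hj.1; have [dj dw hw] := nj.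
exists j.+1; rewrite big_ord_recr /= -[X in X <= _]add0r; apply: lerD; first exact: sumr_ge0.
rewrite (cE j z w hj) /psi /q (asboolT dj) (near_box r12 dj dw hw) nmM nmV mul1r (nmB w).
have F8 := Fge _ _ nj; have b3 := near_b r12 dj dw hw; have bj := bk j dj.
have bw : 0 < b w by exact/b_gt0/discE.
rewrite invfM mulrA; apply: ler_wpM2r; first by rewrite invr_ge0 nm_ge0.
have F0' : 0 < nm (F j w) by lra.
have h1 : (nm (F j w))^-1 <= 8 by rewrite -[8]invrK lef_pV2 ?posrE ?invr_gt0 //; lra.
have h2 : (b w)^-1 <= 3 / b (zeta j) by rewrite ler_pdivlMr // mulrC ler_pdivrMr.
have -> : nm (F j z) / nm (F j w) / b w = nm (F j z) * ((nm (F j w))^-1 / b w) by rewrite mulrA.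
have -> : 24 * nm (F j z) / b (zeta j) = nm (F j z) * (8 * (3 / b (zeta j))) by ring.
apply: ler_wpM2l; first exact: nm_ge0.
by apply: ler_pM h1 h2; rewrite invr_ge0 ltW.
Qed.
End KernelConstruction.

(** * Counting the points of a separated set *)

Section Counting.
Variable R : realType.
Local Notation C := R[i].
Local Notation T2 := (measurableTypeR R * measurableTypeR R)%type.

Let D (t : R) : set T2 := [set p | nm (cx p) < t].

Lemma measurable_disc_set t : measurable (D t).
Proof. exact: measurable_ltr_set (SM_measurable_norm (@cSM_id R)) (measurable_cst _). Qed.

(** Scaling fixes the area up to the factor [w], and the enclosing square bounds that by 4. *)
Lemma disc_area : exists2 w : R, 0 <= w <= 4 &
  forall t, 0 <= t -> lam2 R (D t) = (t ^+ 2 * w)%:E.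
Proof.
have le4 : (lam2 R (D 1) <= 4%:E)%E.
  have <- : 4 * 1 ^+ 2 = 4 :> R by rewrite expr1n mulr1.
  rewrite -(lam2_box (0 : C) ler01); apply: le_measure; rewrite ?inE.
  - exact: measurable_disc_set.
  - exact: measurable_box.
  by move=> p /= h; apply: box0_nm; exact: ltW.
have fin : lam2 R (D 1) \is a fin_num.
  by rewrite ge0_fin_numE ?measure_ge0 // (le_lt_trans le4) // ltry.
exists (fine (lam2 R (D 1))).
  by rewrite fine_ge0 ?measure_ge0 //= -lee_fin fineK.
move=> t; rewrite le_eqVlt => /orP[/eqP<-|t0].
  rewrite expr0n mul0r (_ : D 0 = set0) ?measure0 //.
  by apply/seteqP; split => p //=; rewrite /D /= ltNge nm_ge0.
have ti : 0 < t^-1 by rewrite invr_gt0.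
have := lam2_affine 0 0 ti (measurable_disc_set 1).
rewrite invrK -expr2 => H.
rewrite (_ : (t ^+ 2 * _)%:E = ((t ^+ 2)%:E * (fine (lam2 R (D 1)))%:E)%E) // fineK //.
rewrite -H; congr (lebesgue_measure \x lebesgue_measure)%E.
have E (p : T2) : cx (t^-1 * p.1 + 0, t^-1 * p.2 + 0) = (t^-1)%:C * cx p.
  by case: p => x y; apply/eqP; rewrite eq_complex /= !mul0r subr0 !addr0 !eqxx.
by apply/seteqP; split => p; rewrite /D /= E nmM nm_real gtr0_norm // mulrC ltr_pdivrMr // mul1r.
Qed.

Lemma box_packing (h : R) (s : seq C) (A : set T2) : 0 <= h -> uniq s -> measurable A ->
  (forall c, c \in s -> [set p : T2 | box c h (cx p)] `<=` A) ->
  (forall c c' w, c \in s -> c' \in s -> c <> c' -> box c h w -> ~~ box c' h w) ->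
  (((size s)%:R * (4 * h ^+ 2))%:E <= lam2 R A)%E.
Proof.
move=> h0; elim: s A => [|c s IH] A /=; first by move=> *; rewrite mul0r measure_ge0.
move=> /andP[cs us] mA sA dis.
pose B := [set p : T2 | box c h (cx p)]; have mB : measurable B by exact: measurable_box.
have BA : B `<=` A by apply: sA; rewrite inE eqxx.
have mAB : measurable (A `\` B) by exact: measurableD.
have -> : lam2 R A = (lam2 R B + lam2 R (A `\` B))%E.
  rewrite -measureU ?setDUK //; by apply/seteqP; split => p //= [h1 [_ h2]].
rewrite (lam2_box c h0) -natr1 mulrDl mul1r addrC EFinD; apply: leeD2l.
apply: IH => // [c' c's p hp|c1 c2 w c1s c2s]; last by apply: dis; rewrite inE ?c1s ?c2s orbT.
split; first by apply: (sA c') => //; rewrite inE c's orbT.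
move=> hp'; have cc : c' <> c by move=> e; rewrite -e c's in cs.
by have := dis c' c _ _ _ cc hp; rewrite !inE c's eqxx orbT => /(_ isT isT); rewrite hp'.
Qed.

Variable s : seq C.
Hypothesis s_uniq : uniq s.
Hypothesis s_disc : forall c, c \in s -> nm c < 1.
Hypothesis s_sep : forall c c', c \in s -> c' \in s -> c <> c' -> 1 / 2 <= rho c c'.

(** By [nm2_sub1], rho >= 1/2 reads 4 |c - c'|^2 >= |c - c'|^2 + b c * b c'. *)
Lemma separated_dist c c' : c \in s -> c' \in s -> c <> c' -> b c * b c' <= 3 * nm (c - c') ^+ 2.
Proof.
move=> cs c's cc; have h := s_sep cs c's cc.
have d1 := s_disc cs; have d2 := s_disc c's.
have h1 : (1 / 2) ^+ 2 <= rho c c' ^+ 2 by rewrite lerXn2r ?nnegrE ?rho_ge0.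
have p : 0 < nm (1 - c'^* * c) by rewrite nm_gt0 sub1_neq0 ?(ltW d2) //; exact/discE.
rewrite rhoE [(_ / nm _) ^+ 2]expr_div_n ler_pdivlMr ?exprn_gt0 // nm2_sub1 in h1.
rewrite (mulrC (b c)); have : (1 / 2) ^+ 2 = 1 / 4 :> R by field.
by move=> E; rewrite E in h1; lra.
Qed.

Lemma lt_sqrtE (x t : R) : 0 <= x -> 0 <= t -> (x < Num.sqrt t) = (x ^+ 2 < t).
Proof.
by move=> x0 t0; rewrite -(@ltr_pXn2r _ 2) ?nnegrE ?sqrtr_ge0 // sqr_sqrtr.
Qed.

(** Squares of half-side d/6 about the points are disjoint, since meeting ones would have |c - c'|^2
    <= 2 d^2 / 9. They lie in the annulus 1 - 11d/4 <= |z|^2 < 1 - d/4, of area at most 4 * 5d/2,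
    and each has area d^2 / 9. *)
Lemma layer_count (d : R) : 0 < d <= 1 / 2 ->
  (size [seq c <- s | d < b c <= 2 * d])%:R <= 90 * d^-1 :> R.
Proof.
move=> /andP[d0 d1]; set s' := [seq c <- s | _]; pose h := d / 6.
have s's c : c \in s' -> [/\ c \in s, d < b c & b c <= 2 * d].
  by rewrite mem_filter => /andP[/andP[? ?] ?].
have h0 : 0 <= h by rewrite divr_ge0 // ltW.
have [w w4 area] := disc_area; case/andP: w4 => w0 w4.
pose t2 := 1 - d / 4; pose t1 := Num.max 0 (1 - 11 / 4 * d).
have t10 : 0 <= t1 by rewrite le_max lexx.
have t20 : 0 <= t2 by rewrite /t2; lra.
have t12 : t1 <= t2 by rewrite ge_max t20 /t2; lra.
pose A := D (Num.sqrt t2) `\` D (Num.sqrt t1).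
have mA : measurable A by apply: measurableD; exact: measurable_disc_set.
have close c p : c \in s' -> box c h (cx p) -> nm (cx p - c) <= d / 3.
  move=> _ /andP[x1 x2]; apply: le_trans (nm_le_ReIm _) _; rewrite /h in x1 x2; lra.
have pack : (((size s')%:R * (4 * h ^+ 2))%:E <= lam2 R A)%E.
  apply: box_packing => //; first exact: filter_uniq.
    move=> c cs p hp; have [cs' b1 b2] := s's c cs; have hd := close c p cs hp.
    have c1 := s_disc cs'; have c0 := nm_ge0 c; have p0 := nm_ge0 (cx p).
    have k1 : nm (cx p) <= nm c + d / 3 by have := nmBD (cx p) c; lra.
    have k2 : nm c - d / 3 <= nm (cx p) by have := nmBD c (cx p); rewrite (nmB c); lra.
    rewrite /b in b1 b2; split.
      change (nm (cx p) < Num.sqrt t2); rewrite lt_sqrtE // /t2.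
      have : nm (cx p) ^+ 2 <= (nm c + d / 3) ^+ 2 by rewrite lerXn2r ?nnegrE //; lra.
      by nra.
    change (~ nm (cx p) < Num.sqrt t1); rewrite lt_sqrtE // => hlt.
    have : nm (cx p) ^+ 2 < 1 - 11 / 4 * d.
      move: hlt; rewrite /t1; case: (leP 0 (1 - 11 / 4 * d)) => // _ hlt.
      by have := sqr_ge0 (nm (cx p)); lra.
    have [k3|k3] := leP (nm c) (d / 3); last first.
      have : (nm c - d / 3) ^+ 2 <= nm (cx p) ^+ 2 by rewrite lerXn2r ?nnegrE //; lra.
      by nra.
    by have := sqr_ge0 (nm (cx p)); nra.
  move=> c c' v cs cs' cc h1; apply/negP => h2.
  have [s1 b1 _] := s's c cs; have [s2 b2 _] := s's c' cs'.
  have := separated_dist s1 s2 cc; have : d * d <= b c * b c' by rewrite ler_pM ?ltW.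
  have : nm (c - c') ^+ 2 <= 2 * (d / 3) ^+ 2.
    case/andP: h1 => x1 y1; case/andP: h2 => x2 y2; rewrite nm_sqr.
    have tri (g : {additive C -> R}) : `|g (v - c)| <= h -> `|g (v - c')| <= h -> g (c - c') ^+ 2 <= (d / 3) ^+ 2.
      move=> z1 z2; rewrite -[g (c - c') ^+ 2]real_normK ?num_real // lerXn2r ?nnegrE //; first by lra.
      rewrite (_ : c - c' = (v - c') - (v - c)); last by ring.
      by rewrite raddfB; apply: le_trans (ler_normB _ _) _; rewrite /h in z1 z2; lra.
    by have := tri _ x1 x2; have := tri _ y1 y2; lra.
  by nra.
have E : (lam2 R A = ((t2 - t1) * w)%:E)%E.
  have H : (lam2 R (D (Num.sqrt t2)) = lam2 R (D (Num.sqrt t1)) + lam2 R A)%E.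
    rewrite -measureU //.
    - rewrite setDUK // => p /= hp; rewrite /D /=; apply: lt_le_trans hp _.
      by rewrite ler_wsqrtr.
    - exact: measurable_disc_set.
    - by apply/seteqP; split => p //= [h1 [_ h2]].
  rewrite !area ?sqrtr_ge0 // !sqr_sqrtr // in H.
  move: H; case: (lam2 R A) => [q| |] //=; rewrite -EFinD => -[H]; congr (_%:E).
  by rewrite mulrBl; lra.
rewrite E lee_fin in pack; rewrite ler_pdivlMr //.
have : t2 - t1 <= 5 / 2 * d.
  have : 1 - 11 / 4 * d <= t1 by rewrite le_max lexx orbT.
  by rewrite /t2; lra.
move=> tt; have n0 : 0 <= (size s')%:R :> R by rewrite ler0n.
have : (t2 - t1) * w <= 5 / 2 * d * 4 by apply: ler_pM => //; lra.
move: pack; rewrite /h; move: (size s')%:R n0 => n n0 pack hw.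
have : n * d * d <= 90 * d by rewrite expr2 in pack; nra.
by rewrite ler_pM2r.
Qed.

(** From one dyadic layer of [b] to the next the bound for the count doubles and that for the sum of
    1 / b quadruples, so the last layer governs both. *)
Lemma layers_count n : forall s', {subset s' <= s} -> uniq s' ->
  (forall c, c \in s' -> 2^-1 ^+ n < b c) ->
  (size s')%:R <= 180 * 2 ^+ n :> R /\ \sum_(c <- s') (b c)^-1 <= 120 * (2 ^+ n) ^+ 2.
Proof.
elim: n => [|n IH] s' ss us hb.
  case: s' hb {ss us} => [|c s' /(_ c)]; last by rewrite inE eqxx expr0 ltNge b_le1 => /(_ isT).
  by move=> _; rewrite big_nil /= !expr0 expr1n !mulr1; split; rewrite ler0n.
pose d : R := 2^-1 ^+ n.+1.
have d0 : 0 < d by rewrite exprn_gt0.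
have dE : 2 * d = 2^-1 ^+ n by rewrite /d exprS mulrA mulfV // mul1r.
have dn : d^-1 = 2 ^+ n.+1 by rewrite /d exprVn invrK.
have d1 : d <= 1 / 2 by rewrite /d exprS mul1r ler_piMr // exprn_ile1 // invf_le1 // ler1n.
pose sh := [seq c <- s' | 2^-1 ^+ n < b c]; pose sl := [seq c <- s' | ~~ (2^-1 ^+ n < b c)].
have [i1 i2] := IH sh (fun c => ltac:(by rewrite mem_filter => /andP[_ /ss]))
  (filter_uniq _ us) (fun c => ltac:(by rewrite mem_filter => /andP[])).
have ls : (size sl)%:R <= 90 * d^-1 :> R.
  have dd : 0 < d <= 1 / 2 by rewrite d0 d1.
  apply: le_trans (layer_count dd); rewrite ler_nat; apply: uniq_leq_size; first exact: filter_uniq.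
  move=> c; rewrite !mem_filter -leNgt dE => /andP[h cs].
  by rewrite (hb c cs) h (ss c cs).
have sz : (size s')%:R = (size sh)%:R + (size sl)%:R :> R.
  by rewrite -natrD !size_filter count_predC.
have sm : \sum_(c <- s') (b c)^-1 = \sum_(c <- sh) (b c)^-1 + \sum_(c <- sl) (b c)^-1.
  by rewrite (bigID (fun c => 2^-1 ^+ n < b c)) /= !big_filter.
have sl2 : \sum_(c <- sl) (b c)^-1 <= (size sl)%:R * d^-1.
  apply: le_trans (_ : \sum_(c <- sl) d^-1 <= _).
    rewrite big_seq [X in _ <= X]big_seq; apply: ler_sum => c.
    rewrite mem_filter => /andP[_ /hb h]; have bc : 0 < b c := lt_trans d0 h.
    by rewrite lef_pV2 ?posrE // ltW.
  by rewrite big_const_seq count_predT iter_addr addr0 mulr_natl.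
rewrite sz sm; move: ls sl2 i1 i2; rewrite dn exprS.
have m1 : 0 < 2 ^+ n :> R by rewrite exprn_gt0.
move: (2 ^+ n) m1 => m m1 ls sl2 i1 i2; split; first by lra.
by nra.
Qed.

Lemma net_count (beta : R) : 0 < beta <= 1 -> (forall c, c \in s -> beta <= b c) ->
  (size s)%:R <= 360 / beta :> R /\ \sum_(c <- s) (b c)^-1 <= 480 / beta ^+ 2.
Proof.
move=> /andP[b0 b1] hb.
have ex : exists n, (2^-1 : R) ^+ n < beta by exact: half_pow_lt.
(* Minimality of the exponent gives 2^(n+1) <= 2 / beta. *)
case: (ex_minnP ex) => -[|n] hn mn; first by rewrite expr0 in hn; lra.
have h2 : 2 ^+ n.+1 <= 2 / beta :> R.
  have : ~~ ((2^-1 : R) ^+ n < beta) by apply/negP => /mn; rewrite ltnn.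
  rewrite -leNgt => h; rewrite exprS ler_wpM2l //.
  by rewrite -[2 ^+ n]invrK -exprVn lef_pV2 ?posrE ?exprn_gt0.
have [i1 i2] := layers_count (fun c cs => cs) s_uniq (fun c cs => lt_le_trans hn (hb c cs)).
have p0 : 0 <= 2 ^+ n.+1 :> R by rewrite exprn_ge0.
split; first by apply: le_trans i1 _; rewrite (_ : 360 / beta = 180 * (2 / beta)); [rewrite ler_pM2l | ring].
apply: le_trans i2 _; rewrite (_ : 480 / beta ^+ 2 = 120 * (2 / beta) ^+ 2); last by field; rewrite gt_eqF.
by rewrite ler_pM2l // lerXn2r ?nnegrE // (le_trans p0).
Qed.
End Counting.

(** * Moebius invariance and sums over a net *)

Section MobiusSums.
Variable R : realType.
Local Notation C := R[i].
Implicit Types (z w p q c : C).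

Lemma gk_rho z w : nm z < 1 -> nm w < 1 -> gk z w = 1 - rho z w ^+ 2.
Proof. by move=> hz hw; rewrite rho2E ?(ltW hz) //; [ring | exact/discE]. Qed.

Definition phi z w : C := (w - z) / (1 - z^* * w).

Lemma nm_phi z w : nm (phi z w) = rho w z.
Proof. by rewrite /phi nmM nmV rhoE. Qed.

Lemma phi_disc z w : nm z < 1 -> nm w < 1 -> nm (phi z w) < 1.
Proof. by move=> /discE hz /discE hw; rewrite nm_phi rho_lt1. Qed.

Lemma b_phi z w : nm z < 1 -> nm w < 1 -> b (phi z w) = gk z w.
Proof. by move=> hz hw; rewrite /b nm_phi rhoC -gk_rho. Qed.

(** The automorphism multiplies 1 - conj(p) q by a function of [p] and one of [q]; in [gk] these
    cancel against those coming from [b]. *)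
Lemma phi_den z p q : nm z < 1 -> nm p < 1 -> nm q < 1 ->
  1 - (phi z p)^* * phi z q = (b z)%:C * (1 - p^* * q) / ((1 - z^* * p)^* * (1 - z^* * q)).
Proof.
move=> hz /discE hp /discE hq.
have n1 := sub1_neq0 (ltW hz) hp; have n2 := sub1_neq0 (ltW hz) hq.
have n3 : (1 - z^* * p)^* != 0 by rewrite conjC_eq0.
have E : (b z)%:C = 1 - z * z^* by rewrite /b rmorphB rmorph1 /= nm2E.
have E1 : Num.conj (1 - z^* * p) = 1 - z * p^* by rewrite rmorphB rmorph1 rmorphM; congr (1 - _ * _); exact: conjcK.
have E2 : Num.conj (p - z) = p^* - z^* by rewrite rmorphB.
rewrite (_ : (1 - z^* * p)^* = Num.conj (1 - z^* * p)) // E1 in n3 *.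
have E3 : (phi z p)^* = (p^* - z^*) / (1 - z * p^*).
  by rewrite -E1 -fmorphV; rewrite -[p^* - _]E2 -rmorphM.
transitivity (1 - (p^* - z^*) / (1 - z * p^*) * phi z q).
  by congr (1 - _ * _).
rewrite E /phi.
move: n2 n3; move: (z^*) (p^*) => z' p' n2 n3.
by field; rewrite n2 n3.
Qed.

Lemma gk_phi z p q : nm z < 1 -> nm p < 1 -> nm q < 1 -> gk (phi z p) (phi z q) = gk p q.
Proof.
move=> hz hp hq; rewrite /gk !b_phi // phi_den // /gk !nmM nmV !nmM nm_conj nm_real.
have bz : 0 < b z by exact/b_gt0/discE.
have n1 : nm (1 - z^* * p) != 0 by rewrite nm_eq0 sub1_neq0 ?(ltW hz) //; exact/discE.
have n2 : nm (1 - z^* * q) != 0 by rewrite nm_eq0 sub1_neq0 ?(ltW hz) //; exact/discE.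
have n3 : nm (1 - p^* * q) != 0 by rewrite nm_eq0 sub1_neq0 ?(ltW hp) //; exact/discE.
by rewrite (gtr0_norm bz); field; rewrite n1 n2 n3 gt_eqF.
Qed.

Lemma rho_phi z p q : nm z < 1 -> nm p < 1 -> nm q < 1 -> rho (phi z p) (phi z q) = rho p q.
Proof.
move=> hz hp hq; have h1 := phi_disc hz hp; have h2 := phi_disc hz hq.
have := gk_phi hz hp hq; rewrite !gk_rho // => h.
apply/eqP; rewrite -(@eqrXn2 _ 2) ?rho_ge0 //; apply/eqP; lra.
Qed.

Lemma phi_inj z p q : nm z < 1 -> nm p < 1 -> nm q < 1 -> phi z p = phi z q -> p = q.
Proof.
move=> hz hp hq e; have := rho_phi hz hp hq; rewrite e.
rewrite rhoE subrr nm0 mul0r rhoE => /esym/eqP; rewrite mulf_eq0 invr_eq0 !nm_eq0 subr_eq0.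
move/discE: hp => hp; have /negbTE-> := sub1_neq0 (ltW hq) hp.
by rewrite orbF => /eqP.
Qed.

(** After [z] is moved to 0, gk c p becomes b p' * b c' / |1 - conj(c') p'|^2, with denominator at
    least (1 - |c'|)^2. *)
Lemma gk_harnack z c p : nm z < 1 -> nm c < 1 -> nm p < 1 ->
  gk c p <= gk z p * (gk z c / (1 - rho c z) ^+ 2).
Proof.
move=> hz hc hp; have hpc := phi_disc hz hc; have hpp := phi_disc hz hp.
rewrite -(gk_phi hz hc hp) -(b_phi hz hp) -(b_phi hz hc) -nm_phi /gk.
rewrite [X in X <= _](_ : _ = b (phi z p) * (b (phi z c) / nm (1 - (phi z c)^* * phi z p) ^+ 2)); last by ring.
have bp : 0 <= b (phi z p) by rewrite b_ge0 // ltW.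
have bc : 0 <= b (phi z c) by rewrite b_ge0 // ltW.
rewrite ler_wpM2l // ler_wpM2l //.
have d0 : 0 < 1 - nm (phi z c) by rewrite subr_gt0.
have h := nm_sub1_ge (phi z c) (phi z p).
have h2 : 1 - nm (phi z c) <= nm (1 - (phi z c)^* * phi z p).
  apply: le_trans h; rewrite lerD2l lerN2 ler_piMr ?nm_ge0 //; exact: ltW.
by rewrite lef_pV2 ?posrE ?exprn_gt0 ?(lt_le_trans d0) // lerXn2r ?nnegrE ?(ltW d0) ?nm_ge0.
Qed.

Lemma gk_le_gk z c p (s : R) : nm z < 1 -> nm c < 1 -> nm p < 1 -> 0 < s -> rho c z <= 1 - s ->
  gk c p <= gk z p * (2 / s).
Proof.
move=> hz hc hp s0 h; apply: le_trans (gk_harnack hz hc hp) _.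
have g0 : 0 <= gk z p by rewrite gk_ge0 ?(ltW hz) ?(ltW hp).
rewrite ler_wpM2l // gk_rho // rhoC; have r0 := rho_ge0 c z.
have d0 : 0 < 1 - rho c z by lra.
rewrite ler_pdivrMr ?exprn_gt0 // mulrAC ler_pdivlMr //.
move: (rho c z) r0 h d0 => t t0 ht d0.
have h1 : (1 + t) * s <= 2 * (1 - t) by nra.
by have := ler_wpM2l (ltW d0) h1; lra.
Qed.

(** With t = rho c z, gk z c / (1 - t)^2 is (1 + t)^2 / (1 - t^2). Keeping 1 / b instead of its
    worst value lets [net_count] sum over a group. *)
Lemma gk_le_b z c p : nm z < 1 -> nm c < 1 -> nm p < 1 ->
  gk c p <= gk z p * (4 / b (phi z c)).
Proof.
move=> hz hc hp; apply: le_trans (gk_harnack hz hc hp) _.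
have g0 : 0 <= gk z p by rewrite gk_ge0 ?(ltW hz) ?(ltW hp).
have hpc := phi_disc hz hc; have bp : 0 < b (phi z c) by exact/b_gt0/discE.
rewrite ler_wpM2l // -(b_phi hz hc) -nm_phi; have n0 := nm_ge0 (phi z c).
rewrite ler_pdivrMr ?exprn_gt0 ?subr_gt0 // mulrAC ler_pdivlMr // /b.
move: (nm (phi z c)) n0 hpc => t t0 t1.
have h1 : (1 + t) ^+ 2 <= 4 by nra.
by have := ler_wpM2l (sqr_ge0 (1 - t)) h1; lra.
Qed.

Lemma gk_le1 z w : nm z < 1 -> nm w < 1 -> gk z w <= 1.
Proof. by move=> hz hw; rewrite gk_rho // gerBl sqr_ge0. Qed.

Variables (Z : set C) (eps delta : R).
Hypothesis Z_disc : forall z, Z z -> nm z < 1.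
Hypothesis delta0 : 0 < delta.
Hypothesis Z_char : characteristic_ge Z delta.
Let L := ln (1 / delta).

(** Since rho^2 = 1 - gk <= exp(- gk), the product of the rho^2, at least delta^2, is at most the
    exponential of minus the sum. *)
Lemma Z_sum z (t : seq C) : Z z -> uniq t -> (forall c, c \in t -> Z c /\ c <> z) ->
  \sum_(c <- t) gk c z <= 2 * L.
Proof.
move=> Zz ut ht; have h := Z_char Zz ut ht.
have lnd : ln delta = - L by rewrite /L div1r lnV ?opprK // posrE.
have h2 : delta ^+ 2 <= expR (- \sum_(c <- t) gk c z).
  rewrite -sumrN expR_sum; apply: (@le_trans _ _ (\prod_(j <- t) rho j z ^+ 2)).
    rewrite prodrXl lerXn2r ?nnegrE ?(ltW delta0) //.
    by apply: prodr_ge0 => c _; exact: rho_ge0.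
  rewrite big_seq [X in _ <= X]big_seq; apply: ler_prod => c ct; rewrite sqr_ge0 /=.
  have [Zc _] := ht c ct; have E := gk_rho (Z_disc Zc) (Z_disc Zz).
  have -> : rho c z ^+ 2 = 1 + - gk c z by rewrite E; ring.
  exact: expR_ge1Dx.
have : ln (delta ^+ 2) <= - \sum_(c <- t) gk c z.
  by rewrite -[X in _ <= X]expRK ler_ln ?posrE ?expR_gt0 ?exprn_gt0.
by rewrite lnXn // lnd mulr_natl mulr2n; lra.
Qed.

Lemma L_ge0 z : Z z -> 0 <= L.
Proof.
move=> Zz; have := @Z_sum z [::] Zz isT; rewrite big_nil => h.
by have := h (fun c => ltac:(by [])); lra.
Qed.

(* Each point of [t] is attached to a point of [Z] at pseudohyperbolic distance less than eps;
   the Moebius map centred there carries the group into a disc of radius eps. *)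
Lemma net_sum (t : seq C) p : 1 / 2 <= eps < 1 -> uniq t ->
  (forall c, c \in p :: t -> nm c < 1 /\ exists2 z, Z z & rho c z < eps) ->
  (forall c c', c \in t -> c' \in t -> c <> c' -> 1 / 2 <= rho c c') ->
  \sum_(c <- t) gk c p <= 240 / (1 - eps) + 3420 * L / (1 - eps) ^+ 3.
Proof.
move=> /andP[e2 e1] ut ht sep; set s := 1 - eps; have s0 : 0 < s by rewrite /s; lra.
have ex c : exists z, c \in p :: t -> Z z /\ rho c z < eps.
  have [ct|] := boolP (c \in p :: t); last by exists 0.
  by have [_ [z Zz hz]] := ht c ct; exists z.
have [ix hix] := choice ex.
have pin : p \in p :: t by rewrite inE eqxx.
have [Z0 r0] := hix p pin; set z0 := ix p in Z0 r0.
have tin c : c \in t -> c \in p :: t by rewrite inE => ->; rewrite orbT.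
have hd c : c \in p :: t -> nm c < 1 by move=> /ht[].
have hp := hd p pin.
pose grp z := [seq c <- t | ix c == z].
have cnt z : Z z -> (size (grp z))%:R <= 240 / s :> R /\
    \sum_(c <- grp z) (b (phi z c))^-1 <= 640 / 3 / s ^+ 2.
  move=> Zz; have hz := Z_disc Zz.
  have gin c : c \in grp z -> [/\ c \in t, nm c < 1 & rho c z < eps].
    rewrite mem_filter => /andP[/eqP<- ct]; have := hix c (tin c ct).
    by case=> _ ?; split => //; exact: hd (tin c ct).
  have inj : {in grp z &, injective (phi z)}.
    by move=> c c' /gin[_ h1 _] /gin[_ h2 _]; exact: phi_inj.
  have um : uniq (map (phi z) (grp z)) by rewrite map_inj_in_uniq // filter_uniq.
  (* In the group of [z], b (phi z c) = 1 - rho^2 > s (2 - s) >= 3 s / 2, as s <= 1/2. *)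
  pose beta := 3 / 2 * s.
  have beta1 : 0 < beta <= 1 by apply/andP; split; rewrite /beta /s; lra.
  have [i1 i2] := @net_count R (map (phi z) (grp z)) um
    (fun c => ltac:(by case/mapP => c' /gin[_ h _] ->; exact: phi_disc))
    (fun c c' => ltac:(case/mapP => x /gin[xt hx _] ->; case/mapP => y /gin[yt hy _] -> xy;
       rewrite rho_phi //; apply: sep => // e; apply: xy; by rewrite e)) beta beta1
    (fun c => ltac:(case/mapP => x /gin[xt hx rx] ->; rewrite b_phi // gk_rho // rhoC;
       have := rho_ge0 x z; move: (rho x z) rx => u; rewrite /beta /s; nra)).
  rewrite size_map in i1; rewrite big_map in i2; split.
    by apply: le_trans i1 _; rewrite /beta (_ : 360 / _ = 240 / s) //; field; rewrite gt_eqF.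
  by apply: le_trans i2 _; rewrite /beta (_ : 480 / _ = 640 / 3 / s ^+ 2) //; field; rewrite gt_eqF.
pose zs := undup (map ix t).
have split_sum : \sum_(c <- t) gk c p = \sum_(z <- zs) \sum_(c <- grp z) gk c p.
  under [RHS]eq_bigr do rewrite big_filter.
  rewrite (exchange_big_dep predT) //= big_seq [RHS]big_seq; apply: eq_bigr => c ct.
  under eq_bigl do rewrite eq_sym.
  by rewrite -big_filter (filter_pred1_uniq (undup_uniq _)) ?big_seq1 // mem_undup (map_f ix ct).
have zsZ z : z \in zs -> Z z.
  by rewrite mem_undup => /mapP[c ct ->]; have [] := hix c (tin c ct).
(* The group attached to the same chain point as [p] is merely counted, each term being at most 1;
   the others are compared with gk z z0, which [Z_sum] adds up. *)
rewrite split_sum (bigID (fun z => z == z0)) /=; apply: lerD.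
  have [zin|zin] := boolP (z0 \in zs); last first.
    rewrite big_seq_cond big_pred0; first exact: divr_ge0 (ler0n _ _) (ltW s0).
    by move=> z; apply/negbTE/negP => /andP[zzs /eqP e]; rewrite -e zzs in zin.
  rewrite -big_filter (filter_pred1_uniq (undup_uniq _)) // big_seq1.
  apply: le_trans (cnt z0 Z0).1; rewrite -sum1_size natr_sum big_seq [X in _ <= X]big_seq.
  apply: ler_sum => c; rewrite mem_filter => /andP[_ ct]; exact: gk_le1 (hd c (tin c ct)) hp.
have L0 := L_ge0 Z0.
have s3 : 0 <= (s ^+ 3)^-1 by rewrite invr_ge0 exprn_ge0 // ltW.
have h5 : 0 <= 5120 / 3 / s ^+ 3 := mulr_ge0 (divr_ge0 (ler0n _ _) (ler0n _ _)) s3.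
have h4 : 0 <= 4 * (640 / 3 / s ^+ 2).
  exact: mulr_ge0 (ler0n _ _) (divr_ge0 (divr_ge0 (ler0n _ _) (ler0n _ _)) (sqr_ge0 s)).
(* 2 / s moves [p] to [z0], 4 comes from [gk_le_b] and 640 / (3 s^2) from the count. Multiplied by 2
   L this is 10240/3, rounded up to 3420. *)
have one z : z \in zs -> z != z0 ->
    \sum_(c <- grp z) gk c p <= gk z z0 * (5120 / 3 / s ^+ 3).
  move=> zzs zz0; have Zz := zsZ z zzs; have hz := Z_disc Zz; have hz0 := Z_disc Z0.
  apply: (@le_trans _ _ (\sum_(c <- grp z) gk z p * (4 * (b (phi z c))^-1))).
    rewrite big_seq [X in _ <= X]big_seq.
    apply: ler_sum => c; rewrite mem_filter => /andP[_ ct]; exact: gk_le_b hz (hd c (tin c ct)) hp.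
  rewrite -!mulr_sumr.
  have g0 : 0 <= gk z p by rewrite gk_ge0 ?(ltW hz) ?(ltW hp).
  have g1 : gk z p <= gk z z0 * (2 / s).
    rewrite gkC [gk z z0]gkC; apply: gk_le_gk => //.
    by rewrite /s subKr ltW.
  apply: (@le_trans _ _ (gk z p * (4 * (640 / 3 / s ^+ 2)))).
    by apply: (ler_wpM2l g0); apply: ler_wpM2l; [exact: ler0n | exact: (cnt z Zz).2].
  apply: (@le_trans _ _ (gk z z0 * (2 / s) * (4 * (640 / 3 / s ^+ 2)))).
    exact: (ler_wpM2r h4).
  rewrite (_ : gk z z0 * (2 / s) * _ = gk z z0 * (5120 / 3 / s ^+ 3)) //.
  by field; rewrite gt_eqF.
apply: (@le_trans _ _ (\sum_(z <- zs | z != z0) gk z z0 * (5120 / 3 / s ^+ 3))).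
  rewrite big_seq_cond [X in _ <= X]big_seq_cond; apply: ler_sum => z /andP[? ?]; exact: one.
rewrite -mulr_suml -big_filter.
have h := @Z_sum z0 [seq z <- zs | z != z0] Z0 (filter_uniq _ (undup_uniq _)) (fun c => ltac:(
  by rewrite mem_filter => /andP[/eqP ? /zsZ])).
apply: (@le_trans _ _ (2 * L * (5120 / 3 / s ^+ 3))); first exact: (ler_wpM2r h5).
have h6 := mulr_ge0 L0 s3.
rewrite (_ : 2 * L * _ = 10240 / 3 * (L * (s ^+ 3)^-1)); last by ring.
rewrite (_ : 3420 * L / _ = 3420 * (L * (s ^+ 3)^-1)); last by ring.
by apply: (ler_wpM2r h6); rewrite ler_pdivrMr ?ltr0Sn // -natrM ler_nat.
Qed.
End MobiusSums.

(** * Separated nets and the kernel of a chain *)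

Section Nets.
Variable R : realType.
Local Notation C := R[i].
Local Notation separated := Defs.separated.
Implicit Types (S K Z : set C) (z w p c : C).

Lemma rho_xx z : rho z z = 0.
Proof. by rewrite rhoE subrr nm0 mul0r. Qed.

Lemma separated_setU1 (e : R) S w : separated e S -> (forall z, S z -> e <= rho w z) ->
  separated e (S `|` [set w]).
Proof.
move=> sS h x y [Sx|->] [Sy|->] xy //; first exact: sS.
- by rewrite rhoC; exact: h.
- exact: h.
Qed.

Lemma chain_cover (e : R) K Z w : 0 < e -> chain e K Z -> K w -> exists2 z, Z z & rho w z < e.
Proof.
move=> e0 [ZK sZ mZ] Kw; apply: contrapT => h.
have far z : Z z -> e <= rho w z by move=> Zz; rewrite leNgt; apply/negP => hz; apply: h; exists z.
have E : Z `|` [set w] = Z.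
  by apply: mZ (separated_setU1 sZ far); [exact: subsetUl | rewrite subUset; split => // x ->].
have Zw : Z w by rewrite -E; right.
by have := far w Zw; rewrite rho_xx; lra.
Qed.

Lemma chain_exists (e : R) K : 0 < e -> exists Z, chain e K Z.
Proof.
move=> e0; have [F FP Ftot|Z [[ZK sZ] mZ]] := @Zorn_bigcup C [set S | S `<=` K /\ separated e S].
  split; first by move=> x [S FS Sx]; exact: (FP S FS).1 x Sx.
  move=> x y [S FS Sx] [S' FS' S'y] xy.
  case: (Ftot S S' FS FS') => h; first exact: (FP S' FS').2 (h x Sx) S'y xy.
  exact: (FP S FS).2 Sx (h y S'y) xy.
exists Z; split => // S' ZS' S'K sS'; apply/seteqP; split => //.
by apply: contrapT => h; apply: (mZ S').
Qed.

Lemma separated_close (e : R) z w (m : nat) q : nm z < 1 -> nm w < 1 -> 2 / m.+1%:R <= e * (1 - nm z) ->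
  nm (z - q) < m.+1%:R^-1 -> nm (w - q) < m.+1%:R^-1 -> rho z w < e.
Proof.
move=> hz hw he h1 h2; rewrite rhoE.
have d0 : 0 < 1 - nm z by rewrite subr_gt0.
have hd : 1 - nm z <= nm (1 - w^* * z).
  by apply: le_trans (nm_sub1_ge w z); rewrite lerD2l lerN2 ler_piMl ?nm_ge0 // ltW.
rewrite ltr_pdivrMr ?(lt_le_trans d0) //.
have e0 : 0 <= e.
  by rewrite -(pmulr_lge0 _ d0); apply: le_trans he; rewrite divr_ge0 ?ler0n.
apply: (@lt_le_trans _ _ (e * (1 - nm z))); last exact: ler_wpM2l.
apply: lt_le_trans he.
have -> : z - w = (z - q) + - (w - q) by ring.
have := nmD (z - q) (- (w - q)); rewrite nmN.
by move: (m.+1%:R^-1) h1 h2 => u h1 h2 h3; lra.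
Qed.

(** Points are coded by pairs (n, m): within 1/(m+1) of the dense point q n, at a resolution so fine
    relative to 1 - |z| that two points of [S] with one code would be at rho-distance less than
    [e]. *)
Lemma separated_enum (e : R) S : 0 < e -> S `<=` disc -> separated e S ->
  exists zeta : nat -> C, [/\ forall k, S (zeta k) \/ zeta k = 1,
    forall z, S z -> exists k, zeta k = z &
    forall j k, nm (zeta j) < 1 -> zeta j = zeta k -> j = k].
Proof.
move=> e0 Sd sS; have [_ [q hq]] := @cSM_id R.
pose P n m z := [/\ S z, 2 / m.+1%:R <= e * (1 - nm z) & nm (z - q n) < m.+1%:R^-1].
have /choice[E hE] : forall k : nat, exists z : C,
    if @unpickle (nat * nat)%type k is Some nm then
      (exists w, P nm.1 nm.2 w) -> P nm.1 nm.2 z else z = 1.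
  move=> k; case: unpickle => [[n m]|] /=; last by exists 1.
  by have [[w hw]|h] := pselect (exists w, P n m w); [exists w | exists 1 => /h].
have Esurj z : S z -> exists k, E k = z.
  move=> Sz; have hz : nm z < 1 by exact/discE/Sd.
  have [m hm] : exists m : nat, 2 / m.+1%:R <= e * (1 - nm z).
    have [m hm] := small_inv (mulr_gt0 e0 (divr_gt0 (ltac:(by rewrite subr_gt0) : 0 < 1 - nm z) (ltr0n _ 2))).
    by exists m; have := hm m (leqnn m); move: (m.+1%:R^-1) => u; lra.
  have [n hn] := hq (complex.Re z, complex.Im z) m.+1%:R^-1 (ltac:(by rewrite invr_gt0)).
  have Pz : P n m z by split => //; move: hn; rewrite (_ : cx _ = z) //; case: (z).
  exists (pickle (n, m)); have := hE (pickle (n, m)); rewrite pickleK /= => /(_ (ex_intro _ z Pz)).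
  case=> SE h1 h2; apply: contrapT => ne; have := sS _ _ SE Sz ne.
  by case: Pz => _ _ h3; have := separated_close (proj1 (discE _) (Sd _ SE)) hz h1 h2 h3; lra.
pose E' k := if `[< S (E k) >] then E k else 1.
(* A repeated value becomes the padding point 1, which makes the enumeration injective on the
   disc. *)
pose zeta k := if [exists j : 'I_k, E' j == E' k] then 1 else E' k.
exists zeta; split.
- move=> k; rewrite /zeta; case: ifP => _; first by right.
  by rewrite /E'; case: asboolP => h; [left | right].
- move=> z Sz; have [k0 hk0] := Esurj z Sz.
  have ex : exists k, E' k == z by exists k0; rewrite /E' hk0 asboolT.
  case: (ex_minnP ex) => k /eqP hk mk; exists k; rewrite /zeta ifF //.
  by apply/negbTE/existsPn => j; rewrite hk; apply/negP => /mk; rewrite leqNgt ltn_ord.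
- have zE k : nm (zeta k) < 1 -> zeta k = E' k /\ ~~ [exists j : 'I_k, E' j == E' k].
    by rewrite /zeta; case: ifP => [_|/negbT h _ //]; rewrite nm1 ltxx.
  have key j k : nm (zeta j) < 1 -> zeta j = zeta k -> (j < k)%N -> False.
    move=> hj e1 jk; have hk : nm (zeta k) < 1 by rewrite -e1.
    have [e2 _] := zE j hj; have [e3 /negP h] := zE k hk; apply: h; apply/existsP.
    by exists (Ordinal jk); rewrite /= -e2 -e3 e1.
  move=> j k hj e1; case: (ltngtP j k) => // h; first by case: (key j k hj e1 h).
  by case: (key k j _ (esym e1) h); rewrite -e1.
Qed.

Lemma kernel_of_net (e r N0 : R) S : 0 < e -> S `<=` disc -> separated e S -> 0 < N0 -> 0 < r <= 1 / 2 ->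
  (forall t p, S p -> uniq t -> (forall c, c \in t -> S c) -> \sum_(c <- t) gk c p <= N0) ->
  exists V : set C, exists c : C -> C -> C, ([/\ V `<=` disc,
    forall w z, nm w < 1 -> S z -> rho w z < r -> V w,
    forall w, V w -> holo_lim (c^~ w) &
    forall w, V w -> c w w = 1] /\ [/\
    forall z w, ~ V w -> c z w = 0,
    cSM2 (c : C -> C -> R[i]^o) &
    forall z, nm z < 1 -> cule (fun w => nm (c z w) / (b w * nm (z - w))) (4608 * r * N0)]).
Proof.
move=> e0 Sd sS N00 r12 hsum; have [zeta [z1 z2 z3]] := separated_enum e0 Sd sS.
have Sz k : nm (zeta k) < 1 -> S (zeta k) by case: (z1 k) => // ->; rewrite nm1 ltxx.
have zd k : nm (zeta k) < 1 \/ zeta k = 1 by case: (z1 k) => h; [left; exact/discE/Sd | right].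
have zs j n : nm (zeta j) < 1 -> \sum_(k < n) gk (zeta k) (zeta j) <= N0.
  move=> hj; rewrite -(big_mkord predT (fun k => gk (zeta k) (zeta j))).
  rewrite (bigID (fun k => nm (zeta k) < 1)) /= [X in _ + X]big1 ?addr0; last first.
    move=> k /negbTE hk; case: (zd k); rewrite ?hk // => ->.
    by rewrite /gk /b (@nm1 R) expr1n subrr !mul0r.
  rewrite -big_filter -(big_map zeta predT (fun c => gk c (zeta j))).
  apply: hsum; first exact: Sz.
    rewrite map_inj_in_uniq ?filter_uniq ?iota_uniq // => k k'.
    by rewrite mem_filter => /andP[hk _] _; exact: z3.
  by move=> c /mapP[k]; rewrite mem_filter => /andP[hk _] ->; exact: Sz.
have [c [c1 c2 c3 c4 c5]] := kernel_exists zd N00 zs r12.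
exists [set w | exists j, near zeta r j w], c; split; split => //.
- by move=> w [j [_ hw _]]; exact/discE.
- move=> w z hw Sz' hr; have [j hj] := z2 z Sz'; exists j.
  have hz : nm (zeta j) < 1 by rewrite hj; exact/discE/Sd.
  split => //; move: hr; rewrite -hj rhoE ltr_pdivrMr // nm_gt0.
  by apply: sub1_neq0 (ltW hz) _; exact/discE.
Qed.

Theorem chain_kernel (K Z : set C) (eps delta : R) :
  K `<=` disc -> 0 < eps < 1 -> chain eps K Z -> 0 < delta -> characteristic_ge Z delta ->
  exists (V : set C) (c : C -> C -> C) (A : R), ([/\ V `<=` disc, K `<=` V,
    forall w, V w -> holo_lim (c^~ w) &
    forall w, V w -> c w w = 1] /\ [/\
    forall z w, ~ V w -> c z w = 0,
    cSM2 (c : C -> C -> R[i]^o),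
    forall z, nm z < 1 -> cule (fun w => nm (c z w) / (b w * nm (z - w))) A &
    A / kappa R <= 24 * 10 ^+ 6 * eps / (1 - eps) *
      Num.max 1 (ln (1 / delta) / (1 - Num.max (1 / 2) eps) ^+ 2)]).
Proof.
move=> Kd /andP[e0 e1] cZ d0 hZ; have [ZK sZ mZ] := cZ.
have Zd z : Z z -> nm z < 1 by move=> Zz; exact/discE/Kd/ZK.
set m := Num.max 1 _; have m1 : 1 <= m by rewrite le_max lexx.
have s0 : 0 < 1 - eps by lra.
have m0 : 0 <= m := le_trans ler01 m1.
have k79 := kappa_ge R; have k0 := kappa_gt0 R.
(* 18 / (7/9) = 162/7 < 24. *)
have bound A : A <= 18 * 10 ^+ 6 * eps / (1 - eps) * m -> A / kappa R <= 24 * 10 ^+ 6 * eps / (1 - eps) * m.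
  move=> hA; rewrite ler_pdivrMr //; apply: le_trans hA _.
  have P0 : 0 <= 10 ^+ 6 * eps / (1 - eps) * m.
    exact: mulr_ge0 (divr_ge0 (mulr_ge0 (exprn_ge0 _ (ler0n _ 10)) (ltW e0)) (ltW s0)) m0.
  rewrite -(mulrA 18) -(mulrA 18) -(mulrA 18) -(mulrA 24) -(mulrA 24) -(mulrA 24).
  move: P0 k79; move: (10 ^+ 6 * _ / _ * _) => P P0 k79.
  by have := mulr_ge0 P0 (ltac:(by rewrite subr_ge0) : 0 <= kappa R - 7 / 9); lra.
have Y1 : (1 - eps)^-1 <= m / (1 - eps) by rewrite ler_peMl // invr_ge0 ltW.
(* An empty chain forces [K] to be empty, and the zero kernel serves. *)
have [Z0|/existsNP[z0 /contrapT Zz0]] := pselect (forall z, ~ Z z).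
  exists set0, (fun _ _ => 0), 0; split; split => //.
  - by move=> w Kw; have [z /Z0] := chain_cover e0 cZ Kw.
  - exact: SM_cst.
  - move=> z _; rewrite (_ : (fun _ => _) = fun=> 0); first exact: uint_le0.
    by apply/funext => w; rewrite nm0 mul0r.
  - apply: bound.
    have h := mulr_ge0 (ler0n R 18) (exprn_ge0 6 (ler0n R 10)).
    exact: mulr_ge0 (divr_ge0 (mulr_ge0 h (ltW e0)) (ltW s0)) m0.
have L0 : 0 <= ln (1 / delta) := L_ge0 Zd d0 hZ Zz0.
have [e2|e2] := ltP eps (1 / 2).
  (* Here the inner maximum is 1/2, so the second entry of [m] is 4 log(1/delta). *)
  have mL : 4 * ln (1 / delta) <= m.
    rewrite /m le_max; apply/orP; right; rewrite max_l ?(ltW e2) //.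
    by rewrite (_ : (1 - 1 / 2) ^+ 2 = 4^-1) ?invrK 1?mulrC //; field.
  have hsum t p : Z p -> uniq t -> (forall c, c \in t -> Z c) ->
      \sum_(c <- t) gk c p <= 1 + 2 * ln (1 / delta).
    move=> Zp ut tZ; rewrite (bigID (fun c => c == p)) /=; apply: lerD.
      rewrite -big_filter; have [pt|pt] := boolP (p \in t).
        by rewrite (filter_pred1_uniq ut) // big_seq1; apply: gk_le1; exact: Zd.
      rewrite big_filter big_seq_cond big_pred0 // => c.
      by apply/negbTE/negP => /andP[ct /eqP e]; rewrite -e ct in pt.
    rewrite -big_filter; apply: (Z_sum Zd d0 hZ) => //; first exact: filter_uniq.
    by move=> c; rewrite mem_filter => /andP[/eqP ? /tZ].
  have N00 : 0 < 1 + 2 * ln (1 / delta) by lra.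
  have r12 : 0 < eps <= 1 / 2 by rewrite e0 ltW.
  have [V [c [[h1 h2 h3 h4] [h5 h6 h7]]]] := kernel_of_net e0 (subset_trans ZK Kd) sZ N00 r12 hsum.
  exists V, c, (4608 * eps * (1 + 2 * ln (1 / delta))); split; split => //.
    by move=> w Kw; have [z Zz hz] := chain_cover e0 cZ Kw; apply: h2 Zz hz; exact/discE/Kd.
  apply: bound; rewrite (_ : 18 * 10 ^+ 6 * eps / (1 - eps) * m =
    18 * 10 ^+ 6 * (eps * (m / (1 - eps)))); last by ring.
  have h8 : eps * (1 + 2 * ln (1 / delta)) <= 3 / 2 * (eps * (m / (1 - eps))).
    have : m <= m / (1 - eps) by rewrite ler_pdivlMr // ler_piMr // gerBl ltW.
    move=> /(ler_wpM2l (ltW e0)) h8; have h9 := ler_wpM2l (ltW e0) mL.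
    have h10 := ler_wpM2l (ltW e0) m1; clear -h8 h9 h10; lra.
  have W0 : 0 <= eps * (m / (1 - eps)).
    exact: mulr_ge0 (ltW e0) (divr_ge0 m0 (ltW s0)).
  rewrite -mulrA; move: (eps * (m / _)) (eps * (1 + _)) W0 h8 => W Q W0 h8.
  have -> : 10 ^+ 6 = 1000 * 1000 :> R by ring.
  by clear -W0 h8; lra.
have h0 : 0 < 1 / 2 :> R by lra.
have [S cS] := chain_exists K h0; have [SK sS mS] := cS.
pose N0 := 240 / (1 - eps) + 3420 * ln (1 / delta) / (1 - eps) ^+ 3.
have X2 : 0 <= ln (1 / delta) / (1 - eps) ^+ 3 by rewrite divr_ge0 // exprn_ge0 // ltW.
have X1 : 0 < (1 - eps)^-1 by rewrite invr_gt0.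
have N00 : 0 < N0.
  rewrite /N0 -mulrA; apply: ltr_wpDr; first exact: mulr_ge0 (ler0n _ _) X2.
  exact: mulr_gt0 (ltr0Sn _ _) X1.
have Y2 : ln (1 / delta) / (1 - eps) ^+ 3 <= m / (1 - eps).
  have -> : ln (1 / delta) / (1 - eps) ^+ 3 = ln (1 / delta) / (1 - eps) ^+ 2 / (1 - eps).
    by field; rewrite gt_eqF.
  rewrite ler_wpM2r // ?(ltW X1) // /m le_max; apply/orP; right; rewrite max_r //.
have hsum t p : S p -> uniq t -> (forall c, c \in t -> S c) -> \sum_(c <- t) gk c p <= N0.
  move=> Sp ut tS; apply: (net_sum Zd d0 hZ) => //; first by rewrite e2 e1.
    move=> c; rewrite inE => ct; have Sc : S c by case/orP: ct => [/eqP->|/tS].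
    by split; [exact/discE/Kd/SK | exact: chain_cover e0 cZ (SK _ Sc)].
  by move=> c c' /tS Sc /tS Sc'; exact: sS.
have r12 : 0 < (1 / 2 : R) <= 1 / 2 by rewrite lexx h0.
have [V [c [[h1 h2 h3 h4] [h5 h6 h7]]]] := kernel_of_net h0 (subset_trans SK Kd) sS N00 r12 hsum.
(* 2304 N0 with N0 <= 3660 m / (1 - eps) is at most 8432640 m / (1 - eps); since 1 <= 2 eps, this is
   below 18 * 10^6 eps m / (1 - eps). *)
exists V, c, (4608 * (1 / 2) * N0); split; split => //.
  by move=> w Kw; have [z Sz hz] := chain_cover h0 cS Kw; apply: h2 Sz hz; exact/discE/Kd.
apply: bound; rewrite (_ : 18 * 10 ^+ 6 * eps / (1 - eps) * m =
  18 * 10 ^+ 6 * (eps * (m / (1 - eps)))); last by ring.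
have h8 : 1 / 2 * (m / (1 - eps)) <= eps * (m / (1 - eps)).
  by rewrite ler_wpM2r // ltW // (lt_le_trans X1).
rewrite /N0 -mulrA; have -> : 10 ^+ 6 = 1000 * 1000 :> R by ring.
clear -h8 Y1 Y2 X1; by lra.
Qed.
End Nets.

(** * The solution operator and its properties *)

Section SolutionOperator.
Variable R : realType.
Local Notation C := R[i].
Variables (K V : set C) (c : C -> C -> C) (A : R).
Hypothesis V_disc : forall w, V w -> nm w < 1.
Hypothesis KV : K `<=` V.
Hypothesis c_holo : forall w, V w -> holo_lim (c^~ w).
Hypothesis c_diag : forall w, V w -> c w w = 1.
Hypothesis c_off : forall z w, ~ V w -> c z w = 0.
Hypothesis c_meas : cSM2 (c : C -> C -> R[i]^o).
Hypothesis c_int : forall z, nm z < 1 -> cule (fun w => nm (c z w) / (b w * nm (z - w))) A.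

(* The junk value 0 is taken where the integral does not exist. *)
Definition solution (X : completeNormedModType R[i]^o) (f : C -> X) (z : C) : X :=
  xget 0 [set v | cint (fun w => ker c z w *: f w) v].

Variable X : completeNormedModType R[i]^o.
Implicit Types f g : C -> X.

Lemma solution_eq (Y : completeNormedModType R[i]^o) (f : C -> Y) z v : cint (fun w => ker c z w *: f w) v -> solution f z = v.
Proof.
move=> h; have h' := @xgetPex Y 0 [set v | cint (fun w => ker c z w *: f w) v] (ex_intro _ v h).
exact: bint_unique h' h.
Qed.

(** The estimates above ask for strong measurability at every point, while integrals against the
    kernel see only the a.e. class, so they are computed with [f']. The last clause transfers any
    essential bound on [K], for the operator norm. *)
Lemma Linfty_representative f : Linfty K f -> exists f', [/\ cSM f',
  cae (fun w => f w = f' w), cae (fun w => ~ V w -> f' w = 0),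
  exists2 M, 0 <= M & cae (fun w => nX (f' w) <= M) &
  forall M, 0 <= M -> ae (fun z => K z -> `|f z| <= M%:C) -> cae (fun w => nX (f' w) <= M)].
Proof.
case=> /strongly_measurable_cSM[f' [mf ff]] [M /ae_cae hM] /ae_cae hK; exists f'; split => //.
- apply: cae_imp (cae_and ff hK) => w [<- h] nV; apply: h => Kw; exact/nV/KV.
- exists (Num.max 0 M); first by rewrite le_max lexx.
  apply: cae_imp (cae_and ff hM) => w [<-]; rewrite nXE lecR => h.
  by rewrite le_max h orbT.
- move=> m m0 /ae_cae hm; apply: cae_imp (cae_and ff (cae_and hK hm)) => w [<- [h1 h2]].
  have [/h2|/h1->] := pselect (K w); first by rewrite nXE lecR.
  by rewrite nX0.
Qed.

Lemma cint_representative f f' z v : cae (fun w => f w = f' w) ->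
  cint (fun w => ker c z w *: f w) v -> cint (fun w => ker c z w *: f' w) v.
Proof. by move=> ff; apply: cint_ae; apply: cae_imp ff => w ->. Qed.

Lemma solution_cint f : Linfty K f ->
  forall z, nm z < 1 -> cint (fun w => ker c z w *: f w) (solution f z).
Proof.
move=> /Linfty_representative[f' [mf ff _ [M M0 hM] _]] z hz.
have [v hv] := ker_exists V_disc c_off c_meas c_int mf M0 hM hz.
apply: (@xgetPex _ 0 [set v | cint (fun w => ker c z w *: f w) v]); exists v.
by apply: cint_representative hv; apply: cae_imp ff => w ->.
Qed.

Lemma solution_C_rho f : Linfty K f -> C_rho (solution f).
Proof.
move=> hf; have [f' [mf ff sf [M M0 hM] _]] := Linfty_representative hf.
have hF z hz := cint_representative ff (solution_cint hf (z := z) hz).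
apply: (C_rho_intro (M := M * A / kappa R)).
  exact: F_bound V_disc c_off c_int _ _ _ M0 hM _ hF.
by move=> e; exact: F_modulus V_disc c_holo c_diag c_off c_meas c_int _ _ _ mf M0 hM sf _ hF _.
Qed.

Lemma solution_weak f : Linfty K f -> weak_solution (solution f) f.
Proof.
move=> hf; have [f' [mf ff sf [M M0 hM] _]] := Linfty_representative hf.
have hF z hz := cint_representative ff (solution_cint hf (z := z) hz).
apply: (weak_solution_intro ff) => phi phix phiy r r0 r1.
exact: (weak_identity V_disc c_holo c_diag c_off c_meas c_int mf M0 hM sf hF r0 r1).
Qed.

Lemma solution_ae f g : Linfty K f -> ae (fun z => f z = g z) ->
  forall z, nm z < 1 -> solution f z = solution g z.
Proof.
move=> hf /ae_cae fg z hz; apply/esym/solution_eq; exact: cint_representative fg (solution_cint hf hz).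
Qed.

Lemma solution_linear (a : R[i]^o) f g : Linfty K f -> Linfty K g ->
  forall z, nm z < 1 -> solution (fun w => a *: f w + g w) z = a *: solution f z + solution g z.
Proof.
move=> hf hg z hz; apply: solution_eq.
have := bintD (bintZ a (solution_cint hf hz)) (solution_cint hg hz).
rewrite /cint; congr (bint _ _ _); apply/funext => p /=.
by rewrite scalerDr !scalerA mulrC.
Qed.

Lemma solution_bound f M : Linfty K f -> 0 <= M -> ae (fun z => K z -> `|f z| <= M%:C) ->
  forall z, nm z < 1 -> nX (solution f z) <= M * A / kappa R.
Proof.
move=> hf M0 hM; have [f' [mf ff _ _ h]] := Linfty_representative hf.
have hF z hz := cint_representative ff (solution_cint hf (z := z) hz).
exact: F_bound V_disc c_off c_int _ _ _ M0 (h M M0 hM) _ hF.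
Qed.

Lemma solution_natural (Y : completeNormedModType R[i]^o) (T : {linear X -> Y}) f :
  (exists k : R, forall x, `|T x| <= k%:C * `|x|) -> Linfty K f ->
  forall z, nm z < 1 -> T (solution f z) = solution (fun w => T (f w)) z.
Proof.
move=> [k hk] hf z hz; apply/esym/solution_eq.
have hk' x : nX (T x) <= k * nX x by have := hk x; rewrite !nXE -rmorphM lecR.
have TD x y : T (x + y) = T x + T y by rewrite linearD.
have TZ (a : R[i]^o) x : T (a *: x) = a *: T x by rewrite linearZ.
have := bint_map TD TZ hk' (solution_cint hf hz).
by rewrite /cint; congr (bint _ _ _); apply/funext => p /=; rewrite TZ.
Qed.

Lemma solution_compact f : Linfty K f -> compact (ess_range f) ->
  compact (closure (solution f @` disc)).
Proof.
move=> hf; have [f' [mf ff _ _ _]] := Linfty_representative hf.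
have hF z hz := cint_representative ff (solution_cint hf (z := z) hz).
apply: (compact_range V_disc c_off c_meas c_int mf hF).
by apply: cae_imp ff => w ->.
Qed.

Lemma solution_C1 f g (U : set C) : Linfty K f -> open_set U -> U `<=` disc ->
  ae (fun z => U z -> f z = g z) -> C1_on U g -> C1_on U (solution f).
Proof.
move=> hf oU Ud /ae_cae fg; have [f' [mf ff sf [M M0 hM] _]] := Linfty_representative hf.
have hF z hz := cint_representative ff (solution_cint hf (z := z) hz).
have [_ contF _] := solution_C_rho hf.
apply: (C1_on_intro _ _ oU Ud (f := f')).
- by move=> z /discE; exact: contF.
- move=> chi chix chiy r z r0 r1 hz h1 h2.
  exact: (representation V_disc c_holo c_diag c_off c_meas c_int mf M0 hM sf hF r0 r1 hz h1 h2).
- by apply: cae_imp (cae_and ff fg) => w [<-].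
Qed.
End SolutionOperator.

Theorem theorem1p1 (R : realType) :
  exists c : R, c < 25 * 10 ^+ 6 /\
  forall (K Z : set R[i]) (eps delta : R),
    K `<=` disc -> leb_measurable K -> quasi_interpolating K ->
    0 < eps < 1 -> chain eps K Z ->
    0 < delta -> characteristic_ge Z delta ->
    let eps_star := Num.max (1 / 2) eps in
    let bound := c * eps / (1 - eps) *
                 Num.max 1 (ln (1 / delta) / (1 - eps_star) ^+ 2) in
    exists L : forall X : completeNormedModType R[i]^o,
                 (R[i] -> X) -> (R[i] -> X),
    (
      (* L maps L^infty(K,X) into C_rho(disc,X), and L f is a weak solution *)
      forall (X : completeNormedModType R[i]^o) (f : R[i] -> X),
        Linfty K f -> C_rho (L X f) /\ weak_solution (L X f) f) /\ (
      (* L is well defined on a.e.-classes *)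
      forall (X : completeNormedModType R[i]^o) (f g : R[i] -> X),
        Linfty K f -> Linfty K g -> ae (fun z => f z = g z) ->
        forall z, disc z -> L X f z = L X g z) /\ (
      (* L is linear *)
      forall (X : completeNormedModType R[i]^o) (a : R[i]^o) (f g : R[i] -> X),
        Linfty K f -> Linfty K g ->
        forall z, disc z ->
          L X (fun w => a *: f w + g w) z = a *: L X f z + L X g z) /\ (
      (* operator norm bound: ||L f||_infty <= bound * ||f||_{L^infty(K)} *)
      forall (X : completeNormedModType R[i]^o) (f : R[i] -> X) (M : R),
        Linfty K f -> 0 <= M -> ae (fun z => K z -> `|f z| <= M%:C) ->
        forall z, disc z -> `|L X f z| <= (bound * M)%:C) /\ (
      (* (i) naturality w.r.t. bounded linear operators *)
      forall (X Y : completeNormedModType R[i]^o) (T : {linear X -> Y}),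
        (exists k : R, forall x, `|T x| <= k%:C * `|x|) ->
        forall f : R[i] -> X, Linfty K f ->
        forall z, disc z -> T (L X f z) = L Y (fun w => T (f w)) z) /\ (
      (* (ii) compact essential range => relatively compact range *)
      forall (X : completeNormedModType R[i]^o) (f : R[i] -> X),
        Linfty K f -> compact (ess_range f) ->
        compact (closure (L X f @` disc))) /\ (
      (* (iii) C^1 on an open U => L f is C^1 on U *)
      forall (X : completeNormedModType R[i]^o) (f : R[i] -> X) (U : set R[i]),
        Linfty K f -> open_set U -> U `<=` disc ->
        (exists g : R[i] -> X, ae (fun z => U z -> f z = g z) /\ C1_on U g) ->
        C1_on U (L X f)).
Proof.
exists (24 * 10 ^+ 6); split; first by rewrite ltr_pM2r ?exprn_gt0 ?ltr0n // ltr_nat.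
move=> K Z eps delta Kd _ _ e01 cZ d0 hZ eps_star bound.
have [V [c [A [[Vd KV holo diag] [off meas int hA]]]]] := chain_kernel Kd e01 cZ d0 hZ.
have Vd' w : V w -> nm w < 1 by move/Vd/discE.
exists (solution c); split; [|split; [|split; [|split; [|split; [|split]]]]].
- move=> X f hf; split.
    exact: (solution_C_rho Vd' KV holo diag off meas int hf).
  exact: (solution_weak Vd' KV holo diag off meas int hf).
- by move=> X f g hf _ fg z /discE; exact: (solution_ae Vd' KV off meas int hf fg).
- by move=> X a f g hf hg z /discE; exact: (solution_linear Vd' KV off meas int a hf hg).
- move=> X f M hf M0 hM z /discE hz; rewrite nXE lecR.
  apply: le_trans (solution_bound Vd' KV off meas int hf M0 hM hz) _.
  by rewrite -mulrA mulrC ler_wpM2r.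
- by move=> X Y T hT f hf z /discE; exact: (solution_natural Vd' KV off meas int hT hf).
- by move=> X f hf; exact: (solution_compact Vd' KV off meas int hf).
- move=> X f U hf oU Ud [g [fg hg]].
  exact: (solution_C1 Vd' KV holo diag off meas int hf oU Ud fg hg).
Qed.
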